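(* Let $d\ge1$, $N\in\mathbf N$, and let $\widetilde f(\varphi,t)$ be a real trigonometric polynomial of order $N$ in $(\varphi,t)\in\mathbf T^d\times\mathbf T$. Set $f(\varphi,q,t)=(1-\cos q)\widetilde f(\varphi,t)$ and consider the system $(\mathcal S_\mu)$: $\dot\varphi=I$, $\dot I=-\mu\partial_\varphi f$, $\dot q=p$, $\dot p=\sin q-\mu\partial_q f$, associated with $\mathcal H_\mu=\frac{|I|^2}{2}+\frac{p^2}{2}+(\cos q-1)+\mu f(\varphi,q,t)$. For every $\omega\in\mathbf R^d$ the torus $\mathcal T_\omega=\{I=\omega,\ \varphi\in\mathbf T^d,\ p=q=0\}$ is invariant for $(\mathcal S_\mu)$. Let $q_0(t)=4\arctan(e^t)$ and $$\Gamma(\omega,\theta_0,\varphi_0)=-\int_{\mathbf R}\Big[f(\omega t+\varphi_0,q_0(t),t+\theta_0)-f(\omega t+\varphi_0,0,t+\theta_0)\Big]dt .$$ Assume that for some smooth embedding $\gamma:[0,L]\to\mathbf R^d$ with $\gamma(0)=\omega_I$, $\gamma(L)=\omega_F$, for every $s\in[0,L]$ and $\omega=\gamma(s)$, $\Gamma(\omega,\cdot,\cdot)$ possesses a non-degenerate local minimum $(\theta_0^\omega,\varphi_0^\omega)$. Then for every $\eta>0$ there exist $\mu_0=\mu_0(\gamma,\eta)>0$ and $C=C(\gamma)>0$ such that for all $0<\mu\le\mu_0$ there exists a heteroclinic orbit of $(\mathcal S_\mu)$, $\eta$-close to $\gamma$ (its action component stays within distance $\eta$ of $\gamma([0,L])$),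 connecting the invariant tori $\mathcal T_{\omega_I}$ and $\mathcal T_{\omega_F}$; moreover the time it needs to go from a $\mu$-neighbourhood of $\mathcal T_{\omega_I}$ to a $\mu$-neighbourhood of $\mathcal T_{\omega_F}$ is bounded by $(C/\mu)|\log\mu|$. *)

(* Defs.v *)
From Stdlib Require Import Reals List ZArith.
From Coquelicot Require Import Coquelicot.
Open Scope R_scope.

(* Vectors of R^d are represented as functions nat -> R; only indices i < d matter. *)
Definition vec := nat -> R.
Definition vsum (d : nat) (g : nat -> R) : R := fold_right Rplus 0 (map g (seq 0 d)).
Definition vnorm (d : nat) (v : vec) : R := sqrt (vsum d (fun i => v i ^ 2)).
Definition vupd (v : vec) (i : nat) (x : R) : vec :=
  fun j => if Nat.eqb j i then x else v j.

Record trig_mode := { tm_k : nat -> Z; tm_l : Z; tm_a : R; tm_b : R }.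
Definition mode_order (d : nat) (m : trig_mode) : R :=
  vsum d (fun i => IZR (Z.abs (tm_k m i))) + IZR (Z.abs (tm_l m)).
Definition trig_eval (d : nat) (P : list trig_mode) (phi : vec) (t : R) : R :=
  fold_right Rplus 0 (map (fun m =>
    let x := vsum d (fun i => IZR (tm_k m i) * phi i) + IZR (tm_l m) * t in
    tm_a m * cos x + tm_b m * sin x) P).
Definition is_trig_poly (d N : nat) (ft : vec -> R -> R) : Prop :=
  exists P : list trig_mode,
    List.Forall (fun m => mode_order d m <= INR N) P /\
    forall phi t, ft phi t = trig_eval d P phi t.

Definition fpert (ft : vec -> R -> R) (phi : vec) (q t : R) : R := (1 - cos q) * ft phi t.
Definition dfphi (ft : vec -> R -> R) (i : nat) (phi : vec) (q t : R) : R :=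
  Derive (fun x => fpert ft (vupd phi i x) q t) (phi i).
Definition dfq (ft : vec -> R -> R) (phi : vec) (q t : R) : R :=
  Derive (fun x => fpert ft phi x t) q.

(* (phi, I, q, p) : R -> ... is a global solution of (S_mu) (lifted coordinates) *)
Definition is_solution (d : nat) (ft : vec -> R -> R) (mu : R)
    (phi I : R -> vec) (q p : R -> R) : Prop :=
  forall t : R,
    (forall i, (i < d)%nat ->
       is_derive (fun s => phi s i) t (I t i) /\
       is_derive (fun s => I s i) t (- mu * dfphi ft i (phi t) (q t) t)) /\
    is_derive q t (p t) /\
    is_derive p t (sin (q t) - mu * dfq ft (phi t) (q t) t).

Definition in_nbhd_torus (d : nat) (r : R) (omega I : vec) (q p : R) : Prop :=
  exists k : Z,
    sqrt (vsum d (fun i => (I i - omega i) ^ 2) + p ^ 2 + (q - 2 * PI * IZR k) ^ 2) < r.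

Definition heteroclinic (d : nat) (omegaI omegaF : vec) (I : R -> vec) (q p : R -> R) : Prop :=
  (forall eps, 0 < eps -> exists T, forall t, t <= - T ->
      in_nbhd_torus d eps omegaI (I t) (q t) (p t)) /\
  (forall eps, 0 < eps -> exists T, forall t, T <= t ->
      in_nbhd_torus d eps omegaF (I t) (q t) (p t)).

Definition q0 (t : R) : R := 4 * atan (exp t).

Definition Gamma (ft : vec -> R -> R) (omega : vec) (theta0 : R) (phi0 : vec) : R :=
  - RInt_gen (fun t =>
        fpert ft (fun i => omega i * t + phi0 i) (q0 t) (t + theta0)
      - fpert ft (fun i => omega i * t + phi0 i) 0 (t + theta0))
      (Rbar_locally m_infty) (Rbar_locally p_infty).

Definition Gfun (ft : vec -> R -> R) (omega : vec) (x : vec) : R :=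
  Gamma ft omega (x 0%nat) (fun i => x (S i)).

Definition partial (G : vec -> R) (j : nat) (x : vec) : R :=
  Derive (fun y => G (vupd x j y)) (x j).
Definition hessian (G : vec -> R) (x : vec) (i j : nat) : R :=
  Derive (fun y => partial G i (vupd x j y)) (x j).

Definition nondeg_local_min (n : nat) (G : vec -> R) (x0 : vec) : Prop :=
  (exists delta, 0 < delta /\
     forall x : vec, (forall i, (i < n)%nat -> Rabs (x i - x0 i) < delta) -> G x0 <= G x) /\
  (forall i j, (i < n)%nat -> (j < n)%nat ->
     ex_derive (fun y => partial G i (vupd x0 j y)) (x0 j)) /\
  (forall v : vec,
     (forall i, (i < n)%nat -> vsum n (fun j => hessian G x0 i j * v j) = 0) ->
     forall j, (j < n)%nat -> v j = 0).

Definition smooth_embedding (d : nat) (L : R) (gam : R -> vec) : Prop :=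
  0 < L /\
  (exists e, 0 < e /\ forall i n s, (i < d)%nat -> - e < s < L + e ->
     ex_derive_n (fun x => gam x i) n s) /\
  (forall s, 0 <= s <= L -> exists i, (i < d)%nat /\ Derive (fun x => gam x i) s <> 0) /\
  (forall s1 s2, 0 <= s1 <= L -> 0 <= s2 <= L ->
     (forall i, (i < d)%nat -> gam s1 i = gam s2 i) -> s1 = s2).

(* Main.v *)
(* The orbit is a chain of excursions along the separatrix, its bumps passing q = pi modulo 2 pi at prescribed times and
  angles x_0, x_1, ... that are fixed only at the end (a discrete form of the Lagrangian gluing method). As p > 0
  along it, q can serve as independent variable: a half-excursion, between q = 0 and q = pi modulo 2 pi, is the
  fixed point of a contraction in a norm weighted by the distance to q = 0, and it depends on its velocity, its
  momentum p at q = 0 and its end point with explicit Lipschitz bounds. Two consecutive halves with prescribed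
  end points exist as soon as the elapsed time is at least of the order of |log mu|.
  The matching conditions at the bumps read: (action jump) + mu * grad Gamma + small = 0, where the action is
  almost (difference of angles) / (difference of times). The first term is the gradient of a convex interaction,
  the second is strongly monotone near non-degenerate minima of Gamma, and the remainder has a Lipschitz constant
  that is small with respect to mu. Hence the whole system is a strongly monotone map on a product of balls; its
  variational inequality has a solution, and the behaviour at the boundary makes this solution a zero.
  It remains to place the unperturbed phases: one needs frequencies that move by O(mu) per step along gamma such
  that every phase is close to a minimum of Gamma. On a window of about 1 / sqrt(mu |log mu|) recurrent times a
  quadratic profile of the frequency corrects the phase exactly, and at rational frequencies of a special form
  with large denominators the phase is carried from one minimum to another. *)

Require Import Defs.
From Stdlib Require Import Reals List ZArith Lra Lia Psatz ClassicalEpsilon FunctionalExtensionality Ranalysis5 Sorted.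
From Coquelicot Require Import Coquelicot.
Open Scope R_scope.

(** Gaps between bumps last about [|log mu|], so the kinetic coupling of neighbouring sites is of
    order [1 / |log mu|], far above the Melnikov term of order [mu]: the sites are not a
    perturbation of uncoupled ones. But this coupling is convex in positions and times jointly, so
    it only helps monotonicity; only what is left after subtracting both terms must be small against
    [mu], in size and in Lipschitz constant. The time bound comes from a balance. A window of about
    [X] returns, each a multiple of [n0 ~ |log mu|] periods, closes its phase with frequency
    increments at most [eps * mu], which forces [n0 * X ^ 2] of order [1 / mu]; it moves the
    frequency by about [1 / (n0 * X)]. A curve of fixed length costs about [n0 * X] windows of
    duration [n0 * X], in total [n0 / mu]. Windows rest on Dirichlet and pigeonhole arguments alone,
    so resonances of the curve do no harm. The minima need not depend continuously on the frequency;
    transfers between them occur at finitely many points, whose number does not depend on [mu]. *)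

Ltac pos :=
 first [assumption | lra | lazymatch goal with
 | |- 0 <= _ * _ => apply Rmult_le_pos; pos
 | |- 0 < _ * _ => apply Rmult_lt_0_compat; pos
 | |- 0 <= _ / _ => apply Rdiv_le_0_compat; pos
 | |- 0 < _ / _ => apply Rdiv_lt_0_compat; pos
 | |- 0 < / _ => apply Rinv_0_lt_compat; pos
 | |- 0 <= / _ => left; pos
 | |- 0 <= _ ^ 2 => apply pow2_ge_0
 | |- 0 <= _ ^ _ => apply pow_le; pos
 | |- 0 < _ ^ _ => apply pow_lt; pos
 | |- 0 <= Rabs _ => apply Rabs_pos
 | |- 0 <= INR _ => apply pos_INR
 | |- 0 <= sqrt _ => apply sqrt_pos
 | |- _ /\ _ => split; pos
 end].

Ltac abs_lra :=
 repeat match goal with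
 | H : Rabs _ <= _ |- _ => apply Rabs_le_between in H
 | H : Rabs _ < _ |- _ => apply Rabs_def2 in H
 end; try apply Rabs_le; lra.

Ltac mono :=
 first [assumption | lra | lia | solve [auto with nocore] | lazymatch goal with
 | |- ?a * _ <= ?a * _ => apply Rmult_le_compat_l; [pos | mono]
 | |- _ * ?a <= _ * ?a => apply Rmult_le_compat_r; [pos | mono]
 | |- Rabs _ * Rabs _ <= _ => apply Rmult_le_compat; [apply Rabs_pos | apply Rabs_pos | mono | mono]
 | |- _ * _ <= _ * _ => apply Rmult_le_compat; [pos | pos | mono | mono]
 | |- / _ <= / _ => apply Rinv_le_contravar; pos
 | |- _ + _ <= _ + _ => apply Rplus_le_compat; mono
 | |- _ ^ _ <= _ ^ _ => apply pow_incr; split; [pos | mono]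
 | |- Rabs (_ * _) <= _ => rewrite Rabs_mult; mono
 | |- _ /\ _ => split; mono
 end].

Ltac fin :=
 first [assumption | lra | lia | solve [pos] | solve [abs_lra] | solve [mono] | nra
 | solve [match goal with |- forall _, _ => intros end; fin]
 | solve [match goal with |- _ /\ _ => split end; fin]
 | ring | solve [field; repeat split; fin]
 | solve [f_equal; ring]
 | solve [rewrite ?Rminus_diag, ?Rabs_R0, ?Rabs_R1, ?Rplus_0_r; fin]
 | solve [match goal with |- @eq (_ -> _) _ _ => apply functional_extensionality end; intros; fin]
 | solve [match goal with |- vsum _ _ = vsum _ _ => f_equal; apply functional_extensionality; intros; ring end]
 | solve [match goal with |- Rabs (_ + _) <= _ => eapply Rle_trans; [apply Rabs_triang|]; fin end]
 | solve [match goal with |- Rabs (_ - _) <= _ => eapply Rle_trans; [apply Rabs_triang|]; rewrite Rabs_Ropp; fin end]].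

Ltac triang := eapply Rle_trans; [apply Rabs_triang|].
Tactic Notation "le_by" tactic3(t) := eapply Rle_trans; [t|].
Tactic Notation "le_thru" uconstr(t) := apply Rle_trans with t.
Ltac mul_l := apply Rmult_le_compat_l; [lra|].
Ltac mul_r := apply Rmult_le_compat_r; [lra|].
Ltac mul_abs := apply Rmult_le_compat; try apply Rabs_pos.

Notation ok := ltac:(first [lra | lia]) (only parsing).
Notation bnd d M v := (forall j : nat, (j <= d)%nat -> Rabs (v j) <= M).
Notation bnd2 d M v w := (forall j : nat, (j <= d)%nat -> Rabs (v j - w j) <= M).
Ltac fld := field; lra.
Ltac inv_l := rewrite Rmult_assoc, Rinv_l by lra.
Tactic Notation "reg_r" constr(t) := apply Rmult_le_reg_r with t; [lra|].
Notation NM := R_NormedModule (only parsing).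
Notation CNM := R_CompleteNormedModule (only parsing).
Tactic Notation "note" constr(a) constr(b) "as" ident(h) ident(k) := generalize a b; intros h k.
Tactic Notation "note" constr(a) constr(b) constr(c) "as" ident(h) ident(k) ident(l) :=
 generalize a b c; intros h k l.
Tactic Notation "note" constr(a) constr(b) constr(c) constr(d) "as" ident(h) ident(k) ident(l) ident(m) :=
 generalize a b c d; intros h k l m.
Notation "i <=' j" := (i <= j)%nat (at level 70, only parsing).
Notation "i <' j" := (i < j)%nat (at level 70, only parsing).

(** * Finite sums over indices and over lists *)

Lemma fold_right_Rplus_app (l1 l2 : list R) :
 fold_right Rplus 0 (l1 ++ l2) = fold_right Rplus 0 l1 + fold_right Rplus 0 l2.
Proof. induction l1 as [|a l1 IH]; simpl; lra. Qed.

Lemma vsum_0 g : vsum 0 g = 0.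
Proof. reflexivity. Qed.

Lemma vsum_S n g : vsum (S n) g = vsum n g + g n.
Proof. unfold vsum. rewrite seq_S, map_app, fold_right_Rplus_app. simpl. lra. Qed.

Lemma vsum_ext n g h : (forall i, i <' n -> g i = h i) -> vsum n g = vsum n h.
Proof.
 induction n as [|n IH]; intros H; [reflexivity|].
 rewrite !vsum_S, IH, H; auto.
Qed.

Lemma vsum_plus n g h : vsum n (fun i => g i + h i) = vsum n g + vsum n h.
Proof. induction n as [|n IH]; [rewrite !vsum_0; lra|]. rewrite !vsum_S, IH. lra. Qed.

Lemma vsum_minus n g h : vsum n (fun i => g i - h i) = vsum n g - vsum n h.
Proof. induction n as [|n IH]; [rewrite !vsum_0; lra|]. rewrite !vsum_S, IH. lra. Qed.

Lemma vsum_scal n c g : vsum n (fun i => c * g i) = c * vsum n g.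
Proof. induction n as [|n IH]; [rewrite !vsum_0; lra|]. rewrite !vsum_S, IH. lra. Qed.

Lemma vsum_zero n : vsum n (fun _ => 0) = 0.
Proof. induction n as [|n IH]; [reflexivity|]. rewrite vsum_S, IH. lra. Qed.

Lemma vsum_le n g h : (forall i, i <' n -> g i <= h i) -> vsum n g <= vsum n h.
Proof.
 induction n as [|n IH]; intros H; [rewrite !vsum_0; lra|].
 rewrite !vsum_S. apply Rplus_le_compat; auto.
Qed.

Lemma vsum_nonneg n g : (forall i, i <' n -> 0 <= g i) -> 0 <= vsum n g.
Proof. intros H. rewrite <- (vsum_zero n). now apply vsum_le. Qed.

Lemma vsum_abs n g : Rabs (vsum n g) <= vsum n (fun i => Rabs (g i)).
Proof.
 induction n as [|n IH]; [rewrite !vsum_0, Rabs_R0; lra|].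
 rewrite !vsum_S. triang. lra.
Qed.

Lemma vsum_const n c : vsum n (fun _ => c) = INR n * c.
Proof. induction n as [|n IH]; [rewrite vsum_0; simpl; lra|]. rewrite vsum_S, IH, S_INR. lra. Qed.

Lemma vsum_term_le n g i : (forall i, i <' n -> 0 <= g i) -> i <' n -> g i <= vsum n g.
Proof.
 induction n as [|n IH]; intros H Hi; [lia|]. rewrite vsum_S.
 assert (H0 : 0 <= vsum n g) by (apply vsum_nonneg; auto).
 destruct (Nat.eq_dec i n) as [->|Hn]; [lra|].
 assert (g i <= vsum n g) by (apply IH; [auto|lia]). assert (0 <= g n) by auto. lra.
Qed.

Lemma vsum_first n g : vsum (S n) g = g O + vsum n (fun i => g (S i)).
Proof.
 induction n as [|n IH]; [rewrite vsum_S, !vsum_0; lra|].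
 rewrite vsum_S, IH, vsum_S. lra.
Qed.

Lemma vsum_exchange n m (g : nat -> nat -> R) :
 vsum n (fun i => vsum m (fun j => g i j)) = vsum m (fun j => vsum n (fun i => g i j)).
Proof.
 induction n as [|n IH].
 - symmetry. apply vsum_zero.
 - rewrite vsum_S, IH, <- vsum_plus. apply vsum_ext. intros. now rewrite vsum_S.
Qed.

(** Discriminant of the nonnegative polynomial [sum (g i * t - h i) ^ 2] in [t]. If its leading
    coefficient vanishes it is affine and nonnegative, which forces the mixed sum to vanish. *)
Lemma vsum_Cauchy_Schwarz n g h :
 (vsum n (fun i => g i * h i)) ^ 2 <= vsum n (fun i => g i ^ 2) * vsum n (fun i => h i ^ 2).
Proof.
 assert (Hq : forall t, 0 <= vsum n (fun i => g i ^ 2) * t ^ 2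
       - 2 * vsum n (fun i => g i * h i) * t + vsum n (fun i => h i ^ 2)).
 { intros t. replace (_ - _ + _) with (vsum n (fun i => (g i * t - h i) ^ 2)).
  - apply vsum_nonneg. fin.
  - induction n as [|n IH]; [rewrite !vsum_0; lra|]. rewrite !vsum_S, IH. ring. }
 set (a := vsum n (fun i => g i ^ 2)) in *. set (b := vsum n (fun i => g i * h i)) in *.
 set (c := vsum n (fun i => h i ^ 2)) in *.
 assert (Ha : 0 <= a) by (apply vsum_nonneg; intros; apply pow2_ge_0).
 destruct (Req_dec a 0) as [H0|H0].
 - rewrite H0 in *. destruct (Req_dec b 0) as [->|Hb]; [lra|].
  specialize (Hq ((c + 1) / (2 * b))).
  replace (0 * ((c + 1) / (2 * b)) ^ 2 - 2 * b * ((c + 1) / (2 * b)) + c) with (-1) in Hq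
   by fld. lra.
 - specialize (Hq (b / a)).
  replace (a * (b / a) ^ 2 - 2 * b * (b / a) + c) with ((a * c - b ^ 2) / a) in Hq by fld.
  assert (0 <= (a * c - b ^ 2) / a * a) by fin.
  replace ((a * c - b ^ 2) / a * a) with (a * c - b ^ 2) in H by fld. lra.
Qed.

Definition lsum {A : Type} (l : list A) (h : A -> R) : R := fold_right Rplus 0 (map h l).

Lemma lsum_cons {A} (a : A) l h : lsum (a :: l) h = h a + lsum l h.
Proof. reflexivity. Qed.

Lemma lsum_ext {A} (l : list A) g h : (forall a, g a = h a) -> lsum l g = lsum l h.
Proof. intros H. induction l as [|a l IH]; [reflexivity|]. now rewrite !lsum_cons, IH, H. Qed.

Lemma lsum_plus {A} (l : list A) g h : lsum l (fun a => g a + h a) = lsum l g + lsum l h.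
Proof. induction l as [|a l IH]; [unfold lsum; simpl; lra|]. rewrite !lsum_cons, IH. lra. Qed.

Lemma lsum_minus {A} (l : list A) g h : lsum l (fun a => g a - h a) = lsum l g - lsum l h.
Proof. induction l as [|a l IH]; [unfold lsum; simpl; lra|]. rewrite !lsum_cons, IH. lra. Qed.

Lemma lsum_scal {A} (l : list A) c g : lsum l (fun a => c * g a) = c * lsum l g.
Proof. induction l as [|a l IH]; [unfold lsum; simpl; lra|]. rewrite !lsum_cons, IH. lra. Qed.

Lemma lsum_le {A} (l : list A) g h : (forall a, g a <= h a) -> lsum l g <= lsum l h.
Proof.
 intros H. induction l as [|a l IH]; [unfold lsum; simpl; lra|].
 rewrite !lsum_cons. fin.
Qed.

Lemma lsum_abs {A} (l : list A) g : Rabs (lsum l g) <= lsum l (fun a => Rabs (g a)).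
Proof.
 induction l as [|a l IH]; [unfold lsum; simpl; rewrite Rabs_R0; lra|].
 rewrite !lsum_cons. triang. lra.
Qed.

Lemma lsum_nonneg {A} (l : list A) g : (forall a, 0 <= g a) -> 0 <= lsum l g.
Proof.
 intros H. induction l as [|a l IH]; [unfold lsum; simpl; lra|].
 rewrite lsum_cons. specialize (H a). lra.
Qed.

Lemma lsum_vsum {A} (l : list A) n (g : A -> nat -> R) :
 lsum l (fun a => vsum n (g a)) = vsum n (fun j => lsum l (fun a => g a j)).
Proof.
 induction l as [|a l IH].
 - unfold lsum at 1; simpl. rewrite <- (vsum_zero n). fin.
 - rewrite lsum_cons, IH, <- vsum_plus. fin.
Qed.

(** * Trigonometric modes *)

(* In space-time vectors the index 0 is the time variable and the index [S i] is the angle [phi_i]. *)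
Definition freq (m : trig_mode) (j : nat) : R :=
 match j with O => IZR (tm_l m) | S i => IZR (tm_k m i) end.
Arguments freq : simpl never.
Definition phase (d : nat) (m : trig_mode) (z : vec) : R := vsum (S d) (fun j => freq m j * z j).
Definition mval (m : trig_mode) (c : R) : R := tm_a m * cos c + tm_b m * sin c.
(** The derivative of [mval m]; in turn the derivative of [mder m] is [- mval m]. *)
Definition mder (m : trig_mode) (c : R) : R := - tm_a m * sin c + tm_b m * cos c.
Definition mamp (m : trig_mode) : R := Rabs (tm_a m) + Rabs (tm_b m).
Definition mfreq (d : nat) (m : trig_mode) : R := vsum (S d) (fun j => Rabs (freq m j)).

Definition fz (d : nat) (P : list trig_mode) (z : vec) : R := lsum P (fun m => mval m (phase d m z)).
(** The gradient of [fz] with its time component put to 0: time is treated as an angle whose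
    conjugate action never drifts, so its velocity stays 1 and the same formulas cover all
    components. *)
Definition gz (d : nat) (P : list trig_mode) (j : nat) (z : vec) : R :=
 match j with O => 0 | S _ => lsum P (fun m => freq m j * mder m (phase d m z)) end.

(** One constant for the size, the Lipschitz constants and the second differences of [fz] and [gz]:
    the cube allows one factor of frequency for the gradient and two for a second difference. The
    summand 1 makes it at least 1 even for the zero polynomial. *)
Definition Fbd (d : nat) (P : list trig_mode) : R :=
 1 + lsum P (fun m => mamp m * (1 + mfreq d m) ^ 3).

Lemma mamp_pos m : 0 <= mamp m.
Proof. unfold mamp. generalize (Rabs_pos (tm_a m)) (Rabs_pos (tm_b m)). lra. Qed.

Lemma mfreq_pos d m : 0 <= mfreq d m.
Proof. apply vsum_nonneg. fin. Qed.

Lemma freq_le d m j : j <=' d -> Rabs (freq m j) <= mfreq d m.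
Proof.
 intros H. apply (vsum_term_le (S d) (fun j => Rabs (freq m j))); [intros; apply Rabs_pos|lia].
Qed.

Lemma phase_minus d m z z' : phase d m z - phase d m z' = phase d m (fun j => z j - z' j).
Proof. unfold phase. rewrite <- vsum_minus. apply vsum_ext; intros; lra. Qed.

Lemma phase_plus d m z z' : phase d m (fun j => z j + z' j) = phase d m z + phase d m z'.
Proof. unfold phase. rewrite <- vsum_plus. apply vsum_ext; intros; lra. Qed.

Lemma phase_scal d m c z : phase d m (fun j => c * z j) = c * phase d m z.
Proof. unfold phase. rewrite <- vsum_scal. apply vsum_ext; intros; lra. Qed.

Lemma phase_ext d m z z' : (forall j, j <=' d -> z j = z' j) -> phase d m z = phase d m z'.
Proof. intros H. apply vsum_ext. intros. rewrite H; [auto|lia]. Qed.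

Lemma phase_le d m z M : bnd d M z -> Rabs (phase d m z) <= mfreq d m * M.
Proof.
 intros H. unfold phase, mfreq. le_by apply vsum_abs.
 rewrite Rmult_comm, <- vsum_scal. apply vsum_le. intros. rewrite Rabs_mult, Rmult_comm.
 apply Rmult_le_compat_r; [fin|]. apply H; lia.
Qed.

Lemma sin_Lip a b : Rabs (sin a - sin b) <= Rabs (a - b).
Proof.
 destruct (MVT_gen sin b a cos) as (c & _ & Hc).
 - intros x _. auto_derive; trivial; ring.
 - intros x _. apply continuity_sin.
 - rewrite Hc, Rabs_mult.
  assert (Rabs (cos c) <= 1) by (apply Rabs_le, COS_bound).
  generalize (Rabs_pos (a - b)). nra.
Qed.

Lemma cos_Lip a b : Rabs (cos a - cos b) <= Rabs (a - b).
Proof.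
 rewrite <- !sin_shift. le_by apply sin_Lip.
 replace (PI / 2 - a - (PI / 2 - b)) with (- (a - b)) by ring. rewrite Rabs_Ropp. lra.
Qed.

(** Both increments are first given the same step [D = a' - b'], at a cost controlled by the
    Lipschitz bound; then [cos (x + D) - cos x] has derivative at most [|D|] in [x]. *)
Lemma cos_four a b a' b' :
 Rabs (cos a - cos b - (cos a' - cos b')) <= Rabs (a - b - (a' - b')) + Rabs (b - b') * Rabs (a' - b').
Proof.
 set (D := a' - b').
 replace (cos a - cos b - (cos a' - cos b')) with
  ((cos a - cos (b + D)) + ((cos (b + D) - cos b) - (cos (b' + D) - cos b')))
  by (unfold D; replace (b' + (a' - b')) with a' by ring; ring).
 triang. apply Rplus_le_compat.
 - le_by apply cos_Lip. right. fin.
 - destruct (MVT_gen (fun x => cos (x + D) - cos x) b' b (fun x => sin x - sin (x + D))) as (c & _ & Hc).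
  + intros x _. auto_derive; trivial; ring.
  + intros x _. reg.
  + rewrite Hc, Rabs_mult, Rmult_comm. apply Rmult_le_compat_l; [fin|].
   le_by apply sin_Lip. right. rewrite <- Rabs_Ropp. fin.
Qed.

Lemma sin_four a b a' b' :
 Rabs (sin a - sin b - (sin a' - sin b')) <= Rabs (a - b - (a' - b')) + Rabs (b - b') * Rabs (a' - b').
Proof.
 rewrite <- !cos_shift.
 le_by apply cos_four. right. f_equal.
 - rewrite <- Rabs_Ropp. fin.
 - f_equal; rewrite <- Rabs_Ropp; f_equal; ring.
Qed.

Lemma Rabs_lin_comb a b x y M :
 Rabs x <= M -> Rabs y <= M -> Rabs (a * x + b * y) <= (Rabs a + Rabs b) * M.
Proof.
 intros. triang. rewrite !Rabs_mult.
 generalize (Rabs_pos a) (Rabs_pos b). nra.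
Qed.

Lemma mval_le m c : Rabs (mval m c) <= mamp m.
Proof.
 unfold mval, mamp. replace (_ + Rabs _) with ((Rabs (tm_a m) + Rabs (tm_b m)) * 1) by ring.
 apply Rabs_lin_comb; apply Rabs_le; [apply COS_bound|apply SIN_bound].
Qed.

Lemma mder_le m c : Rabs (mder m c) <= mamp m.
Proof.
 unfold mder, mamp. rewrite <- (Rabs_Ropp (tm_a m)).
 replace (_ + Rabs _) with ((Rabs (- tm_a m) + Rabs (tm_b m)) * 1) by ring.
 apply Rabs_lin_comb; apply Rabs_le; [apply SIN_bound|apply COS_bound].
Qed.

Lemma mval_Lip m c c' : Rabs (mval m c - mval m c') <= mamp m * Rabs (c - c').
Proof.
 unfold mval, mamp.
 replace (_ - _) with (tm_a m * (cos c - cos c') + tm_b m * (sin c - sin c')) by ring.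
 apply Rabs_lin_comb; [apply cos_Lip|apply sin_Lip].
Qed.

Lemma mder_Lip m c c' : Rabs (mder m c - mder m c') <= mamp m * Rabs (c - c').
Proof.
 unfold mder, mamp. rewrite <- (Rabs_Ropp (tm_a m)).
 replace (_ - _) with (- tm_a m * (sin c - sin c') + tm_b m * (cos c - cos c')) by ring.
 apply Rabs_lin_comb; [apply sin_Lip|apply cos_Lip].
Qed.

Lemma mval_four m a b a' b' :
 Rabs (mval m a - mval m b - (mval m a' - mval m b')) <=
 mamp m * (Rabs (a - b - (a' - b')) + Rabs (b - b') * Rabs (a' - b')).
Proof.
 unfold mval, mamp.
 replace (_ - _ - _) with (tm_a m * (cos a - cos b - (cos a' - cos b'))
   + tm_b m * (sin a - sin b - (sin a' - sin b'))) by ring.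
 apply Rabs_lin_comb; [apply cos_four|apply sin_four].
Qed.

Lemma mder_four m a b a' b' :
 Rabs (mder m a - mder m b - (mder m a' - mder m b')) <=
 mamp m * (Rabs (a - b - (a' - b')) + Rabs (b - b') * Rabs (a' - b')).
Proof.
 unfold mder, mamp. rewrite <- (Rabs_Ropp (tm_a m)).
 replace (_ - _ - _) with (- tm_a m * (sin a - sin b - (sin a' - sin b'))
   + tm_b m * (cos a - cos b - (cos a' - cos b'))) by ring.
 apply Rabs_lin_comb; [apply sin_four|apply cos_four].
Qed.

Lemma Fbd_ge1 d P : 1 <= Fbd d P.
Proof.
 unfold Fbd. assert (0 <= lsum P (fun m => mamp m * (1 + mfreq d m) ^ 3)); [|lra].
 apply lsum_nonneg. intros m. apply Rmult_le_pos; [apply mamp_pos|].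
 apply pow_le. generalize (mfreq_pos d m). lra.
Qed.

Lemma lsum_Fbd d P (h : trig_mode -> R) X :
 0 <= X -> (forall m, Rabs (h m) <= mamp m * (1 + mfreq d m) ^ 3 * X) -> Rabs (lsum P h) <= Fbd d P * X.
Proof.
 intros HX H. le_by apply lsum_abs.
 le_thru (lsum P (fun m => X * (mamp m * (1 + mfreq d m) ^ 3))).
 - apply lsum_le. intros m. rewrite (Rmult_comm X). apply H.
 - rewrite lsum_scal. unfold Fbd. lra.
Qed.

Lemma fz_le d P z : Rabs (fz d P z) <= Fbd d P.
Proof.
 rewrite <- (Rmult_1_r (Fbd d P)). apply lsum_Fbd; [lra|]. intros m.
 le_by apply mval_le. note (mamp_pos m) (mfreq_pos d m) as Ha Hf.
 assert (1 <= (1 + mfreq d m) ^ 3) by fin. nra.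
Qed.

Lemma gz_le d P j z : j <=' d -> Rabs (gz d P j z) <= Fbd d P.
Proof.
 intros Hj. destruct j as [|j]; simpl gz; [rewrite Rabs_R0; generalize (Fbd_ge1 d P); lra|].
 rewrite <- (Rmult_1_r (Fbd d P)). apply lsum_Fbd; [lra|]. intros m.
 rewrite Rabs_mult. generalize (mder_le m (phase d m z)) (mamp_pos m) (mfreq_pos d m) (freq_le d m _ Hj).
 generalize (Rabs_pos (freq m (S j))) (Rabs_pos (mder m (phase d m z))). intros.
 le_thru (mfreq d m * mamp m); [fin|].
 assert (mfreq d m <= (1 + mfreq d m) ^ 3) by nra. nra.
Qed.

Section lipschitz.
Variables (d : nat) (P : list trig_mode) (z z' : vec) (M : R).
Hypothesis HM : bnd2 d M z z'.

Lemma phase_Lip m : Rabs (phase d m z - phase d m z') <= mfreq d m * M.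
Proof. rewrite phase_minus. now apply phase_le. Qed.

Lemma lip_bound_pos : 0 <= M.
Proof. le_by apply Rabs_pos; apply (HM O); lia. Qed.

Lemma fz_Lip : Rabs (fz d P z - fz d P z') <= Fbd d P * M.
Proof.
 unfold fz. rewrite <- lsum_minus. assert (HM0 := lip_bound_pos). apply lsum_Fbd; trivial. intros m.
 le_by apply mval_Lip. rewrite Rmult_assoc.
 apply Rmult_le_compat_l; [apply mamp_pos|]. le_by apply phase_Lip.
 apply Rmult_le_compat_r; trivial. generalize (mfreq_pos d m). nra.
Qed.

Lemma gz_Lip j : j <=' d -> Rabs (gz d P j z - gz d P j z') <= Fbd d P * M.
Proof.
 intros Hj. assert (HM0 := lip_bound_pos). destruct j as [|j]; simpl gz.
 - rewrite Rminus_diag, Rabs_R0. generalize (Fbd_ge1 d P). nra.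
 - rewrite <- lsum_minus. apply lsum_Fbd; trivial. intros m.
  rewrite <- Rmult_minus_distr_l, Rabs_mult.
  le_thru (mfreq d m * (mamp m * (mfreq d m * M))).
  + mul_abs; [now apply freq_le|].
   le_by apply mder_Lip. apply Rmult_le_compat_l; [apply mamp_pos|apply phase_Lip].
  + replace (_ * (_ * _)) with (mamp m * (mfreq d m ^ 2) * M) by ring.
   apply Rmult_le_compat_r; trivial. apply Rmult_le_compat_l; [apply mamp_pos|].
   generalize (mfreq_pos d m). nra.
Qed.
End lipschitz.

Section second_difference.
Variables (d : nat) (P : list trig_mode) (z1 z0 z1' z0' : vec) (M1 M2 M3 : R).
Hypothesis H1 : forall j, j <=' d -> Rabs (z1 j - z0 j - (z1' j - z0' j)) <= M1.
Hypothesis H2 : bnd2 d M2 z0 z0'.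
Hypothesis H3 : bnd2 d M3 z1' z0'.

Lemma second_difference_pos : 0 <= M1 + M2 * M3.
Proof.
 specialize (H1 O (Nat.le_0_l d)). specialize (H2 O (Nat.le_0_l d)). specialize (H3 O (Nat.le_0_l d)).
 revert H1 H2 H3. generalize (Rabs_pos (z1 O - z0 O - (z1' O - z0' O)))
  (Rabs_pos (z0 O - z0' O)) (Rabs_pos (z1' O - z0' O)). nra.
Qed.

Lemma phase_second_difference m :
 Rabs (phase d m z1 - phase d m z0 - (phase d m z1' - phase d m z0')) +
 Rabs (phase d m z0 - phase d m z0') * Rabs (phase d m z1' - phase d m z0')
 <= (1 + mfreq d m) ^ 2 * (M1 + M2 * M3).
Proof.
 rewrite !phase_minus.
 generalize (phase_le d m _ M1 H1) (phase_le d m _ M2 H2) (phase_le d m _ M3 H3) (mfreq_pos d m).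
 specialize (H1 O (Nat.le_0_l d)). specialize (H2 O (Nat.le_0_l d)). specialize (H3 O (Nat.le_0_l d)).
 revert H1 H2 H3. generalize (Rabs_pos (z1 O - z0 O - (z1' O - z0' O)))
  (Rabs_pos (z0 O - z0' O)) (Rabs_pos (z1' O - z0' O)).
 set (f := mfreq d m). intros.
 le_thru (f * M1 + (f * M2) * (f * M3)).
 - fin.
 - assert (0 <= M2 * M3) by nra. nra.
Qed.

Lemma fz_four : Rabs (fz d P z1 - fz d P z0 - (fz d P z1' - fz d P z0')) <= Fbd d P * (M1 + M2 * M3).
Proof.
 unfold fz. rewrite <- !lsum_minus. assert (HM0 := second_difference_pos).
 apply lsum_Fbd; trivial. intros m.
 le_by apply mval_four. rewrite Rmult_assoc.
 apply Rmult_le_compat_l; [apply mamp_pos|]. le_by apply phase_second_difference.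
 apply Rmult_le_compat_r; trivial. generalize (mfreq_pos d m). nra.
Qed.

Lemma gz_four j : j <=' d ->
 Rabs (gz d P j z1 - gz d P j z0 - (gz d P j z1' - gz d P j z0')) <= Fbd d P * (M1 + M2 * M3).
Proof.
 intros Hj. assert (HM0 := second_difference_pos). destruct j as [|j]; simpl gz.
 - replace (0 - 0 - (0 - 0)) with 0 by ring. rewrite Rabs_R0. generalize (Fbd_ge1 d P). nra.
 - rewrite <- !lsum_minus. apply lsum_Fbd; trivial. intros m.
  rewrite <- !Rmult_minus_distr_l, Rabs_mult.
  le_thru (mfreq d m * (mamp m * ((1 + mfreq d m) ^ 2 * (M1 + M2 * M3)))).
  + mul_abs; [now apply freq_le|].
   le_by apply mder_four.
   apply Rmult_le_compat_l; [apply mamp_pos|apply phase_second_difference].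
  + replace (_ * (_ * _)) with (mamp m * (mfreq d m * (1 + mfreq d m) ^ 2) * (M1 + M2 * M3)) by ring.
   apply Rmult_le_compat_r; trivial. apply Rmult_le_compat_l; [apply mamp_pos|].
   generalize (mfreq_pos d m). nra.
Qed.
End second_difference.

(** * Preliminaries on functions of one variable *)

Lemma sin_cubic_lower x : 0 <= x <= 2 -> x - x ^ 3 / 6 <= sin x.
Proof.
 intros H. assert (HP := PI2_3_2).
 destruct (pre_sin_bound x 0) as [H1 _]; try lra.
 unfold sin_approx, sin_term in H1. simpl in H1. fin.
Qed.

(** Strictness matters because [q < 4] serves below as an open neighbourhood of the half-excursion
    [0 <= q <= PI]. Equality would give [cos 2 = 0], against [1 - 2 * sin 1 ^ 2 < 0]. *)
Lemma PI_lt_4 : PI < 4.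
Proof.
 destruct PI_4 as [H|H]; [fin|exfalso].
 assert (Hc : cos (2 * 1) = 0) by (replace (2 * 1) with (PI / 2) by lra; apply cos_PI2).
 rewrite cos_2a_sin in Hc. generalize (sin_cubic_lower 1 ok). nra.
Qed.

Lemma sin_lower x : 0 <= x <= 2 -> x / 3 <= sin x.
Proof.
 intros H. generalize (sin_cubic_lower x H). fin.
Qed.

Lemma one_minus_cos_half q : 1 - cos q = 2 * sin (q / 2) ^ 2.
Proof. replace q with (2 * (q / 2)) at 1 by field. rewrite cos_2a_sin. ring. Qed.

Lemma one_minus_cos_lower q : 0 <= q <= 4 -> q ^ 2 / 18 <= 1 - cos q.
Proof.
 intros H. rewrite one_minus_cos_half. assert (q / 2 / 3 <= sin (q / 2)) by (apply sin_lower; lra). nra.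
Qed.

Lemma one_minus_cos_upper q : 1 - cos q <= q ^ 2 / 2.
Proof.
 rewrite one_minus_cos_half.
 assert (Rabs (sin (q / 2)) <= Rabs (q / 2)).
 { generalize (sin_Lip (q / 2) 0). now rewrite sin_0, !Rminus_0_r. }
 rewrite <- (pow2_abs (sin _)). generalize (Rabs_pos (sin (q / 2))). intros.
 assert (Rabs (q / 2) ^ 2 = (q / 2) ^ 2) by apply pow2_abs. nra.
Qed.

Lemma one_minus_cos_pos q : 0 <= 1 - cos q.
Proof. generalize (COS_bound q). lra. Qed.

Lemma Rabs_sin_le q : 0 <= q -> Rabs (sin q) <= q.
Proof.
 intros H. generalize (sin_Lip q 0). rewrite sin_0, !Rminus_0_r, (Rabs_pos_eq q); trivial.
Qed.

(** Integrands are evaluated at [clip q], that is, continued to [q <= 0] by their value at 0;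
    integrals from 0 then have two-sided derivatives at 0, as needed where pieces are glued. *)
Definition clip (q : R) : R := Rmax 0 q.

Lemma clip_id q : 0 <= q -> clip q = q.
Proof. intros; unfold clip; now rewrite Rmax_right. Qed.

Ltac unclip := rewrite clip_id by lra.
Lemma clip_neg q : q <= 0 -> clip q = 0.
Proof. intros; unfold clip; now rewrite Rmax_left. Qed.
Lemma clip_ge q : 0 <= clip q.
Proof. apply Rmax_l. Qed.
Lemma clip_lt q b : 0 < b -> q < b -> clip q < b.
Proof. intros; unfold clip; now apply Rmax_lub_lt. Qed.

Lemma continuous_clip0 q : continuous clip q.
Proof.
 apply continuity_pt_filterlim. unfold clip.
 apply (continuity_pt_ext (fun q => (q + Rabs q) / 2)).
 - intros x. unfold Rmax, Rabs. destruct (Rle_dec 0 x), (Rcase_abs x); lra.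
 - apply continuity_pt_mult; [apply continuity_pt_plus|].
  + apply continuity_pt_id.
  + apply Rcontinuity_abs.
  + apply continuity_pt_const. now intros ? ?.
Qed.

Lemma continuous_eps (f : R -> R) q :
 (forall e, 0 < e -> exists r, 0 < r /\ forall y, Rabs (y - q) < r -> Rabs (f y - f q) < e) ->
 continuous f q.
Proof.
 intros H. apply filterlim_locally. intros e. destruct (H e (cond_pos e)) as (r & Hr & Hy).
 exists (mkposreal r Hr). fin.
Qed.

Lemma continuous_eps_inv (f : R -> R) q :
 continuous f q -> forall e, 0 < e -> exists r, 0 < r /\ forall y, Rabs (y - q) < r -> Rabs (f y - f q) < e.
Proof.
 intros H e He. destruct (proj1 (filterlim_locally f (f q)) H (mkposreal e He)) as [r Hr].
 exists r; split; [apply cond_pos|]. fin.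
Qed.

Lemma continuous_clip (h : R -> R) C q :
 (forall y, y < 4 -> Rabs (h y) <= C * clip y) -> q <= 0 -> continuous h q.
Proof.
 intros H Hq. assert (H0 : h q = 0).
 { specialize (H q ok). rewrite clip_neg, Rmult_0_r in H; trivial.
  fin. }
 apply continuous_eps. intros e He. exists (Rmin 1 (e / (Rabs C + 1))).
 assert (HC : 0 < Rabs C + 1) by (generalize (Rabs_pos C); lra).
 assert (0 < e / (Rabs C + 1)) by now apply Rdiv_lt_0_compat.
 split; [apply Rmin_glb_lt; lra|]. intros y Hy.
 assert (Hy1 : Rabs (y - q) < 1) by (eapply Rlt_le_trans; [exact Hy|apply Rmin_l]).
 assert (Hy2 : Rabs (y - q) < e / (Rabs C + 1)) by (eapply Rlt_le_trans; [exact Hy|apply Rmin_r]).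
 apply Rabs_def2 in Hy1. rewrite H0, Rminus_0_r.
 assert (Hp : clip y <= Rabs (y - q)).
 { unfold clip. apply Rmax_lub; [fin|]. generalize (Rle_abs (y - q)). lra. }
 specialize (H y ok). generalize (clip_ge y) (Rle_abs C). intros.
 apply Rle_lt_trans with ((Rabs C + 1) * Rabs (y - q)); [nra|].
 apply Rmult_lt_compat_l with (r := Rabs C + 1) in Hy2; trivial.
 replace ((Rabs C + 1) * (e / (Rabs C + 1))) with e in Hy2 by fld. fin.
Qed.

Lemma ex_RInt_cont (h : R -> R) a b :
 (forall y, Rmin a b <= y <= Rmax a b -> continuous h y) -> ex_RInt h a b.
Proof. intros H. now apply (@ex_RInt_continuous CNM). Qed.

Ltac ex_rint := apply ex_RInt_cont; rewrite Rmin_left, Rmax_right by lra.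

Lemma RInt_abs_le_const (h : R -> R) b M :
 0 <= b -> (forall y, 0 <= y <= b -> continuous h y) ->
 (forall y, 0 <= y <= b -> Rabs (h y) <= M) -> Rabs (RInt h 0 b) <= b * M.
Proof.
 intros Hb Hc H. replace b with (b - 0) at 2 by ring.
 apply abs_RInt_le_const; trivial. apply ex_RInt_cont.
 rewrite Rmin_left, Rmax_right; trivial.
Qed.

Lemma is_RInt_inv_square C a b :
 0 < a -> a <= b -> is_RInt (fun y => C / y ^ 2) a b (C / a - C / b).
Proof.
 intros Ha Hab.
 replace (C / a - C / b) with (minus (- C / b) (- C / a)) by (unfold minus, plus, opp; simpl; field; lra).
 apply (is_RInt_derive (fun y => - C / y)).
 - rewrite Rmin_left, Rmax_right; trivial. intros y Hy. auto_derive; [lra|]. fin.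
 - rewrite Rmin_left, Rmax_right; trivial. intros y Hy.
  apply continuity_pt_filterlim, derivable_continuous_pt.
  apply ex_derive_Reals_0. auto_derive. fin.
Qed.

Lemma RInt_abs_le_inv_square_ordered (h : R -> R) C a b :
 0 < a -> a <= b -> (forall y, a <= y <= b -> continuous h y) ->
 (forall y, a <= y <= b -> Rabs (h y) <= C / y ^ 2) -> Rabs (RInt h a b) <= C / a - C / b.
Proof.
 intros Ha Hab Hc H. rewrite <- (is_RInt_unique _ _ _ _ (is_RInt_inv_square C a b Ha Hab)).
 assert (Hex : ex_RInt h a b) by (apply ex_RInt_cont; rewrite Rmin_left, Rmax_right; trivial).
 le_by (apply abs_RInt_le; trivial).
 apply RInt_le; trivial.
 - now apply ex_RInt_norm in Hex.
 - eexists; now apply is_RInt_inv_square.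
 - intros y Hy. apply H; lra.
Qed.

(** Below the base point [b] the primitive [C / y] gives the weight [C / a]; beyond it, [a < 4] and
    [1 <= b] cost the factor 4. This turns integrand bounds in [/ y ^ 2] into bounds in the weight
    [/ q]. *)
Lemma RInt_abs_le_inv_square (h : R -> R) C a b :
 0 < a < 4 -> 1 <= b < 4 -> (forall y, 0 < y < 4 -> continuous h y) ->
 (forall y, 0 < y < 4 -> Rabs (h y) <= C / y ^ 2) -> Rabs (RInt h b a) <= 4 * C / a.
Proof.
 intros Ha Hb Hc H.
 assert (HC : 0 <= C).
 { specialize (H 1 ok). fin. }
 assert (forall y, 0 < y -> 0 <= C / y).
 { fin. }
 assert (0 <= C / a) by fin. assert (0 <= C / b) by fin.
 replace (4 * C / a) with (4 * (C / a)) by fin.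
 destruct (Rle_lt_dec a b) as [Hab|Hab].
 - rewrite <- opp_RInt_swap, Rabs_Ropp.
  + eapply Rle_trans; [apply RInt_abs_le_inv_square_ordered with (C := C); try lra|lra].
   * intros; apply Hc; lra.
   * intros; apply H; lra.
  + ex_rint. intros; apply Hc; lra.
 - le_by (apply RInt_abs_le_inv_square_ordered with (C := C); try lra).
  + intros; apply Hc; lra.
  + intros; apply H; lra.
  + assert (C / b <= 4 * (C / a)); [|lra].
   replace (4 * (C / a)) with (C / (a / 4)) by fld.
   apply Rmult_le_compat_l; trivial. fin.
Qed.

Lemma is_derive_RInt_cont (h : R -> R) a b c q :
 a < q < b -> a < c < b -> (forall y, a < y < b -> continuous h y) -> is_derive (fun q => RInt h c q) q (h q).
Proof.
 intros Hq Hc H. apply (is_derive_RInt h _ c).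
 - exists (mkposreal (Rmin (q - a) (b - q)) ltac:(apply Rmin_glb_lt; lra)). intros y Hy.
  change (Rabs (y - q) < Rmin (q - a) (b - q)) in Hy.
  assert (Rabs (y - q) < q - a) by (eapply Rlt_le_trans; [exact Hy|apply Rmin_l]).
  assert (Rabs (y - q) < b - q) by (eapply Rlt_le_trans; [exact Hy|apply Rmin_r]).
  apply Rabs_def2 in H0, H1.
  apply (@RInt_correct CNM), ex_RInt_cont. intros t Ht. apply H. split.
  + eapply Rlt_le_trans; [|apply Ht]. apply Rmin_glb_lt; lra.
  + eapply Rle_lt_trans; [apply Ht|]. apply Rmax_lub_lt; lra.
 - fin.
Qed.

Lemma is_derive_continuous (f : R -> R) q l : is_derive f q l -> continuous f q.
Proof. intros H. apply @ex_derive_continuous. now exists l. Qed.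

Lemma continuous_vsum n (h : nat -> R -> R) q :
 (forall i, i <' n -> continuous (h i) q) -> continuous (fun q => vsum n (fun i => h i q)) q.
Proof.
 induction n as [|n IH]; intros H; [apply continuous_const|].
 apply (continuous_ext (fun q => vsum n (fun i => h i q) + h n q)).
 - intros. now rewrite vsum_S.
 - apply @continuous_plus; auto.
Qed.

Lemma continuous_lsum {A} (l : list A) (h : A -> R -> R) q :
 (forall a, continuous (h a) q) -> continuous (fun q => lsum l (fun a => h a q)) q.
Proof.
 intros H. induction l as [|a l IH]; [apply continuous_const|]. now apply @continuous_plus.
Qed.

Lemma continuous_phase d m (z : R -> vec) q :
 (forall j, j <=' d -> continuous (fun q => z q j) q) -> continuous (fun q => phase d m (z q)) q.
Proof.
 intros H. apply (continuous_vsum (S d) (fun j q => freq m j * z q j)). intros i Hi.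
 apply @continuous_scal_r. apply H. lia.
Qed.

Lemma continuous_fz d P (z : R -> vec) q :
 (forall j, j <=' d -> continuous (fun q => z q j) q) -> continuous (fun q => fz d P (z q)) q.
Proof.
 intros H. apply (continuous_lsum P (fun m q => mval m (phase d m (z q)))). intros m.
 apply (continuous_comp (fun q => phase d m (z q)) (mval m)); [now apply continuous_phase|].
 unfold mval. apply @ex_derive_continuous. auto_derive; trivial.
Qed.

Lemma continuous_gz d P j (z : R -> vec) q :
 (forall j, j <=' d -> continuous (fun q => z q j) q) -> continuous (fun q => gz d P j (z q)) q.
Proof.
 intros H. destruct j as [|j]; [apply continuous_const|].
 apply (continuous_lsum P (fun m q => freq m (S j) * mder m (phase d m (z q)))). intros m.
 apply @continuous_scal_r.
 apply (continuous_comp (fun q => phase d m (z q)) (mder m)); [now apply continuous_phase|].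
 unfold mder. apply @ex_derive_continuous. auto_derive; trivial.
Qed.

Lemma continuous_near (f g : R -> R) q r :
 0 < r -> (forall y, Rabs (y - q) < r -> f y = g y) -> continuous f q -> continuous g q.
Proof.
 intros Hr H Hf. apply (continuous_ext_loc _ f); trivial.
 exists (mkposreal r Hr). fin.
Qed.

(** * Contraction principle *)

Section banach.
Variables (A : Type) (D : A -> Prop) (W : A -> R) (C : (A -> R) -> Prop) (Phi : (A -> R) -> A -> R).
Variables (k : R) (u0 : A -> R) (M0 : R).
Hypothesis W_pos : forall a, D a -> 0 <= W a.
Hypothesis k_range : 0 <= k < 1.
Hypothesis M0_pos : 0 <= M0.
Hypothesis C_u0 : C u0.
Hypothesis C_Phi : forall u, C u -> C (Phi u).
Hypothesis start : forall a, D a -> Rabs (Phi u0 a - u0 a) <= M0 * W a.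
Hypothesis contract : forall u v M, C u -> C v -> 0 <= M ->
 (forall a, D a -> Rabs (u a - v a) <= M * W a) ->
 forall a, D a -> Rabs (Phi u a - Phi v a) <= k * M * W a.
Hypothesis C_closed : forall (un : nat -> A -> R) u (en : nat -> R),
 (forall n, C (un n)) -> is_lim_seq en 0 ->
 (forall n a, D a -> Rabs (un n a - u a) <= en n * W a) -> C u.

Let un n := Nat.iter n Phi u0.

Lemma banach_C n : C (un n).
Proof. induction n as [|n IH]; [fin|]. now apply C_Phi. Qed.

Lemma banach_step n a : D a -> Rabs (un (S n) a - un n a) <= k ^ n * M0 * W a.
Proof.
 revert a. induction n as [|n IH]; intros a Ha.
 - simpl. rewrite Rmult_1_l. fin.
 - replace (k ^ S n * M0 * W a) with (k * (k ^ n * M0) * W a) by (simpl; ring).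
  apply (contract (un (S n)) (un n)); try apply banach_C; trivial.
  fin.
Qed.

Lemma banach_tail n m a : D a -> Rabs (un (n + m)%nat a - un n a) <= k ^ n * (M0 / (1 - k)) * W a.
Proof.
 intros Ha. assert (Hk : 0 < 1 - k) by lra.
 assert (H : Rabs (un (n + m)%nat a - un n a) <= k ^ n * (M0 * (1 - k ^ m) / (1 - k)) * W a).
 { induction m as [|m IH].
  - rewrite Nat.add_0_r, Rminus_diag, Rabs_R0. fin.
  - rewrite Nat.add_succ_r.
   replace (un (S (n + m)) a - un n a) with ((un (S (n + m)) a - un (n + m)%nat a) + (un (n + m)%nat a - un n a)) by ring.
   triang.
   le_by (apply Rplus_le_compat; [now apply banach_step|exact IH]).
   right. rewrite pow_add. simpl. fin. }
 le_by exact H. apply Rmult_le_compat_r; [auto|].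
 apply Rmult_le_compat_l; [fin|]. unfold Rdiv. apply Rmult_le_compat_r.
 - fin.
 - assert (0 <= k ^ m) by now apply pow_le. nra.
Qed.

Lemma geometric_lim c : is_lim_seq (fun n => k ^ n * c) 0.
Proof.
 replace (Finite 0) with (Rbar_mult 0 c) by (simpl; f_equal; ring).
 apply is_lim_seq_scal_r. apply is_lim_seq_geom. rewrite Rabs_pos_eq; lra.
Qed.

(** The metric is the sup norm on [D] weighted by [W]. The iterates converge pointwise with an
    explicit geometric tail; the closed class [C] carries continuity in some applications and bounds
    on the components in others. *)
Lemma banach_fixed_point : exists u, C u /\ forall a, D a -> Phi u a = u a.
Proof.
 set (c := M0 / (1 - k)).
 assert (Hc : 0 <= c) by (unfold c; apply Rmult_le_pos; trivial; left; apply Rinv_0_lt_compat; lra).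
 assert (Hlim : forall a, exists l : R, D a -> is_lim_seq (fun n => un n a) l).
 { intros a. destruct (classic (D a)) as [Ha|Ha]; [|exists 0; tauto].
  assert (Hcv : ex_finite_lim_seq (fun n => un n a)).
  { apply ex_lim_seq_cauchy_corr. intros e.
   assert (Hg := geometric_lim (c * W a)). apply is_lim_seq_spec in Hg.
   destruct (Hg (mkposreal (e / 2) ltac:(generalize (cond_pos e); lra))) as [N HN].
   exists N. intros n m Hn Hm. specialize (HN N (Nat.le_refl N)). simpl in HN.
   rewrite Rminus_0_r, Rabs_pos_eq in HN
    by (apply Rmult_le_pos; [fin|apply Rmult_le_pos; auto]).
   generalize (banach_tail N (n - N) a Ha) (banach_tail N (m - N) a Ha).
   replace (N + (n - N))%nat with n by lia. replace (N + (m - N))%nat with m by lia.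
   fold c. intros H1 H2.
   replace (un n a - un m a) with ((un n a - un N a) - (un m a - un N a)) by ring.
   eapply Rle_lt_trans; [apply Rabs_triang|]. rewrite Rabs_Ropp. fin. }
  destruct Hcv as [l Hl]. exists l. fin. }
 set (u := fun a => proj1_sig (constructive_indefinite_description _ (Hlim a))).
 assert (Hu : forall a, D a -> is_lim_seq (fun n => un n a) (u a)).
 { intros a. unfold u. destruct (constructive_indefinite_description _ (Hlim a)) as [l Hl]. exact Hl. }
 assert (Hnu : forall n a, D a -> Rabs (un n a - u a) <= k ^ n * c * W a).
 { intros n a Ha. rewrite Rabs_minus_sym.
  assert (Hs : is_lim_seq (fun m => Rabs (un (n + m)%nat a - un n a)) (Rabs (u a - un n a))).
  { apply (is_lim_seq_abs _ (Finite (u a - un n a))).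
   apply is_lim_seq_minus'; [|apply is_lim_seq_const].
   apply (is_lim_seq_ext (fun m => un (m + n)%nat a)); [intros; f_equal; lia|].
   apply (proj1 (is_lim_seq_incr_n (fun m => un m a) n (u a))). fin. }
  apply (is_lim_seq_le _ (fun _ => k ^ n * c * W a) (Rabs (u a - un n a)) (k ^ n * c * W a)) in Hs; trivial.
  - intros m. now apply banach_tail.
  - apply is_lim_seq_const. }
 assert (HCu : C u).
 { apply (C_closed un u (fun n => k ^ n * c)); trivial; [apply banach_C|apply geometric_lim]. }
 exists u; split; trivial. intros a Ha.
 assert (Hb : forall n, Rabs (Phi u a - u a) <= k ^ n * (2 * c * W a)).
 { intros n. replace (Phi u a - u a) with ((Phi u a - un (S n) a) + (un (S n) a - u a)) by ring.
  triang.
  assert (H1 : Rabs (Phi u a - Phi (un n) a) <= k * (k ^ n * c) * W a).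
  { apply contract; trivial; [apply banach_C|fin|].
   intros b Hb. rewrite Rabs_minus_sym. fin. }
  generalize (Hnu (S n) a Ha). simpl pow. change (un (S n) a) with (Phi (un n) a). intros H2.
  assert (0 <= k ^ n * c * W a) by (apply Rmult_le_pos; auto; apply Rmult_le_pos; trivial; now apply pow_le).
  fin. }
 assert (Rabs (Phi u a - u a) <= 0).
 { assert (Hg := geometric_lim (2 * c * W a)).
  apply (is_lim_seq_le (fun _ => Rabs (Phi u a - u a)) _ (Rabs (Phi u a - u a)) 0 Hb) in Hg; trivial.
  apply is_lim_seq_const. }
 fin.
Qed.
End banach.

(** Each use of the self-improving estimate halves the excess over [2 * S]. It derives Lipschitz
    dependence of fixed points from the contraction estimate, starting from any crude bound [N0]. *)
Lemma absorb {A : Type} (D : A -> Prop) (e W : A -> R) S N0 :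
 (forall a, D a -> 0 < W a) -> 0 <= S -> 0 <= N0 ->
 (forall a, D a -> e a <= N0 * W a) ->
 (forall N, 0 <= N -> (forall a, D a -> e a <= N * W a) -> forall a, D a -> e a <= (S + N / 2) * W a) ->
 forall a, D a -> e a <= 2 * S * W a.
Proof.
 intros HW HS HN0 H0 Hstep.
 assert (Hn : forall n, forall a, D a -> e a <= (2 * S + N0 * (1 / 2) ^ n) * W a).
 { induction n as [|n IH]; intros a Ha.
  - simpl. le_by now apply H0. apply Rmult_le_compat_r; [left; auto|lra].
  - assert (HN : 0 <= 2 * S + N0 * (1 / 2) ^ n).
   { apply Rplus_le_le_0_compat; [lra|]. fin. }
   le_by apply (Hstep _ HN IH a Ha).
   apply Rmult_le_compat_r; [left; auto|]. simpl. lra. }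
 intros a Ha.
 assert (Hl : is_lim_seq (fun n => (2 * S + N0 * (1 / 2) ^ n) * W a) (2 * S * W a)).
 { replace (Finite (2 * S * W a)) with (Rbar_mult (Finite (2 * S + N0 * 0)) (W a)) by (simpl; f_equal; ring).
  apply is_lim_seq_scal_r. apply is_lim_seq_plus'; [apply is_lim_seq_const|].
  apply (is_lim_seq_scal_l _ N0 0). apply is_lim_seq_geom. rewrite Rabs_pos_eq; lra. }
 apply (is_lim_seq_le (fun _ => e a) _ (e a) (2 * S * W a)) in Hl; trivial.
 - fin.
 - apply is_lim_seq_const.
Qed.

(** * Half of a separatrix excursion *)

Section half.
Variables (d : nat) (P : list trig_mode) (mu : R).
Let F := Fbd d P.

(** With [q] as independent variable the momentum satisfies [p * dp/dq = hA], since the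
    [q]-derivative of [f] is [sin q] times the trigonometric polynomial; [pm] is the resulting
    energy integral with momentum [pc] at [q = 0]. A half after a bump is described by its distance
    to the next crossing, where this equation keeps its form. The sign [s] below is 1 before the
    bump and -1 after it. *)
Definition hA (z : R -> vec) (q : R) : R := sin (clip q) * (1 - mu * fz d P (z (clip q))).
Definition Aint (z : R -> vec) (q : R) : R := RInt (hA z) 0 q.
Definition pm (pc : R) (z : R -> vec) (q : R) : R := sqrt (pc ^ 2 + 2 * Aint z q).
Definition hI (pc : R) (j : nat) (z : R -> vec) (q : R) : R :=
 (1 - cos (clip q)) * gz d P j (z (clip q)) / pm pc z (clip q).
(** Change of the action [I_j] relative to its value [w j] at the crossing [q = 0]. *)
Definition drift (s pc : R) (j : nat) (z : R -> vec) (q : R) : R := - s * mu * RInt (hI pc j z) 0 q.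
Definition hz (s : R) (w : vec) (pc : R) (j : nat) (z : R -> vec) (q : R) : R :=
 (w j + drift s pc j z (clip q)) / pm pc z (clip q).
(** A boundary value problem in integral form: the position [x] is prescribed at the bump [q = PI],
    the velocity [w] and the momentum [pc] at the crossing [q = 0]. *)
Definition Phi_half (s : R) (x w : vec) (pc : R) (z : R -> vec) (q : R) : vec :=
 fun j => x j + s * RInt (hz s w pc j z) PI q.

(** The point 0 is excluded because for [pc = 0] the half takes infinite time, and time and angles
    diverge at [q = 0]. *)
Definition cont04 (z : R -> vec) : Prop :=
 forall j q, j <=' d -> 0 < q < 4 -> continuous (fun q => z q j) q.

Hypothesis mu_pos : 0 < mu.
Hypothesis mu_small : mu * F <= 1 / 1000.

Lemma F_ge1 : 1 <= F. Proof. apply Fbd_ge1. Qed.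

Lemma mu_le : mu <= 1 / 1000.
Proof. generalize F_ge1. nra. Qed.

Lemma muf_le z : Rabs (mu * fz d P z) <= mu * F.
Proof. rewrite Rabs_mult, (Rabs_pos_eq mu); [|lra]. apply Rmult_le_compat_l; [lra|apply fz_le]. Qed.

Lemma hA_sub_sin z q : 0 <= q -> Rabs (hA z q - sin q) <= mu * F * q.
Proof.
 intros Hq. unfold hA. rewrite clip_id; trivial.
 replace (_ - _) with (- (mu * fz d P (z q)) * sin q) by ring.
 rewrite Rabs_mult, Rabs_Ropp. mul_abs; [apply muf_le|now apply Rabs_sin_le].
Qed.

Lemma hA_le z q : Rabs (hA z q) <= 2 * clip q.
Proof.
 unfold hA. rewrite Rabs_mult, Rmult_comm. generalize (clip_ge q). intros.
 mul_abs; [|now apply Rabs_sin_le].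
 generalize (muf_le (z (clip q))). fin.
Qed.

Lemma hA_cont z q : cont04 z -> q < 4 -> continuous (hA z) q.
Proof.
 intros Hz Hq. destruct (Rle_lt_dec q 0) as [H|H].
 - apply (continuous_clip _ 2); trivial. intros; apply hA_le.
 - apply (continuous_near (fun q => sin q * (1 - mu * fz d P (z q))) _ _ q); trivial.
  + intros y Hy. apply Rabs_def2 in Hy. unfold hA. now unclip.
  + apply (continuous_mult (K := R_AbsRing)); [apply continuous_sin|].
   apply @continuous_minus; [apply continuous_const|]. apply (continuous_scal_r (V := NM)).
   apply continuous_fz. intros j Hj. now apply Hz.
Qed.

Lemma Aint_0 z : Aint z 0 = 0.
Proof. unfold Aint. now rewrite RInt_point. Qed.

Lemma Aint_derive z q : cont04 z -> q < 4 -> is_derive (Aint z) q (hA z q).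
Proof.
 intros Hz Hq. apply (is_derive_RInt_cont (hA z) (Rmin q 0 - 1) 4 0).
 - split; [|fin]. generalize (Rmin_l q 0). lra.
 - generalize (Rmin_r q 0). lra.
 - intros y Hy. now apply hA_cont.
Qed.

Lemma RInt_sin q : is_RInt sin 0 q (1 - cos q).
Proof.
 replace (1 - cos q) with (minus (- cos q) (- cos 0)) by (unfold minus, plus, opp; simpl; rewrite cos_0; ring).
 apply (is_RInt_derive (fun y => - cos y)).
 - intros y _. auto_derive; trivial. ring.
 - intros; apply continuous_sin.
Qed.

Lemma Aint_sub_cos z q : cont04 z -> 0 <= q < 4 -> Rabs (Aint z q - (1 - cos q)) <= mu * F * q ^ 2.
Proof.
 intros Hz Hq. rewrite <- (is_RInt_unique _ _ _ _ (RInt_sin q)). unfold Aint.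
 rewrite <- (RInt_minus (V := CNM)).
 - replace (mu * F * q ^ 2) with (q * (mu * F * q)) by ring.
  apply RInt_abs_le_const; [lra| |].
  + intros y Hy. apply @continuous_minus; [apply hA_cont; trivial; lra|apply continuous_sin].
  + intros y Hy. change (Rabs (hA z y - sin y) <= mu * F * q). le_by (apply hA_sub_sin; lra).
   apply Rmult_le_compat_l; [|lra]. generalize F_ge1; nra.
 - ex_rint. intros; apply hA_cont; trivial; lra.
 - eexists. apply RInt_sin.
Qed.

Lemma Aint_bounds z q : cont04 z -> 0 <= q < 4 -> q ^ 2 / 16 <= 2 * Aint z q <= 2 * q ^ 2.
Proof.
 intros Hz Hq. assert (H := Aint_sub_cos z q Hz Hq). apply Rabs_le_between in H.
 generalize (one_minus_cos_lower q ok) (one_minus_cos_upper q). fin.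
Qed.

Lemma pm_sq pc z q : cont04 z -> 0 <= q < 4 -> pm pc z q ^ 2 = pc ^ 2 + 2 * Aint z q.
Proof.
 intros Hz Hq. unfold pm. rewrite pow2_sqrt; trivial.
 generalize (Aint_bounds z q Hz Hq) (pow2_ge_0 pc) (pow2_ge_0 q). lra.
Qed.

Lemma pm_nonneg pc z q : 0 <= pm pc z q.
Proof. apply sqrt_pos. Qed.

(** Uniform in [pc], including the value 0 used on the extreme arcs. This bound is the origin of all
    weights in [/ q]. *)
Lemma pm_ge pc z q : cont04 z -> 0 <= q < 4 -> q / 4 <= pm pc z q.
Proof.
 intros Hz Hq. apply Rsqr_incr_0_var; [|apply pm_nonneg].
 rewrite !Rsqr_pow2, pm_sq; trivial. generalize (Aint_bounds z q Hz Hq) (pow2_ge_0 pc). lra.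
Qed.

Lemma pm_ge_pc pc z q : 0 <= pc -> cont04 z -> 0 <= q < 4 -> pc <= pm pc z q.
Proof.
 intros Hpc Hz Hq. apply Rsqr_incr_0_var; [|apply pm_nonneg].
 rewrite !Rsqr_pow2, pm_sq; trivial. generalize (Aint_bounds z q Hz Hq) (pow2_ge_0 q). lra.
Qed.

Lemma pm_pos pc z q : 0 <= pc -> cont04 z -> 0 <= q < 4 -> 0 < q \/ 0 < pc -> 0 < pm pc z q.
Proof.
 intros Hpc Hz Hq [H|H].
 - generalize (pm_ge pc z q Hz Hq). lra.
 - generalize (pm_ge_pc pc z q Hpc Hz Hq). lra.
Qed.

Lemma pm_cont pc z q : cont04 z -> q < 4 -> continuous (pm pc z) q.
Proof.
 intros Hz Hq. apply (continuous_comp (fun q => pc ^ 2 + 2 * Aint z q) sqrt).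
 - apply @continuous_plus; [apply continuous_const|]. apply @continuous_scal_r.
  eapply is_derive_continuous. now apply Aint_derive.
 - apply continuous_sqrt.
Qed.

Lemma pm_clip_cont pc z q : cont04 z -> q < 4 -> continuous (fun q => pm pc z (clip q)) q.
Proof.
 intros Hz Hq. apply (continuous_comp clip (pm pc z)); [apply continuous_clip0|].
 apply pm_cont; trivial. apply clip_lt; lra.
Qed.

Lemma pm_inv pc z q : cont04 z -> 0 < q < 4 -> / pm pc z q <= 4 / q.
Proof.
 intros Hz Hq. generalize (pm_ge pc z q Hz ok). intros.
 replace (4 / q) with (/ (q / 4)) by fld. fin.
Qed.

Lemma hI_le pc j z q : 0 <= pc -> j <=' d -> cont04 z -> q < 4 -> Rabs (hI pc j z q) <= 2 * F * clip q.
Proof.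
 intros Hpc Hj Hz Hq. unfold hI. destruct (Rle_lt_dec q 0) as [H|H].
 - rewrite clip_neg, cos_0; trivial. fin.
 - unclip. assert (Hp : 0 < pm pc z q) by (apply pm_pos; trivial; lra).
  unfold Rdiv. rewrite !Rabs_mult, Rabs_inv, (Rabs_pos_eq (pm pc z q)), (Rabs_pos_eq (1 - cos q));
   [|apply one_minus_cos_pos|lra].
  replace (2 * F * q) with (q ^ 2 / 2 * F * (4 / q)) by fld.
  assert (0 < / pm pc z q) by fin.
  apply Rmult_le_compat; [|lra| |now apply pm_inv].
  + apply Rmult_le_pos; [apply one_minus_cos_pos|fin].
  + apply Rmult_le_compat; [apply one_minus_cos_pos|fin|apply one_minus_cos_upper|].
   now apply gz_le.
Qed.

Lemma hI_cont pc j z q : 0 <= pc -> j <=' d -> cont04 z -> q < 4 -> continuous (hI pc j z) q.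
Proof.
 intros Hpc Hj Hz Hq. destruct (Rle_lt_dec q 0) as [H|H].
 - apply (continuous_clip _ (2 * F)); trivial. intros; now apply hI_le.
 - apply (continuous_near (fun q => (1 - cos q) * gz d P j (z q) * / pm pc z q) _ _ q); trivial.
  + intros y Hy. apply Rabs_def2 in Hy. unfold hI. now unclip.
  + apply (continuous_mult (K := R_AbsRing)).
   * apply (continuous_mult (K := R_AbsRing)).
    -- apply @continuous_minus; [apply continuous_const|apply continuous_cos].
    -- apply continuous_gz. intros; now apply Hz.
   * apply continuous_Rinv_comp; [now apply pm_cont|].
    apply Rgt_not_eq, pm_pos; trivial; lra.
Qed.

Lemma RInt_hI_derive pc j z q :
 0 <= pc -> j <=' d -> cont04 z -> q < 4 -> is_derive (fun q => RInt (hI pc j z) 0 q) q (hI pc j z q).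
Proof.
 intros Hpc Hj Hz Hq. apply (is_derive_RInt_cont (hI pc j z) (Rmin q 0 - 1) 4 0).
 - split; [|fin]. generalize (Rmin_l q 0). lra.
 - generalize (Rmin_r q 0). lra.
 - intros y Hy. now apply hI_cont.
Qed.

Variable s : R.
Hypothesis Hs : Rabs s = 1.

Lemma drift_0 pc j z : drift s pc j z 0 = 0.
Proof. unfold drift. rewrite RInt_point. unfold zero; simpl. ring. Qed.

Lemma drift_time pc z q : drift s pc 0 z q = 0.
Proof.
 unfold drift. rewrite (RInt_ext _ (fun _ => 0)).
 - rewrite RInt_const. unfold scal; simpl; unfold mult; simpl. ring.
 - intros. unfold hI. simpl. fin.
Qed.

Lemma drift_le pc j z q : 0 <= pc -> j <=' d -> cont04 z -> 0 <= q < 4 ->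
 Rabs (drift s pc j z q) <= 2 * (mu * F) * q ^ 2.
Proof.
 intros Hpc Hj Hz Hq. unfold drift. rewrite !Rabs_mult, Rabs_Ropp, Hs, (Rabs_pos_eq mu); [|lra].
 replace (2 * (mu * F) * q ^ 2) with (1 * mu * (q * (2 * F * q))) by ring.
 mul_l. apply RInt_abs_le_const; [lra| |].
 - intros; apply hI_cont; trivial; lra.
 - intros y Hy. le_by (apply hI_le; trivial; lra). unclip.
  apply Rmult_le_compat_l; [generalize F_ge1; lra|lra].
Qed.

Lemma drift_le1 pc j z q : 0 <= pc -> j <=' d -> cont04 z -> 0 <= q < 4 -> Rabs (drift s pc j z q) <= 1.
Proof.
 intros Hpc Hj Hz Hq. le_by now apply drift_le. fin.
Qed.

Lemma drift_cont pc j z q : 0 <= pc -> j <=' d -> cont04 z -> q < 4 -> continuous (drift s pc j z) q.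
Proof.
 intros Hpc Hj Hz Hq. apply (continuous_scal_r (V := NM)).
 eapply is_derive_continuous. now apply RInt_hI_derive.
Qed.

Lemma hz_cont w pc j z q :
 0 <= pc -> j <=' d -> cont04 z -> q < 4 -> 0 < q \/ 0 < pc -> continuous (hz s w pc j z) q.
Proof.
 intros Hpc Hj Hz Hq H. unfold hz.
 apply (continuous_mult (K := R_AbsRing)).
 - apply @continuous_plus; [apply continuous_const|].
  apply (continuous_comp clip (drift s pc j z)); [apply continuous_clip0|].
  apply drift_cont; trivial. apply clip_lt; lra.
 - apply continuous_Rinv_comp; [now apply pm_clip_cont|].
  apply Rgt_not_eq, pm_pos; trivial.
  + split; [apply clip_ge|apply clip_lt; lra].
  + destruct H; [left; rewrite clip_id; lra|fin].
Qed.

Lemma hz_le w pc j z q W :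
 0 <= pc -> j <=' d -> cont04 z -> 0 < q < 4 -> Rabs (w j) <= W ->
 Rabs (hz s w pc j z q) <= 16 * (W + 1) / q ^ 2.
Proof.
 intros Hpc Hj Hz Hq Hw. unfold hz. unclip.
 assert (Hp : 0 < pm pc z q) by (apply pm_pos; trivial; lra).
 unfold Rdiv at 1. rewrite Rabs_mult, Rabs_inv, (Rabs_pos_eq (pm pc z q)) by lra.
 assert (0 < / pm pc z q) by fin.
 le_thru ((W + 1) * (4 / q)).
 - apply Rmult_le_compat; [fin|lra| |now apply pm_inv].
  triang. apply Rplus_le_compat; trivial. apply drift_le1; trivial; lra.
 - replace (16 * (W + 1) / q ^ 2) with ((W + 1) * (4 / q) * (4 / q)) by fld.
  assert (0 <= W + 1) by fin.
  assert (1 <= 4 / q) by (reg_r q; field_simplify; lra).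
  rewrite <- (Rmult_1_r ((W + 1) * (4 / q))) at 1. fin.
Qed.

Lemma PI_range : 3 < PI < 4.
Proof. generalize PI2_3_2 PI_lt_4. lra. Qed.

Lemma Phi_half_sub x w pc j z q W :
 0 <= pc -> j <=' d -> cont04 z -> 0 < q < 4 -> Rabs (w j) <= W ->
 Rabs (Phi_half s x w pc z q j - x j) <= 64 * (W + 1) / q.
Proof.
 intros Hpc Hj Hz Hq Hw. unfold Phi_half.
 replace (_ - _) with (s * RInt (hz s w pc j z) PI q) by ring.
 rewrite Rabs_mult, Hs, Rmult_1_l. generalize PI_range; intros.
 le_by (apply RInt_abs_le_inv_square with (C := 16 * (W + 1)); try lra).
 - intros; apply hz_cont; trivial; lra.
 - intros; now apply hz_le.
 - fin.
Qed.

Lemma RInt_hz_derive w pc j z q :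
 0 <= pc -> j <=' d -> cont04 z -> q < 4 -> 0 < q \/ 0 < pc ->
 is_derive (fun q => RInt (hz s w pc j z) PI q) q (hz s w pc j z q).
Proof.
 intros Hpc Hj Hz Hq H. generalize PI_range; intros. destruct H as [H|H].
 - apply (is_derive_RInt_cont (hz s w pc j z) 0 4 PI); try lra.
  intros y Hy. apply hz_cont; trivial; lra.
 - apply (is_derive_RInt_cont (hz s w pc j z) (Rmin q 0 - 1) 4 PI).
  + split; [|fin]. generalize (Rmin_l q 0). lra.
  + generalize (Rmin_r q 0). lra.
  + intros y Hy. apply hz_cont; trivial; [lra|fin].
Qed.

Lemma Phi_half_derive x w pc j z q :
 0 <= pc -> j <=' d -> cont04 z -> q < 4 -> 0 < q \/ 0 < pc ->
 is_derive (fun q => Phi_half s x w pc z q j) q (s * hz s w pc j z q).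
Proof.
 intros Hpc Hj Hz Hq H. unfold Phi_half.
 replace (s * hz s w pc j z q) with (plus 0 (s * hz s w pc j z q)) by (unfold plus; simpl; ring).
 apply @is_derive_plus; [apply @is_derive_const|]. apply (is_derive_scal (fun q => RInt (hz s w pc j z) PI q)).
 now apply RInt_hz_derive.
Qed.

Lemma Phi_half_cont x w pc z : 0 <= pc -> cont04 z -> cont04 (Phi_half s x w pc z).
Proof.
 intros Hpc Hz j q Hj Hq. eapply is_derive_continuous. apply Phi_half_derive; trivial; lra.
Qed.

(** * Dependence of the fixed-point map on the data and on the path *)

Section difference.
Variables (pc pc' W N dpc dw : R) (z z' : R -> vec) (w w' x x' : vec).
Hypothesis Hpc : 0 <= pc.
Hypothesis Hpc' : 0 <= pc'.
Hypothesis Hdpc : Rabs (pc - pc') <= dpc.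
Hypothesis Hz : cont04 z.
Hypothesis Hz' : cont04 z'.
Hypothesis HN : forall j q, j <=' d -> 0 < q < 4 -> Rabs (z q j - z' q j) <= N / q.
Hypothesis HN0 : 0 <= N.

Lemma Aint_diff q : 0 <= q < 4 -> Rabs (Aint z q - Aint z' q) <= mu * F * N * q.
Proof.
 intros Hq. unfold Aint. rewrite <- (RInt_minus (V := CNM)).
 - replace (mu * F * N * q) with (q * (mu * F * N)) by ring. apply RInt_abs_le_const; [lra| |].
  + intros y Hy. apply @continuous_minus; apply hA_cont; trivial; lra.
  + intros y Hy. change (Rabs (hA z y - hA z' y) <= mu * F * N). unfold hA. unclip.
   replace (_ - _) with (- (sin y * (mu * (fz d P (z y) - fz d P (z' y))))) by ring.
   rewrite Rabs_Ropp, !Rabs_mult, (Rabs_pos_eq mu) by lra.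
   destruct (Req_dec y 0) as [->|Hy0].
   * rewrite sin_0, Rabs_R0, Rmult_0_l. generalize F_ge1. fin.
   * replace (mu * F * N) with (y * (mu * (F * (N / y)))) by fld.
    apply Rmult_le_compat; [fin| |apply Rabs_sin_le; lra|].
    -- fin.
    -- mul_l. apply fz_Lip. intros; apply HN; trivial; lra.
 - ex_rint. intros; apply hA_cont; trivial; lra.
 - ex_rint. intros; apply hA_cont; trivial; lra.
Qed.

Definition Dinv : R := 64 * (mu * F * N) + 16 * dpc.

Lemma dpc_pos : 0 <= dpc.
Proof. fin. Qed.

Lemma muFN_pos : 0 <= mu * F * N.
Proof. generalize F_ge1. fin. Qed.

Lemma Dinv_pos : 0 <= Dinv.
Proof. unfold Dinv. generalize dpc_pos muFN_pos. lra. Qed.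

(** The squares of the momenta are compared and the result is divided by [p + p'], which dominates
    both [pc + pc'] and [q / 2]. The square root is thus never differentiated, and small [pc] does
    no harm. *)
Lemma pm_inv_diff q : 0 < q < 4 -> Rabs (/ pm pc z q - / pm pc' z' q) <= Dinv / q ^ 2.
Proof.
 intros Hq. set (p := pm pc z q). set (p' := pm pc' z' q).
 assert (Hp : q / 4 <= p) by (apply pm_ge; trivial; lra).
 assert (Hp' : q / 4 <= p') by (apply pm_ge; trivial; lra).
 assert (Hpp : pc <= p) by (apply pm_ge_pc; trivial; lra).
 assert (Hpp' : pc' <= p') by (apply pm_ge_pc; trivial; lra).
 assert (Hsq : (p' - p) * (p + p') = (pc' - pc) * (pc + pc') + 2 * (Aint z' q - Aint z q)).
 { replace ((p' - p) * (p + p')) with (p' ^ 2 - p ^ 2) by ring.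
  unfold p, p'. rewrite !pm_sq; trivial; try lra. }
 assert (HA := Aint_diff q ok). rewrite Rabs_minus_sym in HA.
 assert (Hnum : Rabs (p' - p) <= dpc + 4 * (mu * F * N)).
 { reg_r (p + p'). rewrite <- (Rabs_pos_eq (p + p')) at 1 by lra.
  rewrite <- Rabs_mult, Hsq. triang.
  rewrite !Rabs_mult, (Rabs_pos_eq 2), (Rabs_pos_eq (pc + pc')) by lra.
  rewrite Rabs_minus_sym in Hdpc.
  le_thru (dpc * (p + p') + 2 * (mu * F * N * q)).
  - fin.
  - generalize muFN_pos. nra. }
 replace (/ p - / p') with ((p' - p) * (/ p * / p')) by fld.
 rewrite Rabs_mult. assert (0 < / p) by fin.
 assert (0 < / p') by fin.
 rewrite (Rabs_pos_eq (/ p * / p')) by fin.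
 replace (Dinv / q ^ 2) with ((dpc + 4 * (mu * F * N)) * (4 / q * (4 / q))) by (unfold Dinv; field; lra).
 assert (/ p <= 4 / q) by (apply pm_inv; trivial; lra).
 assert (/ p' <= 4 / q) by (apply pm_inv; trivial; lra).
 fin.
Qed.

Lemma hI_diff j q : j <=' d -> 0 <= q < 4 ->
 Rabs (hI pc j z q - hI pc' j z' q) <= F * (2 * N + Dinv / 2).
Proof.
 intros Hj Hq. note F_ge1 Dinv_pos as HF HD. unfold hI. unclip.
 destruct (Req_dec q 0) as [->|Hq0].
 - rewrite cos_0. replace (_ - _) with 0 by fin. fin.
 - set (p := pm pc z q). set (p' := pm pc' z' q).
  replace (_ - _) with ((1 - cos q) * ((gz d P j (z q) - gz d P j (z' q)) * / p
    + gz d P j (z' q) * (/ p - / p'))) by fin.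
  rewrite Rabs_mult, (Rabs_pos_eq (1 - cos q)) by apply one_minus_cos_pos.
  assert (Hp : 0 < p) by (apply pm_pos; trivial; lra).
  assert (0 < / p) by fin.
  replace (F * (2 * N + Dinv / 2)) with (q ^ 2 / 2 * (F * (N / q) * (4 / q) + F * (Dinv / q ^ 2)))
   by fld.
  apply Rmult_le_compat; [apply one_minus_cos_pos|fin|apply one_minus_cos_upper|].
  triang. rewrite !Rabs_mult. apply Rplus_le_compat.
  + mul_abs.
   * apply gz_Lip; trivial. intros; apply HN; trivial; lra.
   * rewrite Rabs_pos_eq by lra. apply pm_inv; trivial; lra.
  + mul_abs; [now apply gz_le|]. apply pm_inv_diff; lra.
Qed.

Lemma drift_diff j q : j <=' d -> 0 <= q < 4 ->
 Rabs (drift s pc j z q - drift s pc' j z' q) <= mu * F * (2 * N + Dinv / 2) * q.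
Proof.
 intros Hj Hq. unfold drift. rewrite <- Rmult_minus_distr_l.
 rewrite <- (RInt_minus (V := CNM)).
 - rewrite !Rabs_mult, Rabs_Ropp, Hs, (Rabs_pos_eq mu) by lra.
  replace (mu * F * (2 * N + Dinv / 2) * q) with (1 * mu * (q * (F * (2 * N + Dinv / 2)))) by ring.
  mul_l. apply RInt_abs_le_const; [lra| |].
  + intros y Hy. apply @continuous_minus; apply hI_cont; trivial; lra.
  + intros y Hy. apply hI_diff; trivial; lra.
 - ex_rint. intros; apply hI_cont; trivial; lra.
 - ex_rint. intros; apply hI_cont; trivial; lra.
Qed.

Hypothesis HW : 0 <= W.
Hypothesis Hw' : bnd d W w'.
Hypothesis Hdw : bnd2 d dw w w'.

(** Only the coefficient of the path distance [N] decides about contraction, and it carries the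
    factor [mu * F]. *)
Definition Ez : R := 16 * dw + 32 * (W + 2) * dpc + 256 * (mu * F * (W + 2)) * N.

Lemma dw_pos : 0 <= dw.
Proof. le_by apply Rabs_pos; apply (Hdw O (Nat.le_0_l d)). Qed.

Lemma Ez_pos : 0 <= Ez.
Proof.
 unfold Ez. generalize dw_pos dpc_pos F_ge1. intros.
 apply Rplus_le_le_0_compat; [fin|]; repeat apply Rmult_le_pos; lra.
Qed.

Lemma hz_diff j q : j <=' d -> 0 < q < 4 ->
 Rabs (hz s w pc j z q - hz s w' pc' j z' q) <= Ez / q ^ 2.
Proof.
 intros Hj Hq. generalize F_ge1 Dinv_pos dw_pos dpc_pos muFN_pos. intros HF HD Hdw0 Hdpc0 HmN.
 unfold hz. unclip.
 set (p := pm pc z q). set (p' := pm pc' z' q). set (i := drift s pc j z q). set (i' := drift s pc' j z' q).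
 replace (_ - _) with (((w j - w' j) + (i - i')) * / p + (w' j + i') * (/ p - / p')) by fin.
 assert (Hp : 0 < p) by (apply pm_pos; trivial; lra).
 assert (0 < / p) by fin.
 le_thru ((dw + mu * F * (2 * N + Dinv / 2) * q) * (4 / q) + (W + 1) * (Dinv / q ^ 2)).
 - triang. rewrite !Rabs_mult. apply Rplus_le_compat.
  + mul_abs.
   * triang. apply Rplus_le_compat; [fin|].
    apply drift_diff; trivial; lra.
   * rewrite Rabs_pos_eq by lra. apply pm_inv; trivial; lra.
  + mul_abs; [|apply pm_inv_diff; lra].
   triang. apply Rplus_le_compat; [fin|].
   apply drift_le1; trivial; lra.
 - replace ((dw + mu * F * (2 * N + Dinv / 2) * q) * (4 / q) + (W + 1) * (Dinv / q ^ 2))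
   with ((4 * q * dw + 4 * q ^ 2 * (mu * F * (2 * N + Dinv / 2)) + (W + 1) * Dinv) * / q ^ 2) by fld.
  apply Rmult_le_compat_r; [fin|].
  assert (Hq2 : q ^ 2 <= 16) by nra.
  assert (0 <= mu * F * (2 * N + Dinv / 2)) by fin.
  le_thru (16 * dw + 64 * (mu * F * (2 * N + Dinv / 2)) + (W + 1) * Dinv); [nra|].
  unfold Ez. assert (Hm : mu * F * Dinv <= Dinv / 1000) by nra.
  replace (64 * (mu * F * (2 * N + Dinv / 2))) with (128 * (mu * F * N) + 32 * (mu * F * Dinv)) by field.
  replace (256 * (mu * F * (W + 2)) * N) with (256 * (W + 2) * (mu * F * N)) by ring.
  unfold Dinv in *. fin.
Qed.

(** The shift [x j - x' j] is subtracted on the left so that the same estimate serves for second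
    differences, where the reference halves differ by exactly this shift. *)
Lemma Phi_half_diff j q : j <=' d -> 0 < q < 4 ->
 Rabs (Phi_half s x w pc z q j - Phi_half s x' w' pc' z' q j - (x j - x' j)) <= 4 * Ez / q.
Proof.
 intros Hj Hq. unfold Phi_half. generalize PI_range; intros.
 replace (_ - _ - _) with (s * (RInt (hz s w pc j z) PI q - RInt (hz s w' pc' j z') PI q)) by ring.
 rewrite Rabs_mult, Hs, Rmult_1_l. rewrite <- (RInt_minus (V := CNM)).
 - apply RInt_abs_le_inv_square; try lra.
  + intros. apply @continuous_minus; apply hz_cont; trivial; lra.
  + intros. now apply hz_diff.
 - apply ex_RInt_cont. intros y Hy. apply hz_cont; trivial.
  + eapply Rle_lt_trans; [apply Hy|]. apply Rmax_lub_lt; lra.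
  + left. eapply Rlt_le_trans; [|apply Hy]. apply Rmin_glb_lt; lra.
 - apply ex_RInt_cont. intros y Hy. apply hz_cont; trivial.
  + eapply Rle_lt_trans; [apply Hy|]. apply Rmax_lub_lt; lra.
  + left. eapply Rlt_le_trans; [|apply Hy]. apply Rmin_glb_lt; lra.
Qed.
End difference.
End half.

(** * Existence and Lipschitz dependence of half-excursions *)

Section half_solution.
Variables (d : nat) (P : list trig_mode) (mu W : R).
Let F := Fbd d P.
Hypothesis mu_pos : 0 < mu.
Hypothesis W_pos : 0 <= W.
Hypothesis small : mu * F * (W + 2) <= / 10000000.

Lemma small1 : mu * F <= / 10000000.
Proof.
 assert (0 <= mu * F) by (generalize (F_ge1 d P); fold F; nra). nra.
Qed.

Lemma small2 : mu * F <= 1 / 1000.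
Proof. generalize small1. lra. Qed.

Definition is_half (s : R) (x w : vec) (pc : R) (z : R -> vec) : Prop :=
 cont04 d z /\ forall q j, j <=' d -> q < 4 -> z q j = Phi_half d P mu s x w pc z q j.

Section ext.
Variables (s pc : R) (z z' : R -> vec) (w x : vec).
Hypothesis Hs : Rabs s = 1.
Hypothesis Hpc : 0 <= pc.
Hypothesis Hz : cont04 d z.
Hypothesis Hz' : cont04 d z'.
Hypothesis Heq : forall j q, j <=' d -> 0 < q < 4 -> z q j = z' q j.

Lemma ext_dist j q : j <=' d -> 0 < q < 4 -> Rabs (z q j - z' q j) <= 0 / q.
Proof. intros. rewrite Heq, Rminus_diag, Rabs_R0; trivial. fin. Qed.

Lemma Rabs_le_0_eq a b : Rabs (a - b) <= 0 -> a = b.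
Proof. fin. Qed.

Lemma Aint_ext q : 0 <= q < 4 -> Aint d P mu z q = Aint d P mu z' q.
Proof.
 intros Hq. apply Rabs_le_0_eq.
 generalize (Aint_diff d P mu mu_pos small2 0 z z' Hz Hz' ext_dist (Rle_refl 0) q Hq). lra.
Qed.

Lemma pm_ext q : 0 <= q < 4 -> pm d P mu pc z q = pm d P mu pc z' q.
Proof. intros Hq. unfold pm. now rewrite Aint_ext. Qed.

Lemma drift_ext j q : j <=' d -> 0 <= q < 4 -> drift d P mu s pc j z q = drift d P mu s pc j z' q.
Proof.
 intros Hj Hq. apply Rabs_le_0_eq.
 assert (H0 : Rabs (pc - pc) <= 0) by fin.
 generalize (drift_diff d P mu mu_pos small2 s Hs pc pc 0 0 z z' Hpc Hpc H0 Hz Hz' ext_dist (Rle_refl 0) j q Hj Hq).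
 unfold Dinv. lra.
Qed.

Lemma hz_ext j q : j <=' d -> q < 4 -> hz d P mu s w pc j z q = hz d P mu s w pc j z' q.
Proof.
 intros Hj Hq. unfold hz. generalize (clip_ge q) (clip_lt q 4 ok Hq). intros.
 now rewrite drift_ext, pm_ext by fin.
Qed.

(** Values of the path at [q <= 0] do not enter: the integrands see it at [clip q], and at 0 they
    carry a vanishing factor [sin] or [1 - cos]. *)
Lemma Phi_half_ext j q : j <=' d -> q < 4 ->
 Phi_half d P mu s x w pc z q j = Phi_half d P mu s x w pc z' q j.
Proof.
 intros Hj Hq. unfold Phi_half. f_equal. f_equal. apply RInt_ext. intros y Hy. apply hz_ext; trivial.
 eapply Rlt_trans; [apply Hy|]. apply Rmax_lub_lt; trivial. generalize PI_range; lra.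
Qed.
End ext.

Lemma half_exists s x w pc :
 Rabs s = 1 -> 0 <= pc -> bnd d W w -> exists z, is_half s x w pc z.
Proof.
 intros Hs Hpc Hw.
 set (tz := fun (u : nat * R -> R) (q : R) (j : nat) => u (j, q)).
 set (Phi := fun (u : nat * R -> R) (a : nat * R) => Phi_half d P mu s x w pc (tz u) (snd a) (fst a)).
 destruct (banach_fixed_point (nat * R) (fun a => (fst a <= d)%nat /\ 0 < snd a < 4)
   (fun a => / snd a) (fun u => cont04 d (tz u)) Phi (1/2) (fun a => x (fst a)) (64 * (W + 1)))
  as (u & HuC & Hu).
 - fin.
 - lra.
 - lra.
 - intros j q Hj Hq. apply continuous_const.
 - intros u Hu. apply (Phi_half_cont d P mu mu_pos small2 s x w pc (tz u)); trivial.
 - intros [j q] [Hj Hq]. simpl in *. unfold Phi. simpl.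
  apply (Phi_half_sub d P mu mu_pos small2 s Hs); trivial; [|fin].
  intros j' q' _ _. apply continuous_const.
 - intros u v M Hu Hv HM H [j q] [Hj Hq]. simpl in *. unfold Phi. simpl.
  assert (H0 : Rabs (pc - pc) <= 0) by fin.
  assert (H1 : bnd2 d 0 w w) by (intros; rewrite Rminus_diag, Rabs_R0; lra).
  assert (HN : forall j q, j <=' d -> 0 < q < 4 -> Rabs (tz u q j - tz v q j) <= M / q).
  { intros j' q' Hj' Hq'. apply (H (j', q')). fin. }
  generalize (Phi_half_diff d P mu mu_pos small2 s Hs pc pc W M 0 0 (tz u) (tz v) w w x x
   Hpc Hpc H0 Hu Hv HN HM W_pos Hw H1 j q Hj Hq).
  rewrite Rminus_diag, Rminus_0_r. intros H2. le_by exact H2.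
  unfold Ez. fold F. unfold Rdiv. apply Rmult_le_compat_r; [fin|].
  fin.
 (* The weight [/ q] is bounded near a fixed [q > 0], so weighted convergence is locally uniform and
    preserves continuity. *)
 - intros un u en HunC Hen Hun j q Hj Hq.
  apply continuous_eps. intros e He.
  assert (Hq2 : 0 < q / 2) by lra.
  apply is_lim_seq_spec in Hen. destruct (Hen (mkposreal (e / 3 * (q / 2)) ltac:(nra))) as [n Hn].
  specialize (Hn n (Nat.le_refl n)). simpl in Hn. rewrite Rminus_0_r in Hn.
  assert (Hn' : en n <= e / 3 * (q / 2)) by fin.
  assert (Hclose : forall y, q / 2 < y < 4 -> Rabs (un n (j, y) - u (j, y)) <= e / 3).
  { intros y Hy. le_by (apply (Hun n (j, y)); simpl; split; [fin|lra]). simpl.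
   reg_r y. inv_l; rewrite Rmult_1_r. nra. }
  destruct (continuous_eps_inv _ _ (HunC n j q Hj Hq) (e / 3) ok) as (r & Hr & Hry).
  exists (Rmin r (Rmin (q / 2) (4 - q))). split; [repeat apply Rmin_glb_lt; lra|].
  intros y Hy.
  assert (Hy1 : Rabs (y - q) < r) by (eapply Rlt_le_trans; [exact Hy|apply Rmin_l]).
  assert (Hy2 : Rabs (y - q) < Rmin (q / 2) (4 - q)) by (eapply Rlt_le_trans; [exact Hy|apply Rmin_r]).
  assert (Hy3 : Rabs (y - q) < q / 2) by (eapply Rlt_le_trans; [exact Hy2|apply Rmin_l]).
  assert (Hy4 : Rabs (y - q) < 4 - q) by (eapply Rlt_le_trans; [exact Hy2|apply Rmin_r]).
  apply Rabs_def2 in Hy3, Hy4. specialize (Hry y Hy1).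
  generalize (Hclose y ok) (Hclose q ok). unfold tz in *.
  replace (u (j, y) - u (j, q)) with (- (un n (j, y) - u (j, y)) + (un n (j, y) - un n (j, q)) + (un n (j, q) - u (j, q))) by ring.
  intros. eapply Rle_lt_trans; [apply Rabs_triang|].
  eapply Rle_lt_trans; [apply Rplus_le_compat_r, Rabs_triang|]. rewrite Rabs_Ropp. lra.
 (* The fixed point is only controlled on [0 < q < 4]; one more application of the map gives a path
    that satisfies the equation for all [q < 4], as [is_half] asks. *)
 - set (z := tz u). exists (Phi_half d P mu s x w pc z).
  assert (HC : cont04 d (Phi_half d P mu s x w pc z)).
  { now apply (Phi_half_cont d P mu mu_pos small2 s). }
  split; trivial. intros q j Hj Hq. apply Phi_half_ext; trivial.
  intros j' q' Hj' Hq'. symmetry. apply (Hu (j', q')). fin.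
Qed.

(** An instance of [absorb]: [S] below bounds the terms of [Phi_half_diff] that do not involve the
    paths, and the hypothesis [small] makes the coefficient of the remaining one at most one
    half. *)
Lemma half_Lip s x x' w w' pc pc' z z' dx dw dpc :
 Rabs s = 1 -> 0 <= pc -> 0 <= pc' -> Rabs (pc - pc') <= dpc ->
 bnd d W w -> bnd d W w' ->
 bnd2 d dw w w' -> bnd2 d dx x x' ->
 is_half s x w pc z -> is_half s x' w' pc' z' ->
 forall j q, j <=' d -> 0 < q < 4 ->
 Rabs (z q j - z' q j) <= (8 * dx + 128 * dw + 256 * (W + 2) * dpc) / q.
Proof.
 intros Hs Hpc Hpc' Hdpc Hw Hw' Hdw Hdx [Hz Ez1] [Hz' Ez2] j q Hj Hq.
 assert (Hdpc0 := dpc_pos _ _ _ Hdpc). assert (Hdw0 := dw_pos _ _ _ _ Hdw).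
 assert (Hdx0 := dw_pos _ _ _ _ Hdx).
 assert (HWd : 0 <= (W + 2) * dpc) by fin.
 set (S := 4 * dx + 64 * dw + 128 * (W + 2) * dpc).
 le_thru (2 * S * / q); [|right; unfold S, Rdiv; ring].
 apply (absorb (fun a : nat * R => (fst a <= d)%nat /\ 0 < snd a < 4)
  (fun a => Rabs (z (snd a) (fst a) - z' (snd a) (fst a))) (fun a => / snd a) S (4 * dx + 128 * (W + 1)))
  with (a := (j, q)).
 - fin.
 - unfold S. lra.
 - lra.
 - intros [j' q'] [Hj' Hq']. simpl in *. rewrite Ez1, Ez2 by fin.
  generalize (Phi_half_sub d P mu mu_pos small2 s Hs x w pc j' z q' W Hpc Hj' Hz Hq' (Hw j' Hj')).
  generalize (Phi_half_sub d P mu mu_pos small2 s Hs x' w' pc' j' z' q' W Hpc' Hj' Hz' Hq' (Hw' j' Hj')).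
  generalize (Hdx j' Hj').
  set (a := Phi_half d P mu s x w pc z q' j'). set (a' := Phi_half d P mu s x' w' pc' z' q' j'). intros H1 H2 H3.
  replace (a - a') with ((x j' - x' j') + (a - x j') - (a' - x' j')) by ring.
  triang. rewrite Rabs_Ropp.
  le_by apply Rplus_le_compat_r, Rabs_triang.
  assert (dx <= 4 * dx / q').
  { apply Rmult_le_reg_r with q'; [lra|]. replace (4 * dx / q' * q') with (4 * dx) by fld. nra. }
  fin.
 - intros N HN H [j' q'] [Hj' Hq']. simpl in *. rewrite Ez1, Ez2 by fin.
  assert (HN' : forall j q, j <=' d -> 0 < q < 4 -> Rabs (z q j - z' q j) <= N / q).
  { intros j1 q1 Hj1 Hq1. apply (H (j1, q1)). fin. }
  generalize (Phi_half_diff d P mu mu_pos small2 s Hs pc pc' W N dpc dw z z' w w' x x'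
   Hpc Hpc' Hdpc Hz Hz' HN' HN W_pos Hw' Hdw j' q' Hj' Hq').
  set (a := Phi_half d P mu s x w pc z q' j'). set (a' := Phi_half d P mu s x' w' pc' z' q' j'). intros H3.
  replace (a - a') with ((x j' - x' j') + (a - a' - (x j' - x' j'))) by ring.
  triang.
  assert (dx <= 4 * dx / q').
  { apply Rmult_le_reg_r with q'; [lra|]. replace (4 * dx / q' * q') with (4 * dx) by fld. nra. }
  generalize (Hdx j' Hj'). intros.
  le_thru (4 * dx / q' + 4 * Ez d P mu W N dpc dw / q'); [lra|].
  replace (4 * dx / q' + 4 * Ez d P mu W N dpc dw / q') with ((4 * dx + 4 * Ez d P mu W N dpc dw) * / q')
   by fin.
  apply Rmult_le_compat_r; [fin|].
  unfold Ez, S. fold F. fin.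
 - fin.
Qed.
End half_solution.

(** * Passage time near the hyperbolic equilibrium *)

Lemma is_RInt_inv C a b : 0 < a -> a <= b -> is_RInt (fun y => C / y) a b (C * (ln b - ln a)).
Proof.
 intros Ha Hab.
 replace (C * (ln b - ln a)) with (minus (C * ln b) (C * ln a)) by (unfold minus, plus, opp; simpl; ring).
 apply (is_RInt_derive (fun y => C * ln y)).
 - rewrite Rmin_left, Rmax_right; trivial. intros y Hy. auto_derive; [lra|]. fin.
 - rewrite Rmin_left, Rmax_right; trivial. intros y Hy.
  apply @ex_derive_continuous. auto_derive. lra.
Qed.

Section passage.
Variables (d : nat) (P : list trig_mode) (mu : R).
Let F := Fbd d P.
Hypothesis mu_pos : 0 < mu.
Hypothesis mu_small : mu * F <= 1 / 1000.

Definition ipm (pc : R) (z : R -> vec) (q : R) : R := / pm d P mu pc z (clip q).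
Definition tau (pc : R) (z : R -> vec) : R := RInt (ipm pc z) 0 PI.

Lemma ipm_cont pc z q : 0 < pc -> cont04 d z -> q < 4 -> continuous (ipm pc z) q.
Proof.
 intros Hpc Hz Hq. apply continuous_Rinv_comp; [now apply pm_clip_cont|].
 apply Rgt_not_eq, pm_pos; trivial; try lra. split; [apply clip_ge|apply clip_lt; lra].
Qed.

Lemma ipm_ex_RInt pc z a b : 0 < pc -> cont04 d z -> a < 4 -> b < 4 -> ex_RInt (ipm pc z) a b.
Proof.
 intros Hpc Hz Ha Hb. apply ex_RInt_cont. intros y Hy. apply ipm_cont; trivial.
 eapply Rle_lt_trans; [apply Hy|]. now apply Rmax_lub_lt.
Qed.

Lemma ipm_bounds pc z q : 0 < pc -> cont04 d z -> 0 <= q < 4 ->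
 0 < ipm pc z q <= / pc /\ (0 < q -> ipm pc z q <= 4 / q).
Proof.
 intros Hpc Hz Hq. unfold ipm. unclip.
 assert (Hp := pm_ge_pc d P mu mu_pos mu_small pc z q ok Hz Hq).
 repeat split.
 - fin.
 - fin.
 - intros. apply (pm_inv d P mu mu_pos mu_small); trivial. lra.
Qed.

Lemma ipm_lower pc z q : 0 < pc -> cont04 d z -> pc <= q < 4 -> 1 / 2 / q <= ipm pc z q.
Proof.
 intros Hpc Hz Hq. unfold ipm. unclip.
 replace (1 / 2 / q) with (/ (2 * q)) by fld. apply Rinv_le_contravar.
 - apply (pm_pos d P mu mu_pos mu_small); trivial; lra.
 - apply Rsqr_incr_0_var; [|lra]. rewrite !Rsqr_pow2, (pm_sq d P mu mu_pos mu_small) by fin.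
  generalize (Aint_bounds d P mu mu_pos mu_small z q Hz ok). nra.
Qed.

(** At [q = pc] the two lower bounds [pc] and [q / 4] of the momentum exchange their roles: the
    first part lasts at most 1, the second is comparable to [- ln pc]. *)
Lemma tau_split pc z : 0 < pc <= 1 -> cont04 d z ->
 tau pc z = RInt (ipm pc z) 0 pc + RInt (ipm pc z) pc PI.
Proof.
 intros Hpc Hz. generalize PI_range; intros. unfold tau. symmetry.
 apply (RInt_Chasles (V := CNM)); apply ipm_ex_RInt; trivial; lra.
Qed.

Lemma tau_upper pc z : 0 < pc <= 1 -> cont04 d z -> tau pc z <= 1 + 4 * (ln 4 - ln pc).
Proof.
 intros Hpc Hz. generalize PI_range; intros. rewrite tau_split; trivial. apply Rplus_le_compat.
 - le_thru (Rabs (RInt (ipm pc z) 0 pc)); [apply Rle_abs|].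
  replace 1 with (pc * / pc) by fld. apply RInt_abs_le_const; [lra| |].
  + intros; apply ipm_cont; trivial; lra.
  + intros y Hy. destruct (ipm_bounds pc z y ok Hz ok). fin.
 - le_thru (4 * (ln PI - ln pc)).
  + rewrite <- (is_RInt_unique _ _ _ _ (is_RInt_inv 4 pc PI ok ok)).
   apply RInt_le; [lra|apply ipm_ex_RInt; trivial; lra|eexists; apply is_RInt_inv; lra|].
   intros y Hy. apply ipm_bounds; trivial; lra.
  + assert (ln PI <= ln 4) by (apply ln_le; lra). lra.
Qed.

Lemma tau_lower pc z : 0 < pc <= 1 -> cont04 d z -> - ln pc / 2 <= tau pc z.
Proof.
 intros Hpc Hz. generalize PI_range; intros. rewrite tau_split; trivial.
 assert (0 <= RInt (ipm pc z) 0 pc).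
 { apply RInt_ge_0; [lra|apply ipm_ex_RInt; trivial; lra|].
  intros y Hy. destruct (ipm_bounds pc z y ok Hz ok). lra. }
 assert (1 / 2 * (ln PI - ln pc) <= RInt (ipm pc z) pc PI).
 { rewrite <- (is_RInt_unique _ _ _ _ (is_RInt_inv (1/2) pc PI ok ok)).
  apply RInt_le; [lra|eexists; apply is_RInt_inv; lra|apply ipm_ex_RInt; trivial; lra|].
  intros y Hy. apply ipm_lower; trivial; lra. }
 assert (0 <= ln PI) by (rewrite <- ln_1; apply ln_le; lra). lra.
Qed.

Lemma pm_diff_pc pc pc' z q : 0 < pc -> 0 < pc' -> cont04 d z -> 0 <= q < 4 ->
 ipm pc z q - ipm pc' z q =
 (pc' - pc) * (pc + pc') * (ipm pc z q * ipm pc' z q / (pm d P mu pc z q + pm d P mu pc' z q)).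
Proof.
 intros Hpc Hpc' Hz Hq. unfold ipm. unclip.
 assert (H1 := pm_ge_pc d P mu mu_pos mu_small pc z q ok Hz Hq).
 assert (H2 := pm_ge_pc d P mu mu_pos mu_small pc' z q ok Hz Hq).
 assert (S1 := pm_sq d P mu mu_pos mu_small pc z q Hz Hq).
 assert (S2 := pm_sq d P mu mu_pos mu_small pc' z q Hz Hq).
 set (p := pm d P mu pc z q) in *. set (p' := pm d P mu pc' z q) in *.
 replace ((pc' - pc) * (pc + pc')) with (p' ^ 2 - p ^ 2) by fin.
 fin.
Qed.

(** The constant blows up as the momenta tend to 0; the estimate serves for continuity in the
    intermediate value argument of [passage_momentum]. *)
Lemma tau_pc_Lip pc pc' z : 0 < pc -> 0 < pc' -> cont04 d z ->
 Rabs (tau pc z - tau pc' z) <= 4 * Rabs (pc - pc') / (pc * pc').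
Proof.
 intros Hpc Hpc' Hz. generalize PI_range; intros. unfold tau.
 rewrite <- (RInt_minus (V := CNM)); try (apply ipm_ex_RInt; trivial; lra).
 le_thru (PI * (Rabs (pc - pc') / (pc * pc'))).
 - apply RInt_abs_le_const; [lra| |].
  + intros. apply @continuous_minus; apply ipm_cont; trivial; lra.
  + intros y Hy. change (Rabs (ipm pc z y - ipm pc' z y) <= Rabs (pc - pc') / (pc * pc')).
   rewrite pm_diff_pc by fin.
   assert (H1 := pm_ge_pc d P mu mu_pos mu_small pc z y ok Hz ok).
   assert (H2 := pm_ge_pc d P mu mu_pos mu_small pc' z y ok Hz ok).
   destruct (ipm_bounds pc z y Hpc Hz ok) as [B1 _].
   destruct (ipm_bounds pc' z y Hpc' Hz ok) as [B2 _].
   set (p := pm d P mu pc z y) in *. set (p' := pm d P mu pc' z y) in *.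
   set (i := ipm pc z y) in *. set (i' := ipm pc' z y) in *.
   rewrite !Rabs_mult, Rabs_minus_sym. unfold Rdiv at 2. rewrite Rmult_assoc.
   apply Rmult_le_compat_l; [fin|].
   rewrite (Rabs_pos_eq (pc + pc')) by lra.
   rewrite Rabs_pos_eq by fin.
   replace ((pc + pc') * (i * i' / (p + p'))) with (i * i' * ((pc + pc') / (p + p'))) by fin.
   rewrite <- (Rmult_1_r (/ (pc * pc'))), Rinv_mult.
   assert ((pc + pc') / (p + p') <= 1) by (reg_r (p + p'); field_simplify; lra).
   fin.
 - assert (0 <= Rabs (pc - pc') / (pc * pc')).
  { fin. }
  fin.
Qed.

(** Only [0 <= q <= pc'] is exploited: there both momenta are at most [2 * pc'], so the integrand is
    at least of the size [(pc' - pc) / pc' ^ 2]. The rest contributes with the same sign. *)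
Lemma tau_decr pc pc' z : 0 < pc <= pc' -> pc' <= 1 -> cont04 d z ->
 (pc' - pc) / (16 * pc') <= tau pc z - tau pc' z.
Proof.
 intros Hpc Hpc' Hz. generalize PI_range; intros. unfold tau.
 rewrite <- (RInt_minus (V := CNM)); try (apply ipm_ex_RInt; trivial; lra).
 set (h := fun q => minus (ipm pc z q) (ipm pc' z q)).
 assert (Hex : forall a b, a < 4 -> b < 4 -> ex_RInt h a b).
 { intros. apply (ex_RInt_minus (V := NM)); apply ipm_ex_RInt; trivial; lra. }
 assert (Hh : forall y, 0 <= y < 4 -> h y = (pc' - pc) * (pc + pc') *
   (ipm pc z y * ipm pc' z y / (pm d P mu pc z y + pm d P mu pc' z y))).
 { intros. apply pm_diff_pc; trivial; lra. }
 assert (Hpos : forall y, 0 <= y < 4 -> 0 < ipm pc z y * ipm pc' z y / (pm d P mu pc z y + pm d P mu pc' z y)).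
 { intros y Hy.
  assert (H1 := pm_ge_pc d P mu mu_pos mu_small pc z y ok Hz ok).
  assert (H2 := pm_ge_pc d P mu mu_pos mu_small pc' z y ok Hz ok).
  destruct (ipm_bounds pc z y ok Hz ok) as [B1 _].
  destruct (ipm_bounds pc' z y ok Hz ok) as [B2 _].
  fin. }
 change (RInt _ 0 PI) with (RInt h 0 PI).
 rewrite <- (RInt_Chasles (V := CNM) h 0 pc' PI) by (apply Hex; lra).
 change plus with Rplus.
 assert (Hnn : 0 <= (pc' - pc) * (pc + pc')) by fin.
 assert (0 <= RInt h pc' PI).
 { apply RInt_ge_0; [lra|apply Hex; lra|]. intros y Hy. rewrite Hh by lra.
  apply Rmult_le_pos; trivial. left. apply Hpos. lra. }
 assert ((pc' - pc) / (16 * pc') <= RInt h 0 pc'); [|lra].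
 replace ((pc' - pc) / (16 * pc')) with (RInt (fun _ => (pc' - pc) / (16 * pc' ^ 2)) 0 pc').
 2:{ rewrite RInt_const. unfold scal; simpl; unfold mult; simpl. fin. }
 apply RInt_le; [lra|apply ex_RInt_const|apply Hex; lra|].
 intros y Hy. rewrite Hh by lra.
 assert (Hup : pm d P mu pc z y <= 2 * pc' /\ pm d P mu pc' z y <= 2 * pc').
 { generalize (Aint_bounds d P mu mu_pos mu_small z y Hz ok). intros.
  split; apply Rsqr_incr_0_var; try lra;
   rewrite !Rsqr_pow2, (pm_sq d P mu mu_pos mu_small) by fin; nra. }
 unfold ipm. unclip.
 assert (H1 := pm_ge_pc d P mu mu_pos mu_small pc z y ok Hz ok).
 assert (H2 := pm_ge_pc d P mu mu_pos mu_small pc' z y ok Hz ok).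
 set (p := pm d P mu pc z y) in *. set (p' := pm d P mu pc' z y) in *.
 replace ((pc' - pc) / (16 * pc' ^ 2)) with ((pc' - pc) * pc' * (/ (2 * pc') * / (2 * pc') * / (4 * pc'))) by fld.
 apply Rmult_le_compat.
 - fin.
 - fin.
 - fin.
 - assert (0 < / (2 * pc')) by fin.
  assert (0 < / (4 * pc')) by fin.
  apply Rmult_le_compat; [nra|lra| |fin].
  fin.
Qed.

Lemma tau_z_Lip pc z z' N : 0 < pc <= 1 -> cont04 d z -> cont04 d z' -> 0 <= N ->
 (forall j q, j <=' d -> 0 < q < 4 -> Rabs (z q j - z' q j) <= N / q) ->
 Rabs (tau pc z - tau pc z') <= 68 * (mu * F * N) / pc.
Proof.
 intros Hpc Hz Hz' HN0 HN. generalize PI_range; intros. unfold tau.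
 set (nu := mu * F * N).
 assert (Hnu : 0 <= nu) by (apply (muFN_pos d P mu mu_pos N HN0)).
 rewrite <- (RInt_minus (V := CNM)); try (apply ipm_ex_RInt; trivial; lra).
 set (h := fun q => minus (ipm pc z q) (ipm pc z' q)).
 assert (Hc : forall y, y < 4 -> continuous h y).
 { intros. apply @continuous_minus; apply ipm_cont; trivial; lra. }
 assert (Hex : forall a b, a < 4 -> b < 4 -> ex_RInt h a b).
 { intros a b Ha Hb. apply ex_RInt_cont. intros y Hy. apply Hc.
  eapply Rle_lt_trans; [apply Hy|]. now apply Rmax_lub_lt. }
 assert (Hh : forall y, 0 <= y < 4 -> Rabs (h y) <= 4 * nu * (ipm pc z y * ipm pc z' y)).
 { intros y Hy. change (h y) with (ipm pc z y - ipm pc z' y).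
  assert (H1 := pm_ge_pc d P mu mu_pos mu_small pc z y ok Hz ok).
  assert (H2 := pm_ge_pc d P mu mu_pos mu_small pc z' y ok Hz' ok).
  assert (G1 := pm_ge d P mu mu_pos mu_small pc z y Hz ok).
  assert (G2 := pm_ge d P mu mu_pos mu_small pc z' y Hz' ok).
  assert (S1 := pm_sq d P mu mu_pos mu_small pc z y Hz ok).
  assert (S2 := pm_sq d P mu mu_pos mu_small pc z' y Hz' ok).
  assert (HA := Aint_diff d P mu mu_pos mu_small N z z' Hz Hz' HN HN0 y Hy). fold F in HA. fold nu in HA.
  unfold ipm. unclip.
  set (p := pm d P mu pc z y) in *. set (p' := pm d P mu pc z' y) in *.
  replace (/ p - / p') with ((p' - p) * (/ p * / p')) by fld.
  assert (Hi : 0 < / p * / p') by fin.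
  rewrite Rabs_mult, (Rabs_pos_eq (/ p * / p')) by lra. mul_r.
  reg_r (p + p').
  rewrite <- (Rabs_pos_eq (p + p')) at 1 by lra. rewrite <- Rabs_mult.
  replace ((p' - p) * (p + p')) with (p' ^ 2 - p ^ 2) by ring. rewrite S1, S2.
  replace (pc ^ 2 + 2 * Aint d P mu z' y - (pc ^ 2 + 2 * Aint d P mu z y))
   with (- (2 * (Aint d P mu z y - Aint d P mu z' y))) by ring.
  rewrite Rabs_Ropp, Rabs_mult, (Rabs_pos_eq 2) by lra.
  fin. }
 change (RInt _ 0 PI) with (RInt h 0 PI).
 rewrite <- (RInt_Chasles (V := CNM) h 0 pc PI) by (apply Hex; lra).
 triang.
 replace (68 * nu / pc) with (pc * (4 * nu / pc ^ 2) + 64 * nu / pc) by fld.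
 apply Rplus_le_compat.
 - apply RInt_abs_le_const; [lra|intros; apply Hc; lra|]. intros y Hy.
  le_by (apply Hh; lra). unfold Rdiv. mul_l.
  destruct (ipm_bounds pc z y ok Hz ok) as [B1 _].
  destruct (ipm_bounds pc z' y ok Hz' ok) as [B2 _].
  replace (/ pc ^ 2) with (/ pc * / pc) by fld. fin.
 - le_by (apply RInt_abs_le_inv_square_ordered with (C := 64 * nu); try lra).
  + intros; apply Hc; lra.
  + intros y Hy. le_by (apply Hh; lra).
   destruct (ipm_bounds pc z y ok Hz ok) as [B1 B1'].
   destruct (ipm_bounds pc z' y ok Hz' ok) as [B2 B2'].
   replace (64 * nu / y ^ 2) with (4 * nu * (4 / y * (4 / y))) by fld.
   fin.
  + assert (0 <= 64 * nu / PI); [|lra]. fin.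
Qed.

Lemma passage_momentum T z z' :
 2 + 8 * (ln 4 - ln mu) < T -> cont04 d z -> cont04 d z' ->
 exists pc, 0 < pc <= mu /\ tau pc z + tau pc z' = T.
Proof.
 intros HT Hz Hz'. assert (Hmu : mu <= 1 / 1000) by (apply (mu_le d P mu); trivial).
 assert (HT0 : 0 <= - ln mu) by (assert (ln mu <= ln 1) by (apply ln_le; lra); rewrite ln_1 in *; lra).
 assert (Hln4 : 0 <= ln 4) by (rewrite <- ln_1; apply ln_le; lra).
 (* At this momentum [tau_lower] makes each half last at least [(T + 1) / 2], so the sum exceeds
    [T]; at [mu] the hypothesis on [T] and [tau_upper] put it below. *)
 set (pa := exp (- T - 1)).
 assert (Hpa : 0 < pa) by apply exp_pos.
 assert (Hpamu : pa < mu).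
 { rewrite <- (exp_ln mu) by trivial. apply exp_increasing. lra. }
 set (g := fun pc => T - (tau pc z + tau pc z')).
 assert (Hcont : forall x, pa <= x <= mu -> continuity_pt g x).
 { intros x Hx. apply continuity_pt_filterlim. apply continuous_eps. intros e He.
  assert (Hr : 0 < Rmin (x / 2) (e * x ^ 2 / 32)).
  { apply Rmin_glb_lt; [lra|]. fin. }
  eexists; split; [exact Hr|]. intros y Hy.
  assert (Hy1 : Rabs (y - x) < x / 2) by (eapply Rlt_le_trans; [exact Hy|apply Rmin_l]).
  assert (Hy2 : Rabs (y - x) < e * x ^ 2 / 32) by (eapply Rlt_le_trans; [exact Hy|apply Rmin_r]).
  apply Rabs_def2 in Hy1. unfold g.
  note (tau_pc_Lip y x z ok ok Hz) (tau_pc_Lip y x z' ok ok Hz') as L1 L2.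
  replace (T - (tau y z + tau y z') - (T - (tau x z + tau x z')))
   with (- ((tau y z - tau x z) + (tau y z' - tau x z'))) by ring.
  rewrite Rabs_Ropp. eapply Rle_lt_trans; [apply Rabs_triang|].
  assert (4 * Rabs (y - x) / (y * x) < e / 2); [|lra].
  apply Rmult_lt_reg_r with (y * x); [nra|].
  replace (4 * Rabs (y - x) / (y * x) * (y * x)) with (4 * Rabs (y - x)) by fld.
  apply Rlt_le_trans with (e * x ^ 2 / 8); [lra|]. assert (e * (x * x) <= e * (4 * y * x)) by fin. lra. }
 destruct (IVT_interv g pa mu Hcont Hpamu) as (pc & Hpc & Hg).
 - unfold g. generalize (tau_lower pa z ok Hz) (tau_lower pa z' ok Hz').
  unfold pa at 1 3. rewrite !ln_exp. lra.
 - unfold g. generalize (tau_upper mu z ok Hz) (tau_upper mu z' ok Hz'). lra.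
 - exists pc. unfold g in Hg. fin.
Qed.
End passage.

(** * Two consecutive bumps *)

Section gap.
Variables (d : nat) (P : list trig_mode) (mu W : R).
Let F := Fbd d P.
Hypothesis mu_pos : 0 < mu.
Hypothesis W_ge : 2 <= W.
Hypothesis small : mu * F * (W + 2) <= / 10000000.

Let W_pos : 0 <= W. Proof. lra. Qed.
Let muF : mu * F <= 1 / 1000 := small2 d P mu W mu_pos W_pos small.

Lemma muF_small : 0 <= mu * F <= / 10000000.
Proof.
 split; [|fin].
 generalize (F_ge1 d P). fold F. nra.
Qed.

(** The two halves together have slope at least [/ (8 * pc')] by [tau_decr]. Multiplying by
    [8 * pc'] cancels the singular factor [/ pc'] of [tau_z_Lip] and leaves a factor [mu] in front
    of the time difference. *)
Lemma passage_Lip z1 z2 z1' z2' pc pc' T T' N :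
 cont04 d z1 -> cont04 d z2 -> cont04 d z1' -> cont04 d z2' -> 0 <= N ->
 (forall j q, j <=' d -> 0 < q < 4 -> Rabs (z1 q j - z1' q j) <= N / q) ->
 (forall j q, j <=' d -> 0 < q < 4 -> Rabs (z2 q j - z2' q j) <= N / q) ->
 0 < pc <= mu -> 0 < pc' <= mu ->
 tau d P mu pc z1 + tau d P mu pc z2 = T -> tau d P mu pc' z1' + tau d P mu pc' z2' = T' ->
 Rabs (pc - pc') <= 8 * mu * Rabs (T - T') + 1088 * (mu * F * N).
Proof.
 revert z1 z2 z1' z2' pc pc' T T'.
 assert (Hwlog : forall z1 z2 z1' z2' pc pc' T T',
  cont04 d z1 -> cont04 d z2 -> cont04 d z1' -> cont04 d z2' -> 0 <= N ->
  (forall j q, j <=' d -> 0 < q < 4 -> Rabs (z1 q j - z1' q j) <= N / q) ->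
  (forall j q, j <=' d -> 0 < q < 4 -> Rabs (z2 q j - z2' q j) <= N / q) ->
  0 < pc <= pc' -> pc' <= mu ->
  tau d P mu pc z1 + tau d P mu pc z2 = T -> tau d P mu pc' z1' + tau d P mu pc' z2' = T' ->
  pc' - pc <= 8 * mu * Rabs (T - T') + 1088 * (mu * F * N)).
 { intros z1 z2 z1' z2' pc pc' T T' H1 H2 H1' H2' HN N1 N2 Hpc Hpc' ET ET'.
  assert (Hmu : mu <= 1 / 1000) by (apply (mu_le d P mu); trivial).
  generalize (tau_decr d P mu mu_pos muF pc pc' z1 Hpc ok H1)
   (tau_decr d P mu mu_pos muF pc pc' z2 Hpc ok H2)
   (tau_z_Lip d P mu mu_pos muF pc' z1 z1' N ok H1 H1' HN N1)
   (tau_z_Lip d P mu mu_pos muF pc' z2 z2' N ok H2 H2' HN N2). fold F.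
  intros D1 D2 L1 L2. apply Rabs_le_between in L1, L2.
  generalize (Rle_abs (T - T')) (muFN_pos d P mu mu_pos N HN). fold F. intros HT Hnu.
  set (nu := mu * F * N) in *.
  assert (Hm : (pc' - pc) / (8 * pc') <= Rabs (T - T') + 136 * nu / pc').
  { replace ((pc' - pc) / (8 * pc')) with ((pc' - pc) / (16 * pc') + (pc' - pc) / (16 * pc')) by fld.
   fin. }
  apply Rmult_le_compat_r with (r := 8 * pc') in Hm; [|lra].
  replace ((pc' - pc) / (8 * pc') * (8 * pc')) with (pc' - pc) in Hm by fld.
  replace ((Rabs (T - T') + 136 * nu / pc') * (8 * pc')) with (8 * pc' * Rabs (T - T') + 1088 * nu) in Hm
   by fld.
  generalize (Rabs_pos (T - T')). nra. }
 intros z1 z2 z1' z2' pc pc' T T' H1 H2 H1' H2' HN N1 N2 Hpc Hpc' ET ET'.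
 destruct (Rle_lt_dec pc pc') as [H|H].
 - rewrite Rabs_minus_sym, Rabs_pos_eq by lra.
  apply (Hwlog z1 z2 z1' z2'); trivial; lra.
 - rewrite Rabs_pos_eq by lra. rewrite Rabs_minus_sym.
  apply (Hwlog z1' z2' z1 z2); trivial; try lra; intros; rewrite Rabs_minus_sym; auto.
Qed.

(** Displacement due to the drift of the action; without it the half would advance by [w j] times
    its duration, see [half_crossing]. *)
Definition edrift (s pc : R) (j : nat) (z : R -> vec) : R :=
 RInt (fun q => drift d P mu s pc j z (clip q) / pm d P mu pc z (clip q)) 0 PI.

Section one_half.
Variables (s : R).
Hypothesis Hs : Rabs s = 1.

Lemma edrift_integrand pc j z :
 (fun q => drift d P mu s pc j z (clip q) / pm d P mu pc z (clip q)) = hz d P mu s (fun _ => 0) pc j z.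
Proof. apply FunctionalExtensionality.functional_extensionality. intros q. unfold hz. fin. Qed.

Lemma drift_ratio_le pc j z q : 0 <= pc -> j <=' d -> cont04 d z -> 0 <= q < 4 ->
 Rabs (drift d P mu s pc j z q / pm d P mu pc z q) <= 32 * (mu * F).
Proof.
 intros Hpc Hj Hz Hq. generalize muF_small; intros Hm.
 destruct (Req_dec q 0) as [->|H0].
 - rewrite drift_0. fin.
 - assert (Hp := pm_pos d P mu mu_pos muF pc z q Hpc Hz Hq ok).
  unfold Rdiv. rewrite Rabs_mult, Rabs_inv, (Rabs_pos_eq (pm _ _ _ _ _ _)) by lra.
  assert (0 < / pm d P mu pc z q) by fin.
  le_thru (2 * (mu * F) * q ^ 2 * (4 / q)).
  + apply Rmult_le_compat; [fin|lra|now apply drift_le|]. apply pm_inv; trivial; lra.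
  + replace (2 * (mu * F) * q ^ 2 * (4 / q)) with (8 * (mu * F) * q) by fld. nra.
Qed.

Lemma edrift_cont pc j z q : 0 < pc -> j <=' d -> cont04 d z -> q < 4 ->
 continuous (fun q => drift d P mu s pc j z (clip q) / pm d P mu pc z (clip q)) q.
Proof.
 intros Hpc Hj Hz Hq. rewrite edrift_integrand.
 apply (hz_cont d P mu mu_pos muF); trivial; try lra.
Qed.

Lemma edrift_le pc j z : 0 < pc -> j <=' d -> cont04 d z -> Rabs (edrift s pc j z) <= 128 * (mu * F).
Proof.
 intros Hpc Hj Hz. generalize PI_range muF_small; intros. unfold edrift.
 le_thru (PI * (32 * (mu * F))); [|nra].
 apply RInt_abs_le_const; [lra| |].
 - intros. apply edrift_cont; trivial; lra.
 - intros. unclip. apply drift_ratio_le; trivial; lra.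
Qed.

Lemma edrift_time pc z : edrift s pc 0 z = 0.
Proof.
 unfold edrift. rewrite (RInt_ext _ (fun _ => 0)).
 - rewrite RInt_const. unfold scal; simpl; unfold mult; simpl. ring.
 - intros. rewrite drift_time. fin.
Qed.

Lemma edrift_Lip pc pc' j z z' N dpc :
 0 < pc -> 0 < pc' -> Rabs (pc - pc') <= dpc -> j <=' d -> cont04 d z -> cont04 d z' -> 0 <= N ->
 (forall j q, j <=' d -> 0 < q < 4 -> Rabs (z q j - z' q j) <= N / q) ->
 Rabs (edrift s pc j z - edrift s pc' j z') <= 256 * (mu * F) * (N + 2 * dpc).
Proof.
 intros Hpc Hpc' Hdpc Hj Hz Hz' HN0 HN. note PI_range muF_small (dpc_pos _ _ _ Hdpc) as HPI Hm Hd0.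
 assert (Hex : forall pc z, 0 < pc -> cont04 d z ->
  ex_RInt (fun q => drift d P mu s pc j z (clip q) / pm d P mu pc z (clip q)) 0 PI).
 { intros pc1 z1 H1 H2. ex_rint.
  intros; apply edrift_cont; trivial; lra. }
 unfold edrift. rewrite <- (RInt_minus (V := CNM)) by now apply Hex.
 le_thru (PI * (64 * (mu * F) * (N + 2 * dpc))).
 2:{ assert (0 <= 64 * (mu * F) * (N + 2 * dpc)) by fin. nra. }
 apply RInt_abs_le_const; [lra| |].
 - intros. apply @continuous_minus; apply edrift_cont; trivial; lra.
 - intros q Hq. unclip.
  change (Rabs (drift d P mu s pc j z q / pm d P mu pc z q - drift d P mu s pc' j z' q / pm d P mu pc' z' q)
   <= 64 * (mu * F) * (N + 2 * dpc)).
  destruct (Req_dec q 0) as [->|Hq0].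
  { rewrite !drift_0. unfold Rdiv. rewrite !Rmult_0_l, Rminus_0_r, Rabs_R0. fin. }
  generalize (drift_diff d P mu mu_pos muF s Hs pc pc' N dpc z z' ok ok Hdpc Hz Hz' HN HN0 j q Hj ok)
   (pm_inv_diff d P mu mu_pos muF pc pc' N dpc z z' ok ok Hdpc Hz Hz' HN HN0 q ok)
   (pm_inv d P mu mu_pos muF pc z q Hz ok)
   (drift_le d P mu mu_pos muF s Hs pc' j z' q ok Hj Hz' ok).
  fold F. intros H1 H2 H3 H4.
  assert (Hp := pm_pos d P mu mu_pos muF pc z q ok Hz ok ok).
  assert (0 < / pm d P mu pc z q) by fin.
  set (i := drift d P mu s pc j z q) in *. set (i' := drift d P mu s pc' j z' q) in *.
  set (p := pm d P mu pc z q) in *. set (p' := pm d P mu pc' z' q) in *.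
  replace (i / p - i' / p') with ((i - i') * / p + i' * (/ p - / p')) by fin.
  triang. rewrite !Rabs_mult.
  set (Dv := Dinv d P mu N dpc) in *.
  assert (HD : 0 <= Dv <= N + 16 * dpc).
  { split; [apply (Dinv_pos d P mu mu_pos pc pc' N dpc Hdpc HN0)|].
   unfold Dv, Dinv. fold F. nra. }
  le_thru (mu * F * (2 * N + Dv / 2) * q * (4 / q) + 2 * (mu * F) * q ^ 2 * (Dv / q ^ 2)).
  + apply Rplus_le_compat; mul_abs; trivial.
   fin.
  + replace (_ + _) with (mu * F * (8 * N + 4 * Dv)) by fld.
   fin.
Qed.

Lemma half_crossing x w pc z j : 0 < pc -> j <=' d -> is_half d P mu s x w pc z ->
 z 0 j = x j - s * (w j * tau d P mu pc z + edrift s pc j z).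
Proof.
 intros Hpc Hj [Hz Ez]. generalize PI_range; intros HPI. rewrite Ez by fin. unfold Phi_half.
 assert (Hex : forall w, ex_RInt (hz d P mu s w pc j z) 0 PI).
 { intros w0. ex_rint.
  intros y Hy. apply (hz_cont d P mu mu_pos muF); trivial; lra. }
 rewrite <- (opp_RInt_swap (V := CNM)) by apply Hex.
 unfold tau, edrift. rewrite edrift_integrand.
 rewrite (RInt_ext (hz d P mu s w pc j z)
  (fun q => plus (scal (w j) (ipm d P mu pc z q)) (hz d P mu s (fun _ => 0) pc j z q))).
 - rewrite (RInt_plus (V := CNM)); [|apply (ex_RInt_scal (V := NM))|fin].
  + rewrite (RInt_scal (V := CNM)).
   * unfold opp, plus, scal; simpl; unfold mult; simpl. ring.
   * apply (ipm_ex_RInt d P mu mu_pos muF); trivial; lra.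
  + apply (ipm_ex_RInt d P mu mu_pos muF); trivial; lra.
 - intros q _. unfold hz, ipm, plus, scal; simpl; unfold mult; simpl. fin.
Qed.
End one_half.

Lemma Rabs_1 : Rabs 1 = 1. Proof. fin. Qed.
Lemma Rabs_m1 : Rabs (-1) = 1. Proof. replace (-1) with (- (1)) by ring. rewrite Rabs_Ropp. fin. Qed.

(** The outgoing half [zm] of the bump at [xm] and the incoming half [zp] of the bump at [xp] meet
    at the crossing with common velocity [w] and momentum [pc]. Since time is component 0,
    prescribing [xm] and [xp] prescribes the elapsed time. *)
Definition is_gap (xm xp w : vec) (pc : R) (zm zp : R -> vec) : Prop :=
 w O = 1 /\ 0 < pc <= mu /\ (bnd d W w) /\
 is_half d P mu (-1) xm w pc zm /\ is_half d P mu 1 xp w pc zp /\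
 (forall j, j <=' d -> zp 0 j = zm 0 j).

Lemma is_gap_time xm xp w pc zm zp : is_gap xm xp w pc zm zp ->
 tau d P mu pc zp + tau d P mu pc zm = xp O - xm O.
Proof.
 intros (Hw & Hpc & _ & Hm & Hp & Hc). specialize (Hc O (Nat.le_0_l d)).
 rewrite (half_crossing 1 xp w pc zp O), (half_crossing (-1) xm w pc zm O) in Hc; trivial; try lra; try lia.
 rewrite !edrift_time, Hw in Hc. lra.
Qed.

Lemma is_gap_velocity xm xp w pc zm zp j : is_gap xm xp w pc zm zp -> j <=' d ->
 w j * (xp O - xm O) = xp j - xm j - (edrift 1 pc j zp + edrift (-1) pc j zm).
Proof.
 intros Hg Hj. rewrite <- (is_gap_time _ _ _ _ _ _ Hg).
 destruct Hg as (Hw & Hpc & _ & Hm & Hp & Hc). specialize (Hc j Hj).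
 rewrite (half_crossing 1 xp w pc zp j), (half_crossing (-1) xm w pc zm j) in Hc; trivial; try lra.
Qed.

(** A fixed point in the [d + 1] unknowns [(pc, w)]: the halves are built from the old values, then
    [pc] is reset from the elapsed time and [w] from the mean velocity. The new values depend on the
    old ones only through the halves, hence with a factor [mu * F]. *)
Lemma gap_exists xm xp :
 let T := xp O - xm O in
 2 + 8 * (ln 4 - ln mu) < T -> bnd2 d ((W - 1) * T) xp xm ->
 exists w pc zm zp, is_gap xm xp w pc zm zp.
Proof.
 intros T HT Hx. generalize muF_small; intros HmF.
 assert (Hmu : mu <= 1 / 1000) by (apply (mu_le d P mu); trivial).
 assert (HT1 : 1 <= T).
 { assert (0 <= ln 4) by (rewrite <- ln_1; apply ln_le; lra).
  assert (ln mu <= 0) by (rewrite <- ln_1; apply ln_le; lra). lra. }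
 set (wv := fun (v : nat -> R) (j : nat) => match j with O => 1 | S _ => v j end).
 set (Dom := fun v : nat -> R => 0 < v O <= mu /\ forall j, (1 <= j <= d)%nat -> Rabs (v j) <= W).
 assert (HwW : forall v, Dom v -> bnd d W (wv v)).
 { intros v [_ Hv] j Hj. destruct j as [|j]; simpl; [fin|]. apply Hv. lia. }
 assert (inhabited (R -> vec)) as inh by (constructor; exact (fun _ _ => 0)).
 set (zh := fun s x v => epsilon inh (fun z => is_half d P mu s x (wv v) (v O) z)).
 assert (Hzh : forall s x v, Rabs s = 1 -> 0 <= v O -> (forall j, (1 <= j <= d)%nat -> Rabs (v j) <= W) ->
   is_half d P mu s x (wv v) (v O) (zh s x v)).
 { intros s x v Hs H1 H2. unfold zh. apply epsilon_spec. apply (half_exists d P mu W); trivial.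
  intros j Hj. destruct j as [|j]; simpl; [fin|]. apply H2; lia. }
 set (pcn := fun v => epsilon (inhabits 0) (fun pc => 0 < pc <= mu /\
   tau d P mu pc (zh 1 xp v) + tau d P mu pc (zh (-1) xm v) = T)).
 set (Cl := fun v : nat -> R => 0 <= v O <= mu /\ forall j, (1 <= j <= d)%nat -> Rabs (v j) <= W).
 assert (Hpcn : forall v, Cl v -> 0 < pcn v <= mu /\
   tau d P mu (pcn v) (zh 1 xp v) + tau d P mu (pcn v) (zh (-1) xm v) = T).
 { intros v [H1 H2]. unfold pcn. apply epsilon_spec. apply (passage_momentum d P mu mu_pos muF); trivial.
  - apply Hzh; trivial; [apply Rabs_1|lra].
  - apply Hzh; trivial; [apply Rabs_m1|lra]. }
 set (Phi := fun (v : nat -> R) (a : nat) => match a with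
   | O => pcn v
   | S _ => (xp a - xm a - (edrift 1 (pcn v) a (zh 1 xp v) + edrift (-1) (pcn v) a (zh (-1) xm v))) / T end).
 assert (HPhi : forall v, Cl v -> Cl (Phi v)).
 { intros v Hv. destruct (Hpcn v Hv) as [H1 _]. split; [simpl; lra|].
  intros j Hj. destruct j as [|j]; [lia|]. simpl.
  destruct Hv as [Hv1 Hv2].
  assert (C1 : cont04 d (zh 1 xp v)) by (apply Hzh; trivial; [apply Rabs_1|lra]).
  assert (C2 : cont04 d (zh (-1) xm v)) by (apply Hzh; trivial; [apply Rabs_m1|lra]).
  note (edrift_le 1 Rabs_1 (pcn v) (S j) _ ok ok C1) (edrift_le (-1) Rabs_m1 (pcn v) (S j) _ ok ok C2) (Hx (S j) ok) as B1 B2 B3. apply Rabs_le_between in B1, B2, B3. unfold Rdiv. rewrite Rabs_mult, Rabs_inv, (Rabs_pos_eq T) by lra.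
  reg_r T. inv_l; rewrite Rmult_1_r.
  fin. }
 destruct (banach_fixed_point nat (fun a => (a <= d)%nat) (fun _ => 1) Cl Phi (1/2)
   (fun a => match a with O => mu | S _ => 0 end) (2 * W)) as (u & HuC & Hu).
 - fin.
 - lra.
 - lra.
 - split; [fin|]. intros j Hj. destruct j; [lia|]. fin.
 - trivial.
 - intros a Ha. set (u0 := fun a : nat => match a with O => mu | S _ => 0 end).
  assert (H0 : Cl u0) by (split; [simpl; lra|]; intros j Hj; destruct j; [lia|]; simpl; rewrite Rabs_R0; lra).
  destruct (HPhi u0 H0) as [H1 H2]. destruct a as [|a].
  + fin.
  + rewrite Rminus_0_r. specialize (H2 (S a) ok). fin.
 - intros u v M Hu Hv HM H a Ha.
  set (N := 384 * (W + 2) * M).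
  assert (HN0 : 0 <= N) by (unfold N; apply Rmult_le_pos; lra).
  assert (Hwv : bnd2 d M (wv u) (wv v)).
  { intros j Hj. destruct j as [|j]; simpl; [fin|].
   specialize (H (S j) Hj). lra. }
  assert (Hpc0 : Rabs (u O - v O) <= M) by (specialize (H O (Nat.le_0_l d)); lra).
  assert (Hwu : bnd d W (wv u)).
  { intros j Hj. destruct j as [|j]; simpl; [fin|]. apply Hu; lia. }
  assert (Hwv' : bnd d W (wv v)).
  { intros j Hj. destruct j as [|j]; simpl; [fin|]. apply Hv; lia. }
  assert (HZ : forall s x, Rabs s = 1 -> cont04 d (zh s x u) /\ cont04 d (zh s x v) /\
    forall j q, j <=' d -> 0 < q < 4 -> Rabs (zh s x u q j - zh s x v q j) <= N / q).
  { intros s x Hs. destruct Hu as [Hu1 Hu2], Hv as [Hv1 Hv2].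
   assert (I1 := Hzh s x u Hs ok Hu2). assert (I2 := Hzh s x v Hs ok Hv2).
   split; [apply I1|split; [apply I2|]]. intros j q Hj Hq.
   assert (Hx0 : bnd2 d 0 x x) by (intros; rewrite Rminus_diag, Rabs_R0; lra).
   le_by (apply (half_Lip d P mu W mu_pos W_pos small s x x (wv u) (wv v) (u O) (v O) _ _ 0 M M); trivial; lra).
   unfold Rdiv. apply Rmult_le_compat_r; [fin|]. unfold N. nra. }
  destruct (HZ 1 xp Rabs_1) as (C1 & C1' & L1). destruct (HZ (-1) xm Rabs_m1) as (C2 & C2' & L2).
  destruct (Hpcn u Hu) as [P1 P2]. destruct (Hpcn v Hv) as [P1' P2'].
  assert (Hpcd := passage_Lip _ _ _ _ _ _ T T N C1 C2 C1' C2' HN0 L1 L2 P1 P1' P2 P2').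
  rewrite (Rminus_diag T), Rabs_R0 in Hpcd.
  assert (HmN : mu * F * N <= M / 10000).
  { unfold N. fin. }
  destruct a as [|a]; simpl Phi; [lra|].
  clearbody zh pcn.
  set (dpc := 1088 * (mu * F * N)).
  assert (Hd : Rabs (pcn u - pcn v) <= dpc) by (unfold dpc; lra).
  note (edrift_Lip 1 Rabs_1 (pcn u) (pcn v) (S a) _ _ N dpc ok ok Hd Ha C1 C1' HN0 L1) (edrift_Lip (-1) Rabs_m1 (pcn u) (pcn v) (S a) _ _ N dpc ok ok Hd Ha C2 C2' HN0 L2) as E1 E2.
  set (e1 := edrift 1 (pcn u) _ _) in *. set (e1' := edrift 1 (pcn v) _ _) in *.
  set (e2 := edrift (-1) (pcn u) _ _) in *. set (e2' := edrift (-1) (pcn v) _ _) in *.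
  replace (_ - _) with (((e1' - e1) + (e2' - e2)) * / T) by fin.
  rewrite Rabs_mult, Rabs_inv, (Rabs_pos_eq T) by lra.
  assert (/ T <= 1) by (rewrite <- Rinv_1; apply Rinv_le_contravar; lra).
  assert (0 < / T) by fin.
  assert (Hsum : Rabs (e1' - e1 + (e2' - e2)) <= 512 * (mu * F) * (N + 2 * dpc)).
  { fin. }
  assert (512 * (mu * F) * (N + 2 * dpc) <= M / 2).
  { assert (0 <= mu * F * N) by fin.
   assert (mu * F * dpc <= dpc) by (unfold dpc; nra). unfold dpc in *. nra. }
  fin.
 - intros un u en HunC Hen Hun.
  assert (Hl : forall a, a <=' d -> is_lim_seq (fun n => un n a) (u a)).
  { intros a Ha. apply is_lim_seq_spec. intros e. apply is_lim_seq_spec in Hen.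
   destruct (Hen e) as [n Hn]. exists n. intros m Hm. specialize (Hn m Hm). rewrite Rminus_0_r in Hn.
   eapply Rle_lt_trans; [fin|]. fin. }
  split; [split|].
  + apply (is_lim_seq_le (fun _ => 0) (fun n => un n O) 0 (u O)).
   * intros n. apply (HunC n).
   * apply is_lim_seq_const.
   * apply Hl. lia.
  + apply (is_lim_seq_le (fun n => un n O) (fun _ => mu) (u O) mu).
   * intros n. apply (HunC n).
   * apply Hl. lia.
   * apply is_lim_seq_const.
  + intros j Hj. apply (is_lim_seq_le (fun n => Rabs (un n j)) (fun _ => W) (Rabs (u j)) W).
   * intros n. now apply (HunC n).
   * apply (is_lim_seq_abs _ (Finite (u j))). apply Hl. lia.
   * apply is_lim_seq_const.
 - assert (H0 := Hu O (Nat.le_0_l d)). simpl in H0.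
  destruct (Hpcn u HuC) as [P1 P2]. destruct HuC as [Hu1 Hu2].
  assert (I1 := Hzh 1 xp u Rabs_1 ok Hu2). assert (I2 := Hzh (-1) xm u Rabs_m1 ok Hu2).
  exists (wv u), (u O), (zh (-1) xm u), (zh 1 xp u).
  split; [reflexivity|]. split; [lra|]. split; [|split; [fin|split; [fin|]]].
  + intros j Hj. destruct j as [|j]; simpl; [fin|]. apply Hu2; lia.
  + intros j Hj. rewrite (half_crossing 1 xp (wv u) (u O)) by fin.
   rewrite (half_crossing (-1) xm (wv u) (u O)) by fin.
   rewrite H0 in P2.
   assert (Hwj : wv u j * T = xp j - xm j - (edrift 1 (u O) j (zh 1 xp u) + edrift (-1) (u O) j (zh (-1) xm u))).
   { destruct j as [|j].
    - simpl. rewrite !edrift_time. unfold T. ring.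
    - specialize (Hu (S j) Hj). simpl in Hu. rewrite H0 in Hu. simpl. rewrite <- Hu. fin. }
   fin.
Qed.

(** One round of absorption: a velocity difference [M] changes the halves, these change the drift
    integrals with a factor [mu * F], and it returns as at most [M / 2]. *)
Lemma gap_Lip_aux xm xp w pc zm zp xm' xp' w' pc' zm' zp' dx M :
 is_gap xm xp w pc zm zp -> is_gap xm' xp' w' pc' zm' zp' ->
 1 <= xp O - xm O ->
 bnd2 d dx xm xm' ->
 bnd2 d dx xp xp' ->
 bnd2 d M w w' ->
 Rabs (pc - pc') <= 20000 * (mu * F) * dx + 300000 * (mu * F) * M /\
 bnd2 d ((2 * W + 3) * dx / (xp O - xm O) + M / 2) w w'.
Proof.
 intros Hg Hg' HT Hdm Hdp HM. generalize muF_small; intros HmF.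
 assert (Hdx : 0 <= dx) by (le_by apply Rabs_pos; apply (Hdm O (Nat.le_0_l d))).
 assert (HM0 : 0 <= M) by (le_by apply Rabs_pos; apply (HM O (Nat.le_0_l d))).
 assert (Hmu : mu <= mu * F) by (generalize (F_ge1 d P); fold F; nra).
 assert (Tt := is_gap_time _ _ _ _ _ _ Hg). assert (Tt' := is_gap_time _ _ _ _ _ _ Hg').
 assert (Vv := fun j => is_gap_velocity _ _ _ _ _ _ j Hg).
 assert (Vv' := fun j => is_gap_velocity _ _ _ _ _ _ j Hg').
 set (T := xp O - xm O) in *. set (T' := xp' O - xm' O) in *.
 destruct Hg as (Hw & Hpc & HwW & Hm & Hp & _). destruct Hg' as (Hw' & Hpc' & HwW' & Hm' & Hp' & _).
 assert (HTT : Rabs (T - T') <= 2 * dx).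
 { unfold T, T'. generalize (Hdm O (Nat.le_0_l d)) (Hdp O (Nat.le_0_l d)). fin. }
 set (dpc := Rabs (pc - pc')). assert (Hd0 : 0 <= dpc) by apply Rabs_pos.
 assert (Hdpc : Rabs (pc - pc') <= dpc) by apply Rle_refl.
 set (N := 8 * dx + 128 * M + 256 * (W + 2) * dpc).
 assert (HWd : 0 <= (W + 2) * dpc) by fin.
 assert (HN0 : 0 <= N) by (unfold N; lra).
 assert (Lm := half_Lip d P mu W mu_pos W_pos small (-1) xm xm' w w' pc pc' zm zm' dx M dpc Rabs_m1
  ok ok Hdpc HwW HwW' HM Hdm Hm Hm').
 assert (Lp := half_Lip d P mu W mu_pos W_pos small 1 xp xp' w w' pc pc' zp zp' dx M dpc Rabs_1
  ok ok Hdpc HwW HwW' HM Hdp Hp Hp').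
 fold N in Lm, Lp.
 destruct Hm as [Cm _], Hp as [Cp _], Hm' as [Cm' _], Hp' as [Cp' _].
 assert (Hpas := passage_Lip zp zm zp' zm' pc pc' T T' N Cp Cm Cp' Cm' HN0 Lp Lm Hpc Hpc' Tt Tt').
 fold dpc in Hpas.
 assert (Hsm : mu * F * ((W + 2) * dpc) <= / 10000000 * dpc).
 { fin. }
 set (m := mu * F) in *.
 assert (Hpcb : dpc <= 20000 * m * dx + 300000 * m * M).
 { assert (mu * Rabs (T - T') <= m * (2 * dx)) by fin.
  assert (0 <= m * dx) by fin. assert (0 <= m * M) by fin.
  unfold N in Hpas. lra. }
 split; [fin|]. intros j Hj.
 assert (HWd2 : 256 * (W + 2) * dpc <= dx + 10 * M).
 { fin. }
 assert (HNb : N <= 9 * dx + 138 * M) by (unfold N; lra).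
 assert (Hdb : dpc <= dx + 10 * M).
 { fin. }
 generalize (edrift_Lip 1 Rabs_1 pc pc' j zp zp' N dpc ok ok Hdpc Hj Cp Cp' HN0 Lp)
   (edrift_Lip (-1) Rabs_m1 pc pc' j zm zm' N dpc ok ok Hdpc Hj Cm Cm' HN0 Lm).
 fold m. specialize (Vv j Hj). specialize (Vv' j Hj).
 set (e1 := edrift 1 pc j zp) in *. set (e1' := edrift 1 pc' j zp') in *.
 set (e2 := edrift (-1) pc j zm) in *. set (e2' := edrift (-1) pc' j zm') in *. intros E1 E2.
 assert (HE : 256 * m * (N + 2 * dpc) <= dx / 100 + M / 50).
 { fin. }
 assert (HwT : (w j - w' j) * T = (xp j - xp' j) - (xm j - xm' j) - (e1 - e1') - (e2 - e2') - w' j * (T - T')) by lra.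
 reg_r T.
 rewrite <- (Rabs_pos_eq T) at 1 by lra. rewrite <- Rabs_mult, HwT.
 replace (((2 * W + 3) * dx / T + M / 2) * T) with ((2 * W + 3) * dx + M / 2 * T) by fld.
 assert (HwTT : Rabs (w' j * (T - T')) <= W * (2 * dx)).
 { fin. }
 note (Hdm j Hj) (Hdp j Hj) as H1 H2. apply Rabs_le_between in H1, H2, E1, E2, HwTT.
 assert (M / 2 <= M / 2 * T) by nra. fin.
Qed.

(** The gain of the inverse elapsed time in the velocities and the factor [mu * F] in the momentum
    are what makes the remainder of the matching equations Lipschitz with a small constant. *)
Lemma gap_Lip xm xp w pc zm zp xm' xp' w' pc' zm' zp' dx :
 is_gap xm xp w pc zm zp -> is_gap xm' xp' w' pc' zm' zp' ->
 1 <= xp O - xm O ->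
 bnd2 d dx xm xm' ->
 bnd2 d dx xp xp' ->
 Rabs (pc - pc') <= 4000000 * (W * (mu * F)) * dx /\
 bnd2 d (10 * W * dx / (xp O - xm O)) w w'.
Proof.
 intros Hg Hg' HT Hdm Hdp. generalize muF_small; intros HmF.
 assert (Hdx : 0 <= dx) by (le_by apply Rabs_pos; apply (Hdm O (Nat.le_0_l d))).
 set (T := xp O - xm O) in *.
 assert (HiT : 0 < / T <= 1).
 { split; [fin|]. rewrite <- Rinv_1. fin. }
 assert (Hw : bnd2 d (10 * W * dx / T) w w').
 { intros j Hj.
  le_thru (2 * ((2 * W + 3) * dx / T) * 1).
  - apply (absorb (fun a => (a <= d)%nat) (fun a => Rabs (w a - w' a)) (fun _ => 1) _ (2 * W)); trivial.
   + fin.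
   + fin.
   + lra.
   + intros a Ha. destruct Hg as (_ & _ & HwW & _). destruct Hg' as (_ & _ & HwW' & _).
    specialize (HwW a Ha). specialize (HwW' a Ha). fin.
   + intros N HN H a Ha.
    destruct (gap_Lip_aux _ _ _ _ _ _ _ _ _ _ _ _ dx N Hg Hg' HT Hdm Hdp) as [_ H2].
    * intros b Hb. specialize (H b Hb). lra.
    * specialize (H2 a Ha). fold T in H2. lra.
  - replace (2 * ((2 * W + 3) * dx / T) * 1) with ((4 * W + 6) * (dx * / T)) by fin.
   replace (10 * W * dx / T) with (10 * W * (dx * / T)) by fin.
   fin. }
 split; trivial.
 destruct (gap_Lip_aux _ _ _ _ _ _ _ _ _ _ _ _ dx (10 * W * dx / T) Hg Hg' HT Hdm Hdp Hw) as [H1 _].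
 le_by exact H1.
 assert (10 * W * dx / T <= 10 * W * dx).
 { unfold Rdiv. rewrite <- (Rmult_1_r (10 * W * dx)) at 2. fin. }
 set (m := mu * F) in *.
 le_thru (20000 * m * dx + 300000 * m * (10 * W * dx)).
 - fin.
 - assert (0 <= m * dx) by fin.
  fin.
Qed.
End gap.

(** * Comparison with the unperturbed separatrix *)

Definition p0 (q : R) : R := 2 * sin (q / 2).
(* Time needed by the unperturbed separatrix to go from [q] to [PI]. *)
Definition T0 (q : R) : R := - RInt (fun y => / p0 y) PI q.

Lemma p0_sq q : p0 q ^ 2 = 2 * (1 - cos q).
Proof. rewrite one_minus_cos_half. unfold p0. ring. Qed.

Lemma p0_ge q : 0 <= q <= 4 -> q / 4 <= p0 q.
Proof. intros H. unfold p0. generalize (sin_lower (q / 2) ok). lra. Qed.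

Lemma p0_inv q : 0 < q <= 4 -> 0 < / p0 q <= 4 / q.
Proof.
 intros H. generalize (p0_ge q ok). intros. split; [fin|].
 replace (4 / q) with (/ (q / 4)) by fld. fin.
Qed.

Lemma p0_cont q : continuous p0 q.
Proof. apply @ex_derive_continuous. unfold p0. auto_derive; trivial. Qed.

Lemma p0_inv_cont q : 0 < q < 4 -> continuous (fun y => / p0 y) q.
Proof.
 intros H. apply continuous_Rinv_comp; [apply p0_cont|]. generalize (p0_ge q ok). lra.
Qed.

Lemma p0_inv_ex_RInt q : 0 < q < 4 -> ex_RInt (fun y => / p0 y) PI q.
Proof.
 intros H. generalize PI_range; intros. apply ex_RInt_cont. intros y Hy. apply p0_inv_cont. split.
 - eapply Rlt_le_trans; [|apply Hy]. apply Rmin_glb_lt; lra.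
 - eapply Rle_lt_trans; [apply Hy|]. apply Rmax_lub_lt; lra.
Qed.

Lemma T0_derive q : 0 < q < 4 -> is_derive T0 q (- / p0 q).
Proof.
 intros H. unfold T0. apply @is_derive_opp. generalize PI_range; intros.
 apply (is_derive_RInt_cont (fun y => / p0 y) 0 4 PI); try lra. intros. now apply p0_inv_cont.
Qed.

Lemma T0_PI : T0 PI = 0.
Proof. unfold T0. rewrite RInt_point. unfold zero; simpl. ring. Qed.

Lemma T0_le q : 0 < q < 4 -> Rabs (T0 q) <= 64 / q.
Proof.
 intros H. unfold T0. rewrite Rabs_Ropp. generalize PI_range; intros.
 le_by (apply RInt_abs_le_inv_square with (C := 16); try lra).
 - intros; now apply p0_inv_cont.
 - intros y Hy. generalize (p0_inv y ok). intros. rewrite Rabs_pos_eq by lra.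
  le_by apply H1. replace (16 / y ^ 2) with (4 / y * (4 / y)) by fld.
  rewrite <- (Rmult_1_r (4 / y)) at 1. mul_l.
  reg_r y. field_simplify; lra.
 - lra.
Qed.

(** Reference half: the angles turn with constant frequency [om] while [q] follows the unperturbed
    separatrix, whose momentum is [p0]. *)
Definition z0 (s : R) (om x : vec) (q : R) : vec := fun j => x j - s * om j * T0 q.

Lemma z0_cont04 d s om x : cont04 d (z0 s om x).
Proof.
 intros j q Hj Hq. unfold z0. apply @continuous_minus; [apply continuous_const|].
 apply (continuous_scal_r (V := NM)). eapply is_derive_continuous. now apply T0_derive.
Qed.

Lemma RInt_minus4 (f g h k : R -> R) a b :
 ex_RInt f a b -> ex_RInt g a b -> ex_RInt h a b -> ex_RInt k a b ->
 RInt f a b - RInt g a b - (RInt h a b - RInt k a b) = RInt (fun q => f q - g q - (h q - k q)) a b.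
Proof.
 intros Hf Hg Hh Hk. symmetry. apply is_RInt_unique.
 apply (is_RInt_minus (V := NM) (fun q => f q - g q) (fun q => h q - k q));
  apply (is_RInt_minus (V := NM)); now apply (RInt_correct (V := CNM)).
Qed.

Section comparison.
Variables (d : nat) (P : list trig_mode) (mu W : R).
Let F := Fbd d P.
Hypothesis mu_pos : 0 < mu.
Hypothesis W_ge : 2 <= W.
Hypothesis small : mu * F * (W + 2) <= / 10000000.
Let W_pos : 0 <= W. Proof. lra. Qed.
Let muF : mu * F <= 1 / 1000 := small2 d P mu W mu_pos W_pos small.
Variable s : R.
Hypothesis Hs : Rabs s = 1.

Definition hI0 (j : nat) (z : R -> vec) (q : R) : R := (1 - cos (clip q)) * gz d P j (z (clip q)) / p0 (clip q).

Lemma hI0_le j z q : j <=' d -> q < 4 -> Rabs (hI0 j z q) <= 2 * F * clip q.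
Proof.
 intros Hj Hq. unfold hI0. destruct (Rle_lt_dec q 0) as [H|H].
 - rewrite clip_neg, cos_0; trivial. fin.
 - unclip. destruct (p0_inv q ok) as [Hp1 Hp2].
  unfold Rdiv. rewrite !Rabs_mult, (Rabs_pos_eq (/ p0 q)), (Rabs_pos_eq (1 - cos q));
   [|apply one_minus_cos_pos|lra].
  replace (2 * F * q) with (q ^ 2 / 2 * F * (4 / q)) by fld.
  apply Rmult_le_compat; [|lra| |fin].
  + apply Rmult_le_pos; [apply one_minus_cos_pos|fin].
  + apply Rmult_le_compat; [apply one_minus_cos_pos|fin|apply one_minus_cos_upper|].
   now apply gz_le.
Qed.

Lemma hI0_cont j z q : j <=' d -> cont04 d z -> q < 4 -> continuous (hI0 j z) q.
Proof.
 intros Hj Hz Hq. destruct (Rle_lt_dec q 0) as [H|H].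
 - apply (continuous_clip _ (2 * F)); trivial. intros; now apply hI0_le.
 - apply (continuous_near (fun q => (1 - cos q) * gz d P j (z q) * / p0 q) _ _ q); trivial.
  + intros y Hy. apply Rabs_def2 in Hy. unfold hI0. now unclip.
  + apply (continuous_mult (K := R_AbsRing)); [|apply p0_inv_cont; lra].
   apply (continuous_mult (K := R_AbsRing)).
   * apply @continuous_minus; [apply continuous_const|apply continuous_cos].
   * apply continuous_gz. intros; now apply Hz.
Qed.

Definition drift0 (j : nat) (om x : vec) : R := - s * mu * RInt (hI0 j (z0 s om x)) 0 PI.

Section size.
Variables (x w om : vec) (pc ew : R) (z : R -> vec).
Hypothesis Hpc : 0 <= pc.
Hypothesis Hz : is_half d P mu s x w pc z.
Hypothesis Hom : bnd d W om.
Hypothesis Hw : bnd2 d ew w om.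

Definition B0 : R := 16 * pc + 256 * (mu * F).
Definition Y0 : R := 64 * (ew + W * pc) + 2048 * (W + 1) * (mu * F).

Lemma muF_pos : 0 <= mu * F.
Proof. generalize (F_ge1 d P). fold F. nra. Qed.

Lemma ew_pos : 0 <= ew.
Proof. le_by apply Rabs_pos; apply (Hw O (Nat.le_0_l d)). Qed.

Lemma Y0_pos : 0 <= Y0.
Proof.
 unfold Y0. generalize muF_pos ew_pos. intros.
 assert (0 <= W * pc) by fin.
 assert (0 <= (W + 1) * (mu * F)) by fin. lra.
Qed.

Lemma pm_p0_inv q : 0 < q < 4 -> Rabs (/ pm d P mu pc z q - / p0 q) <= B0 / q ^ 2.
Proof.
 intros Hq. destruct Hz as [Cz _].
 assert (Hp : q / 4 <= pm d P mu pc z q) by (apply pm_ge; trivial; lra).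
 assert (Hpp : pc <= pm d P mu pc z q) by (apply pm_ge_pc; trivial; lra).
 assert (Hp0 : q / 4 <= p0 q) by (apply p0_ge; lra).
 assert (Hsq := pm_sq d P mu mu_pos muF pc z q Cz ok).
 assert (HA := Aint_sub_cos d P mu mu_pos muF z q Cz ok). fold F in HA.
 note (p0_sq q) muF_pos as H0 HmF.
 assert (Hi := pm_inv d P mu mu_pos muF pc z q Cz ok). destruct (p0_inv q ok) as [Hi0 Hi0'].
 set (p := pm d P mu pc z q) in *. set (r := p0 q) in *.
 replace (/ p - / r) with ((r - p) * (/ p * / r)) by fld.
 rewrite Rabs_mult. assert (0 < / p) by fin.
 rewrite (Rabs_pos_eq (/ p * / r)) by fin.
 assert (Hnum : Rabs (r - p) <= pc + 4 * (mu * F) * q).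
 { reg_r (p + r). rewrite <- (Rabs_pos_eq (p + r)) at 1 by lra.
  rewrite <- Rabs_mult. replace ((r - p) * (p + r)) with (r ^ 2 - p ^ 2) by ring.
  rewrite H0, Hsq. apply Rabs_le_between in HA. apply Rabs_le.
  assert (pc * pc <= pc * (p + r)) by fin.
  fin. }
 replace (B0 / q ^ 2) with ((pc + 16 * (mu * F)) * (4 / q * (4 / q))) by (unfold B0; field; lra).
 apply Rmult_le_compat; [fin|fin| |fin].
 fin.
Qed.

Lemma hz_sub_ref j q : j <=' d -> 0 < q < 4 ->
 Rabs (hz d P mu s w pc j z q - om j * / p0 q) <= Y0 / 4 / q ^ 2.
Proof.
 intros Hj Hq. generalize ew_pos muF_pos; intros Hew HmF. unfold hz. unclip.
 destruct Hz as [Cz _].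
 assert (Hdr := drift_le d P mu mu_pos muF s Hs pc j z q Hpc Hj Cz ok). fold F in Hdr.
 assert (Hi := pm_inv d P mu mu_pos muF pc z q Cz ok).
 assert (Hpp := pm_pos d P mu mu_pos muF pc z q Hpc Cz ok ok).
 assert (0 < / pm d P mu pc z q) by fin.
 assert (HB := pm_p0_inv q Hq).
 set (p := pm d P mu pc z q) in *. set (i := drift d P mu s pc j z q) in *.
 replace ((w j + i) / p - om j * / p0 q) with ((w j - om j + i) * / p + om j * (/ p - / p0 q)) by fin.
 triang. rewrite !Rabs_mult, (Rabs_pos_eq (/ p)) by lra.
 le_thru ((ew + 2 * (mu * F) * q ^ 2) * (4 / q) + W * (B0 / q ^ 2)).
 - apply Rplus_le_compat; mul_abs; try lra; auto.
  triang. fin.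
 - replace (_ + _) with ((4 * q * ew + 8 * q ^ 3 * (mu * F) + W * B0) / q ^ 2) by fld.
  unfold Rdiv at 1. replace (Y0 / 4 / q ^ 2) with (Y0 / 4 * / q ^ 2) by fin.
  apply Rmult_le_compat_r; [fin|].
  assert (q ^ 3 <= 64) by nra. unfold Y0, B0.
  fin.
Qed.

Lemma z_sub_ref j q : j <=' d -> 0 < q < 4 -> Rabs (z q j - z0 s om x q j) <= Y0 / q.
Proof.
 intros Hj Hq. generalize PI_range; intros. destruct (Hz) as [Cz Ez1]. rewrite Ez1 by fin.
 unfold Phi_half, z0, T0.
 replace (_ - _) with (s * (RInt (hz d P mu s w pc j z) PI q - om j * RInt (fun y => / p0 y) PI q)) by ring.
 rewrite Rabs_mult, Hs, Rmult_1_l.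
 change (om j * RInt (fun y => / p0 y) PI q) with (scal (om j) (RInt (fun y => / p0 y) PI q)).
 rewrite <- (RInt_scal (V := CNM)) by now apply p0_inv_ex_RInt.
 rewrite <- (RInt_minus (V := CNM)).
 - replace (Y0 / q) with (4 * (Y0 / 4) / q) by fin. apply RInt_abs_le_inv_square; try lra.
  + intros y Hy. apply @continuous_minus; [apply (hz_cont d P mu mu_pos muF); trivial; lra|].
   apply (continuous_scal_r (V := NM)). now apply p0_inv_cont.
  + intros y Hy. now apply hz_sub_ref.
 - apply ex_RInt_cont. intros y Hy. apply (hz_cont d P mu mu_pos muF); trivial.
  + eapply Rle_lt_trans; [apply Hy|]. apply Rmax_lub_lt; lra.
  + left. eapply Rlt_le_trans; [|apply Hy]. apply Rmin_glb_lt; lra.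
 - apply (ex_RInt_scal (V := NM)). now apply p0_inv_ex_RInt.
Qed.

Lemma Aint_sub_ref : Rabs (Aint d P mu z PI - Aint d P mu (z0 s om x) PI) <= 4 * (mu * F) * Y0.
Proof.
 generalize PI_range; intros. destruct (Hz) as [Cz Ez1].
 generalize (Aint_diff d P mu mu_pos muF Y0 z (z0 s om x) Cz (z0_cont04 d s om x) z_sub_ref Y0_pos PI ok).
 fold F. generalize (muFN_pos d P mu mu_pos Y0 Y0_pos). fold F. nra.
Qed.

Lemma drift_sub_ref j : j <=' d ->
 Rabs (drift d P mu s pc j z PI - drift0 j om x) <= 4 * (mu * F) * (2 * Y0 + B0).
Proof.
 intros Hj. generalize PI_range Y0_pos muF_pos; intros HPI HY HmF. destruct (Hz) as [Cz _].
 generalize (F_ge1 d P). fold F. intros HF.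
 assert (HB0 : 0 <= B0) by (unfold B0; lra).
 unfold drift, drift0. rewrite <- Rmult_minus_distr_l, <- (RInt_minus (V := CNM)).
 - rewrite !Rabs_mult, Rabs_Ropp, Hs, (Rabs_pos_eq mu) by lra.
  le_thru (1 * mu * (PI * (F * (2 * Y0 + B0)))).
  + mul_l. apply RInt_abs_le_const; [lra| |].
   * intros. apply @continuous_minus; [apply (hI_cont d P mu mu_pos muF)|apply hI0_cont]; trivial; try lra.
    apply z0_cont04.
   * intros q Hq. change (Rabs (hI d P mu pc j z q - hI0 j (z0 s om x) q) <= F * (2 * Y0 + B0)).
    unfold hI, hI0. unclip. destruct (Req_dec q 0) as [->|Hq0].
    { rewrite cos_0. replace (_ - _) with 0 by fin. fin. }
    assert (Hg := gz_Lip d P (z q) (z0 s om x q) (Y0 / q) (fun j Hj => z_sub_ref j q Hj ok) j Hj).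
    assert (Hg0 := gz_le d P j (z0 s om x q) Hj).
    assert (HB := pm_p0_inv q ok).
    assert (Hi := pm_inv d P mu mu_pos muF pc z q Cz ok).
    assert (Hpp := pm_pos d P mu mu_pos muF pc z q Hpc Cz ok ok).
    assert (0 < / pm d P mu pc z q) by fin. fold F in Hg, Hg0.
    set (p := pm d P mu pc z q) in *. set (g := gz d P j (z q)) in *. set (g0 := gz d P j (z0 s om x q)) in *.
    replace (_ - _) with ((1 - cos q) * ((g - g0) * / p + g0 * (/ p - / p0 q))) by fin.
    rewrite Rabs_mult, (Rabs_pos_eq (1 - cos q)) by apply one_minus_cos_pos.
    le_thru (q ^ 2 / 2 * (F * (Y0 / q) * (4 / q) + F * (B0 / q ^ 2))).
    { apply Rmult_le_compat; [apply one_minus_cos_pos|fin|apply one_minus_cos_upper|].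
     triang. rewrite !Rabs_mult.
     apply Rplus_le_compat; mul_abs; trivial.
     fin. }
    replace (_ * _) with (F * (2 * Y0 + B0 / 2)) by fld. fin.
  + assert (0 <= mu * F * (2 * Y0 + B0)) by fin.
   fin.
 - ex_rint.
  intros; apply (hI_cont d P mu mu_pos muF); trivial; lra.
 - ex_rint.
  intros; apply hI0_cont; trivial; [apply z0_cont04|lra].
Qed.
End size.

(** * Second differences between true and reference halves *)

Section second_order.
Variables (x w x' w' om : vec) (pc pc' ew dx dw dpc : R) (z z' : R -> vec).
Hypothesis Hpc : 0 <= pc.
Hypothesis Hpc' : 0 <= pc'.
Hypothesis Hz : is_half d P mu s x w pc z.
Hypothesis Hz' : is_half d P mu s x' w' pc' z'.
Hypothesis Hom : bnd d W om.
Hypothesis HwW : bnd d W w.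
Hypothesis HwW' : bnd d W w'.
Hypothesis Hw : bnd2 d ew w om.
Hypothesis Hw' : bnd2 d ew w' om.
Hypothesis Hdx : bnd2 d dx x x'.
Hypothesis Hdw : bnd2 d dw w w'.
Hypothesis Hdpc : Rabs (pc - pc') <= dpc.

Let N := 8 * dx + 128 * dw + 256 * (W + 2) * dpc.
Let E := Ez d P mu W N dpc dw.
Let Y := Y0 pc' ew.

Let Hdx0 : 0 <= dx. Proof. exact (dw_pos _ _ _ _ Hdx). Qed.
Let Hdw0 : 0 <= dw. Proof. exact (dw_pos _ _ _ _ Hdw). Qed.
Let Hdpc0 : 0 <= dpc. Proof. fin. Qed.
Let HN0 : 0 <= N.
Proof. assert (0 <= (W + 2) * dpc) by fin. unfold N. lra. Qed.
Let HY0 : 0 <= Y. Proof. exact (Y0_pos w' om pc' ew Hpc' Hw'). Qed.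

Lemma second_order_dist j q : j <=' d -> 0 < q < 4 -> Rabs (z q j - z' q j) <= N / q.
Proof. apply (half_Lip d P mu W mu_pos W_pos small s x x' w w' pc pc' z z'); trivial. Qed.

Let HE0 : 0 <= E.
Proof. exact (Ez_pos d P mu mu_pos pc pc' W N dpc dw w w' Hdpc HN0 W_pos Hdw). Qed.

Lemma second_order_z j q : j <=' d -> 0 < q < 4 ->
 Rabs (z q j - z0 s om x q j - (z' q j - z0 s om x' q j)) <= 4 * E / q.
Proof.
 intros Hj Hq. destruct (Hz) as [Cz Ez1]. destruct (Hz') as [Cz' Ez2].
 rewrite Ez1, Ez2 by fin.
 replace (_ - _ - _) with (Phi_half d P mu s x w pc z q j - Phi_half d P mu s x' w' pc' z' q j - (x j - x' j))
  by (unfold z0; ring).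
 apply (Phi_half_diff d P mu mu_pos muF s Hs pc pc' W N dpc dw z z' w w' x x'); trivial.
 apply second_order_dist.
Qed.

Let K := 4 * E + dx * Y.
Let HK0 : 0 <= K.
Proof. unfold K. fin. Qed.

Lemma z0_diff q j : j <=' d -> Rabs (z0 s om x q j - z0 s om x' q j) <= dx.
Proof. intros Hj. unfold z0. replace (_ - _) with (x j - x' j) by ring. auto. Qed.

Lemma second_order_scale q : 0 < q -> 4 * E / q + dx * (Y / q) = K / q.
Proof. intros. unfold K. fin. Qed.

(** A first-order estimate of the perturbed term alone would give a Lipschitz constant of order
    [mu], as large as the Melnikov term. Pairing it with the reference leaves [K], in which every
    summand is small: [E] measures changes of velocity and momentum and the coupling by [mu * F],
    and [dx * Y] is the variation of a quantity at distance [Y]. *)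
Lemma Aint_second_order :
 Rabs (Aint d P mu z PI - Aint d P mu (z0 s om x) PI - (Aint d P mu z' PI - Aint d P mu (z0 s om x') PI))
 <= 4 * (mu * F) * K.
Proof.
 generalize PI_range muF_pos; intros HPI HmF. destruct (Hz) as [Cz _]. destruct (Hz') as [Cz' _].
 assert (Hex : forall z, cont04 d z -> ex_RInt (hA d P mu z) 0 PI).
 { intros z1 H1. ex_rint.
  intros; apply (hA_cont d P mu mu_pos muF); trivial; lra. }
 unfold Aint. rewrite RInt_minus4 by (apply Hex; trivial; apply z0_cont04).
 le_thru (PI * (mu * F * K)).
 2:{ assert (0 <= mu * F * K) by pos. nra. }
 apply RInt_abs_le_const; [lra| |].
 - intros. repeat apply @continuous_minus; apply (hA_cont d P mu mu_pos muF); trivial; try lra; apply z0_cont04.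
 - intros q Hq.
  unfold hA. unclip.
  replace (_ - _ - _) with (- (sin q * (mu * (fz d P (z q) - fz d P (z0 s om x q) -
    (fz d P (z' q) - fz d P (z0 s om x' q)))))) by ring.
  destruct (Req_dec q 0) as [->|Hq0].
  { rewrite sin_0, Rmult_0_l, Ropp_0, Rabs_R0. fin. }
  rewrite Rabs_Ropp, !Rabs_mult, (Rabs_pos_eq mu) by lra.
  replace (mu * F * K) with (q * (mu * (F * (K / q)))) by fld.
  apply Rmult_le_compat; [apply Rabs_pos| |apply Rabs_sin_le; lra|].
  + fin.
  + mul_l. rewrite <- second_order_scale by lra.
   apply fz_four.
   * intros; apply second_order_z; trivial; lra.
   * intros; now apply z0_diff.
   * intros; apply (z_sub_ref x' w' om pc' ew z' Hpc' Hz' Hom Hw'); trivial; lra.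
Qed.

Let Dv := Dinv d P mu N dpc.
Let B := B0 pc.

Lemma drift_second_order j : j <=' d ->
 Rabs (drift d P mu s pc j z PI - drift0 j om x - (drift d P mu s pc' j z' PI - drift0 j om x'))
 <= 4 * (mu * F) * (2 * K + Dv + dx * B).
Proof.
 intros Hj. generalize PI_range muF_pos; intros HPI HmF. destruct (Hz) as [Cz _]. destruct (Hz') as [Cz' _].
 generalize (F_ge1 d P). fold F. intros HF.
 assert (HD0 : 0 <= Dv) by exact (Dinv_pos d P mu mu_pos pc pc' N dpc Hdpc HN0).
 assert (HB0 : 0 <= B) by (unfold B, B0; lra).
 assert (HdB : 0 <= dx * B) by fin.
 assert (Hex : forall pc z, 0 <= pc -> cont04 d z -> ex_RInt (hI d P mu pc j z) 0 PI).
 { intros pc1 z1 H0 H1. ex_rint.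
  intros; apply (hI_cont d P mu mu_pos muF); trivial; lra. }
 assert (Hex0 : forall z, cont04 d z -> ex_RInt (hI0 j z) 0 PI).
 { intros z1 H1. ex_rint.
  intros; apply hI0_cont; trivial; lra. }
 assert (C0 := z0_cont04 d s om x). assert (C0' := z0_cont04 d s om x').
 unfold drift, drift0. rewrite <- !Rmult_minus_distr_l.
 rewrite RInt_minus4 by auto.
 rewrite !Rabs_mult, Rabs_Ropp, Hs, (Rabs_pos_eq mu) by lra.
 le_thru (1 * mu * (PI * (F * (2 * K + Dv + dx * B)))).
 2:{ assert (0 <= mu * F * (2 * K + Dv + dx * B)) by fin.
   fin. }
 mul_l. apply RInt_abs_le_const; [lra| |].
 - intros. repeat apply @continuous_minus; try apply (hI_cont d P mu mu_pos muF); try apply hI0_cont; trivial; lra.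
 - intros q Hq.
  unfold hI, hI0. unclip. destruct (Req_dec q 0) as [->|Hq0].
  { rewrite cos_0. replace (_ - _ - _) with 0 by fin. fin. }
  assert (Hg4 : Rabs (gz d P j (z q) - gz d P j (z0 s om x q) - (gz d P j (z' q) - gz d P j (z0 s om x' q))) <= F * (K / q)).
  { rewrite <- second_order_scale by lra. apply gz_four; trivial.
   - intros; apply second_order_z; trivial; lra.
   - intros; now apply z0_diff.
   - intros; apply (z_sub_ref x' w' om pc' ew z' Hpc' Hz' Hom Hw'); trivial; lra. }
  assert (Hg' := gz_le d P j (z' q) Hj).
  assert (Hg0 := gz_Lip d P (z0 s om x q) (z0 s om x' q) dx (fun j Hj => z0_diff q j Hj) j Hj).
  assert (HB := pm_p0_inv x w pc z Hpc Hz q ok).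
  assert (HD := pm_inv_diff d P mu mu_pos muF pc pc' N dpc z z' Hpc Hpc' Hdpc Cz Cz' second_order_dist HN0 q ok).
  assert (Hi := pm_inv d P mu mu_pos muF pc z q Cz ok).
  assert (Hpp := pm_pos d P mu mu_pos muF pc z q Hpc Cz ok ok).
  assert (0 < / pm d P mu pc z q) by fin. fold F in Hg', Hg0. fold B in HB. fold Dv in HD.
  set (p := pm d P mu pc z q) in *. set (p' := pm d P mu pc' z' q) in *.
  set (g := gz d P j (z q)) in *. set (g0 := gz d P j (z0 s om x q)) in *.
  set (g' := gz d P j (z' q)) in *. set (g0' := gz d P j (z0 s om x' q)) in *.
  replace (_ - _ - _) with ((1 - cos q) * ((g - g0 - (g' - g0')) * / p + g' * (/ p - / p')
    + (g0 - g0') * (/ p - / p0 q))) by fin.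
  rewrite Rabs_mult, (Rabs_pos_eq (1 - cos q)) by apply one_minus_cos_pos.
  le_thru (q ^ 2 / 2 * (F * (K / q) * (4 / q) + F * (Dv / q ^ 2) + F * dx * (B / q ^ 2))).
  + apply Rmult_le_compat; [apply one_minus_cos_pos|fin|apply one_minus_cos_upper|].
   triang. apply Rplus_le_compat; [|fin].
   triang. rewrite !Rabs_mult.
   apply Rplus_le_compat; mul_abs; trivial.
   fin.
  + replace (_ * _) with (F * (2 * K + Dv / 2 + dx * B / 2)) by fld. fin.
Qed.
End second_order.
End comparison.

(** * The Melnikov potential *)

Definition kern (q : R) : R := (1 - cos (clip q)) / p0 (clip q).
(** By the substitution [q = q0 t] this is the integral of [(1 - cos (q0 t)) * cos (k * t)] over
    [t <= 0]: half of the Fourier transform of an even function. *)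
Definition Jm (k : R) : R := RInt (fun q => kern q * cos (k * T0 (clip q))) 0 PI.

Lemma kern_le q : q < 4 -> 0 <= kern q <= 2 * clip q.
Proof.
 intros Hq. unfold kern. destruct (Rle_lt_dec q 0) as [H|H].
 - rewrite clip_neg, cos_0; trivial. fin.
 - unclip. destruct (p0_inv q ok) as [Hp1 Hp2].
  generalize (one_minus_cos_pos q) (one_minus_cos_upper q). intros. split.
  + fin.
  + replace (2 * q) with (q ^ 2 / 2 * (4 / q)) by fld. fin.
Qed.

Lemma kern_mult_cont (h : R -> R) M q :
 (forall y, Rabs (h y) <= M) -> (forall y, 0 < y < 4 -> continuous h y) -> q < 4 ->
 continuous (fun q => kern q * h (clip q)) q.
Proof.
 intros HM Hh Hq. destruct (Rle_lt_dec q 0) as [H|H].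
 - apply (continuous_clip _ (2 * M)); trivial. intros y Hy. rewrite Rabs_mult.
  generalize (kern_le y Hy). intros. rewrite Rabs_pos_eq by lra.
  replace (2 * M * clip y) with (2 * clip y * M) by ring.
  fin.
 - apply (continuous_near (fun q => (1 - cos q) * / p0 q * h q) _ _ q); trivial.
  + intros y Hy. apply Rabs_def2 in Hy. unfold kern. now unclip.
  + apply (continuous_mult (K := R_AbsRing)); [|apply Hh; lra].
   apply (continuous_mult (K := R_AbsRing)); [|apply p0_inv_cont; lra].
   apply @continuous_minus; [apply continuous_const|apply continuous_cos].
Qed.

Lemma cos_T0_cont k q : 0 < q < 4 -> continuous (fun q => cos (k * T0 q)) q.
Proof.
 intros Hq. apply (continuous_comp (fun q => k * T0 q) cos); [|apply continuous_cos].
 apply (continuous_scal_r (V := NM)). eapply is_derive_continuous. now apply T0_derive.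
Qed.

Lemma Jm_integrand_cont k q : q < 4 -> continuous (fun q => kern q * cos (k * T0 (clip q))) q.
Proof.
 intros Hq. apply (kern_mult_cont (fun q => cos (k * T0 q)) 1); trivial.
 - intros. apply Rabs_le, COS_bound.
 - intros. now apply cos_T0_cont.
Qed.

Lemma ex_RInt_below4 (h : R -> R) : (forall q, q < 4 -> continuous h q) -> ex_RInt h 0 PI.
Proof.
 intros H. generalize PI_range; intros. ex_rint.
 intros; apply H; lra.
Qed.

Lemma Jm_le k : Rabs (Jm k) <= 32.
Proof.
 generalize PI_range; intros HPI. unfold Jm. le_thru (PI * 8); [|lra].
 apply RInt_abs_le_const; [lra| |].
 - intros. apply Jm_integrand_cont. lra.
 - intros y Hy. rewrite Rabs_mult. generalize (kern_le y ok). unclip. intros.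
  rewrite (Rabs_pos_eq (kern y)) by lra. assert (Rabs (cos (k * T0 y)) <= 1) by apply Rabs_le, COS_bound.
  fin.
Qed.

(** [kern] vanishes like [q] at 0, where [T0] is bounded by [64 / q], so the product stays
    bounded. *)
Lemma Jm_Lip k k' : Rabs (Jm k - Jm k') <= 512 * Rabs (k - k').
Proof.
 generalize PI_range; intros HPI. unfold Jm.
 rewrite <- (RInt_minus (V := CNM)) by (apply ex_RInt_below4; intros; now apply Jm_integrand_cont).
 le_thru (PI * (128 * Rabs (k - k'))); [|generalize (Rabs_pos (k - k')); nra].
 apply RInt_abs_le_const; [lra| |].
 - intros. apply @continuous_minus; apply Jm_integrand_cont; lra.
 - intros y Hy. change (Rabs (kern y * cos (k * T0 (clip y)) - kern y * cos (k' * T0 (clip y))) <= 128 * Rabs (k - k')).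
  generalize (kern_le y ok). unclip. intros Hk.
  destruct (Req_dec y 0) as [->|Hy0].
  { assert (kern 0 = 0) by lra. rewrite H. replace (_ - _) with 0 by ring. fin. }
  rewrite <- Rmult_minus_distr_l, Rabs_mult, (Rabs_pos_eq (kern y)) by lra.
  replace (128 * Rabs (k - k')) with (2 * y * (Rabs (k - k') * (64 / y))) by fld.
  apply Rmult_le_compat; try lra; [fin|].
  le_by apply cos_Lip. rewrite <- Rmult_minus_distr_r, Rabs_mult.
  apply Rmult_le_compat_l; [fin|]. apply T0_le. lra.
Qed.

Section melnikov.
Variables (d : nat) (P : list trig_mode).

Lemma is_RInt_lsum {A} (l : list A) (h : A -> R -> R) (I : A -> R) a b :
 (forall m, is_RInt (h m) a b (I m)) -> is_RInt (fun q => lsum l (fun m => h m q)) a b (lsum l I).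
Proof.
 intros H. induction l as [|m l IH].
 - replace (lsum nil I) with (scal (b - a) 0) by (unfold scal, lsum; simpl; unfold mult; simpl; ring).
  apply (is_RInt_const (V := NM)).
 - apply (is_RInt_plus (V := NM)); [fin|fin].
Qed.

Lemma is_RInt_Jm_sum (c : trig_mode -> R) (om : vec) :
 is_RInt (fun q => lsum P (fun m => c m * (kern q * cos (phase d m om * T0 (clip q))))) 0 PI
  (lsum P (fun m => c m * Jm (phase d m om))).
Proof.
 apply is_RInt_lsum. intros m. apply (is_RInt_scal (V := NM)).
 apply (RInt_correct (V := CNM)). apply ex_RInt_below4. intros; now apply Jm_integrand_cont.
Qed.

Lemma phase_z0 m s om x q : phase d m (z0 s om x q) = phase d m x - s * (phase d m om * T0 q).
Proof.
 unfold z0.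
 replace (s * (phase d m om * T0 q)) with ((s * T0 q) * phase d m om) by ring.
 rewrite <- phase_scal, phase_minus. apply phase_ext. fin.
Qed.

Lemma mval_pm m c a : mval m (c - 1 * a) + mval m (c - -1 * a) = 2 * mval m c * cos a.
Proof.
 unfold mval. replace (c - 1 * a) with (c - a) by ring. replace (c - -1 * a) with (c + a) by ring.
 rewrite cos_minus, sin_minus, cos_plus, sin_plus. ring.
Qed.

Lemma mder_pm m c a : mder m (c - 1 * a) + mder m (c - -1 * a) = 2 * mder m c * cos a.
Proof.
 unfold mder. replace (c - 1 * a) with (c - a) by ring. replace (c - -1 * a) with (c + a) by ring.
 rewrite cos_minus, sin_minus, cos_plus, sin_plus. ring.
Qed.

Lemma mval_mp m c a : mval m (c - 1 * a) - mval m (c - -1 * a) = - (2 * mder m c * sin a).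
Proof.
 unfold mval, mder. replace (c - 1 * a) with (c - a) by ring. replace (c - -1 * a) with (c + a) by ring.
 rewrite cos_minus, sin_minus, cos_plus, sin_plus. ring.
Qed.

(** The Melnikov potential mode by mode, identified with [Gamma] in [Gfun_eq]. The reflection
    symmetry of the separatrix leaves only cosine integrals; [om] includes the frequency 1 of time
    as component 0. *)
Definition Gpot (om x : vec) : R := - lsum P (fun m => 2 * mval m (phase d m x) * Jm (phase d m om)).
(** The derivative of [Gpot om] at [x] in the direction [v]. *)
Definition Gder (om v x : vec) : R :=
 - lsum P (fun m => 2 * mder m (phase d m x) * phase d m v * Jm (phase d m om)).
Definition unit_vec (j : nat) : vec := fun i => if Nat.eqb i j then 1 else 0.

Lemma vsum_unit n j g : j <' n -> vsum n (fun i => g i * unit_vec j i) = g j.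
Proof.
 intros Hj. induction n as [|n IH]; [lia|]. rewrite vsum_S. unfold unit_vec at 2.
 destruct (Nat.eqb_spec n j) as [->|Hn].
 - rewrite (vsum_ext _ _ (fun _ => 0)), vsum_zero; [ring|]. intros i Hi. unfold unit_vec.
  destruct (Nat.eqb_spec i j); [lia|ring].
 - rewrite IH by lia. ring.
Qed.

Lemma phase_unit m j : j <=' d -> phase d m (unit_vec j) = freq m j.
Proof. intros Hj. unfold phase. apply vsum_unit. lia. Qed.

Variables (mu : R) (om x : vec).

(** The halves before and after the bump see phases [c - a] and [c + a]; in the sum the odd parts in
    [a] cancel and the cosine integral [Jm] remains. *)
Lemma drift0_jump j : (1 <= j <= d)%nat ->
 drift0 d P mu 1 j om x - drift0 d P mu (-1) j om x = mu * Gder om (unit_vec j) x.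
Proof.
 intros Hj. unfold drift0, Gder.
 assert (Hex : forall s, ex_RInt (hI0 d P j (z0 s om x)) 0 PI).
 { intros s. apply ex_RInt_below4. intros; apply hI0_cont; trivial; [lia|apply z0_cont04]. }
 replace (_ - _) with (- mu * (RInt (hI0 d P j (z0 1 om x)) 0 PI + RInt (hI0 d P j (z0 (-1) om x)) 0 PI)) by ring.
 rewrite Ropp_mult_distr_r_reverse, <- Ropp_mult_distr_l. f_equal. f_equal.
 change Rplus with (@plus R_AbelianMonoid) at 1.
 rewrite <- (RInt_plus (V := CNM)) by apply Hex.
 apply is_RInt_unique.
 eapply is_RInt_ext; [|eapply eq_rect; [apply (is_RInt_Jm_sum (fun m => 2 * mder m (phase d m x) * freq m j) om)|]].
 - intros q _. change plus with Rplus. destruct j as [|j]; [lia|]. unfold hI0. simpl gz.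
  match goal with |- _ = ?A * ?S1 / ?p + ?A * ?S2 / ?p =>
   replace (A * S1 / p + A * S2 / p) with (kern q * (S1 + S2)) by (unfold kern, Rdiv; ring) end.
  rewrite <- lsum_plus, <- lsum_scal.
  apply lsum_ext. intros m. rewrite !phase_z0, <- Rmult_plus_distr_l, mder_pm. ring.
 - apply lsum_ext. intros m. rewrite phase_unit by lia. ring.
Qed.

Lemma is_derive_square_bound (U : R -> R) C : (forall y, Rabs (U y) <= C * y ^ 2) -> is_derive U 0 0.
Proof.
 intros H. assert (H0 : U 0 = 0).
 { specialize (H 0). fin. }
 assert (HC : 0 <= C) by (specialize (H 1); generalize (Rabs_pos (U 1)); lra).
 apply is_derive_Reals. intros e He.
 assert (Hr : 0 < e / (C + 1)) by fin.
 exists (mkposreal _ Hr). intros h Hh0 Hh. simpl in Hh. rewrite Rplus_0_l, H0, !Rminus_0_r.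
 unfold Rdiv. rewrite Rabs_mult, Rabs_inv. specialize (H h).
 assert (Hhp : 0 < Rabs h) by now apply Rabs_pos_lt.
 apply Rmult_lt_reg_r with (Rabs h); trivial. inv_l; rewrite Rmult_1_r.
 rewrite <- pow2_abs in H.
 assert ((C + 1) * Rabs h < e).
 { apply Rmult_lt_compat_l with (r := C + 1) in Hh; [|lra].
  replace ((C + 1) * (e / (C + 1))) with e in Hh by fld. exact Hh. }
 nra.
Qed.

(** Integration by parts: [(1 - cos q) * sin (k * T0 q)] vanishes at 0 by its first factor and at
    [PI] because [T0 PI = 0]. The factor [k] turns the energy jump at a bump into the derivative of
    the potential along [om]. *)
Lemma sin_T0_moment k : is_RInt (fun q => sin (clip q) * sin (k * T0 (clip q))) 0 PI (k * Jm k).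
Proof.
 generalize PI_range; intros HPI.
 set (U := fun q => (1 - cos (clip q)) * sin (k * T0 (clip q))).
 set (u := fun q => sin (clip q) * sin (k * T0 (clip q)) - k * (kern q * cos (k * T0 (clip q)))).
 assert (Hsc : forall q, q < 4 -> continuous (fun q => sin (clip q) * sin (k * T0 (clip q))) q).
 { intros q Hq. destruct (Rle_lt_dec q 0) as [H|H].
  - apply (continuous_clip _ 1); trivial. intros y Hy. rewrite Rabs_mult, Rmult_1_l.
   assert (Rabs (sin (k * T0 (clip y))) <= 1) by apply Rabs_le, SIN_bound.
   generalize (Rabs_sin_le (clip y) (clip_ge y)) (Rabs_pos (sin (clip y))) (Rabs_pos (sin (k * T0 (clip y)))). nra.
  - apply (continuous_near (fun q => sin q * sin (k * T0 q)) _ _ q); trivial.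
   + intros y Hy. apply Rabs_def2 in Hy. now unclip.
   + apply (continuous_mult (K := R_AbsRing)); [apply continuous_sin|].
    apply (continuous_comp (fun q => k * T0 q) sin); [|apply continuous_sin].
    apply (continuous_scal_r (V := NM)). eapply is_derive_continuous. apply T0_derive; lra. }
 assert (HU : is_RInt u 0 PI (minus (U PI) (U 0))).
 { apply (is_RInt_derive U u).
  - rewrite Rmin_left, Rmax_right by lra. intros q Hq. destruct (Req_dec q 0) as [->|Hq0].
   + replace (u 0) with 0.
    (* [T0] diverges at 0, so the product rule fails there; the bound [|U y| <= y ^ 2 / 2] gives the
       derivative 0 directly. *)
    * apply (is_derive_square_bound U (1 / 2)). intros y. unfold U. rewrite Rabs_mult.
     rewrite (Rabs_pos_eq (1 - cos _)) by apply one_minus_cos_pos.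
     assert (Rabs (sin (k * T0 (clip y))) <= 1) by apply Rabs_le, SIN_bound.
     generalize (one_minus_cos_upper (clip y)) (one_minus_cos_pos (clip y)) (Rabs_pos (sin (k * T0 (clip y)))). intros.
     assert (clip y ^ 2 <= y ^ 2).
     { destruct (Rle_lt_dec y 0); [rewrite clip_neg by lra; generalize (pow2_ge_0 y); lra|rewrite clip_id by lra; lra]. }
     nra.
    * unfold u, kern. rewrite clip_neg, sin_0, cos_0 by lra. fin.
   + apply (is_derive_ext_loc (fun q => (1 - cos q) * sin (k * T0 q))).
    * exists (mkposreal q ok). intros y Hy. change (Rabs (y - q) < q) in Hy. apply Rabs_def2 in Hy.
     unfold U. now unclip.
    * unfold u, kern. unclip.
     replace (_ - _) with (sin q * sin (k * T0 q) + (1 - cos q) * (k * - / p0 q * cos (k * T0 q))) by fin.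
     apply (is_derive_mult (fun q => 1 - cos q) (fun q => sin (k * T0 q))).
     -- auto_derive; trivial; ring.
     -- apply (is_derive_comp sin (fun q => k * T0 q)); [apply is_derive_sin|].
       apply (is_derive_scal T0). apply T0_derive; lra.
     -- intros; apply Rmult_comm.
  - rewrite Rmin_left, Rmax_right by lra. intros q Hq. apply @continuous_minus; [apply Hsc; lra|].
   apply (continuous_scal_r (V := NM)). apply Jm_integrand_cont; lra. }
 assert (HU0 : minus (U PI) (U 0) = 0).
 { unfold minus, plus, opp; simpl. unfold U. rewrite (clip_id PI), (clip_id 0), T0_PI, Rmult_0_r, sin_0, cos_0 by lra. ring. }
 rewrite HU0 in HU.
 assert (HJ : is_RInt (fun q => k * (kern q * cos (k * T0 (clip q)))) 0 PI (k * Jm k)).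
 { apply (is_RInt_scal (V := NM)). apply (RInt_correct (V := CNM)).
  apply ex_RInt_below4. intros; now apply Jm_integrand_cont. }
 generalize (is_RInt_plus (V := NM) _ _ _ _ _ _ HU HJ).
 unfold plus; simpl. rewrite Rplus_0_l. apply is_RInt_ext. intros q _. unfold u.
 fin.
Qed.

Lemma Aint_jump : Rabs (mu * Fbd d P) <= 1 / 1000 -> 0 < mu ->
 Aint d P mu (z0 1 om x) PI - Aint d P mu (z0 (-1) om x) PI = - mu * Gder om om x.
Proof.
 intros Hm Hmu. unfold Aint, Gder.
 assert (Hex : forall s, ex_RInt (hA d P mu (z0 s om x)) 0 PI).
 { intros s. apply ex_RInt_below4. intros; apply hA_cont; trivial; [|apply z0_cont04].
  fin. }
 change (Rminus) with (fun a b => @minus R_AbelianGroup a b).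
 cbv beta. rewrite <- (RInt_minus (V := CNM)) by apply Hex.
 apply is_RInt_unique.
 eapply is_RInt_ext; [|eapply eq_rect; [apply (is_RInt_lsum P
   (fun m q => 2 * mu * mder m (phase d m x) * (sin (clip q) * sin (phase d m om * T0 (clip q))))); intros m;
   apply (is_RInt_scal (V := NM)), sin_T0_moment|]].
 - intros q _. unfold minus, plus, opp; simpl. unfold hA, fz.
  replace (_ + _) with (- (mu * sin (clip q)) * (lsum P (fun m => mval m (phase d m (z0 1 om x (clip q)))) -
   lsum P (fun m => mval m (phase d m (z0 (-1) om x (clip q)))))) by ring.
  rewrite <- lsum_minus, <- lsum_scal. apply lsum_ext. intros m.
  rewrite !phase_z0, mval_mp. ring.
 - replace (- mu * - lsum P _) with (mu * lsum P (fun m => 2 * mder m (phase d m x) * phase d m om * Jm (phase d m om))) by ring.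
  rewrite <- lsum_scal. apply lsum_ext. intros m. unfold scal; simpl; unfold mult; simpl. ring.
Qed.
End melnikov.

Lemma q0_0 : q0 0 = PI.
Proof. unfold q0. rewrite exp_0, atan_1. field. Qed.

Lemma q0_derive t : is_derive q0 t (4 * exp t / (1 + exp t ^ 2)).
Proof.
 unfold q0. generalize (exp_pos t). intros. auto_derive; trivial. fin.
Qed.

Lemma q0_pos t : 0 < q0 t.
Proof.
 unfold q0. assert (0 < atan (exp t)); [|lra]. rewrite <- atan_0. apply atan_increasing, exp_pos.
Qed.

Lemma q0_le_PI t : t <= 0 -> q0 t <= PI.
Proof.
 intros H. rewrite <- q0_0. unfold q0. mul_l.
 destruct H as [H|H]; [|subst; lra]. left. apply atan_increasing, exp_increasing, H.
Qed.

Lemma q0_opp t : q0 (- t) = 2 * PI - q0 t.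
Proof.
 unfold q0. rewrite exp_Ropp, atan_inv by apply exp_pos. field.
Qed.

Lemma sin_2atan u : sin (2 * atan u) = 2 * u / (1 + u ^ 2).
Proof.
 rewrite sin_2a, sin_atan, cos_atan. unfold Rsqr.
 assert (H : 0 < 1 + u * u) by nra.
 assert (Hs := sqrt_lt_R0 _ H). replace (1 + u ^ 2) with (sqrt (1 + u * u) * sqrt (1 + u * u)).
 - fin.
 - rewrite sqrt_sqrt; lra.
Qed.

Lemma p0_q0 t : p0 (q0 t) = 4 * exp t / (1 + exp t ^ 2).
Proof.
 unfold p0, q0. replace (4 * atan (exp t) / 2) with (2 * atan (exp t)) by field.
 rewrite sin_2atan. fin.
Qed.

Lemma T0_q0 t : t <= 0 -> T0 (q0 t) = - t.
Proof.
 intros Ht. generalize PI_range; intros HPI. set (h := fun u => T0 (q0 u) + u).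
 assert (Hd : forall u, u <= 0 -> is_derive h u 0).
 { intros u Hu. generalize (q0_pos u) (q0_le_PI u Hu). intros.
  replace 0 with (4 * exp u / (1 + exp u ^ 2) * (- / p0 (q0 u)) + 1).
  - apply @is_derive_plus; [|apply @is_derive_id].
   apply (is_derive_comp T0 q0); [apply T0_derive; lra|apply q0_derive].
  - rewrite p0_q0. generalize (exp_pos u). fin. }
 destruct Ht as [Ht|Ht].
 - destruct (MVT_gen h t 0 (fun _ => 0)) as (c & _ & Hc).
  + intros u Hu. rewrite Rmin_left, Rmax_right in Hu by lra. apply Hd; lra.
  + intros u Hu. rewrite Rmin_left, Rmax_right in Hu by lra. apply continuity_pt_filterlim.
   eapply is_derive_continuous. apply Hd; lra.
  + unfold h in Hc. rewrite q0_0, T0_PI in Hc. lra.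
 - subst. rewrite q0_0, T0_PI. ring.
Qed.

Lemma is_RInt_gen_line (f : R -> R) la lb :
 (forall t, continuous f t) ->
 filterlim (fun t => RInt f 0 t) (Rbar_locally m_infty) (locally la) ->
 filterlim (fun t => RInt f 0 t) (Rbar_locally p_infty) (locally lb) ->
 is_RInt_gen f (Rbar_locally m_infty) (Rbar_locally p_infty) (lb - la).
Proof.
 intros Hc Ha Hb.
 assert (Hd : forall x, is_derive (fun t => RInt f 0 t) x (f x)).
 { intros x. apply (is_derive_RInt_cont f (Rmin x 0 - 1) (Rmax x 0 + 1) 0); auto.
  - generalize (Rmin_l x 0) (Rmax_l x 0). lra.
  - generalize (Rmin_r x 0) (Rmax_r x 0). lra. }
 assert (HD : Derive (fun t => RInt f 0 t) = f).
 { apply functional_extensionality. intros x. now apply is_derive_unique. }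
 rewrite <- HD at 1. apply is_RInt_gen_Derive; trivial; try apply Rbar_locally_filter.
 - apply filter_forall. intros ab x _. now exists (f x).
 - apply filter_forall. intros ab x _. now rewrite HD.
Qed.

Section potential.
Variables (d : nat) (P : list trig_mode).

Definition hf (z : R -> vec) (q : R) : R := kern q * fz d P (z (clip q)).

Lemma hf_cont z q : cont04 d z -> q < 4 -> continuous (hf z) q.
Proof.
 intros Hz Hq. apply (kern_mult_cont (fun q => fz d P (z q)) (Fbd d P)); trivial.
 - intros; apply fz_le.
 - intros. apply continuous_fz. fin.
Qed.

Definition along (om x : vec) (t : R) : R := (1 - cos (q0 t)) * fz d P (fun j => x j + t * om j).

Lemma along_cont om x t : continuous (along om x) t.
Proof.
 apply (continuous_mult (K := R_AbsRing)).
 - apply @continuous_minus; [apply continuous_const|].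
  apply (continuous_comp q0 cos); [|apply continuous_cos].
  eapply is_derive_continuous. apply q0_derive.
 - apply (continuous_fz d P (fun t j => x j + t * om j)). intros.
  apply @ex_derive_continuous. auto_derive; trivial.
Qed.

Lemma fz_ext z z' : (forall j, j <=' d -> z j = z' j) -> fz d P z = fz d P z'.
Proof. intros H. apply lsum_ext. intros m. now rewrite (phase_ext d m z z'). Qed.

Lemma along_RInt om x t : t <= 0 -> RInt (along om x) 0 t = RInt (hf (z0 1 om x)) PI (q0 t).
Proof.
 intros Ht. generalize PI_range; intros HPI. set (K := fun u => RInt (hf (z0 1 om x)) PI (q0 u)).
 change (RInt (hf (z0 1 om x)) PI (q0 t)) with (K t).
 assert (K0 : K 0 = 0) by (unfold K; rewrite q0_0, RInt_point; reflexivity).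
 replace (K t) with (minus (K t) (K 0)) by (rewrite K0; unfold minus, plus, opp; simpl; ring).
 apply is_RInt_unique, (is_RInt_derive K).
 - rewrite Rmin_right, Rmax_left by lra. intros u Hu. generalize (q0_pos u) (q0_le_PI u ok). intros.
  replace (along om x u) with (4 * exp u / (1 + exp u ^ 2) * hf (z0 1 om x) (q0 u)).
  + apply (is_derive_comp (fun q => RInt (hf (z0 1 om x)) PI q) q0); [|apply q0_derive].
   apply (is_derive_RInt_cont (hf (z0 1 om x)) 0 4 PI); try lra.
   intros; apply hf_cont; [apply z0_cont04|lra].
  + rewrite <- p0_q0. unfold hf, along, kern. unclip.
   rewrite (fz_ext (z0 1 om x (q0 u)) (fun j => x j + u * om j)).
   * field. generalize (p0_ge (q0 u) ok). lra.
   * intros j _. unfold z0. rewrite T0_q0 by lra. ring.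
 - intros; apply along_cont.
Qed.

Lemma q0_small e : 0 < e -> exists M, forall t, t < M -> q0 t < e.
Proof.
 intros He. exists (ln (e / 4)). intros t Ht. unfold q0.
 assert (exp t < e / 4) by (rewrite <- (exp_ln (e / 4)) by lra; now apply exp_increasing).
 assert (atan (exp t) <= exp t); [|lra].
 assert (Hp := exp_pos t).
 destruct (MVT_gen atan 0 (exp t) (fun u => / (1 + u ^ 2))) as (c & Hc & Hm).
 - intros u _. auto_derive; trivial. fin.
 - intros u _. apply derivable_continuous_pt, derivable_pt_atan.
 - rewrite atan_0, !Rminus_0_r in Hm. rewrite Hm. rewrite <- (Rmult_1_l (exp t)) at 2.
  mul_r. rewrite <- Rinv_1. apply Rinv_le_contravar; nra.
Qed.

Lemma along_lim_m om x :
 filterlim (fun t => RInt (along om x) 0 t) (Rbar_locally m_infty) (locally (- RInt (hf (z0 1 om x)) 0 PI)).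
Proof.
 generalize PI_range; intros HPI.
 assert (Hc : continuous (fun q => RInt (hf (z0 1 om x)) PI q) 0).
 { eapply is_derive_continuous. apply (is_derive_RInt_cont (hf (z0 1 om x)) (-1) 4 PI); try lra.
  intros; apply hf_cont; [apply z0_cont04|lra]. }
 assert (H0 : RInt (hf (z0 1 om x)) PI 0 = - RInt (hf (z0 1 om x)) 0 PI).
 { symmetry. apply (opp_RInt_swap (V := CNM)). apply ex_RInt_below4.
  intros; apply hf_cont; trivial; apply z0_cont04. }
 apply filterlim_locally. intros e.
 destruct (continuous_eps_inv _ _ Hc e (cond_pos e)) as (r & Hr & Hy).
 destruct (q0_small r Hr) as [M HM]. exists (Rmin M 0). intros t Ht.
 assert (t < M) by (eapply Rlt_le_trans; [exact Ht|apply Rmin_l]).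
 assert (t < 0) by (eapply Rlt_le_trans; [exact Ht|apply Rmin_r]).
 rewrite along_RInt by lra. rewrite <- H0. apply Hy. rewrite Rminus_0_r, Rabs_pos_eq.
 - fin.
 - left; apply q0_pos.
Qed.

Lemma along_reflect om x t : RInt (along om x) 0 t = - RInt (along (fun j => - om j) x) 0 (- t).
Proof.
 rewrite <- (Ropp_involutive (RInt (along om x) 0 t)). f_equal. symmetry. apply is_RInt_unique.
 assert (Ha : is_RInt (along om x) 0 t (RInt (along om x) 0 t)).
 { apply (RInt_correct (V := CNM)), ex_RInt_cont. intros; apply along_cont. }
 apply (is_RInt_ext (fun y => opp (opp (along (fun j => - om j) x y)))).
 - intros. unfold opp; simpl. fin.
 - apply (is_RInt_opp (V := NM)).
  apply (is_RInt_ext (fun y => opp (along om x (- y)))).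
  + intros y _. unfold along. rewrite q0_opp, cos_minus, cos_2PI, sin_2PI.
   rewrite (fz_ext (fun j => x j + - y * om j) (fun j => x j + y * - om j)) by (intros; ring).
   fin.
  + apply (is_RInt_comp_opp (V := NM)). now rewrite Ropp_0, Ropp_involutive.
Qed.

(** Reduced to the limit at minus infinity: [q0] is symmetric about the bump, and reversing time
    reverses [om]. *)
Lemma along_lim_p om x :
 filterlim (fun t => RInt (along om x) 0 t) (Rbar_locally p_infty) (locally (RInt (hf (z0 (-1) om x)) 0 PI)).
Proof.
 assert (Hz : z0 (-1) om x = z0 1 (fun j => - om j) x).
 { apply functional_extensionality; intros q. apply functional_extensionality; intros j. unfold z0. ring. }
 rewrite Hz, <- (Ropp_involutive (RInt _ 0 PI)).
 apply (filterlim_ext (fun t => - RInt (along (fun j => - om j) x) 0 (- t))).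
 { intros t. symmetry. apply along_reflect. }
 apply (filterlim_comp _ _ _ (fun t => RInt (along (fun j => - om j) x) 0 (- t)) Ropp _
  (locally (- RInt (hf (z0 1 (fun j => - om j) x)) 0 PI))).
 - apply (filterlim_comp _ _ _ Ropp (fun t => RInt (along (fun j => - om j) x) 0 t) _ (Rbar_locally m_infty)).
  + apply (filterlim_Rbar_opp p_infty).
  + apply along_lim_m.
 - apply (filterlim_opp (K := R_AbsRing) (V := NM)).
Qed.

Lemma hf_sum om x : RInt (hf (z0 (-1) om x)) 0 PI + RInt (hf (z0 1 om x)) 0 PI = - Gpot d P om x.
Proof.
 unfold Gpot. rewrite Ropp_involutive.
 assert (Hex : forall s, ex_RInt (hf (z0 s om x)) 0 PI).
 { intros s. apply ex_RInt_below4. intros; apply hf_cont; trivial; apply z0_cont04. }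
 change Rplus with (@plus R_AbelianMonoid) at 1.
 rewrite <- (RInt_plus (V := CNM)) by apply Hex.
 apply is_RInt_unique. eapply is_RInt_ext; [|apply (is_RInt_Jm_sum d P (fun m => 2 * mval m (phase d m x)) om)].
 intros q _. unfold hf. change plus with Rplus. rewrite Rplus_comm, <- Rmult_plus_distr_l. unfold fz.
 rewrite <- lsum_plus, <- lsum_scal. apply lsum_ext. intros m. rewrite !phase_z0, mval_pm. ring.
Qed.

(** Used for points in space-time and, as [stv 1 om], for frequencies extended by that of time. *)
Definition stv (t : R) (phi : vec) : vec := fun j => match j with O => t | S i => phi i end.

Lemma trig_eval_fz phi t : trig_eval d P phi t = fz d P (stv t phi).
Proof.
 unfold trig_eval, fz. change (fold_right Rplus 0 (map ?f P)) with (lsum P f).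
 apply lsum_ext. intros m. unfold mval, phase. rewrite vsum_first. unfold freq, stv.
 rewrite (Rplus_comm (IZR (tm_l m) * t)). fin.
Qed.

Variable ft : vec -> R -> R.
Hypothesis hft : forall phi t, ft phi t = trig_eval d P phi t.

Lemma Gfun_eq om x : Gfun ft om x = Gpot d P (stv 1 om) x.
Proof.
 unfold Gfun, Gamma. rewrite <- (Ropp_involutive (Gpot d P (stv 1 om) x)). f_equal.
 rewrite <- hf_sum. apply is_RInt_gen_unique.
 set (a := along (stv 1 om) x).
 replace (_ + _) with (RInt (hf (z0 (-1) (stv 1 om) x)) 0 PI - - RInt (hf (z0 1 (stv 1 om) x)) 0 PI) by ring.
 replace (fun t : R => _) with a.
 - apply is_RInt_gen_line; [intros; apply along_cont|apply along_lim_m|apply along_lim_p].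
 - apply functional_extensionality. intros t. unfold a, along, fpert. rewrite cos_0, !hft, !trig_eval_fz.
  rewrite (fz_ext (fun j => x j + t * stv 1 om j) (stv (t + x O) (fun i => om i * t + x (S i)))).
  + ring.
  + intros j _. destruct j; simpl; ring.
Qed.
End potential.

(** * Zeros of strongly monotone maps *)

Section projection.
Variables (d : nat) (r : R).
Hypothesis r_pos : 0 < r.

Definition sq (v : vec) : R := vsum d (fun i => v i ^ 2).
Definition bproj (v : vec) : vec := if Rle_dec (sq v) (r ^ 2) then v else fun i => r / sqrt (sq v) * v i.

Lemma sq_scal c v : sq (fun i => c * v i) = c ^ 2 * sq v.
Proof. unfold sq. rewrite <- vsum_scal. apply vsum_ext. fin. Qed.

Lemma bproj_spec v : sq (bproj v) <= r ^ 2 /\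
 exists l, 0 <= l /\ (forall i, v i - bproj v i = l * bproj v i) /\ (l = 0 \/ sq (bproj v) = r ^ 2).
Proof.
 unfold bproj. destruct (Rle_dec (sq v) (r ^ 2)) as [H|H].
 - split; trivial. exists 0. fin.
 - apply Rnot_le_lt in H. assert (Hv : 0 < sq v) by fin.
  assert (Hs := sqrt_lt_R0 _ Hv). assert (Hs2 : sqrt (sq v) ^ 2 = sq v) by (apply pow2_sqrt; lra).
  assert (Hrs : r < sqrt (sq v)) by fin.
  assert (Heq : sq (fun i => r / sqrt (sq v) * v i) = r ^ 2).
  { rewrite sq_scal. rewrite <- Hs2 at 2. fin. }
  split; [fin|]. exists (sqrt (sq v) / r - 1). repeat split.
  + assert (1 <= sqrt (sq v) / r); [|lra]. apply Rmult_le_reg_r with r; trivial.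
   unfold Rdiv. inv_l; rewrite Rmult_1_r. lra.
  + fin.
  + fin.
Qed.

(** [v - bproj v] is a nonnegative multiple of [bproj v], zero unless that point lies on the sphere;
    there Cauchy-Schwarz concludes. *)
Lemma bproj_angle v y : sq y <= r ^ 2 -> vsum d (fun i => (v i - bproj v i) * (y i - bproj v i)) <= 0.
Proof.
 intros Hy. destruct (bproj_spec v) as (Hp & l & Hl & He & Hc). set (p := bproj v) in *.
 rewrite (vsum_ext _ _ (fun i => l * (p i * y i - p i ^ 2))) by (intros; rewrite He; ring).
 rewrite vsum_scal, vsum_minus. fold (sq p).
 destruct Hc as [->|Hc]; [lra|].
 assert (vsum d (fun i => p i * y i) <= r ^ 2); [|nra].
 generalize (vsum_Cauchy_Schwarz d p y). fold (sq p) (sq y). fin.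
Qed.

Lemma bproj_nonexp v v' : vsum d (fun i => (bproj v i - bproj v' i) ^ 2) <= vsum d (fun i => (v i - v' i) ^ 2).
Proof.
 generalize (bproj_angle v (bproj v') (proj1 (bproj_spec v'))) (bproj_angle v' (bproj v) (proj1 (bproj_spec v))).
 set (p := bproj v). set (p' := bproj v'). intros H1 H2.
 assert (H3 : 0 <= vsum d (fun i => ((v i - v' i) - (p i - p' i)) ^ 2)) by (apply vsum_nonneg; intros; apply pow2_ge_0).
 assert (He : vsum d (fun i => ((v i - v' i) - (p i - p' i)) ^ 2) =
  vsum d (fun i => (v i - v' i) ^ 2) - vsum d (fun i => (p i - p' i) ^ 2)
  + 2 * vsum d (fun i => (v i - p i) * (p' i - p i)) + 2 * vsum d (fun i => (v' i - p' i) * (p i - p' i))).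
 { rewrite <- !vsum_scal, <- vsum_minus, <- !vsum_plus. apply vsum_ext. fin. }
 lra.
Qed.
End projection.

Section variational_inequality.
Variables (n d : nat) (r kap Lam : R) (G : (nat -> vec) -> nat -> vec).
Hypothesis r_pos : 0 < r.
Hypothesis kap_pos : 0 < kap.

(* Each site carries a scalar (component 0) and a vector (components 1 to d), both constrained to balls of radius r. *)
Definition vtail (v : vec) : vec := fun i => v (S i).
Definition dot (u v : nat -> vec) : R := vsum n (fun i => vsum (S d) (fun j => u i j * v i j)).
Definition dist2 (u v : nat -> vec) : R := vsum n (fun i => vsum (S d) (fun j => (u i j - v i j) ^ 2)).
Definition in_balls (u : nat -> vec) : Prop :=
 forall i, i <' n -> u i O ^ 2 <= r ^ 2 /\ sq d (vtail (u i)) <= r ^ 2.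

Hypothesis G_mono : forall u v, in_balls u -> in_balls v ->
 kap * dist2 u v <= dot (fun i j => G u i j - G v i j) (fun i j => u i j - v i j).
Hypothesis G_Lip : forall u v, in_balls u -> in_balls v -> dist2 (G u) (G v) <= Lam * dist2 u v.

Lemma dist2_pos u v : 0 <= dist2 u v.
Proof. apply vsum_nonneg; intros; apply vsum_nonneg; intros; apply pow2_ge_0. Qed.

Lemma dist2_comp u v i j : i <' n -> j <=' d -> (u i j - v i j) ^ 2 <= dist2 u v.
Proof.
 intros Hi Hj.
 le_thru (vsum (S d) (fun j => (u i j - v i j) ^ 2)).
 - apply (vsum_term_le (S d) (fun j => (u i j - v i j) ^ 2)); [intros; apply pow2_ge_0|lia].
 - apply (vsum_term_le n (fun i => vsum (S d) (fun j => (u i j - v i j) ^ 2))); trivial.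
  intros; apply vsum_nonneg; intros; apply pow2_ge_0.
Qed.

Definition site_proj (v : vec) : vec := fun j =>
 match j with O => bproj 1 r (fun _ => v O) O | S i => bproj d r (vtail v) i end.

Lemma sq_1 v : sq 1 v = v O ^ 2.
Proof. unfold sq. rewrite vsum_S, vsum_0. ring. Qed.

(** With step [t = kap / Lam'] strong monotonicity contracts squared distances by
    [1 - kap ^ 2 / Lam']; the summand [kap ^ 2] keeps this factor nonnegative. *)
Let Lam' := Rabs Lam + kap ^ 2 + 1.
Let t := kap / Lam'.
Let Phi (u : nat -> vec) : nat -> vec := fun i => site_proj (fun j => u i j - t * G u i j).

Lemma Lam'_pos : 0 < Lam'.
Proof. unfold Lam'. generalize (Rabs_pos Lam) (pow2_ge_0 kap). lra. Qed.

Lemma Phi_in u : in_balls (Phi u).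
Proof.
 intros i _. split.
 - unfold Phi, site_proj. rewrite <- sq_1. apply (bproj_spec 1 r r_pos).
 - apply (bproj_spec d r r_pos).
Qed.

Let k2 := 1 - kap ^ 2 / Lam'.

Lemma k2_range : 0 <= k2 < 1.
Proof.
 unfold k2. assert (H := Lam'_pos). assert (0 < kap ^ 2 / Lam') by fin.
 assert (kap ^ 2 / Lam' <= 1); [|lra]. apply Rmult_le_reg_r with Lam'; trivial.
 unfold Rdiv. rewrite Rmult_assoc, Rinv_l, Rmult_1_r, Rmult_1_l by lra.
 unfold Lam'. generalize (Rabs_pos Lam). lra.
Qed.

Lemma Phi_contract u v : in_balls u -> in_balls v -> dist2 (Phi u) (Phi v) <= k2 * dist2 u v.
Proof.
 intros Hu Hv. assert (HL := Lam'_pos).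
 le_thru (dist2 (fun i j => u i j - t * G u i j) (fun i j => v i j - t * G v i j)).
 - apply vsum_le. intros i Hi. rewrite !(vsum_first d). apply Rplus_le_compat.
  + unfold Phi, site_proj.
   generalize (bproj_nonexp 1 r r_pos (fun _ => u i O - t * G u i O) (fun _ => v i O - t * G v i O)).
   rewrite !vsum_S, !vsum_0. lra.
  + unfold Phi, site_proj. apply (bproj_nonexp d r r_pos).
 - replace (dist2 (fun i j => u i j - t * G u i j) (fun i j => v i j - t * G v i j)) with
   (dist2 u v - 2 * t * dot (fun i j => G u i j - G v i j) (fun i j => u i j - v i j) + t ^ 2 * dist2 (G u) (G v)).
  + note (G_mono u v Hu Hv) (G_Lip u v Hu Hv) (dist2_pos u v) as H1 H2 H3.
   assert (Ht : 0 < t) by (apply Rdiv_lt_0_compat; lra).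
   assert (Lam * dist2 u v <= Lam' * dist2 u v).
   { apply Rmult_le_compat_r; trivial. unfold Lam'. generalize (Rle_abs Lam) (pow2_ge_0 kap). lra. }
   assert (t * (kap * dist2 u v) <= t * dot (fun i j => G u i j - G v i j) (fun i j => u i j - v i j))
    by fin.
   assert (t ^ 2 * dist2 (G u) (G v) <= t ^ 2 * (Lam' * dist2 u v)) by fin.
   replace (k2 * dist2 u v) with (dist2 u v - 2 * (t * (kap * dist2 u v)) + t ^ 2 * (Lam' * dist2 u v)); [lra|].
   unfold k2, t. fin.
  + unfold dist2, dot. rewrite <- !vsum_scal, <- vsum_minus, <- vsum_plus. apply vsum_ext. intros i _.
   rewrite <- !vsum_scal, <- vsum_minus, <- vsum_plus. apply vsum_ext. fin.
Qed.

Lemma Phi_iter_in m u : in_balls u -> in_balls (Nat.iter m Phi u).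
Proof. intros H. destruct m; [fin|apply Phi_in]. Qed.

Lemma Phi_iter_contract m u v : in_balls u -> in_balls v ->
 dist2 (Nat.iter m Phi u) (Nat.iter m Phi v) <= k2 ^ m * dist2 u v.
Proof.
 intros Hu Hv. induction m as [|m IH]; [simpl; lra|].
 le_by (apply (Phi_contract (Nat.iter m Phi u) (Nat.iter m Phi v)); now apply Phi_iter_in).
 simpl pow. rewrite Rmult_assoc. apply Rmult_le_compat_l; trivial. apply k2_range.
Qed.

Lemma sq_le_of_bound u v M : (forall i j, i <' n -> j <=' d -> Rabs (u i j - v i j) <= M) ->
 dist2 u v <= INR n * (INR (S d) * M ^ 2).
Proof.
 intros H. unfold dist2. rewrite <- vsum_const. apply vsum_le. intros i Hi.
 rewrite <- vsum_const. apply vsum_le. intros j Hj. rewrite <- pow2_abs.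
 apply pow_incr. split; [fin|apply H; lia].
Qed.

(** A fixed point of the projected step. The multipliers [l0] and [l1] describe the normal cones of
    the two balls at a site and vanish off the spheres. *)
Lemma variational_inequality : exists u, in_balls u /\ forall i, i <' n ->
 exists l0 l1, 0 <= l0 /\ 0 <= l1 /\
  G u i O = - l0 * u i O /\ (forall j, (1 <= j <= d)%nat -> G u i j = - l1 * u i j) /\
  (l0 = 0 \/ u i O ^ 2 = r ^ 2) /\ (l1 = 0 \/ sq d (vtail (u i)) = r ^ 2).
Proof.
 set (Nn := INR n * INR (S d)).
 assert (HNn : 0 <= Nn) by (apply Rmult_le_pos; apply pos_INR).
 (* The contraction holds for [dist2], whereas [banach_fixed_point] uses the maximum norm; the power
    [m] beats the dimension factor [Nn]. The 4 gives the constant 1/2 after a square root. *)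
 destruct (pow_lt_1_zero k2 (ltac:(rewrite Rabs_pos_eq; apply k2_range)) (/ (4 * (Nn + 1)))
  (ltac:(apply Rinv_0_lt_compat; lra))) as [m Hm].
 specialize (Hm m (Nat.le_refl m)).
 rewrite Rabs_pos_eq in Hm by (apply pow_le, k2_range).
 set (un := fun (a : nat * nat -> R) (i : nat) (j : nat) => a (i, j)).
 destruct (banach_fixed_point (nat * nat) (fun a => (fst a < n)%nat /\ snd a <=' d) (fun _ => 1)
  (fun a => in_balls (un a)) (fun a p => Nat.iter m Phi (un a) (fst p) (snd p)) (1/2) (fun _ => 0) (r + r))
  as (a & Ha & Hfix).
 - fin.
 - lra.
 - lra.
 - intros i _. unfold un, sq, vtail. split; [fin|].
  rewrite (vsum_ext _ _ (fun _ => 0)), vsum_zero by (intros; ring). fin.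
 - intros a Ha. apply (Phi_iter_in m (un a) Ha).
 - intros [i j] [Hi Hj]. simpl in *. rewrite Rminus_0_r, Rmult_1_r.
  assert (H0 : in_balls (un (fun _ => 0))).
  { intros i' _. unfold un, sq, vtail. split; [fin|].
   rewrite (vsum_ext _ _ (fun _ => 0)), vsum_zero by (intros; ring). fin. }
  destruct (Phi_iter_in m _ H0 i Hi) as [H1 H2].
  set (v := Nat.iter m Phi (un (fun _ => 0)) i) in *.
  assert (v j ^ 2 <= r ^ 2).
  { destruct j as [|j]; trivial. eapply Rle_trans; [|exact H2].
   apply (vsum_term_le d (fun i => vtail v i ^ 2) j); [intros; apply pow2_ge_0|lia]. }
  le_thru r; [|lra]. apply pow_incr_inv with 1%nat || apply Rsqr_incr_0_var; [|lra].
  rewrite !Rsqr_pow2, pow2_abs; trivial.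
 - intros a b M Ha Hb HM H [i j] [Hi Hj]. simpl in *. rewrite Rmult_1_r.
  assert (Hd : dist2 (un a) (un b) <= Nn * M ^ 2).
  { unfold Nn. rewrite Rmult_assoc. apply sq_le_of_bound. intros i' j' Hi' Hj'.
   unfold un. specialize (H (i', j')). simpl in H. rewrite Rmult_1_r in H. apply H; now split. }
  note (Phi_iter_contract m (un a) (un b) Ha Hb) (dist2_comp (Nat.iter m Phi (un a)) (Nat.iter m Phi (un b)) i j Hi Hj) as H1 H2.
  apply Rsqr_incr_0_var; [|lra]. rewrite !Rsqr_pow2, pow2_abs.
  le_by exact H2. le_by exact H1.
  assert (Hk : 0 <= k2 ^ m) by (apply pow_le, k2_range).
  le_thru (k2 ^ m * (Nn * M ^ 2)); [fin|].
  assert (Hk' : k2 ^ m * (Nn + 1) <= 1 / 4).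
  { apply Rmult_lt_compat_r with (r := Nn + 1) in Hm; [|lra].
   replace (/ (4 * (Nn + 1)) * (Nn + 1)) with (1 / 4) in Hm by fld. lra. }
  fin.
 - intros an a en Han Hen Hd i Hi.
  assert (Hl : forall j, j <=' d -> is_lim_seq (fun m => an m (i, j)) (a (i, j))).
  { intros j Hj. apply is_lim_seq_spec. intros e. apply is_lim_seq_spec in Hen.
   destruct (Hen e) as [N HN]. exists N. intros p Hp. specialize (HN p Hp). rewrite Rminus_0_r in HN.
   eapply Rle_lt_trans; [apply (Hd p (i, j)); now split|]. fin. }
  split.
  + apply (is_lim_seq_le (fun m => an m (i, O) ^ 2) (fun _ => r ^ 2) (a (i, O) ^ 2) (r ^ 2)).
   * intros p. apply (Han p i Hi).
   * simpl. rewrite Rmult_1_r. apply (is_lim_seq_ext (fun m => an m (i, O) * an m (i, O))); [intros; ring|].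
    apply is_lim_seq_mult'; apply Hl; lia.
   * apply is_lim_seq_const.
  + apply (is_lim_seq_le (fun m => sq d (vtail (un (an m) i))) (fun _ => r ^ 2) (sq d (vtail (un a i))) (r ^ 2)).
   * intros p. apply (Han p i Hi).
   * unfold sq, vtail, un.
    assert (Hs : forall e, e <=' d -> is_lim_seq (fun m => vsum e (fun i0 => an m (i, S i0) ^ 2)) (vsum e (fun i0 => a (i, S i0) ^ 2))).
    { induction e as [|e IH]; intros He; [apply is_lim_seq_const|].
     rewrite vsum_S. apply (is_lim_seq_ext (fun m => vsum e (fun i0 => an m (i, S i0) ^ 2) + an m (i, S e) * an m (i, S e))).
     - intros p. rewrite vsum_S. ring.
     - apply is_lim_seq_plus'; [apply IH; lia|]. replace (a (i, S e) ^ 2) with (a (i, S e) * a (i, S e)) by ring.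
      apply is_lim_seq_mult'; apply Hl; lia. }
    now apply Hs.
   * apply is_lim_seq_const.
 - set (u := un a) in *.
  assert (Hd0 : dist2 (Nat.iter m Phi u) u = 0).
  { unfold dist2. rewrite <- (vsum_zero n). apply vsum_ext. intros i Hi.
   rewrite <- (vsum_zero (S d)). apply vsum_ext. intros j Hj.
   specialize (Hfix (i, j)). simpl in Hfix. rewrite Hfix by fin. fin. }
  assert (HPhi : forall i j, i <' n -> j <=' d -> Phi u i j = u i j).
  { assert (Heq : forall i j, i <' n -> j <=' d -> Nat.iter m Phi u i j = u i j).
   { intros i j Hi Hj. generalize (dist2_comp _ _ i j Hi Hj : _ <= dist2 (Nat.iter m Phi u) u). fin. }
   (* The iterate fixes both [u] and [Phi u], and it contracts: hence [Phi u = u], and the fixed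
      point of the iterate is one of [Phi]. *)
   assert (Hsub : dist2 (Phi u) u <= k2 ^ m * dist2 (Phi u) u).
   { generalize (Phi_iter_contract m (Phi u) u (Phi_in u) Ha).
    replace (Nat.iter m Phi (Phi u)) with (Phi (Nat.iter m Phi u)) by (now rewrite <- Nat.iter_succ, Nat.iter_succ_r).
    intros H1.
    assert (Hc : dist2 (Phi (Nat.iter m Phi u)) (Phi u) <= 0).
    { rewrite <- (Rmult_0_r k2), <- Hd0. apply Phi_contract; trivial. now apply Phi_iter_in. }
    assert (Hcomp : forall i j, i <' n -> j <=' d -> Phi (Nat.iter m Phi u) i j = Phi u i j).
    { intros i j Hi Hj. generalize (dist2_comp (Phi (Nat.iter m Phi u)) (Phi u) i j Hi Hj).
     fin. }
    replace (dist2 (Phi u) u) with (dist2 (Phi (Nat.iter m Phi u)) (Nat.iter m Phi u)) at 1; trivial.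
    apply vsum_ext. intros i Hi. apply vsum_ext. intros j Hj. rewrite Hcomp, Heq by fin. fin. }
   assert (Hkm : k2 ^ m < 1).
   { eapply Rlt_trans; [exact Hm|]. rewrite <- Rinv_1. apply Rinv_lt_contravar; lra. }
   assert (Hp0 := dist2_pos (Phi u) u). assert (Hz : dist2 (Phi u) u = 0) by nra.
   intros i j Hi Hj. generalize (dist2_comp (Phi u) u i j Hi Hj). fin. }
  exists u. split; trivial. intros i Hi.
  assert (Ht : 0 < t) by (apply Rdiv_lt_0_compat; [fin|apply Lam'_pos]).
  destruct (bproj_spec 1 r r_pos (fun _ => u i O - t * G u i O)) as (_ & l0 & Hl0 & E0 & C0).
  destruct (bproj_spec d r r_pos (vtail (fun j => u i j - t * G u i j))) as (_ & l1 & Hl1 & E1 & C1).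
  assert (P0 : bproj 1 r (fun _ => u i O - t * G u i O) O = u i O) by (apply (HPhi i O); [fin|lia]).
  assert (P1 : forall j, j <' d -> bproj d r (vtail (fun j => u i j - t * G u i j)) j = u i (S j)).
  { intros j Hj. apply (HPhi i (S j)); [fin|lia]. }
  exists (l0 / t), (l1 / t). repeat split.
  + fin.
  + fin.
  + specialize (E0 O). rewrite P0 in E0. apply Rmult_eq_reg_l with t; [|lra].
   replace (t * (- (l0 / t) * u i O)) with (- (l0 * u i O)) by fld. lra.
  + intros j Hj. destruct j as [|j]; [lia|]. specialize (E1 j). rewrite P1 in E1 by lia.
   unfold vtail at 1 in E1. apply Rmult_eq_reg_l with t; [|lra].
   replace (t * (- (l1 / t) * u i (S j))) with (- (l1 * u i (S j))) by fld. lra.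
  + destruct C0 as [->|C0]; [fin|right]. rewrite sq_1, P0 in C0. exact C0.
  + destruct C1 as [->|C1]; [fin|right]. rewrite <- C1.
   apply vsum_ext. intros j Hj. rewrite P1 by trivial. fin.
Qed.
End variational_inequality.

(** * The discrete equilibrium problem *)

Lemma Rabs_prod_diff a b a' b' A B dA dB :
 Rabs a <= A -> Rabs b' <= B -> Rabs (a - a') <= dA -> Rabs (b - b') <= dB ->
 Rabs (a * b - a' * b') <= A * dB + dA * B.
Proof.
 intros H1 H2 H3 H4. replace (a * b - a' * b') with (a * (b - b') + (a - a') * b') by ring.
 triang. fin.
Qed.

Lemma vsum_abs_le n g M : (forall i, i <' n -> Rabs (g i) <= M) -> Rabs (vsum n g) <= INR n * M.
Proof.
 intros H. le_by apply vsum_abs. rewrite <- vsum_const. now apply vsum_le.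
Qed.

Lemma vsum_telescope n (a b : nat -> R) :
 vsum (S n) (fun i => a i * (b i - b (S i))) =
 a O * b O - a n * b (S n) + vsum n (fun i => (a (S i) - a i) * b (S i)).
Proof.
 induction n as [|n IH]; [rewrite vsum_S, !vsum_0; ring|].
 rewrite vsum_S, IH, (vsum_S n (fun i => (a (S i) - a i) * b (S i))). ring.
Qed.

Section discrete.
Variables (n d : nat) (mu eps W Bb CG r kap : R).
Variables (Om c b : nat -> vec).
Variables (Gae Re : (nat -> vec) -> nat -> R) (Gaphi Rphi : (nat -> vec) -> nat -> nat -> R).

Hypothesis n_pos : 1 <=' n.
Hypothesis mu_pos : 0 < mu <= 1.
Hypothesis eps_pos : 0 < eps <= 1.
Hypothesis W_ge : 1 <= W.
Hypothesis Bb_pos : 0 <= Bb.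
Hypothesis CG_pos : 0 <= CG.
Hypothesis r_range : 0 < r <= 1.
Hypothesis kap_range : 0 < kap.
Let K := INR d.
Let dB := 1 + K * Bb.
Hypothesis eps_dB : eps * dB <= 1 / 4.

Hypothesis Om_0 : forall i, Om i O = 1.
Hypothesis Om_le : forall i j, j <=' d -> Rabs (Om i j) <= W.
Hypothesis Om_step : forall i j, j <=' d -> Rabs (Om (S i) j - Om i j) <= eps * mu.
Hypothesis b_le : forall i j, Rabs (b i j) <= Bb.
Hypothesis c_step : forall i j, S i <' n -> j <=' d ->
 c (S i) j - c i j = (c (S i) O - c i O) * Om (S i) j.
Hypothesis c_gap : forall i, S i <' n -> 1 / eps + 2 * dB <= c (S i) O - c i O.

Definition bdot (i : nat) (v : vec) : R := vsum d (fun j => b i (S j) * v (S j)).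
Definition sig (i : nat) (v : vec) : R := v O - bdot i v.
(** Component 0 moves the bump along the flow direction [Om (S i)], component [j] along
    [e_j - b i j * Om (S i)]; [b] will make these directions conjugate for the Hessian of the
    potential. *)
Definition Lmap (i : nat) (v : vec) : vec := fun j =>
 sig i v * Om (S i) j + match j with O => 0 | S _ => v j end.
Definition Xs (u : nat -> vec) (i : nat) : vec := fun j => c i j + Lmap i (u i) j.
Definition Dt (u : nat -> vec) (i : nat) : R := Xs u (S i) O - Xs u i O.
(** Mean velocity of arc [i], which is nearly its action. The two extreme arcs are not bounded by
    two bumps and have prescribed actions. *)
Definition Ib (u : nat -> vec) (i : nat) : vec := fun j =>
 match i with
 | O => Om 0 j
 | S k => if Nat.eqb i n then Om n j else (Xs u i j - Xs u k j) / Dt u k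
 end.
Definition Gphi u i j : R := Ib u i j - Ib u (S i) j + mu * Gaphi u i j + Rphi u i j.
Definition Mm u i j : R := Om (S i) j - (Ib u i j + Ib u (S i) j) / 2.
(** Energy matching plus multiples of the action equations, which vanish at a solution. With the
    weights [Mm] the kinetic part becomes the flow direction applied to the velocity jump minus the
    jump of kinetic energy, that is, the derivative of the kinetic action along [(1, Om)]. *)
Definition Ge u i : R := mu * Gae u i + Re u i + vsum d (fun j => Mm u i (S j) * Gphi u i (S j)).
(** The equations in the coordinates of [Lmap]: the pairing with the directions [Om (S i)] and
    [e_j - b i j * Om (S i)]. *)
Definition Ghat u i : vec := fun j =>
 match j with O => Ge u i | S _ => Gphi u i j - b i j * Ge u i end.

(** The default 0 beyond the last site lets [N3] name the right neighbour of every site. *)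
Definition N1 (u v : nat -> vec) (i : nat) : R :=
 if Nat.ltb i n then vsum (S d) (fun j => Rabs (u i j - v i j)) else 0.
Definition N3 u v i : R := match i with O => 0 | S k => N1 u v k end + N1 u v i + N1 u v (S i).

Let inb := in_balls n d r.

Hypothesis S1 : forall u v i, inb u -> inb v -> i <' n ->
 kap * vsum (S d) (fun j => (u i j - v i j) ^ 2) <=
 (sig i (u i) - sig i (v i)) * (Gae u i - Gae v i) +
 vsum d (fun j => (u i (S j) - v i (S j)) * (Gaphi u i (S j) - Gaphi v i (S j))).
Hypothesis S2 : forall u i, inb u -> i <' n -> sq d (vtail (u i)) = r ^ 2 ->
 kap * r ^ 2 <= vsum d (fun j => u i (S j) * Gaphi u i (S j)) - bdot i (u i) * Gae u i.
Hypothesis S3 : forall u i, inb u -> i <' n -> u i O ^ 2 = r ^ 2 ->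
 kap * r ^ 2 <= u i O * Gae u i.
Hypothesis Gaphi_le : forall u i j, inb u -> i <' n -> (1 <= j <= d)%nat -> Rabs (Gaphi u i j) <= CG.
Hypothesis Gaphi_Lip : forall u v i j, inb u -> inb v -> i <' n -> (1 <= j <= d)%nat ->
 Rabs (Gaphi u i j - Gaphi v i j) <= CG * N1 u v i.
Hypothesis Gae_Lip : forall u v i, inb u -> inb v -> i <' n ->
 Rabs (Gae u i - Gae v i) <= CG * N1 u v i.
Hypothesis Rphi_le : forall u i j, inb u -> i <' n -> (1 <= j <= d)%nat -> Rabs (Rphi u i j) <= eps * mu.
Hypothesis Re_le : forall u i, inb u -> i <' n -> Rabs (Re u i) <= eps * mu.
Hypothesis Rphi_Lip : forall u v i j, inb u -> inb v -> i <' n -> (1 <= j <= d)%nat ->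
 Rabs (Rphi u i j - Rphi v i j) <= eps * mu * N3 u v i.
Hypothesis Re_Lip : forall u v i, inb u -> inb v -> i <' n ->
 Rabs (Re u i - Re v i) <= eps * mu * N3 u v i.

Lemma K_pos : 0 <= K. Proof. apply pos_INR. Qed.

Lemma KB_pos : 0 <= K * Bb. Proof. apply Rmult_le_pos; [apply K_pos|fin]. Qed.

Lemma N1_pos u v i : 0 <= N1 u v i.
Proof. unfold N1. destruct (Nat.ltb i n); [apply vsum_nonneg; intros; apply Rabs_pos|lra]. Qed.

Lemma N3_ge u v i : N1 u v i <= N3 u v i /\ 0 <= N3 u v i /\ N1 u v (S i) <= N3 u v i /\
 match i with O => True | S k => N1 u v k <= N3 u v i end.
Proof.
 unfold N3. generalize (N1_pos u v i) (N1_pos u v (S i)). destruct i as [|k]; [lra|].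
 generalize (N1_pos u v k). lra.
Qed.

Lemma N1_comp u v i j : i <' n -> j <=' d -> Rabs (u i j - v i j) <= N1 u v i.
Proof.
 intros Hi Hj. unfold N1. destruct (Nat.ltb_spec i n); [|lia].
 apply (vsum_term_le (S d) (fun j => Rabs (u i j - v i j))); [intros; apply Rabs_pos|lia].
Qed.

Lemma inb_comp u i j : inb u -> i <' n -> j <=' d -> Rabs (u i j) <= r.
Proof.
 intros Hu Hi Hj. destruct (Hu i Hi) as [H1 H2].
 apply Rsqr_incr_0_var; [|lra]. rewrite !Rsqr_pow2, pow2_abs. destruct j as [|j]; trivial.
 eapply Rle_trans; [|exact H2]. apply (vsum_term_le d (fun i0 => vtail (u i) i0 ^ 2) j); [intros; apply pow2_ge_0|lia].
Qed.

Lemma bdot_le u i : inb u -> i <' n -> Rabs (bdot i (u i)) <= K * Bb * r.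
Proof.
 intros Hu Hi. unfold bdot. rewrite Rmult_assoc. apply vsum_abs_le. intros j Hj. rewrite Rabs_mult.
 mul_abs; trivial. apply inb_comp; trivial; lia.
Qed.

Lemma sig_le u i : inb u -> i <' n -> Rabs (sig i (u i)) <= dB.
Proof.
 intros Hu Hi. unfold sig. note (bdot_le u i Hu Hi) (inb_comp u i O Hu Hi (Nat.le_0_l d)) KB_pos as H1 H2 H3.
 apply Rabs_le_between in H1, H2. apply Rabs_le. unfold dB. nra.
Qed.

Lemma sig_Lip u v i : i <' n -> Rabs (sig i (u i) - sig i (v i)) <= dB * N1 u v i.
Proof.
 intros Hi. unfold sig, bdot, dB.
 replace (_ - _) with ((u i O - v i O) - (vsum d (fun j => b i (S j) * u i (S j)) - vsum d (fun j => b i (S j) * v i (S j)))) by ring.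
 rewrite <- vsum_minus. triang. rewrite Rabs_Ropp.
 replace ((1 + K * Bb) * N1 u v i) with (N1 u v i + K * (Bb * N1 u v i)) by ring.
 apply Rplus_le_compat; [apply N1_comp; trivial; lia|]. apply vsum_abs_le. intros j Hj.
 rewrite <- Rmult_minus_distr_l, Rabs_mult. mul_abs; trivial.
 apply N1_comp; trivial; lia.
Qed.

Lemma Xs_time u i : Xs u i O = c i O + sig i (u i).
Proof. unfold Xs, Lmap. rewrite Om_0. ring. Qed.

Lemma Dt_ge u i : inb u -> S i <' n -> 1 / eps <= Dt u i.
Proof.
 intros Hu Hi. unfold Dt. rewrite !Xs_time. generalize (c_gap i Hi) (sig_le u (S i) Hu Hi) (sig_le u i Hu ok).
 fin.
Qed.

Lemma Dt_inv u i : inb u -> S i <' n -> 0 < / Dt u i <= eps /\ 0 < Dt u i.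
Proof.
 intros Hu Hi. assert (H := Dt_ge u i Hu Hi).
 assert (0 < 1 / eps) by fin.
 repeat split; [fin| |lra].
 replace eps with (/ (1 / eps)) by fld. fin.
Qed.

(* [cg u i] is the inverse duration of the gap ending at site [i], and 0 for the two infinite gaps. *)
Definition cg (u : nat -> vec) (i : nat) : R :=
 match i with O => 0 | S k => if Nat.eqb i n then 0 else / Dt u k end.
Definition dxi (u : nat -> vec) (i j : nat) : R :=
 match i with O => 0 | S k => if Nat.eqb i n then 0 else u i j - u k j end.

Lemma cg_range u i : inb u -> i <=' n -> 0 <= cg u i <= eps.
Proof.
 intros Hu Hi. unfold cg. destruct i as [|k]; [lra|]. destruct (Nat.eqb_spec (S k) n); [lra|].
 destruct (Dt_inv u k Hu ok). lra.
Qed.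

(** By [c_step] the unperturbed phases advance exactly with [Om i], and moving both ends along the
    flow does not change the mean velocity. What is left is the transverse displacement over the
    duration, and [e] from the change of [Om] between two sites. *)
Lemma Ib_decomp u i j : inb u -> i <=' n -> (1 <= j <= d)%nat ->
 exists e, Rabs e <= eps * mu / 4 /\ Ib u i j = Om i j + cg u i * dxi u i j + e.
Proof.
 intros Hu Hi Hj. unfold Ib, cg, dxi. assert (0 < eps * mu) by fin.
 destruct i as [|k]; [exists 0; rewrite Rabs_R0; split; [lra|ring]|].
 destruct (Nat.eqb_spec (S k) n) as [E|E].
 { exists 0; rewrite Rabs_R0, E; split; [lra|ring]. }
 destruct (Dt_inv u k Hu ok) as [Hc HD].
 exists (/ Dt u k * (sig (S k) (u (S k)) * (Om (S (S k)) j - Om (S k) j))). split.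
 - rewrite !Rabs_mult, (Rabs_pos_eq (/ Dt u k)) by lra.
  note (sig_le u (S k) Hu ok) (Om_step (S k) j ok) as H1 H2.
  le_thru (eps * (dB * (eps * mu))).
  + fin.
  + fin.
 - apply Rmult_eq_reg_r with (Dt u k); [|lra].
  replace ((Xs u (S k) j - Xs u k j) / Dt u k * Dt u k) with (Xs u (S k) j - Xs u k j) by fld.
  replace ((Om (S k) j + / Dt u k * (u (S k) j - u k j) + / Dt u k * (sig (S k) (u (S k)) * (Om (S (S k)) j - Om (S k) j))) * Dt u k)
   with (Om (S k) j * Dt u k + (u (S k) j - u k j) + sig (S k) (u (S k)) * (Om (S (S k)) j - Om (S k) j)) by fld.
  unfold Dt. rewrite !Xs_time. unfold Xs, Lmap.
  generalize (c_step k j ok ok). destruct j as [|j]; [lia|]. fin.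
Qed.

Lemma dxi_le u i j : inb u -> i <=' n -> (1 <= j <= d)%nat -> Rabs (dxi u i j) <= 2.
Proof.
 intros Hu Hi Hj. unfold dxi. destruct i as [|k]; [fin|].
 destruct (Nat.eqb_spec (S k) n); [fin|].
 generalize (inb_comp u (S k) j Hu ok ok) (inb_comp u k j Hu ok ok). fin.
Qed.

Lemma site_bounds u i j : inb u -> i <' n -> (1 <= j <= d)%nat ->
 let s := cg u i * Rabs (dxi u i j) + cg u (S i) * Rabs (dxi u (S i) j) in
 0 <= s <= 4 * eps /\ Rabs (Mm u i j) <= s / 2 + eps * mu /\ Rabs (Gphi u i j) <= s + (CG + 3) * mu.
Proof.
 intros Hu Hi Hj s.
 destruct (Ib_decomp u i j Hu ok Hj) as (e1 & He1 & E1).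
 destruct (Ib_decomp u (S i) j Hu ok Hj) as (e2 & He2 & E2).
 destruct (cg_range u i Hu ok) as [C1 C1']. destruct (cg_range u (S i) Hu ok) as [C2 C2'].
 note (dxi_le u i j Hu ok Hj) (dxi_le u (S i) j Hu ok Hj) (Om_step i j ok) as D1 D2 O1. note (Rabs_pos (dxi u i j)) (Rabs_pos (dxi u (S i) j)) as P1 P2.
 assert (T1 : Rabs (cg u i * dxi u i j) = cg u i * Rabs (dxi u i j)) by (rewrite Rabs_mult, Rabs_pos_eq; trivial).
 assert (T2 : Rabs (cg u (S i) * dxi u (S i) j) = cg u (S i) * Rabs (dxi u (S i) j)) by (rewrite Rabs_mult, Rabs_pos_eq; trivial).
 assert (0 <= cg u i * Rabs (dxi u i j) <= eps * 2) by fin.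
 assert (0 <= cg u (S i) * Rabs (dxi u (S i) j) <= eps * 2) by fin.
 generalize (Rle_abs (cg u i * dxi u i j)) (Rle_abs (- (cg u i * dxi u i j)))
  (Rle_abs (cg u (S i) * dxi u (S i) j)) (Rle_abs (- (cg u (S i) * dxi u (S i) j))).
 rewrite !Rabs_Ropp, T1, T2. intros A1 A2 A3 A4.
 apply Rabs_le_between in He1, He2, O1.
 assert (Hem : 0 < eps * mu) by fin.
 assert (Hem2 : eps * mu <= mu) by nra.
 split; [unfold s; lra|]. split.
 - unfold Mm. rewrite E1, E2. apply Rabs_le. unfold s. lra.
 - unfold Gphi. rewrite E1, E2.
  note (Gaphi_le u i j Hu Hi Hj) (Rphi_le u i j Hu Hi Hj) as H1 H2. apply Rabs_le_between in H1, H2.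
  apply Rabs_le. unfold s. nra.
Qed.

Lemma Mm_le u i j : inb u -> i <' n -> (1 <= j <= d)%nat -> Rabs (Mm u i j) <= 3 * eps.
Proof.
 intros Hu Hi Hj. destruct (site_bounds u i j Hu Hi Hj) as (H1 & H2 & _). nra.
Qed.

Hypothesis eps_bdry : eps * (4 * K + K * Bb + K * Bb * K * (4 * CG + 24) + 2) < kap * r ^ 2.
Hypothesis eps_KB : 3 * eps * (K * Bb) <= 1 / 4.

Lemma dot_ge_half_square m (x y : vec) : sq m y <= sq m x ->
 vsum m (fun j => (x j - y j) ^ 2) / 2 <= vsum m (fun j => (x j - y j) * x j).
Proof.
 intros H.
 assert (Heq : 2 * vsum m (fun j => (x j - y j) * x j) - vsum m (fun j => (x j - y j) ^ 2) = sq m x - sq m y).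
 { unfold sq. rewrite <- vsum_scal, <- !vsum_minus. apply vsum_ext. fin. }
 lra.
Qed.

(** When a site touches the sphere its neighbours are no farther out, so each kinetic term points
    outwards by at least half of [c * |dxi| ^ 2]. The products [Mm * Gphi] are not of order [mu],
    but their large part is quadratic in the same [dxi], hence at most [eps * Q], and is
    absorbed. *)
Lemma xi_interior u i : inb u -> i <' n -> sq d (vtail (u i)) = r ^ 2 ->
 0 < vsum d (fun j => u i (S j) * Ghat u i (S j)).
Proof.
 intros Hu Hi Hr.
 set (xi := fun j => u i (S j)).
 set (c1 := cg u i). set (c2 := cg u (S i)).
 destruct (cg_range u i Hu ok) as [C1 C1']. destruct (cg_range u (S i) Hu ok) as [C2 C2'].
 fold c1 in C1, C1'. fold c2 in C2, C2'.
 set (Q1 := vsum d (fun j => dxi u i (S j) ^ 2)). set (Q2 := vsum d (fun j => dxi u (S i) (S j) ^ 2)).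
 set (Q := c1 * Q1 + c2 * Q2).
 assert (HQ1 : 0 <= Q1) by (apply vsum_nonneg; intros; apply pow2_ge_0).
 assert (HQ2 : 0 <= Q2) by (apply vsum_nonneg; intros; apply pow2_ge_0).
 assert (HQ : 0 <= Q) by (unfold Q; apply Rplus_le_le_0_compat; apply Rmult_le_pos; trivial).
 assert (Hem : 0 < eps * mu) by fin.
 assert (HK := K_pos).
 assert (Hxi : forall j, j <' d -> Rabs (xi j) <= 1).
 { intros j Hj. generalize (inb_comp u i (S j) Hu Hi ok). fold (xi j). lra. }
 assert (HE : Q / 2 - 2 * K * (eps * mu) <= vsum d (fun j => xi j * (Ib u i (S j) - Ib u (S i) (S j)))).
 { assert (Hdec : forall j, j <' d ->
   c1 * (dxi u i (S j) * xi j) + c2 * (- dxi u (S i) (S j) * xi j) - 2 * (eps * mu)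
   <= xi j * (Ib u i (S j) - Ib u (S i) (S j))).
  { intros j Hj.
   destruct (Ib_decomp u i (S j) Hu ok ok) as (e1 & He1 & E1).
   destruct (Ib_decomp u (S i) (S j) Hu ok ok) as (e2 & He2 & E2).
   rewrite E1, E2. fold c1 c2.
   note (Om_step i (S j) ok) (Hxi j Hj) as O1 X1.
   assert (Hb : Rabs (xi j * (Om (S i) (S j) - Om i (S j) - e1 + e2)) <= 1 * (2 * (eps * mu))).
   { rewrite Rabs_mult. mul_abs; trivial.
    fin. }
   fin. }
  assert (H1 : Q1 / 2 <= vsum d (fun j => dxi u i (S j) * xi j)).
  { unfold Q1, dxi. destruct i as [|k].
   - rewrite (vsum_ext _ _ (fun _ => 0)), vsum_zero by (intros; ring).
    rewrite (vsum_ext _ _ (fun _ => 0)), vsum_zero by (intros; ring). lra.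
   - destruct (Nat.eqb_spec (S k) n); [lia|].
    apply (dot_ge_half_square d xi (fun j => u k (S j))). change (sq d (vtail (u k)) <= sq d (vtail (u (S k)))).
    rewrite Hr. apply Hu. lia. }
  assert (H2 : Q2 / 2 <= vsum d (fun j => - dxi u (S i) (S j) * xi j)).
  { unfold Q2, dxi. destruct (Nat.eqb_spec (S i) n).
   - rewrite (vsum_ext _ _ (fun _ => 0)), vsum_zero by (intros; ring).
    rewrite (vsum_ext _ _ (fun _ => 0)), vsum_zero by (intros; ring). lra.
   - rewrite (vsum_ext _ (fun j => (u (S i) (S j) - u i (S j)) ^ 2) (fun j => (xi j - u (S i) (S j)) ^ 2)) by (intros; unfold xi; ring).
    rewrite (vsum_ext _ (fun j => - (u (S i) (S j) - u i (S j)) * xi j) (fun j => (xi j - u (S i) (S j)) * xi j)) by (intros; unfold xi; ring).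
    apply (dot_ge_half_square d xi (fun j => u (S i) (S j))). change (sq d (vtail (u (S i))) <= sq d (vtail (u i))).
    rewrite Hr. apply Hu. lia. }
  eapply Rle_trans; [|apply vsum_le; exact Hdec].
  rewrite vsum_minus, vsum_plus, !vsum_scal, vsum_const. fold K. unfold Q.
  fin. }
 set (MG := vsum d (fun j => Mm u i (S j) * Gphi u i (S j))).
 assert (HMG : Rabs MG <= eps * Q + K * (eps * mu * (4 * CG + 24))).
 { unfold MG. le_by apply vsum_abs.
  le_thru (vsum d (fun j => eps * (c1 * dxi u i (S j) ^ 2 + c2 * dxi u (S i) (S j) ^ 2) + eps * mu * (4 * CG + 24))).
  - apply vsum_le. intros j Hj. destruct (site_bounds u i (S j) Hu Hi ok) as (B1 & B2 & B3).
   fold c1 c2 in B1, B2, B3.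
   set (a := Rabs (dxi u i (S j))) in *. set (a' := Rabs (dxi u (S i) (S j))) in *.
   set (s := c1 * a + c2 * a') in *.
   rewrite Rabs_mult. rewrite <- (pow2_abs (dxi u i (S j))), <- (pow2_abs (dxi u (S i) (S j))). fold a a'.
   assert (Hs2 : s ^ 2 / 2 <= eps * (c1 * a ^ 2 + c2 * a' ^ 2)).
   { assert (s ^ 2 / 2 <= c1 * c1 * a ^ 2 + c2 * c2 * a' ^ 2).
    { unfold s. generalize (pow2_ge_0 (c1 * a - c2 * a')). fin. }
    assert (c1 * (c1 * a ^ 2) <= eps * (c1 * a ^ 2)).
    { fin. }
    assert (c2 * (c2 * a' ^ 2) <= eps * (c2 * a' ^ 2)).
    { fin. }
    lra. }
   le_thru ((s / 2 + eps * mu) * (s + (CG + 3) * mu)).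
   + fin.
   + assert (s * mu <= 4 * eps * mu) by fin.
    assert (s * mu * CG <= 4 * eps * mu * CG) by fin.
    assert (eps * mu * s <= eps * mu * 4) by fin.
    assert (eps * mu * mu <= eps * mu * 1) by fin.
    assert (eps * mu * mu * CG <= eps * mu * 1 * CG) by fin.
    replace ((s / 2 + eps * mu) * (s + (CG + 3) * mu)) with
     (s ^ 2 / 2 + s * mu * CG / 2 + 3 / 2 * (s * mu) + eps * mu * s + eps * mu * mu * CG + 3 * (eps * mu * mu)) by field.
    assert (0 <= eps * mu * CG) by fin. lra.
  - rewrite vsum_plus, vsum_scal, vsum_plus, !vsum_scal, vsum_const. fold K. unfold Q, Q1, Q2. lra. }
 assert (Hb := bdot_le u i Hu Hi). assert (HKB := KB_pos).
 assert (Hb1 : Rabs (bdot i (u i)) <= K * Bb).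
 { fin. }
 assert (Hexp : vsum d (fun j => u i (S j) * Ghat u i (S j)) =
   vsum d (fun j => xi j * (Ib u i (S j) - Ib u (S i) (S j)))
   + mu * (vsum d (fun j => u i (S j) * Gaphi u i (S j)) - bdot i (u i) * Gae u i)
   + vsum d (fun j => xi j * Rphi u i (S j)) - bdot i (u i) * Re u i - bdot i (u i) * MG).
 { assert (H0 : vsum d (fun j => u i (S j) * Ghat u i (S j)) =
   vsum d (fun j => xi j * Gphi u i (S j)) - bdot i (u i) * Ge u i).
  { unfold bdot. rewrite Rmult_comm, <- vsum_scal, <- vsum_minus. apply vsum_ext. intros j _. unfold xi, Ghat. ring. }
  rewrite H0. unfold Ge. fold MG.
  assert (H1 : vsum d (fun j => xi j * Gphi u i (S j)) =
   vsum d (fun j => xi j * (Ib u i (S j) - Ib u (S i) (S j))) + mu * vsum d (fun j => u i (S j) * Gaphi u i (S j))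
   + vsum d (fun j => xi j * Rphi u i (S j))).
  { rewrite <- vsum_scal, <- !vsum_plus. apply vsum_ext. intros j _. unfold xi, Gphi. ring. }
  fin. }
 rewrite Hexp.
 assert (HS2 := S2 u i Hu Hi Hr).
 assert (HR : Rabs (vsum d (fun j => xi j * Rphi u i (S j))) <= K * (eps * mu)).
 { apply vsum_abs_le. intros j Hj. rewrite Rabs_mult, <- (Rmult_1_l (eps * mu)).
  mul_abs; auto. apply Rphi_le; trivial; lia. }
 assert (HRe : Rabs (bdot i (u i) * Re u i) <= K * Bb * (eps * mu)).
 { fin. }
 assert (HbMG : Rabs (bdot i (u i) * MG) <= K * Bb * (eps * Q + K * (eps * mu * (4 * CG + 24)))).
 { fin. }
 apply Rabs_le_between in HR, HRe, HbMG.
 assert (HQa : K * Bb * (eps * Q) <= Q / 4) by nra.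
 assert (mu * (kap * r ^ 2) <= mu * (vsum d (fun j => u i (S j) * Gaphi u i (S j)) - bdot i (u i) * Gae u i))
  by fin.
 assert (Hfin : mu * (eps * (4 * K + K * Bb + K * Bb * K * (4 * CG + 24) + 2)) < mu * (kap * r ^ 2))
  by (apply Rmult_lt_compat_l; lra).
 fin.
Qed.

(** If [Gphi = b * Ge], the correction in [Ge] is a multiple [m * Ge] with [|m| <= 1 / 4], so [Ge]
    has the sign of [mu * Gae + Re]. *)
Lemma tau_interior u i : inb u -> i <' n -> u i O ^ 2 = r ^ 2 ->
 (forall j, (1 <= j <= d)%nat -> Gphi u i j = b i j * Ge u i) -> 0 < u i O * Ge u i.
Proof.
 intros Hu Hi Hr HG.
 assert (Hem : 0 < eps * mu) by fin.
 set (m := vsum d (fun j => Mm u i (S j) * b i (S j))).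
 assert (Hm : Rabs m <= 1 / 4).
 { le_by apply (vsum_abs_le d _ (3 * eps * Bb)).
  - intros j Hj. rewrite Rabs_mult. mul_abs; trivial. apply Mm_le; trivial; lia.
  - fold K. lra. }
 assert (He : Ge u i * (1 - m) = mu * Gae u i + Re u i).
 { assert (H1 : vsum d (fun j => Mm u i (S j) * Gphi u i (S j)) = m * Ge u i).
  { unfold m. rewrite (Rmult_comm _ (Ge u i)), <- vsum_scal. apply vsum_ext. intros j Hj. rewrite HG by lia. ring. }
  assert (HGe : Ge u i = mu * Gae u i + Re u i + m * Ge u i) by (rewrite <- H1; reflexivity).
  lra. }
 apply Rabs_le_between in Hm.
 assert (Hpos : 0 < u i O * (mu * Gae u i + Re u i)).
 { note (S3 u i Hu Hi Hr) (Re_le u i Hu Hi) (inb_comp u i O Hu Hi (Nat.le_0_l d)) as H1 H2 H3.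
  assert (Rabs (u i O * Re u i) <= 1 * (eps * mu)).
  { fin. }
  apply Rabs_le_between in H.
  assert (mu * (kap * r ^ 2) <= mu * (u i O * Gae u i)) by fin.
  assert (mu * (eps * 2) < mu * (kap * r ^ 2)).
  { apply Rmult_lt_compat_l; [lra|]. eapply Rle_lt_trans; [|exact eps_bdry]. mul_l.
   assert (0 <= K * Bb * K * (4 * CG + 24)) by (repeat apply Rmult_le_pos; try apply K_pos; lra).
   generalize K_pos KB_pos. lra. }
  lra. }
 fin.
Qed.

Definition CL : R := dB * W + 1.

Lemma CL_ge : 1 <= CL /\ dB <= CL.
Proof. unfold CL. assert (1 <= dB) by (unfold dB; generalize KB_pos; lra). nra. Qed.

Lemma Xs_Lip u v i j : i <' n -> j <=' d -> Rabs (Xs u i j - Xs v i j) <= CL * N1 u v i.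
Proof.
 intros Hi Hj. unfold Xs, Lmap, CL. note (sig_Lip u v i Hi) (Om_le (S i) j Hj) as H1 H2.
 replace (_ - _) with ((sig i (u i) - sig i (v i)) * Om (S i) j +
  (match j with O => 0 | S _ => u i j end - match j with O => 0 | S _ => v i j end)) by ring.
 triang. rewrite Rabs_mult, Rmult_plus_distr_r, Rmult_1_l.
 apply Rplus_le_compat.
 - replace (dB * W * N1 u v i) with (dB * N1 u v i * W) by ring.
  fin.
 - destruct j as [|j]; [rewrite Rminus_0_r, Rabs_R0; apply N1_pos|]. now apply N1_comp.
Qed.

Lemma Ib_le u i j : inb u -> i <=' n -> (1 <= j <= d)%nat -> Rabs (Ib u i j) <= W + 3.
Proof.
 intros Hu Hi Hj. destruct (Ib_decomp u i j Hu Hi Hj) as (e & He & E). rewrite E.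
 note (Om_le i j ok) (cg_range u i Hu Hi) (dxi_le u i j Hu Hi Hj) as H1 H2 H3.
 assert (Rabs (cg u i * dxi u i j) <= 1 * 2).
 { rewrite Rabs_mult. mul_abs; trivial. fin. }
 assert (eps * mu <= 1) by nra.
 fin.
Qed.

Lemma Ib_Lip u v i j : inb u -> inb v -> i <=' n -> (1 <= j <= d)%nat ->
 Rabs (Ib u i j - Ib v i j) <= 2 * (W + 4) * eps * CL *
  (match i with O => 0 | S k => N1 u v k end + N1 u v i).
Proof.
 intros Hu Hv Hi Hj. generalize CL_ge; intros [HCL _].
 assert (Hrhs : 0 <= 2 * (W + 4) * eps * CL * (match i with O => 0 | S k => N1 u v k end + N1 u v i)).
 { apply Rmult_le_pos.
  - fin.
  - generalize (N1_pos u v i). destruct i as [|k]; [lra|]. generalize (N1_pos u v k). lra. }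
 generalize (Ib_le v i j Hv Hi Hj). revert Hrhs. unfold Ib. destruct i as [|k].
 { fin. }
 destruct (Nat.eqb_spec (S k) n) as [E|E].
 { fin. }
 intros _ HI. destruct (Dt_inv u k Hu ok) as [Hc HD]. destruct (Dt_inv v k Hv ok) as [Hc' HD'].
 set (I := (Xs v (S k) j - Xs v k j) / Dt v k) in *.
 replace ((Xs u (S k) j - Xs u k j) / Dt u k - I) with
  (/ Dt u k * ((Xs u (S k) j - Xs v (S k) j) - (Xs u k j - Xs v k j) - I * (Dt u k - Dt v k)))
  by (unfold I; field; lra).
 rewrite Rabs_mult, (Rabs_pos_eq (/ Dt u k)) by lra.
 replace (2 * (W + 4) * eps * CL * (N1 u v k + N1 u v (S k))) with (eps * (2 * (W + 4) * (CL * (N1 u v k + N1 u v (S k))))) by ring.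
 apply Rmult_le_compat; try lra; [fin|].
 note (Xs_Lip u v (S k) j ok ok) (Xs_Lip u v k j ok ok) (Xs_Lip u v (S k) O ok ok) (Xs_Lip u v k O ok ok) as L1 L2 L3 L4.
 set (n1 := CL * N1 u v (S k)) in *. set (n0 := CL * N1 u v k) in *.
 replace (CL * (N1 u v k + N1 u v (S k))) with (n0 + n1) by (unfold n0, n1; ring).
 assert (HT : Rabs (I * (Dt u k - Dt v k)) <= (W + 3) * (n0 + n1)).
 { rewrite Rabs_mult. mul_abs; trivial. unfold Dt.
  fin. }
 fin.
Qed.

Let CI := 2 * (W + 4) * CL.

Lemma CI_pos : 0 <= CI.
Proof. unfold CI. destruct CL_ge. fin. Qed.

Lemma Ib_Lip3 u v i j : inb u -> inb v -> i <' n -> (1 <= j <= d)%nat ->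
 Rabs (Ib u i j - Ib v i j) <= eps * CI * N3 u v i /\ Rabs (Ib u (S i) j - Ib v (S i) j) <= eps * CI * N3 u v i.
Proof.
 intros Hu Hv Hi Hj. generalize CI_pos; intros HCI.
 assert (Hec : 0 <= eps * CI) by fin.
 split.
 - le_by (apply Ib_Lip; trivial; lia).
  replace (2 * (W + 4) * eps * CL) with (eps * CI) by (unfold CI; ring). apply Rmult_le_compat_l; trivial.
  unfold N3. generalize (N1_pos u v (S i)). lra.
 - le_by (apply Ib_Lip; trivial; lia).
  replace (2 * (W + 4) * eps * CL) with (eps * CI) by (unfold CI; ring). apply Rmult_le_compat_l; trivial.
  unfold N3. destruct i as [|k]; [lra|]. generalize (N1_pos u v k). lra.
Qed.

Lemma Mm_Lip u v i j : inb u -> inb v -> i <' n -> (1 <= j <= d)%nat ->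
 Rabs (Mm u i j - Mm v i j) <= eps * CI * N3 u v i.
Proof.
 intros Hu Hv Hi Hj. destruct (Ib_Lip3 u v i j Hu Hv Hi Hj) as [H1 H2].
 apply Rabs_le_between in H1, H2. unfold Mm. fin.
Qed.

(* The part of the equations that is small together with its Lipschitz constant. *)
Definition Rest u i : R := Re u i + vsum d (fun j => Mm u i (S j) * (mu * Gaphi u i (S j) + Rphi u i (S j))).

Let CR := 1 + K * (3 * (CG + 1) + CI * (CG + 1)).

Lemma CR_ge : 1 <= CR.
Proof.
 unfold CR. assert (0 <= K * (3 * (CG + 1) + CI * (CG + 1))); [|lra].
 apply Rmult_le_pos; [apply K_pos|]. generalize CI_pos. nra.
Qed.

Lemma Rest_Lip u v i : inb u -> inb v -> i <' n -> Rabs (Rest u i - Rest v i) <= eps * mu * CR * N3 u v i.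
Proof.
 intros Hu Hv Hi. unfold Rest. generalize CI_pos; intros HCI.
 destruct (N3_ge u v i) as (HN1 & HN & _). set (N := N3 u v i) in *.
 replace (_ - _) with ((Re u i - Re v i) + (vsum d (fun j => Mm u i (S j) * (mu * Gaphi u i (S j) + Rphi u i (S j)))
  - vsum d (fun j => Mm v i (S j) * (mu * Gaphi v i (S j) + Rphi v i (S j))))) by ring.
 rewrite <- vsum_minus. triang.
 replace (eps * mu * CR * N) with (eps * mu * N + K * (3 * eps * (mu * (CG + 1) * N) + eps * CI * N * (mu * (CG + 1))))
  by (unfold CR; ring).
 apply Rplus_le_compat; [fin|]. apply vsum_abs_le. intros j Hj.
 assert (Hem2 : eps * mu <= mu) by nra.
 apply Rabs_prod_diff.
 - apply Mm_le; trivial; lia.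
 - note (Gaphi_le v i (S j) Hv Hi ok) (Rphi_le v i (S j) Hv Hi ok) as H1 H2.
  apply Rabs_le_between in H1, H2. apply Rabs_le. nra.
 - apply Mm_Lip; trivial; lia.
 - generalize (Gaphi_Lip u v i (S j) Hu Hv Hi ok) (Rphi_Lip u v i (S j) Hu Hv Hi ok). fold N. intros H1 H2.
  replace (_ - _) with (mu * (Gaphi u i (S j) - Gaphi v i (S j)) + (Rphi u i (S j) - Rphi v i (S j))) by ring.
  triang. rewrite Rabs_mult, (Rabs_pos_eq mu) by lra.
  le_thru (mu * (CG * N) + mu * N); [|lra].
  apply Rplus_le_compat.
  + mul_l. fin.
  + fin.
Qed.

Lemma sum_N3_sq u v : vsum n (fun i => N3 u v i ^ 2) <= 9 * INR (S d) * dist2 n d u v.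
Proof.
 assert (HN1 : vsum n (fun i => N1 u v i ^ 2) <= INR (S d) * dist2 n d u v).
 { unfold dist2. rewrite <- vsum_scal. apply vsum_le. intros i Hi. unfold N1.
  destruct (Nat.ltb_spec i n); [|lia].
  generalize (vsum_Cauchy_Schwarz (S d) (fun _ => 1) (fun j => Rabs (u i j - v i j))).
  rewrite (vsum_ext _ (fun i => 1 ^ 2) (fun _ => 1)), vsum_const by (intros; ring).
  rewrite (vsum_ext _ (fun i0 => 1 * Rabs (u i i0 - v i i0)) (fun j => Rabs (u i j - v i j))) by (intros; ring).
  rewrite (vsum_ext _ (fun i0 => Rabs (u i i0 - v i i0) ^ 2) (fun j => (u i j - v i j) ^ 2)) by (intros; apply pow2_abs).
  lra. }
 assert (Hprev : forall m, m <=' n -> vsum m (fun i => match i with O => 0 | S k => N1 u v k end ^ 2) <= vsum m (fun i => N1 u v i ^ 2)).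
 { intros m Hm. destruct m as [|m]; [rewrite !vsum_0; lra|].
  rewrite vsum_first, vsum_S. fin. }
 assert (Hnext : vsum n (fun i => N1 u v (S i) ^ 2) <= vsum n (fun i => N1 u v i ^ 2)).
 { assert (Hz : N1 u v n = 0) by (unfold N1; now rewrite Nat.ltb_irrefl).
  assert (H := vsum_first n (fun i => N1 u v i ^ 2)). rewrite vsum_S, Hz in H. fin. }
 specialize (Hprev n (Nat.le_refl n)).
 le_thru (vsum n (fun i => 3 * (match i with O => 0 | S k => N1 u v k end ^ 2 + N1 u v i ^ 2 + N1 u v (S i) ^ 2))).
 - apply vsum_le. intros i _. unfold N3. set (a := match i with O => 0 | S k => N1 u v k end).
  generalize (pow2_ge_0 (a - N1 u v i)) (pow2_ge_0 (a - N1 u v (S i))) (pow2_ge_0 (N1 u v i - N1 u v (S i))). nra.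
 - rewrite vsum_scal, !vsum_plus. lra.
Qed.

(** Abel summation moves the differences onto the gaps, without boundary terms because the extreme
    velocities are prescribed. A gap then contributes [(A - B) ^ 2 * (Dt u i + Dt v i) / 2]: the
    joint convexity of [|x| ^ 2 / (2 * t)]. *)
Lemma kinetic_monotone u v : inb u -> inb v ->
 0 <= vsum n (fun i => vsum d (fun j =>
  (Xs u i (S j) - Xs v i (S j)) * ((Ib u i (S j) - Ib u (S i) (S j)) - (Ib v i (S j) - Ib v (S i) (S j)))
  - (Xs u i O - Xs v i O) / 2 * ((Ib u i (S j) ^ 2 - Ib u (S i) (S j) ^ 2) - (Ib v i (S j) ^ 2 - Ib v (S i) (S j) ^ 2)))).
Proof.
 intros Hu Hv. rewrite vsum_exchange. apply vsum_nonneg. intros j Hj.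
 assert (Hm : exists m, n = S m) by (exists (n - 1)%nat; lia). destruct Hm as [m En].
 replace (vsum n) with (vsum (S m)) by now rewrite En.
 set (a := fun i => Xs u i (S j) - Xs v i (S j)). set (t := fun i => Xs u i O - Xs v i O).
 set (p := fun i => Ib u i (S j) - Ib v i (S j)). set (q := fun i => (Ib u i (S j) ^ 2 - Ib v i (S j) ^ 2) / 2).
 rewrite (vsum_ext _ _ (fun i => a i * (p i - p (S i)) - t i * (q i - q (S i)))) by (intros; unfold a, t, p, q; field).
 rewrite vsum_minus, !vsum_telescope.
 assert (P0 : p O = 0 /\ q O = 0) by (unfold p, q, Ib; split; field).
 assert (Pn : p (S m) = 0 /\ q (S m) = 0).
 { unfold p, q, Ib. rewrite En, Nat.eqb_refl. fin. }
 destruct P0 as [-> ->], Pn as [-> ->].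
 match goal with |- 0 <= _ - _ + ?A - (_ - _ + ?B) => assert (HAB : 0 <= A - B); [|lra] end.
 rewrite <- vsum_minus. apply vsum_nonneg. intros i Hi.
 destruct (Dt_inv u i Hu ok) as [_ HD]. destruct (Dt_inv v i Hv ok) as [_ HD'].
 unfold p, q, Ib. rewrite En. destruct (Nat.eqb_spec (S i) (S m)); [lia|].
 set (A := (Xs u (S i) (S j) - Xs u i (S j)) / Dt u i). set (B := (Xs v (S i) (S j) - Xs v i (S j)) / Dt v i).
 assert (HA : Xs u (S i) (S j) - Xs u i (S j) = A * Dt u i) by (unfold A; field; lra).
 assert (HB : Xs v (S i) (S j) - Xs v i (S j) = B * Dt v i) by (unfold B; field; lra).
 replace (a (S i) - a i) with (A * Dt u i - B * Dt v i) by (unfold a; lra).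
 replace (t (S i) - t i) with (Dt u i - Dt v i) by (unfold t, Dt; ring).
 replace (_ - _) with ((A - B) ^ 2 * ((Dt u i + Dt v i) / 2)) by field.
 fin.
Qed.

Hypothesis eps_mono : eps * (9 * INR (S d) * ((dB + K) * CR)) <= kap / 2.

Lemma Ghat_mono u v : inb u -> inb v ->
 mu * kap / 2 * dist2 n d u v <= dot n d (fun i j => Ghat u i j - Ghat v i j) (fun i j => u i j - v i j).
Proof.
 intros Hu Hv.
 set (Kin := fun i => vsum d (fun j =>
  (Xs u i (S j) - Xs v i (S j)) * ((Ib u i (S j) - Ib u (S i) (S j)) - (Ib v i (S j) - Ib v (S i) (S j)))
  - (Xs u i O - Xs v i O) / 2 * ((Ib u i (S j) ^ 2 - Ib u (S i) (S j) ^ 2) - (Ib v i (S j) ^ 2 - Ib v (S i) (S j) ^ 2)))).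
 assert (Hsite : forall i, i <' n ->
  Kin i + (mu * kap * vsum (S d) (fun j => (u i j - v i j) ^ 2) - eps * mu * ((dB + K) * CR) * N3 u v i ^ 2)
  <= vsum (S d) (fun j => (Ghat u i j - Ghat v i j) * (u i j - v i j))).
 { intros i Hi. rewrite (vsum_first d (fun j => (Ghat u i j - Ghat v i j) * (u i j - v i j))).
  set (ds := sig i (u i) - sig i (v i)).
  assert (Hds : ds = (u i O - v i O) - vsum d (fun j => b i (S j) * (u i (S j) - v i (S j)))).
  { unfold ds, sig, bdot.
   rewrite (vsum_ext _ (fun j => b i (S j) * (u i (S j) - v i (S j))) (fun j => b i (S j) * u i (S j) - b i (S j) * v i (S j))) by (intros; ring).
   rewrite vsum_minus. ring. }
  assert (Hpair : (Ghat u i O - Ghat v i O) * (u i O - v i O)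
    + vsum d (fun j => (Ghat u i (S j) - Ghat v i (S j)) * (u i (S j) - v i (S j)))
   = ds * (Ge u i - Ge v i) + vsum d (fun j => (u i (S j) - v i (S j)) * (Gphi u i (S j) - Gphi v i (S j)))).
  { rewrite Hds. unfold Ghat.
   rewrite (vsum_ext _ (fun j => (Gphi u i (S j) - b i (S j) * Ge u i - (Gphi v i (S j) - b i (S j) * Ge v i)) * (u i (S j) - v i (S j)))
    (fun j => (u i (S j) - v i (S j)) * (Gphi u i (S j) - Gphi v i (S j)) - (Ge u i - Ge v i) * (b i (S j) * (u i (S j) - v i (S j))))) by (intros; ring).
   rewrite vsum_minus, vsum_scal. ring. }
  rewrite Hpair.
  assert (Hexp : ds * (Ge u i - Ge v i) + vsum d (fun j => (u i (S j) - v i (S j)) * (Gphi u i (S j) - Gphi v i (S j)))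
   = Kin i + mu * (ds * (Gae u i - Gae v i) + vsum d (fun j => (u i (S j) - v i (S j)) * (Gaphi u i (S j) - Gaphi v i (S j))))
    + ds * (Rest u i - Rest v i) + vsum d (fun j => (u i (S j) - v i (S j)) * (Rphi u i (S j) - Rphi v i (S j)))).
  { assert (HGe : forall w, Ge w i = mu * Gae w i + Rest w i + vsum d (fun j => Mm w i (S j) * (Ib w i (S j) - Ib w (S i) (S j)))).
   { intros w. unfold Ge, Rest. rewrite !Rplus_assoc, <- vsum_plus. f_equal. f_equal. apply vsum_ext. intros j _. unfold Gphi. ring. }
   rewrite !HGe. unfold Kin.
   rewrite (vsum_ext _ (fun j => (u i (S j) - v i (S j)) * (Gphi u i (S j) - Gphi v i (S j)))
    (fun j => (u i (S j) - v i (S j)) * ((Ib u i (S j) - Ib u (S i) (S j)) - (Ib v i (S j) - Ib v (S i) (S j)))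
     + mu * ((u i (S j) - v i (S j)) * (Gaphi u i (S j) - Gaphi v i (S j)))
     + (u i (S j) - v i (S j)) * (Rphi u i (S j) - Rphi v i (S j)))) by (intros; unfold Gphi; ring).
   rewrite !vsum_plus, vsum_scal.
   match goal with |- ds * (_ + _ + ?A - (_ + _ + ?B)) + (?C + _ + _) = ?D + _ + _ + _ =>
    assert (HD : D = ds * (A - B) + C) end.
   { rewrite <- vsum_minus, <- vsum_scal, <- vsum_plus. apply vsum_ext. intros j _.
    rewrite !Xs_time. unfold Xs, Lmap, Mm.
    replace (c i O + sig i (u i) - (c i O + sig i (v i))) with ds by (unfold ds; ring).
    replace (c i (S j) + (sig i (u i) * Om (S i) (S j) + u i (S j)) - (c i (S j) + (sig i (v i) * Om (S i) (S j) + v i (S j))))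
     with (ds * Om (S i) (S j) + (u i (S j) - v i (S j))) by (unfold ds; ring).
    field. }
   fin. }
  rewrite Hexp. generalize (S1 u v i Hu Hv Hi). fold ds. intros H1.
  destruct (N3_ge u v i) as (HN1 & HN & _). set (N := N3 u v i) in *.
  assert (Hem : 0 < eps * mu) by fin. generalize CR_ge K_pos KB_pos; intros HCR HK HKB.
  assert (H2 : Rabs (ds * (Rest u i - Rest v i)) <= dB * N * (eps * mu * CR * N)).
  { rewrite Rabs_mult. mul_abs; [|now apply Rest_Lip].
   le_by now apply sig_Lip. apply Rmult_le_compat_l; trivial. unfold dB; lra. }
  assert (H3 : Rabs (vsum d (fun j => (u i (S j) - v i (S j)) * (Rphi u i (S j) - Rphi v i (S j)))) <= K * (N * (eps * mu * N))).
  { apply vsum_abs_le. intros j Hj. rewrite Rabs_mult. mul_abs.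
   - eapply Rle_trans; [apply N1_comp; trivial; lia|fin].
   - apply Rphi_Lip; trivial; lia. }
  assert (H4 : K * (N * (eps * mu * N)) <= K * (N * (eps * mu * N)) * CR).
  { rewrite <- (Rmult_1_r (K * (N * (eps * mu * N)))) at 1. fin. }
  apply Rabs_le_between in H2, H3.
  fin. }
 unfold dot. eapply Rle_trans; [|apply vsum_le; exact Hsite].
 rewrite vsum_plus, vsum_minus, !vsum_scal.
 assert (HK0 : 0 <= vsum n Kin) by exact (kinetic_monotone u v Hu Hv).
 fold (dist2 n d u v).
 note (sum_N3_sq u v) (dist2_pos n d u v) as HS HD.
 assert (Hem : 0 < eps * mu) by fin.
 assert (HdK : 0 <= (dB + K) * CR).
 { generalize CR_ge K_pos KB_pos; intros. unfold dB. fin. }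
 assert (eps * mu * ((dB + K) * CR) * vsum n (fun i => N3 u v i ^ 2) <= mu * (kap / 2) * dist2 n d u v).
 { le_thru (eps * mu * ((dB + K) * CR) * (9 * INR (S d) * dist2 n d u v)).
  - fin.
  - replace (eps * mu * ((dB + K) * CR) * (9 * INR (S d) * dist2 n d u v)) with
    (mu * dist2 n d u v * (eps * (9 * INR (S d) * ((dB + K) * CR)))) by ring.
   replace (mu * (kap / 2) * dist2 n d u v) with (mu * dist2 n d u v * (kap / 2)) by ring.
   fin. }
 lra.
Qed.

Lemma Gphi_Lip u v i j : inb u -> inb v -> i <' n -> (1 <= j <= d)%nat ->
 Rabs (Gphi u i j - Gphi v i j) <= (2 * CI + CG + 1) * N3 u v i.
Proof.
 intros Hu Hv Hi Hj. unfold Gphi. destruct (N3_ge u v i) as (HN1 & HN & _).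
 destruct (Ib_Lip3 u v i j Hu Hv Hi Hj) as [H1 H2].
 note (Gaphi_Lip u v i j Hu Hv Hi Hj) (Rphi_Lip u v i j Hu Hv Hi Hj) CI_pos as H3 H4 HCI.
 set (N := N3 u v i) in *.
 assert (eps * CI * N <= CI * N) by (apply Rmult_le_compat_r; trivial; nra).
 assert (Hem2 : eps * mu <= 1) by nra.
 assert (eps * mu * N <= N) by fin.
 assert (CG * N1 u v i <= CG * N) by fin.
 assert (H50 : Rabs (mu * (Gaphi u i j - Gaphi v i j)) <= CG * N).
 { rewrite Rabs_mult, (Rabs_pos_eq mu) by lra. generalize (Rabs_pos (Gaphi u i j - Gaphi v i j)). nra. }
 fin.
Qed.

Lemma Ge_Lip u v i : inb u -> inb v -> i <' n ->
 Rabs (Ge u i - Ge v i) <= (CG + 1 + K * (3 * (2 * CI + CG + 1) + CI * (CG + 7))) * N3 u v i.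
Proof.
 intros Hu Hv Hi. unfold Ge. destruct (N3_ge u v i) as (HN1 & HN & _).
 note (Gae_Lip u v i Hu Hv Hi) (Re_Lip u v i Hu Hv Hi) CI_pos as H1 H2 HCI. set (N := N3 u v i) in *.
 assert (Hem2 : eps * mu <= 1) by nra.
 assert (eps * mu * N <= N) by fin.
 assert (CG * N1 u v i <= CG * N) by fin.
 assert (H30 : Rabs (mu * (Gae u i - Gae v i)) <= CG * N).
 { rewrite Rabs_mult, (Rabs_pos_eq mu) by lra. generalize (Rabs_pos (Gae u i - Gae v i)). nra. }
 assert (H40 : Rabs (vsum d (fun j => Mm u i (S j) * Gphi u i (S j)) - vsum d (fun j => Mm v i (S j) * Gphi v i (S j)))
  <= K * (3 * ((2 * CI + CG + 1) * N) + CI * N * (CG + 7))).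
 { rewrite <- vsum_minus. apply vsum_abs_le. intros j Hj. apply Rabs_prod_diff.
  - eapply Rle_trans; [apply Mm_le; trivial; lia|lra].
  - destruct (site_bounds v i (S j) Hv Hi ok) as (B1 & _ & B3). nra.
  - le_by (apply Mm_Lip; trivial; lia). apply Rmult_le_compat_r; trivial. nra.
  - apply Gphi_Lip; trivial; lia. }
 fin.
Qed.

Lemma Ghat_Lip : exists Lam, forall u v, inb u -> inb v -> dist2 n d (Ghat u) (Ghat v) <= Lam * dist2 n d u v.
Proof.
 set (L1 := 2 * CI + CG + 1). set (L2 := CG + 1 + K * (3 * (2 * CI + CG + 1) + CI * (CG + 7))).
 set (L := L1 + (1 + Bb) * L2).
 exists (INR (S d) * L ^ 2 * (9 * INR (S d))). intros u v Hu Hv.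
 generalize CI_pos K_pos; intros HCI HK.
 assert (HL1 : 0 <= L1) by (unfold L1; lra).
 assert (HL2 : 0 <= L2).
 { unfold L2. assert (0 <= K * (3 * (2 * CI + CG + 1) + CI * (CG + 7))); [|lra]. apply Rmult_le_pos; nra. }
 assert (HcompL : forall i j, i <' n -> j <=' d -> Rabs (Ghat u i j - Ghat v i j) <= L * N3 u v i).
 { intros i j Hi Hj. destruct (N3_ge u v i) as (_ & HN & _).
  generalize (Ge_Lip u v i Hu Hv Hi). fold L2. intros H1.
  destruct j as [|j]; unfold Ghat.
  - le_by exact H1. apply Rmult_le_compat_r; trivial. unfold L. nra.
  - generalize (Gphi_Lip u v i (S j) Hu Hv Hi ok). fold L1. intros H2.
   replace (_ - _) with ((Gphi u i (S j) - Gphi v i (S j)) - b i (S j) * (Ge u i - Ge v i)) by ring.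
   triang. rewrite Rabs_Ropp, Rabs_mult.
   assert (Rabs (b i (S j)) * Rabs (Ge u i - Ge v i) <= Bb * (L2 * N3 u v i)).
   { fin. }
   assert (0 <= L2 * N3 u v i) by fin. unfold L. nra. }
 le_thru (vsum n (fun i => INR (S d) * L ^ 2 * N3 u v i ^ 2)).
 - unfold dist2. apply vsum_le. intros i Hi.
  replace (INR (S d) * L ^ 2 * N3 u v i ^ 2) with (INR (S d) * ((L * N3 u v i) ^ 2)) by ring.
  rewrite <- vsum_const. apply vsum_le. intros j Hj. rewrite <- pow2_abs. apply pow_incr.
  split; [fin|apply HcompL; lia].
 - rewrite vsum_scal, (Rmult_assoc (INR (S d) * L ^ 2)). apply Rmult_le_compat_l; [|apply sum_N3_sq].
  fin.
Qed.

(** A positive multiplier would make [Ghat] point inwards on a sphere, against [xi_interior] or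
    [tau_interior]. The vector multipliers come first, since the scalar case uses the equations they
    yield; once [Gphi] vanishes, so does the correction in [Ge]. *)
Theorem discrete_equilibrium : exists u, inb u /\ forall i, i <' n ->
 (forall j, (1 <= j <= d)%nat -> Gphi u i j = 0) /\ mu * Gae u i + Re u i = 0.
Proof.
 destruct Ghat_Lip as [Lam HLam].
 destruct (variational_inequality n d r (mu * kap / 2) Lam Ghat ok ltac:(nra) Ghat_mono HLam) as (u & Hu & H).
 assert (Hxi : forall i, i <' n -> forall j, (1 <= j <= d)%nat -> Gphi u i j = b i j * Ge u i).
 { intros i Hi. destruct (H i Hi) as (l0 & l1 & Hl0 & Hl1 & E0 & E1 & C0 & C1).
  assert (Hz : l1 = 0).
  { destruct C1 as [C1|C1]; trivial. exfalso.
   generalize (xi_interior u i Hu Hi C1).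
   rewrite (vsum_ext _ _ (fun j => - l1 * u i (S j) ^ 2)).
   - rewrite vsum_scal. change (vsum d (fun i0 => u i (S i0) ^ 2)) with (sq d (vtail (u i))). fin.
   - intros j Hj. rewrite E1 by lia. ring. }
  intros j Hj. specialize (E1 j Hj). rewrite Hz in E1. destruct j as [|j]; [lia|]. unfold Ghat in E1. lra. }
 exists u. split; trivial. intros i Hi.
 destruct (H i Hi) as (l0 & l1 & Hl0 & Hl1 & E0 & E1 & C0 & C1).
 assert (Hz : l0 = 0).
 { destruct C0 as [C0|C0]; trivial. exfalso.
  generalize (tau_interior u i Hu Hi C0 (Hxi i Hi)). change (Ge u i) with (Ghat u i O). fin. }
 assert (HGe : Ge u i = 0) by (change (Ge u i) with (Ghat u i O); rewrite E0, Hz; ring).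
 assert (HGp : forall j, (1 <= j <= d)%nat -> Gphi u i j = 0) by (intros; rewrite Hxi, HGe by trivial; ring).
 split; trivial. unfold Ge in HGe.
 rewrite (vsum_ext _ _ (fun _ => 0)), vsum_zero in HGe by (intros; rewrite HGp by lia; ring). lra.
Qed.
End discrete.

(** * Splitting of the equations into their Melnikov part and a remainder *)

Section gradient.
Variables (d : nat) (P : list trig_mode).

Lemma Gder_le om v x V : 0 <= V -> bnd d V v -> Rabs (Gder d P om v x) <= 64 * Fbd d P * V.
Proof.
 intros HV Hv. unfold Gder. rewrite Rabs_Ropp.
 replace (64 * Fbd d P * V) with (Fbd d P * (64 * V)) by ring.
 apply lsum_Fbd; [lra|]. intros m. rewrite !Rabs_mult, (Rabs_pos_eq 2) by lra.
 generalize (mder_le m (phase d m x)) (phase_le d m v V Hv) (Jm_le (phase d m om)) (mamp_pos m) (mfreq_pos d m).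
 intros H1 H2 H3 H4 H5.
 le_thru (2 * mamp m * (mfreq d m * V) * 32).
 - fin.
 - replace (2 * mamp m * (mfreq d m * V) * 32) with (mamp m * mfreq d m * (64 * V)) by ring.
  mul_r. apply Rmult_le_compat_l; trivial. nra.
Qed.

Lemma Gder_Lip om v x x' V dx : 0 <= V -> bnd d V v ->
 bnd2 d dx x x' ->
 Rabs (Gder d P om v x - Gder d P om v x') <= 64 * Fbd d P * V * dx.
Proof.
 intros HV Hv Hx. assert (Hdx : 0 <= dx) by (le_by apply Rabs_pos; apply (Hx O); lia).
 unfold Gder. replace (_ - _) with (- (lsum P (fun m => 2 * mder m (phase d m x) * phase d m v * Jm (phase d m om))
  - lsum P (fun m => 2 * mder m (phase d m x') * phase d m v * Jm (phase d m om)))) by ring.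
 rewrite Rabs_Ropp, <- lsum_minus.
 replace (64 * Fbd d P * V * dx) with (Fbd d P * (64 * V * dx)) by ring.
 apply lsum_Fbd; [fin|]. intros m.
 replace (_ - _) with (2 * (mder m (phase d m x) - mder m (phase d m x')) * phase d m v * Jm (phase d m om)) by ring.
 rewrite !Rabs_mult, (Rabs_pos_eq 2) by lra.
 generalize (mder_Lip m (phase d m x) (phase d m x')) (phase_le d m v V Hv) (Jm_le (phase d m om)) (mamp_pos m) (mfreq_pos d m)
  (phase_Lip d x x' dx Hx m). intros H1 H2 H3 H4 H5 H6.
 le_thru (2 * (mamp m * (mfreq d m * dx)) * (mfreq d m * V) * 32).
 - assert (Rabs (mder m (phase d m x) - mder m (phase d m x')) <= mamp m * (mfreq d m * dx)).
  { fin. }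
  fin.
 - replace (2 * (mamp m * (mfreq d m * dx)) * (mfreq d m * V) * 32) with (mamp m * mfreq d m ^ 2 * (64 * V * dx)) by ring.
  apply Rmult_le_compat_r; [fin|]. apply Rmult_le_compat_l; trivial. nra.
Qed.

Lemma Gder_unit_sum om v x :
 Gder d P om v x = vsum (S d) (fun j => v j * Gder d P om (unit_vec j) x).
Proof.
 unfold Gder. rewrite (vsum_ext _ _ (fun j => - (v j * lsum P (fun m => 2 * mder m (phase d m x) * phase d m (unit_vec j) * Jm (phase d m om)))))
  by (intros; ring).
 rewrite (vsum_ext _ _ (fun j => (-1) * lsum P (fun m => v j * (2 * mder m (phase d m x) * phase d m (unit_vec j) * Jm (phase d m om)))))
  by (intros; rewrite lsum_scal; ring).
 rewrite vsum_scal, <- lsum_vsum. match goal with |- - ?a = _ * ?b => enough (a = b) as Heq by fin end. apply lsum_ext. intros m.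
 unfold phase at 2. rewrite Rmult_assoc, (Rmult_comm (vsum _ _)), <- Rmult_assoc, <- vsum_scal.
 apply vsum_ext. intros j Hj. rewrite phase_unit by lia. ring.
Qed.
End gradient.

Section remainder.
Variables (d : nat) (P : list trig_mode) (mu W eps : R).
Let F := Fbd d P.
Hypothesis mu_pos : 0 < mu.
Hypothesis W_ge : 2 <= W.
Hypothesis small : mu * F * (W + 2) <= / 10000000.
Hypothesis eps_pos : 0 < eps <= 1.
Hypothesis muF_eps : mu * F <= eps.

Definition CRem : R := 4000000 * (W + 2) ^ 2 * F.

Lemma F1 : 1 <= F. Proof. apply Fbd_ge1. Qed.
Lemma mu_le_muF : mu <= mu * F. Proof. generalize F1; nra. Qed.

Section port.
Variables (s : R) (om : vec).
Hypothesis Hs : Rabs s = 1.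
Hypothesis Hom : bnd d W om.

Lemma port_size x w pc z : 0 <= pc <= mu -> is_half d P mu s x w pc z ->
 bnd2 d eps w om ->
 (forall j, j <=' d -> Rabs (drift d P mu s pc j z PI - drift0 d P mu s j om x) <= CRem * eps * mu) /\
 Rabs (Aint d P mu z PI - Aint d P mu (z0 s om x) PI) <= CRem * eps * mu.
Proof.
 intros Hpc Hz Hw. generalize F1 mu_le_muF; intros HF Hm.
 assert (HY : Y0 d P mu W pc eps <= 2112 * (W + 1) * eps).
 { unfold Y0. fold F.
  fin. }
 assert (HB : B0 d P mu pc <= 272 * eps) by (unfold B0; fold F; lra).
 assert (Hm0 : 0 <= mu * F) by lra.
 assert (Hfin : mu * F * (18000 * (W + 1) * eps) <= CRem * eps * mu).
 { unfold CRem. replace (4000000 * (W + 2) ^ 2 * F * eps * mu) with (mu * F * (4000000 * (W + 2) ^ 2 * eps)) by ring.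
  apply Rmult_le_compat_l; trivial. fin. }
 split.
 - intros j Hj. le_by (apply (drift_sub_ref d P mu W mu_pos W_ge small s Hs x w om pc eps z); trivial; lra).
  fold F. eapply Rle_trans; [|exact Hfin].
  replace (4 * (mu * F) * (2 * Y0 d P mu W pc eps + B0 d P mu pc)) with
   (mu * F * (4 * (2 * Y0 d P mu W pc eps + B0 d P mu pc))) by ring.
  apply Rmult_le_compat_l; trivial. nra.
 - le_by (apply (Aint_sub_ref d P mu W mu_pos W_ge small s Hs x w om pc eps z); trivial; lra).
  fold F. eapply Rle_trans; [|exact Hfin].
  replace (4 * (mu * F) * Y0 d P mu W pc eps) with (mu * F * (4 * Y0 d P mu W pc eps)) by ring.
  apply Rmult_le_compat_l; trivial. nra.
Qed.

(** Velocity and momentum vary by at most [eps * dx], and the half is [O(eps)]-close to its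
    reference; each term of the second-order estimates contains one of these or [mu * F], so the
    constant is [eps * mu] instead of [mu]. *)
Lemma port_Lip x w pc z x' w' pc' z' dx :
 0 <= pc <= mu -> 0 <= pc' <= mu -> is_half d P mu s x w pc z -> is_half d P mu s x' w' pc' z' ->
 bnd d W w -> bnd d W w' ->
 bnd2 d eps w' om ->
 bnd2 d dx x x' ->
 bnd2 d (eps * dx) w w' ->
 Rabs (pc - pc') <= eps * dx ->
 (forall j, j <=' d -> Rabs (drift d P mu s pc j z PI - drift0 d P mu s j om x -
   (drift d P mu s pc' j z' PI - drift0 d P mu s j om x')) <= CRem * eps * mu * dx) /\
 Rabs (Aint d P mu z PI - Aint d P mu (z0 s om x) PI - (Aint d P mu z' PI - Aint d P mu (z0 s om x') PI)) <= CRem * eps * mu * dx.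
Proof.
 intros Hpc Hpc' Hz Hz' HwW HwW' Hw' Hdx Hdw Hdpc. generalize F1 mu_le_muF; intros HF Hm.
 assert (Hdx0 : 0 <= dx) by (le_by apply Rabs_pos; apply (Hdx O); lia).
 set (N := 8 * dx + 128 * (eps * dx) + 256 * (W + 2) * (eps * dx)).
 assert (Hed : 0 <= eps * dx <= dx) by nra.
 set (V := W + 2) in *. assert (HV : 4 <= V) by (unfold V; lra).
 assert (HN : 0 <= N <= 400 * V * dx).
 { unfold N. fin. }
 set (m := mu * F) in *. assert (Hm0 : 0 <= m) by lra.
 set (D := eps * dx) in *.
 assert (HmN : m * N <= 400 * V * D).
 { le_thru (eps * (400 * V * dx)); [fin|unfold D; lra]. }
 set (E := Ez d P mu W N D D).
 assert (HE : 0 <= E <= 103000 * V ^ 2 * D).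
 { unfold E, Ez. fold F V. fold m.
  replace (256 * (m * V) * N) with (256 * V * (m * N)) by ring.
  assert (256 * V * (m * N) <= 256 * V * (400 * V * D)) by fin.
  assert (0 <= 256 * V * (m * N)) by fin.
  fin. }
 set (Y := Y0 d P mu W pc' eps).
 assert (HY : 0 <= Y <= 2112 * V * eps).
 { unfold Y, Y0. fold F. fold m.
  assert (0 <= W * pc' <= W * eps) by fin.
  assert (0 <= (W + 1) * m <= (W + 1) * eps) by fin.
  unfold V. lra. }
 assert (HYd : 0 <= dx * Y <= 528 * V ^ 2 * D).
 { split; [fin|]. le_thru (dx * (2112 * V * eps)); [fin|].
  replace (dx * (2112 * V * eps)) with (2112 * V * D) by (unfold D; ring).
  fin. }
 assert (HDv : Dinv d P mu N D <= 6500 * V ^ 2 * D).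
 { unfold Dinv. fold F. fold m.
  fin. }
 assert (HB : dx * B0 d P mu pc <= 17 * V ^ 2 * D).
 { le_thru (dx * (272 * eps)).
  - apply Rmult_le_compat_l; trivial. unfold B0. fold F. fold m. lra.
  - replace (dx * (272 * eps)) with (272 * D) by (unfold D; ring). apply Rmult_le_compat_r; [lra|nra]. }
 assert (HVD : 0 <= V ^ 2 * D) by fin.
 assert (Hfin : 4 * m * (1000000 * V ^ 2 * D) = CRem * eps * mu * dx) by (unfold CRem, m, D; fold V; ring).
 split.
 - intros j Hj. le_by (apply (drift_second_order d P mu W mu_pos W_ge small s Hs x w x' w' om pc pc' eps dx D D z z'); trivial; lra).
  fold F V. fold N. fold m. fold E. fold Y. fin.
 - le_by (apply (Aint_second_order d P mu W mu_pos W_ge small s Hs x w x' w' om pc pc' eps dx D D z z'); trivial; lra).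
  fold F V. fold N. fold m. fold E. fold Y. fin.
Qed.
End port.

Hypothesis muF_eps2 : 4000000 * (W * (mu * F)) <= eps.

(** The error is the drift displacement, of order [mu * F], over the elapsed time; the latter
    supplies the factor [eps]. *)
Lemma gap_velocity xm xp w pc zm zp j : is_gap d P mu W xm xp w pc zm zp -> j <=' d ->
 10 * W / eps <= xp O - xm O ->
 Rabs (w j - (xp j - xm j) / (xp O - xm O)) <= CRem * eps * mu.
Proof.
 intros Hg Hj HT. generalize F1 mu_le_muF; intros HF Hm.
 assert (Hv := is_gap_velocity d P mu W mu_pos W_ge small _ _ _ _ _ _ j Hg Hj).
 destruct Hg as (_ & Hpc & _ & [Cm _] & [Cp _] & _).
 generalize (edrift_le d P mu W mu_pos W_ge small 1 Rabs_1 pc j zp ok Hj Cp)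
  (edrift_le d P mu W mu_pos W_ge small (-1) Rabs_m1 pc j zm ok Hj Cm). fold F.
 set (e1 := edrift d P mu 1 pc j zp) in *. set (e2 := edrift d P mu (-1) pc j zm) in *. intros E1 E2.
 assert (HT1 : 1 / eps <= xp O - xm O).
 { eapply Rle_trans; [|exact HT]. unfold Rdiv. fin. }
 assert (0 < 1 / eps) by fin.
 set (T := xp O - xm O) in *.
 assert (HiT : 0 < / T <= eps).
 { split; [fin|]. replace eps with (/ (1 / eps)) by fld. fin. }
 replace (w j - (xp j - xm j) / T) with (- (e1 + e2) * / T).
 2:{ apply Rmult_eq_reg_r with T; [|lra]. inv_l; rewrite Rmult_1_r.
   replace ((w j - (xp j - xm j) / T) * T) with (w j * T - (xp j - xm j)) by fld. lra. }
 rewrite Rabs_mult, (Rabs_pos_eq (/ T)) by lra.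
 le_thru (256 * (mu * F) * eps).
 - apply Rmult_le_compat; try lra; [fin|]. fin.
 - unfold CRem. replace (4000000 * (W + 2) ^ 2 * F * eps * mu) with (4000000 * (W + 2) ^ 2 * (mu * F) * eps) by ring.
  mul_r. fin.
Qed.

Lemma gap_velocity_Lip xm xp w pc zm zp xm' xp' w' pc' zm' zp' dx :
 is_gap d P mu W xm xp w pc zm zp -> is_gap d P mu W xm' xp' w' pc' zm' zp' ->
 10 * W / eps <= xp O - xm O -> 10 * W / eps <= xp' O - xm' O ->
 bnd2 d dx xm xm' ->
 bnd2 d dx xp xp' ->
 Rabs (pc - pc') <= eps * dx /\ (bnd2 d (eps * dx) w w') /\
 (forall j, j <=' d -> Rabs ((w j - (xp j - xm j) / (xp O - xm O)) - (w' j - (xp' j - xm' j) / (xp' O - xm' O)))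
   <= CRem * eps * mu * dx).
Proof.
 intros Hg Hg' HT HT' Hdm Hdp. generalize F1 mu_le_muF; intros HF Hm.
 assert (Hdx : 0 <= dx) by (le_by apply Rabs_pos; apply (Hdm O); lia).
 assert (H1e : 1 <= 1 / eps) by (reg_r eps; field_simplify; lra).
 assert (HTe : 10 / eps <= 10 * W / eps).
 { fin. }
 assert (HTe' : 10 / eps = 10 * (1 / eps)) by fin.
 destruct (gap_Lip d P mu W mu_pos W_ge small _ _ _ _ _ _ _ _ _ _ _ _ dx Hg Hg' ok Hdm Hdp) as [Hpcd Hwd].
 fold F in Hpcd.
 assert (Hpcd' : Rabs (pc - pc') <= eps * dx).
 { fin. }
 assert (Hwd' : bnd2 d (eps * dx) w w').
 { intros j Hj. le_by fin.
  replace (10 * W * dx / (xp O - xm O)) with (dx * (10 * W / (xp O - xm O))) by fin.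
  rewrite (Rmult_comm eps). apply Rmult_le_compat_l; trivial.
  reg_r (xp O - xm O).
  replace (10 * W / (xp O - xm O) * (xp O - xm O)) with (10 * W) by fld.
  apply Rmult_le_compat_l with (r := eps) in HT; [|lra].
  replace (eps * (10 * W / eps)) with (10 * W) in HT by fld. lra. }
 split; [fin|split; trivial]. intros j Hj.
 assert (Hv := is_gap_velocity d P mu W mu_pos W_ge small _ _ _ _ _ _ j Hg Hj).
 assert (Hv' := is_gap_velocity d P mu W mu_pos W_ge small _ _ _ _ _ _ j Hg' Hj).
 destruct Hg as (_ & Hpc & HwW & Hm1 & Hp1 & _). destruct Hg' as (_ & Hpc' & HwW' & Hm1' & Hp1' & _).
 set (N := 8 * dx + 128 * (eps * dx) + 256 * (W + 2) * (eps * dx)).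
 assert (W_pos : 0 <= W) by lra.
 assert (Lm := half_Lip d P mu W mu_pos W_pos small (-1) xm xm' w w' pc pc' zm zm' dx (eps * dx) (eps * dx) Rabs_m1
  ok ok Hpcd' HwW HwW' Hwd' Hdm Hm1 Hm1').
 assert (Lp := half_Lip d P mu W mu_pos W_pos small 1 xp xp' w w' pc pc' zp zp' dx (eps * dx) (eps * dx) Rabs_1
  ok ok Hpcd' HwW HwW' Hwd' Hdp Hp1 Hp1').
 fold N in Lm, Lp.
 assert (Hed : 0 <= eps * dx <= dx) by nra.
 assert (HN : 0 <= N <= 400 * (W + 2) * dx).
 { unfold N. fin. }
 destruct Hm1 as [Cm _], Hp1 as [Cp _], Hm1' as [Cm' _], Hp1' as [Cp' _].
 generalize (edrift_Lip d P mu W mu_pos W_ge small 1 Rabs_1 pc pc' j zp zp' N (eps * dx) ok ok Hpcd' Hj Cp Cp' ok Lp)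
  (edrift_Lip d P mu W mu_pos W_ge small (-1) Rabs_m1 pc pc' j zm zm' N (eps * dx) ok ok Hpcd' Hj Cm Cm' ok Lm)
  (edrift_le d P mu W mu_pos W_ge small 1 Rabs_1 pc' j zp' ok Hj Cp')
  (edrift_le d P mu W mu_pos W_ge small (-1) Rabs_m1 pc' j zm' ok Hj Cm'). fold F.
 set (e1 := edrift d P mu 1 pc j zp) in *. set (e2 := edrift d P mu (-1) pc j zm) in *.
 set (e1' := edrift d P mu 1 pc' j zp') in *. set (e2' := edrift d P mu (-1) pc' j zm') in *.
 intros L1 L2 B1 B2.
 assert (HTT : Rabs ((xp O - xm O) - (xp' O - xm' O)) <= 2 * dx).
 { generalize (Hdm O (Nat.le_0_l d)) (Hdp O (Nat.le_0_l d)). fin. }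
 set (T := xp O - xm O) in *. set (T' := xp' O - xm' O) in *.
 assert (HiT : 0 < / T <= eps).
 { split; [fin|]. replace eps with (/ (1 / eps)) by fld. fin. }
 assert (HiT' : 0 < / T' <= 1).
 { split; [fin|]. rewrite <- Rinv_1. fin. }
 set (E := e1 + e2). set (E' := e1' + e2').
 assert (Hw1 : w j - (xp j - xm j) / T = - E * / T).
 { apply Rmult_eq_reg_r with T; [|lra]. inv_l; rewrite Rmult_1_r.
  replace ((w j - (xp j - xm j) / T) * T) with (w j * T - (xp j - xm j)) by fld. unfold E; lra. }
 assert (Hw2 : w' j - (xp' j - xm' j) / T' = - E' * / T').
 { apply Rmult_eq_reg_r with T'; [|lra]. inv_l; rewrite Rmult_1_r.
  replace ((w' j - (xp' j - xm' j) / T') * T') with (w' j * T' - (xp' j - xm' j)) by fld. unfold E'; lra. }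
 rewrite Hw1, Hw2.
 replace (- E * / T - - E' * / T') with (((E' - E) + E' * (T - T') * / T') * / T) by fld.
 rewrite Rabs_mult, (Rabs_pos_eq (/ T)) by lra.
 set (m := mu * F) in *. assert (Hm0 : 0 <= m) by lra.
 assert (HE : Rabs (E' - E) <= 512 * m * (N + 2 * (eps * dx))).
 { unfold E, E'. fin. }
 assert (HE' : Rabs (E' * (T - T') * / T') <= 256 * m * (2 * dx) * 1).
 { rewrite !Rabs_mult, (Rabs_pos_eq (/ T')) by lra.
  apply Rmult_le_compat; try lra; [fin|].
  mul_abs; trivial. unfold E'.
  fin. }
 le_thru ((512 * m * (N + 2 * (eps * dx)) + 256 * m * (2 * dx) * 1) * eps).
 - apply Rmult_le_compat; try lra; [fin|]. fin.
 - replace (CRem * eps * mu * dx) with (4000000 * (W + 2) ^ 2 * (m * dx) * eps) by (unfold CRem, m; ring).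
  mul_r.
  assert (Hmd : 0 <= m * dx) by fin.
  assert (m * N <= 400 * (W + 2) * (m * dx)).
  { fin. }
  assert (m * (eps * dx) <= m * dx) by fin.
  assert ((W + 2) * (m * dx) <= (W + 2) ^ 2 * (m * dx)) by (apply Rmult_le_compat_r; trivial; nra).
  fin.
Qed.
End remainder.

(** * Existence of chains of excursions *)

Definition site_sig (d : nat) (b v : vec) : R := v O - vsum d (fun j => b (S j) * v (S j)).
Definition site_pt (d : nat) (om b c v : vec) : vec := fun j =>
 c j + (site_sig d b v * om j + match j with O => 0 | S _ => v j end).
Definition site_ball (d : nat) (r : R) (v : vec) : Prop := v O ^ 2 <= r ^ 2 /\ sq d (vtail v) <= r ^ 2.

(* Near c, in the coordinates given by the flow direction om and by directions conjugate to it, the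
  gradient of the Melnikov potential is strongly monotone and points outwards on the boundary. *)
Definition good_site (d : nat) (P : list trig_mode) (W Bb r kap : R) (om b c : vec) : Prop :=
 om O = 1 /\ (bnd d W om) /\ (forall j, Rabs (b j) <= Bb) /\
 (forall u v, site_ball d r u -> site_ball d r v ->
  kap * vsum (S d) (fun j => (u j - v j) ^ 2) <=
  (site_sig d b u - site_sig d b v) *
   (Gder d P om om (site_pt d om b c u) - Gder d P om om (site_pt d om b c v)) +
  vsum d (fun j => (u (S j) - v (S j)) *
   (Gder d P om (unit_vec (S j)) (site_pt d om b c u) - Gder d P om (unit_vec (S j)) (site_pt d om b c v)))) /\
 (forall u, site_ball d r u -> sq d (vtail u) = r ^ 2 ->
  kap * r ^ 2 <= vsum d (fun j => u (S j) * Gder d P om (unit_vec (S j)) (site_pt d om b c u)) -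
   vsum d (fun j => b (S j) * u (S j)) * Gder d P om om (site_pt d om b c u)) /\
 (forall u, site_ball d r u -> u O ^ 2 = r ^ 2 ->
  kap * r ^ 2 <= u O * Gder d P om om (site_pt d om b c u)).

(* Arc i leads to site i, arc i + 1 leaves it; zi and zo are the two halves of the excursion at site i.
  The extreme arcs lie on the separatrices of the invariant tori (crossing momentum 0). *)
Definition is_chain (d : nat) (P : list trig_mode) (mu W : R) (n : nat)
  (x w : nat -> vec) (pc : nat -> R) (zi zo : nat -> R -> vec) : Prop :=
 pc O = 0 /\ pc n = 0 /\ (forall i, i <=' n -> 0 <= pc i <= mu) /\
 (forall i, i <=' n -> w i O = 1 /\ bnd d W (w i)) /\
 (forall i, i <' n -> is_half d P mu 1 (x i) (w i) (pc i) (zi i) /\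
  is_half d P mu (-1) (x i) (w (S i)) (pc (S i)) (zo i)) /\
 (forall i j, i <' n -> (1 <= j <= d)%nat ->
  w i j + drift d P mu 1 (pc i) j (zi i) PI = w (S i) j + drift d P mu (-1) (pc (S i)) j (zo i) PI) /\
 (forall i, i <' n ->
  pc i ^ 2 / 2 + Aint d P mu (zi i) PI = pc (S i) ^ 2 / 2 + Aint d P mu (zo i) PI) /\
 (forall i, S i <' n -> 0 < pc (S i) /\ forall j, j <=' d -> zi (S i) 0 j = zo i 0 j).

Section chain.
Variables (d : nat) (P : list trig_mode) (W0 Bb r kap eps mu : R) (n : nat) (Om c b : nat -> vec).
Let F := Fbd d P.
Let W := W0 + 4.
Let dB := 1 + INR d * Bb.
Let C1 := CL d W0 Bb.
(** With this choice gaps of length at least [1 / eps] exceed the [10 * W / e] required by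
    [gap_velocity_Lip]. *)
Let e := 16 * W * eps.
Let epsN := 4 * CRem d P W * C1 * e.
Hypothesis n_pos : 1 <=' n.
Hypothesis mu_pos : 0 < mu <= 1.
Hypothesis W0_ge : 1 <= W0.
Hypothesis Bb_pos : 0 <= Bb.
Hypothesis r_range : 0 < r <= 1.
Hypothesis eps_pos : 0 < eps <= 1.
Hypothesis e_le : e <= 1.
Hypothesis small : mu * F * (W + 2) <= / 10000000.
Hypothesis muF_e : mu * F <= e.
Hypothesis muF_e2 : 4000000 * (W * (mu * F)) <= e.
Hypothesis mu_CRem : CRem d P W * mu <= / 2.
Hypothesis eps_dB : eps * dB <= 1 / 4.

Hypothesis Om_0 : forall i, Om i O = 1.
Hypothesis Om_le : forall i j, j <=' d -> Rabs (Om i j) <= W0.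
Hypothesis Om_step : forall i j, j <=' d -> Rabs (Om (S i) j - Om i j) <= eps * mu.
Hypothesis b_le : forall i j, Rabs (b i j) <= Bb.
Hypothesis c_step : forall i j, S i <' n -> j <=' d ->
 c (S i) j - c i j = (c (S i) O - c i O) * Om (S i) j.
Hypothesis c_gap : forall i, S i <' n -> 1 / eps + 2 * dB <= c (S i) O - c i O.
Hypothesis c_log : forall i, S i <' n -> 2 + 8 * (ln 4 - ln mu) + 2 * dB < c (S i) O - c i O.

Let inb := in_balls n d r.
Notation X := (Xs d Om c b).

Let W_ge : 2 <= W. Proof. unfold W; lra. Qed.
Let e_pos : 0 < e <= 1. Proof. split; [unfold e, W; nra|fin]. Qed.
Let mu0 : 0 < mu. Proof. lra. Qed.
Let C1_ge : 1 <= C1. Proof. apply (CL_ge d W0 Bb W0_ge Bb_pos). Qed.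
Let CR_pos : 0 < CRem d P W.
Proof. unfold CRem. generalize (Fbd_ge1 d P). fin. Qed.

Let Ce_pos : 0 <= CRem d P W * e * mu.
Proof. fin. Qed.

Definition gapdata : Type := (vec * R * (R -> vec) * (R -> vec))%type.
Definition gd (u : nat -> vec) (k : nat) : gapdata :=
 epsilon (inhabits (fun _ => 0, 0, fun _ _ => 0, fun _ _ => 0))
  (fun g : gapdata => is_gap d P mu W (X u k) (X u (S k)) (fst (fst (fst g))) (snd (fst (fst g))) (snd (fst g)) (snd g)).
Definition arc_w (u : nat -> vec) (i : nat) : vec :=
 match i with O => Om 0 | S k => if Nat.eqb i n then Om n else fst (fst (fst (gd u k))) end.
Definition arc_pc (u : nat -> vec) (i : nat) : R :=
 match i with O => 0 | S k => if Nat.eqb i n then 0 else snd (fst (fst (gd u k))) end.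
Definition end_half (s : R) (x w : vec) : R -> vec :=
 epsilon (inhabits (fun _ _ => 0)) (is_half d P mu s x w 0).
Definition half_in (u : nat -> vec) (i : nat) : R -> vec :=
 match i with O => end_half 1 (X u O) (Om 0) | S k => snd (gd u k) end.
Definition half_out (u : nat -> vec) (i : nat) : R -> vec :=
 if Nat.eqb (S i) n then end_half (-1) (X u i) (Om n) else snd (fst (gd u i)).

Lemma gd_time u k : inb u -> S k <' n ->
 10 * W / e <= X u (S k) O - X u k O.
Proof.
 intros Hu Hk.
 le_thru (1 / eps); [|apply (Dt_ge n d mu eps Bb r Om c b); trivial].
 unfold e. replace (10 * W / (16 * W * eps)) with (5 / 8 * (1 / eps)) by fld.
 assert (0 < 1 / eps) by fin. lra.
Qed.

Lemma Ib_0 u i : inb u -> i <=' n -> Ib n d Om c b u i O = 1.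
Proof.
 intros Hu Hi. destruct i as [|k]; [apply Om_0|]. unfold Ib. destruct (Nat.eqb_spec (S k) n); [fin|].
 unfold Dt. apply Rdiv_diag. assert (H := gd_time u k Hu ok).
 assert (0 < 10 * W / e) by fin. lra.
Qed.

Lemma Ib_Om u i j : inb u -> i <=' n -> j <=' d -> Rabs (Ib n d Om c b u i j - Om i j) <= e / 4.
Proof.
 intros Hu Hi Hj. destruct j as [|j].
 - rewrite Ib_0, Om_0 by trivial. fin.
 - destruct (Ib_decomp n d mu eps Bb r Om c b n_pos mu_pos eps_pos Bb_pos r_range eps_dB Om_0 Om_step b_le c_step c_gap
   u i (S j) Hu Hi ok) as (e1 & He1 & ->).
  assert (H1 := dxi_le n d r n_pos r_range u i (S j) Hu Hi ok).
  assert (H2 : 0 <= cg n d Om c b u i <= eps) by (eapply (cg_range n d mu eps Bb r Om c b); eauto).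
  assert (H3 : Rabs (cg n d Om c b u i * dxi n u i (S j)) <= eps * 2).
  { rewrite Rabs_mult, (Rabs_pos_eq (cg _ _ _ _ _ _ _)) by lra. fin. }
  replace (Om i (S j) + cg n d Om c b u i * dxi n u i (S j) + e1 - Om i (S j)) with (cg n d Om c b u i * dxi n u i (S j) + e1) by ring.
  triang. unfold e, W. nra.
Qed.

Lemma gd_spec u k : inb u -> S k <' n ->
 is_gap d P mu W (X u k) (X u (S k)) (fst (fst (fst (gd u k)))) (snd (fst (fst (gd u k)))) (snd (fst (gd u k))) (snd (gd u k)).
Proof.
 intros Hu Hk. unfold gd. apply epsilon_spec.
 destruct (gap_exists d P mu W mu0 W_ge small (X u k) (X u (S k))) as (w & pc & zm & zp & H).
 - generalize (c_log k Hk). rewrite !(Xs_time d Om c b Om_0).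
  assert (Hs : forall i, i <' n -> Rabs (sig d b i (u i)) <= dB)
   by (intros; apply (sig_le n d mu eps Bb r b); trivial).
  generalize (Hs k ok) (Hs (S k) ok). fin.
 - intros j Hj. assert (HT := gd_time u k Hu Hk).
  assert (0 < 10 * W / e) by fin.
  set (T := X u (S k) O - X u k O) in *.
  assert (HI : Rabs (Ib n d Om c b u (S k) j) <= W - 1).
  { note (Ib_Om u (S k) j Hu ok Hj) (Om_le (S k) j Hj) as H1 H2.
   apply Rabs_le_between in H1, H2. unfold W. fin. }
  unfold Ib in HI. destruct (Nat.eqb_spec (S k) n); [lia|]. unfold Dt in HI. fold T in HI.
  unfold Rdiv in HI. rewrite Rabs_mult, Rabs_inv, (Rabs_pos_eq T) in HI by lra.
  apply Rmult_le_reg_r with (/ T); [fin|].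
  rewrite (Rmult_assoc (W - 1)), Rinv_r, Rmult_1_r by lra. exact HI.
 - exists (w, pc, zm, zp). exact H.
Qed.

Lemma arc_spec u i : inb u -> i <=' n ->
 0 <= arc_pc u i <= mu /\ arc_w u i O = 1 /\
 (forall j, j <=' d -> Rabs (arc_w u i j) <= W /\
  Rabs (arc_w u i j - Ib n d Om c b u i j) <= CRem d P W * e * mu).
Proof.
 intros Hu Hi.
 assert (H0 := Ce_pos).
 assert (Hend : forall i j, j <=' d -> Rabs (Om i j) <= W) by (intros; eapply Rle_trans; [fin|unfold W; lra]).
 unfold arc_pc, arc_w, Ib. destruct i as [|k].
 { fin. }
 destruct (Nat.eqb_spec (S k) n) as [_|Hn].
 { fin. }
 assert (Hg := gd_spec u k Hu ok). assert (Hv := fun j Hj => gap_velocity d P mu W e mu0 W_ge small e_pos _ _ _ _ _ _ j Hg Hj (gd_time u k Hu ok)).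
 destruct Hg as (Hg0 & Hg1 & Hg2 & _). repeat split; try lra; trivial; [fin|]. fin.
Qed.

Lemma arc_Om u i k j : inb u -> i <' n -> j <=' d -> k = i \/ k = S i ->
 Rabs (arc_w u k j - Om (S i) j) <= e.
Proof.
 intros Hu Hi Hj Hk. assert (Hkn : k <=' n) by lia.
 destruct (arc_spec u k Hu Hkn) as (_ & _ & H). destruct (H j Hj) as [_ H1].
 assert (H2 := Ib_Om u k j Hu Hkn Hj).
 assert (H3 : Rabs (Om k j - Om (S i) j) <= e / 4).
 { destruct Hk as [->| ->].
  - rewrite Rabs_minus_sym. le_by fin. unfold e, W. nra.
  - fin. }
 assert (CRem d P W * e * mu <= e / 2).
 { fin. }
 fin.
Qed.

Lemma halves_spec u i : inb u -> i <' n ->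
 is_half d P mu 1 (X u i) (arc_w u i) (arc_pc u i) (half_in u i) /\
 is_half d P mu (-1) (X u i) (arc_w u (S i)) (arc_pc u (S i)) (half_out u i).
Proof.
 intros Hu Hi.
 assert (HW : 0 <= W) by lra.
 assert (Hend : forall s x i, Rabs s = 1 -> is_half d P mu s x (Om i) 0 (end_half s x (Om i))).
 { intros s x k Hs. unfold end_half. apply epsilon_spec. apply (half_exists d P mu W); trivial; [lra|].
  intros j Hj. eapply Rle_trans; [fin|unfold W; lra]. }
 split.
 - destruct i as [|k]; unfold arc_w, arc_pc, half_in; [apply Hend, Rabs_1|].
  destruct (Nat.eqb_spec (S k) n); [lia|]. now apply gd_spec.
 - unfold arc_w, arc_pc, half_out. destruct (Nat.eqb_spec (S i) n) as [E1|E1]; [apply Hend, Rabs_m1|].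
  apply (gd_spec u i); trivial; lia.
Qed.

Lemma arc_Lip u v i D : inb u -> inb v -> i <=' n ->
 (forall k j, k <' n -> k = i \/ S k = i -> j <=' d -> Rabs (X u k j - X v k j) <= D) ->
 0 <= D ->
 Rabs (arc_pc u i - arc_pc v i) <= e * D /\ forall j, j <=' d -> Rabs (arc_w u i j - arc_w v i j) <= e * D /\
 Rabs ((arc_w u i j - Ib n d Om c b u i j) - (arc_w v i j - Ib n d Om c b v i j)) <= CRem d P W * e * mu * D.
Proof.
 intros Hu Hv Hi HX HD.
 assert (H0 : 0 <= CRem d P W * e * mu * D) by fin.
 assert (H1 : 0 <= e * D) by fin.
 unfold arc_pc, arc_w, Ib. destruct i as [|k].
 { fin. }
 destruct (Nat.eqb_spec (S k) n) as [_|Hn].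
 { fin. }
 destruct (gap_velocity_Lip d P mu W e mu0 W_ge small e_pos muF_e muF_e2 _ _ _ _ _ _ _ _ _ _ _ _ D
  (gd_spec u k Hu ok) (gd_spec v k Hv ok) (gd_time u k Hu ok) (gd_time v k Hv ok)) as (G1 & G2 & G3).
 - intros j Hj. apply HX; [lia|fin|fin].
 - intros j Hj. apply HX; [lia|fin|fin].
 - fin.
Qed.

Definition I_in u i j := arc_w u i j + drift d P mu 1 (arc_pc u i) j (half_in u i) PI.
Definition I_out u i j := arc_w u (S i) j + drift d P mu (-1) (arc_pc u (S i)) j (half_out u i) PI.
Definition P_in u i := arc_pc u i ^ 2 / 2 + Aint d P mu (half_in u i) PI.
Definition P_out u i := arc_pc u (S i) ^ 2 / 2 + Aint d P mu (half_out u i) PI.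
Definition Gae0 u i := Gder d P (Om (S i)) (Om (S i)) (X u i).
Definition Gaphi0 u i j := Gder d P (Om (S i)) (unit_vec j) (X u i).
(** Defined as what is left, so that the equations of [discrete_equilibrium] are exactly the
    matching conditions; the work is to bound it through [Rphi0_split]. *)
Definition Rphi0 u i j := I_in u i j - I_out u i j - (Ib n d Om c b u i j - Ib n d Om c b u (S i) j) - mu * Gaphi0 u i j.
Definition Re0 u i := - (P_in u i - P_out u i) - mu * Gae0 u i.

Let Om_leW i j : j <=' d -> Rabs (Om i j) <= W.
Proof. intros; eapply Rle_trans; [fin|unfold W; lra]. Qed.

Lemma Rphi0_split u i j : (1 <= j <= d)%nat -> Rphi0 u i j =
 (arc_w u i j - Ib n d Om c b u i j) - (arc_w u (S i) j - Ib n d Om c b u (S i) j) +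
 (drift d P mu 1 (arc_pc u i) j (half_in u i) PI - drift0 d P mu 1 j (Om (S i)) (X u i)) -
 (drift d P mu (-1) (arc_pc u (S i)) j (half_out u i) PI - drift0 d P mu (-1) j (Om (S i)) (X u i)).
Proof.
 intros Hj. unfold Rphi0, Gaphi0, I_in, I_out. rewrite <- (drift0_jump d P mu (Om (S i)) (X u i) j Hj). ring.
Qed.

Lemma Re0_split u i : Re0 u i =
 arc_pc u (S i) ^ 2 / 2 - arc_pc u i ^ 2 / 2 -
 (Aint d P mu (half_in u i) PI - Aint d P mu (z0 1 (Om (S i)) (X u i)) PI) +
 (Aint d P mu (half_out u i) PI - Aint d P mu (z0 (-1) (Om (S i)) (X u i)) PI).
Proof.
 unfold Re0, P_in, P_out, Gae0.
 assert (HA := Aint_jump d P mu (Om (S i)) (X u i)). fold F in HA.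
 generalize (F1 d P) (mu_le_muF d P mu mu0). fold F. intros HF Hm.
 assert (HmF : mu * F <= / 10000000) by (unfold W in small; nra).
 rewrite Rabs_pos_eq in HA by lra. fin.
Qed.

Lemma epsN_ge : 4 * (CRem d P W * e * mu) <= epsN * mu /\ 4 * (CRem d P W * e) * C1 = epsN.
Proof.
 split; [|unfold epsN; ring]. unfold epsN.
 fin.
Qed.

Lemma pc_sq u i : inb u -> i <=' n -> 0 <= arc_pc u i ^ 2 / 2 <= CRem d P W * e * mu.
Proof.
 intros Hu Hi. destruct (arc_spec u i Hu Hi) as (Hp & _). generalize (mu_le_muF d P mu mu0). fold F. intros Hm.
 assert (HC : 1 <= CRem d P W). { unfold CRem. generalize (F1 d P). fin. }
 split; [nra|]. le_thru (e * mu); [nra|].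
 fin.
Qed.

Lemma R0_le u i : inb u -> i <' n ->
 (forall j, (1 <= j <= d)%nat -> Rabs (Rphi0 u i j) <= epsN * mu) /\ Rabs (Re0 u i) <= epsN * mu.
Proof.
 intros Hu Hi. destruct epsN_ge as [HN _]. destruct (halves_spec u i Hu Hi) as [Hh1 Hh2].
 destruct (arc_spec u i Hu ok) as (P1 & _ & A1). destruct (arc_spec u (S i) Hu ok) as (P2 & _ & A2).
 destruct (port_size d P mu W e mu0 W_ge small e_pos muF_e 1 (Om (S i)) Rabs_1 (Om_leW (S i)) _ _ _ _ P1 Hh1
  (fun j Hj => arc_Om u i i j Hu Hi Hj (or_introl eq_refl))) as [D1 E1].
 destruct (port_size d P mu W e mu0 W_ge small e_pos muF_e (-1) (Om (S i)) Rabs_m1 (Om_leW (S i)) _ _ _ _ P2 Hh2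
  (fun j Hj => arc_Om u i (S i) j Hu Hi Hj (or_intror eq_refl))) as [D2 E2].
 split.
 - intros j Hj. rewrite Rphi0_split by trivial.
  destruct (A1 j ok) as [_ B1]. destruct (A2 j ok) as [_ B2].
  specialize (D1 j ok). specialize (D2 j ok).
  fin.
 - rewrite Re0_split. generalize (pc_sq u i Hu ok) (pc_sq u (S i) Hu ok). intros.
  fin.
Qed.

Lemma R0_Lip u v i : inb u -> inb v -> i <' n ->
 (forall j, (1 <= j <= d)%nat -> Rabs (Rphi0 u i j - Rphi0 v i j) <= epsN * mu * N3 n d u v i) /\
 Rabs (Re0 u i - Re0 v i) <= epsN * mu * N3 n d u v i.
Proof.
 intros Hu Hv Hi. destruct epsN_ge as [_ HN].
 destruct (halves_spec u i Hu Hi) as [Hh1 Hh2]. destruct (halves_spec v i Hv Hi) as [Hh1' Hh2'].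
 destruct (arc_spec u i Hu ok) as (P1 & _ & A1). destruct (arc_spec u (S i) Hu ok) as (P2 & _ & A2).
 destruct (arc_spec v i Hv ok) as (P1' & _ & A1'). destruct (arc_spec v (S i) Hv ok) as (P2' & _ & A2').
 set (D := C1 * N3 n d u v i).
 destruct (N3_ge n d u v i) as (NA & NB & NC & ND).
 assert (HD : 0 <= D) by (apply Rmult_le_pos; lra).
 assert (HX : forall k j, k <' n -> k = i \/ k = S i \/ S k = i -> j <=' d -> Rabs (X u k j - X v k j) <= D).
 { intros k j Hk Hki Hj. le_by (apply (Xs_Lip n d W0 Bb Om c b); trivial).
  unfold D. fold C1. mul_l. destruct Hki as [->|[->|E]]; trivial. subst i. exact ND. }
 destruct (arc_Lip u v i D Hu Hv ok) as [Q1 L1]; trivial.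
 { intros k j Hk Hki Hj. apply HX; trivial. tauto. }
 destruct (arc_Lip u v (S i) D Hu Hv ok) as [Q2 L2]; trivial.
 { intros k j Hk Hki Hj. apply HX; trivial. fin. }
 destruct (port_Lip d P mu W e mu0 W_ge small e_pos muF_e 1 (Om (S i)) Rabs_1 (Om_leW (S i)) _ _ _ _ _ _ _ _ D P1 P1' Hh1 Hh1'
  (fun j Hj => proj1 (A1 j Hj)) (fun j Hj => proj1 (A1' j Hj)) (fun j Hj => arc_Om v i i j Hv Hi Hj (or_introl eq_refl))
  (fun j Hj => HX i j Hi (or_introl eq_refl) Hj) (fun j Hj => proj1 (L1 j Hj)) Q1) as [D1 E1].
 destruct (port_Lip d P mu W e mu0 W_ge small e_pos muF_e (-1) (Om (S i)) Rabs_m1 (Om_leW (S i)) _ _ _ _ _ _ _ _ D P2 P2' Hh2 Hh2'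
  (fun j Hj => proj1 (A2 j Hj)) (fun j Hj => proj1 (A2' j Hj)) (fun j Hj => arc_Om v i (S i) j Hv Hi Hj (or_intror eq_refl))
  (fun j Hj => HX i j Hi (or_introl eq_refl) Hj) (fun j Hj => proj1 (L2 j Hj)) Q2) as [D2 E2].
 assert (Hfin : epsN * mu * N3 n d u v i = 4 * (CRem d P W * e * mu * D)) by (unfold D; rewrite <- HN; ring).
 rewrite Hfin. split.
 - intros j Hj. rewrite !Rphi0_split by trivial.
  destruct (L1 j ok) as [_ B1]. destruct (L2 j ok) as [_ B2].
  specialize (D1 j ok). specialize (D2 j ok).
  fin.
 - rewrite !Re0_split.
  assert (Hsq : forall p p', 0 <= p <= mu -> 0 <= p' <= mu -> Rabs (p - p') <= e * D ->
   Rabs (p ^ 2 / 2 - p' ^ 2 / 2) <= CRem d P W * e * mu * D).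
  { intros p p' Hp Hp' Hpp. replace (p ^ 2 / 2 - p' ^ 2 / 2) with ((p + p') / 2 * (p - p')) by field.
   rewrite Rabs_mult, (Rabs_pos_eq ((p + p') / 2)) by lra.
   le_thru (mu * (e * D)); [fin|].
   assert (HC : 1 <= CRem d P W). { unfold CRem. generalize (F1 d P). unfold W. intros. nra. }
   replace (CRem d P W * e * mu * D) with (CRem d P W * (mu * (e * D))) by ring.
   assert (0 <= mu * (e * D)) by fin. nra. }
  note (Hsq _ _ P1 P1' Q1) (Hsq _ _ P2 P2' Q2) as S1 S2.
  fin.
Qed.
End chain.

(** Serves several smallness conditions [X * Y <= A] at once: [M] is a sum that dominates all the
    ratios [Y / A]. *)
Lemma small_product A X Y M : 0 <= X <= / M -> 0 < M -> Y <= A * M -> X * Y <= Rmax 0 A.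
Proof.
 intros HX HM HY. assert (HA := Rmax_l 0 A). assert (HA' := Rmax_r 0 A).
 le_thru (X * (Rmax 0 A * M)).
 - mul_l. fin.
 - rewrite (Rmult_comm (Rmax 0 A)), <- Rmult_assoc. rewrite <- (Rmult_1_l (Rmax 0 A)) at 2.
  apply Rmult_le_compat_r; trivial. le_thru (/ M * M); [fin|].
  rewrite Rinv_l; lra.
Qed.

(** Two parameters are kept apart: [eps] limits the frequency step [eps * mu] and so enters the
    diffusion time, while [theta] measures the spacing and only controls how close the velocities
    stay to [Om]. The tolerance of the final theorem acts on [theta] and on the threshold for [mu],
    so the time constant stays independent of it. *)
Theorem chain_exists d P W0 Bb r kap : 1 <= W0 -> 0 <= Bb -> 0 < r <= 1 -> 0 < kap ->
 exists eps0, 0 < eps0 <= 1 /\ forall eps, 0 < eps <= eps0 -> exists mu0, 0 < mu0 <= 1 /\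
 forall mu theta n Om c b, 0 < mu <= mu0 -> 0 < theta <= eps -> 1 <=' n ->
 (forall i, Om i O = 1) -> (forall i j, j <=' d -> Rabs (Om i j) <= W0) ->
 (forall i j, j <=' d -> Rabs (Om (S i) j - Om i j) <= eps * mu) ->
 (forall i j, Rabs (b i j) <= Bb) ->
 (forall i, i <' n -> good_site d P W0 Bb r kap (Om (S i)) (b i) (c i)) ->
 (forall i j, S i <' n -> j <=' d -> c (S i) j - c i j = (c (S i) O - c i O) * Om (S i) j) ->
 (forall i, S i <' n -> 1 / theta + 2 * (1 + INR d * Bb) <= c (S i) O - c i O) ->
 (forall i, S i <' n -> 2 + 8 * (ln 4 - ln mu) + 2 * (1 + INR d * Bb) < c (S i) O - c i O) ->
 exists x w pc zi zo, is_chain d P mu (W0 + 4) n x w pc zi zo /\ w O = Om O /\ w n = Om n /\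
  (forall i j, i <=' n -> (1 <= j <= d)%nat -> Rabs (w i j - Om i j) <= 2 * theta + (1 + CRem d P (W0 + 4)) * mu) /\
  (forall i j, i <' n -> j <=' d -> Rabs (x i j - c i j) <= CL d W0 Bb).
Proof.
 intros HW0 HBb Hr Hk.
 assert (HF := Fbd_ge1 d P). set (F := Fbd d P) in *.
 set (W := W0 + 4). set (K := INR d). assert (HK : 0 <= K) by apply pos_INR. set (dB := 1 + K * Bb).
 assert (HKB : 0 <= K * Bb) by fin.
 assert (HC1 : 1 <= CL d W0 Bb) by (apply (CL_ge d W0 Bb HW0 HBb)). set (C1 := CL d W0 Bb) in *.
 set (CG := 64 * F * W0 * C1).
 assert (HWC : 1 <= W0 * C1) by nra.
 assert (HCG : 0 < CG /\ 64 * F <= CG /\ 64 * F * C1 <= CG).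
 { unfold CG. replace (64 * F * W0 * C1) with (64 * F * (W0 * C1)) by ring. split; [|split].
  - fin.
  - fin.
  - mul_l. nra. }
 set (Q := 4 * K + K * Bb + K * Bb * K * (4 * CG + 24) + 2).
 set (CR := 1 + K * (3 * (CG + 1) + 2 * (W0 + 4) * C1 * (CG + 1))).
 set (Q2 := 9 * INR (S d) * ((dB + K) * CR)).
 assert (HW : 5 <= W) by (unfold W; lra).
 assert (HCR : 4000000 <= CRem d P W) by (unfold CRem; fold F; nra).
 set (A := 4 * CRem d P W * C1 * (16 * W)).
 assert (HA : 16 * W <= A).
 { unfold A. assert (1 <= 4 * CRem d P W * C1) by nra. nra. }
 assert (HQ : 0 <= Q).
 { unfold Q. assert (0 <= K * Bb * K * (4 * CG + 24)) by fin. lra. }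
 assert (HQ2 : 0 <= Q2).
 { unfold Q2, CR, dB. generalize (pos_INR (S d)). intros.
  assert (0 <= K * (3 * (CG + 1) + 2 * (W0 + 4) * C1 * (CG + 1))).
  { apply Rmult_le_pos; trivial. fin. }
  fin. }
 assert (Hkr : 0 < kap * r ^ 2) by fin.
 set (M := 1 + 4 * dB + 12 * (K * Bb) + Q / (kap * r ^ 2 / 2) + Q2 / (kap / 2)).
 assert (HM1 : 0 <= Q / (kap * r ^ 2 / 2)) by fin.
 assert (HM2 : 0 <= Q2 / (kap / 2)) by fin.
 assert (HdB : 1 <= dB) by (unfold dB; lra).
 assert (HM : 5 <= M) by (unfold M; lra).
 assert (HAM : 1 <= A * M) by nra.
 assert (HA0 : 0 < A) by lra.
 exists (/ (A * M)). split.
 { split; [fin|]. rewrite <- Rinv_1. fin. }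
 intros eps Heps.
 assert (HAe : 0 < A * eps <= / M).
 { split; [nra|]. le_thru (A * / (A * M)); [fin|].
  right. field. lra. }
 assert (HiM : / M <= / 5) by fin.
 set (e := 16 * W * eps).
 assert (He : 0 < e <= A * eps) by (unfold e; split; nra).
 (* Chosen after [eps]: it makes [mu * F * (W + 2) ^ 2] small against [e], from which all smallness
    conditions on [mu] follow. *)
 exists (e / (10000000 * (W + 2) ^ 2 * F)).
 assert (HD : 10000000 <= 10000000 * (W + 2) ^ 2 * F) by nra.
 set (D := 10000000 * (W + 2) ^ 2 * F) in *.
 split.
 { split; [fin|]. reg_r D. unfold Rdiv. inv_l. nra. }
 intros mu theta n Om c b Hmu Hth Hn HOm0 HOmW HOms Hb Hsite Hcs Hcgt Hcl.
 assert (Hcg : forall i, S i <' n -> 1 / eps + 2 * (1 + INR d * Bb) <= c (S i) O - c i O).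
 { intros i Hi. eapply Rle_trans; [|fin]. apply Rplus_le_compat_r. unfold Rdiv. fin. }
 assert (HmuD : mu * D <= e).
 { le_thru (e / D * D); [fin|]. right. field. lra. }
 assert (Hmu1 : 0 < mu <= 1) by nra.
 set (m := mu * F).
 assert (Hm : 0 < m /\ m * (10000000 * (W + 2) ^ 2) <= e).
 { unfold m. split; [nra|]. unfold D in HmuD. lra. }
 destruct Hm as [Hm0 Hm].
 assert (Hs1 : m * (W + 2) <= / 10000000).
 { assert (m * (W + 2) * 10000000 <= m * (10000000 * (W + 2) ^ 2)).
  { replace (m * (W + 2) * 10000000) with (m * (10000000 * (W + 2))) by ring. apply Rmult_le_compat_l; nra. } lra. }
 assert (Hs2 : m <= e).
 { assert (m * 1 <= m * (10000000 * (W + 2) ^ 2)) by (apply Rmult_le_compat_l; nra). lra. }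
 assert (Hs3 : 4000000 * (W * m) <= e).
 { assert (m * (4000000 * W) <= m * (10000000 * (W + 2) ^ 2)) by (apply Rmult_le_compat_l; nra). lra. }
 assert (Hs4 : CRem d P W * mu <= / 2).
 { unfold CRem. fold F. replace (4000000 * (W + 2) ^ 2 * F * mu) with (2 / 5 * (m * (10000000 * (W + 2) ^ 2))) by (unfold m; field). lra. }
 assert (Hed : eps * dB <= 1 / 4).
 { assert (A * eps * dB <= Rmax 0 (1 / 4)) by (apply (small_product _ _ _ M); [lra|lra|unfold M; lra]).
  rewrite Rmax_right in H by lra. assert (eps * dB <= A * eps * dB); [|lra]. apply Rmult_le_compat_r; nra. }
 assert (He1 : e <= 1) by lra. assert (Heps1 : 0 < eps <= 1) by nra.
 assert (HepsN : 4 * CRem d P W * C1 * e = A * eps) by (unfold A, e; ring).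
 assert (Hinb : forall u i, in_balls n d r u -> i <' n -> site_ball d r (u i)) by (intros u i Hu Hi; exact (Hu i Hi)).
 destruct (discrete_equilibrium n d mu (A * eps) W0 Bb CG r kap Om c b
  (Gae0 d P Om c b) (Re0 d P W0 mu n Om c b) (Gaphi0 d P Om c b) (Rphi0 d P W0 mu n Om c b)) as (u & Hu & H); trivial; try lra.
 - fold K dB. assert (A * eps * dB <= Rmax 0 (1 / 4)) by (apply (small_product _ _ _ M); [lra|lra|unfold M; lra]).
  rewrite Rmax_right in H; lra.
 - intros i j Hj. le_by fin. apply Rmult_le_compat_r; [lra|nra].
 - intros i Hi. eapply Rle_trans; [|fin]. fold K dB. apply Rplus_le_compat_r.
  unfold Rdiv. rewrite !Rmult_1_l. apply Rinv_le_contravar; [lra|nra].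
 - intros u v i Hu Hv Hi. destruct (Hsite i Hi) as (_ & _ & _ & S1 & _). fin.
 - intros u i Hu Hi Hbd. destruct (Hsite i Hi) as (_ & _ & _ & _ & S2 & _). fin.
 - intros u i Hu Hi Hbd. destruct (Hsite i Hi) as (_ & _ & _ & _ & _ & S3). fin.
 - intros u i j Hu Hi Hj. eapply Rle_trans; [apply (Gder_le d P _ _ _ 1); [lra|]|fold F; lra].
  intros k Hk1. unfold unit_vec. destruct (Nat.eqb k j); rewrite ?Rabs_R1, ?Rabs_R0; lra.
 - intros u v i j Hu Hv Hi Hj. unfold Gaphi0.
  le_by (apply (Gder_Lip d P _ _ _ _ 1 (C1 * N1 n d u v i)); [lra| |]).
  + intros k Hk1. unfold unit_vec. destruct (Nat.eqb k j); rewrite ?Rabs_R1, ?Rabs_R0; lra.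
  + intros k Hk1. apply (Xs_Lip n d W0 Bb); trivial.
  + fold F. rewrite Rmult_1_r, <- Rmult_assoc. apply Rmult_le_compat_r; [apply (N1_pos n d)|lra].
 - intros u v i Hu Hv Hi. unfold Gae0.
  le_by (apply (Gder_Lip d P _ _ _ _ W0 (C1 * N1 n d u v i)); [lra|fin|]).
  + intros k Hk1. apply (Xs_Lip n d W0 Bb); trivial.
  + fold F. rewrite <- Rmult_assoc. apply Rmult_le_compat_r; [apply (N1_pos n d)|unfold CG; lra].
 - intros u i j Hu Hi Hj. rewrite <- HepsN. apply (R0_le d P W0 Bb r eps mu n Om c b); trivial.
 - intros u i Hu Hi. rewrite <- HepsN. apply (R0_le d P W0 Bb r eps mu n Om c b); trivial.
 - intros u v i j Hu Hv Hi Hj. rewrite <- HepsN. apply (R0_Lip d P W0 Bb r eps mu n Om c b); trivial.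
 - intros u v i Hu Hv Hi. rewrite <- HepsN. apply (R0_Lip d P W0 Bb r eps mu n Om c b); trivial.
 - fold K Q. apply Rle_lt_trans with (kap * r ^ 2 / 2); [|lra].
  assert (A * eps * Q <= Rmax 0 (kap * r ^ 2 / 2)); [|rewrite Rmax_right in H; lra].
  apply (small_product _ _ _ M); try lra. apply Rmult_le_reg_r with (/ (kap * r ^ 2 / 2)); [fin|].
  replace (kap * r ^ 2 / 2 * M * / (kap * r ^ 2 / 2)) with M by (field; split; lra).
  change (Q * / (kap * r ^ 2 / 2)) with (Q / (kap * r ^ 2 / 2)). unfold M; lra.
 - fold K. assert (A * eps * (12 * (K * Bb)) <= Rmax 0 1) by (apply (small_product _ _ _ M); [lra|lra|unfold M; lra]).
  rewrite Rmax_right in H; lra.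
 - fold K dB C1. change (A * eps * Q2 <= kap / 2).
  assert (A * eps * Q2 <= Rmax 0 (kap / 2)); [|rewrite Rmax_right in H; lra].
  apply (small_product _ _ _ M); try lra. apply Rmult_le_reg_r with (/ (kap / 2)); [fin|].
  replace (kap / 2 * M * / (kap / 2)) with M by fld.
  change (Q2 * / (kap / 2)) with (Q2 / (kap / 2)). unfold M; lra.
 - assert (Harc : forall i, i <=' n -> 0 <= arc_pc d P W0 mu n Om c b u i <= mu /\ arc_w d P W0 mu n Om c b u i O = 1 /\
   (forall j, j <=' d -> Rabs (arc_w d P W0 mu n Om c b u i j) <= W /\
    Rabs (arc_w d P W0 mu n Om c b u i j - Ib n d Om c b u i j) <= CRem d P W * e * mu)).
  { intros i Hi. apply (arc_spec d P W0 Bb r eps mu n Om c b); trivial. }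
  exists (Xs d Om c b u), (arc_w d P W0 mu n Om c b u), (arc_pc d P W0 mu n Om c b u),
   (half_in d P W0 mu Om c b u), (half_out d P W0 mu n Om c b u).
  split; [repeat apply conj|split; [|split; [|split]]].
  + reflexivity.
  + unfold arc_pc. destruct n; [lia|]. now rewrite Nat.eqb_refl.
  + intros i Hi. now destruct (Harc i Hi).
  + intros i Hi. destruct (Harc i Hi) as (_ & H1 & H2). split; trivial. intros j Hj. now destruct (H2 j Hj).
  + intros i Hi. apply (halves_spec d P W0 Bb r eps mu n Om c b); trivial.
  + intros i j Hi Hj. destruct (H i Hi) as [H1 _]. specialize (H1 j Hj). unfold Gphi, Rphi0, I_in, I_out in H1.
   fin.
  + intros i Hi. destruct (H i Hi) as [_ H1]. unfold Re0, P_in, P_out in H1. lra.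
  + intros i Hi. assert (Hg := gd_spec d P W0 Bb r eps mu n Om c b Hn Hmu1 HW0 HBb Hr Heps1 He1 Hs1 Hed HOm0 HOmW HOms Hb Hcs Hcg Hcl u i Hu Hi).
   destruct Hg as (_ & Hpc & _ & _ & _ & Hc). unfold arc_pc, half_in, half_out.
   destruct (Nat.eqb_spec (S i) n); [lia|]. fin.
  + reflexivity.
  + unfold arc_w. destruct n; [lia|]. now rewrite Nat.eqb_refl.
  + intros i j Hi Hj. destruct (Harc i Hi) as (_ & _ & H2). destruct (H2 j ok) as [_ H3].
   destruct (Ib_decomp n d mu eps Bb r Om c b Hn Hmu1 Heps1 HBb Hr Hed HOm0 HOms Hb Hcs Hcg u i j Hu Hi Hj) as (e1 & He2 & E).
   rewrite E in H3.
   assert (H5 := dxi_le n d r Hn Hr u i j Hu Hi Hj).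
   assert (H6 : 0 <= cg n d Om c b u i <= theta) by (apply (cg_range n d mu theta Bb r Om c b); trivial; lra).
   assert (H7 : Rabs (cg n d Om c b u i * dxi n u i j) <= theta * 2).
   { rewrite Rabs_mult, (Rabs_pos_eq (cg _ _ _ _ _ _ _)) by lra. fin. }
   assert (CRem d P W * e * mu <= CRem d P W * mu) by (mul_r; rewrite <- (Rmult_1_r (CRem d P W)) at 2; apply Rmult_le_compat_l; lra).
   assert (eps * mu / 4 <= mu) by nra.
   fin.
  + intros i j Hi Hj. unfold Xs, Lmap.
   match goal with |- Rabs (?a + ?b - ?a) <= _ => replace (a + b - a) with b by ring end.
   assert (Hsg : Rabs (sig d b i (u i)) <= dB) by (apply (sig_le n d mu eps Bb r b); trivial).
   triang. unfold C1, CL. fold K. fold dB. apply Rplus_le_compat.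
   * fin.
   * destruct j as [|j]; [fin|].
    eapply Rle_trans; [apply (inb_comp n d r Hn Hr u i (S j)); trivial|lra].
Qed.

(** * From chains to orbits *)

Lemma is_derive_eps (f : R -> R) x l : is_derive f x l <->
 forall e, 0 < e -> exists r, 0 < r /\ forall y, Rabs (y - x) < r -> Rabs (f y - f x - (y - x) * l) <= e * Rabs (y - x).
Proof.
 split.
 - intros [_ H] e He. destruct (H x (fun P HP => HP) (mkposreal e He)) as [r Hr].
  exists r. split; [apply cond_pos|]. fin.
 - intros H. split; [apply is_linear_scal_l|]. intros x0 Hx0 e.
  replace x0 with x by (now apply (is_filter_lim_locally_unique (K := R_AbsRing) (V := NM) x)).
  destruct (H e (cond_pos e)) as (r & Hr & Hy). exists (mkposreal r Hr). fin.
Qed.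

Lemma is_derive_glue (F f g : R -> R) c l r0 : 0 < r0 -> is_derive f c l -> is_derive g c l -> f c = g c ->
 (forall y, c - r0 < y <= c -> F y = f y) -> (forall y, c <= y < c + r0 -> F y = g y) -> is_derive F c l.
Proof.
 rewrite !is_derive_eps. intros Hr0 Hf Hg Hc HFf HFg e He.
 destruct (Hf e He) as (r1 & Hr1 & H1). destruct (Hg e He) as (r2 & Hr2 & H2).
 exists (Rmin r0 (Rmin r1 r2)). split; [repeat apply Rmin_glb_lt; trivial|]. intros y Hy.
 assert (Hy0 := Rlt_le_trans _ _ _ Hy (Rmin_l _ _)). assert (Hy' := Rlt_le_trans _ _ _ Hy (Rmin_r _ _)).
 assert (Hy1 := Rlt_le_trans _ _ _ Hy' (Rmin_l _ _)). assert (Hy2 := Rlt_le_trans _ _ _ Hy' (Rmin_r _ _)).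
 apply Rabs_def2 in Hy0. rewrite (HFf c) by lra. destruct (Rle_lt_dec y c).
 - rewrite HFf by lra. fin.
 - rewrite HFg, Hc by lra. fin.
Qed.

Lemma increasing_of_derive (T D : R -> R) a b : (forall x, a < x < b -> is_derive T x (D x) /\ 0 < D x) ->
 forall x y, a < x -> x < y -> y < b -> T x < T y.
Proof.
 intros H x y Hx Hxy Hy.
 destruct (MVT_gen T x y D) as (c & Hc & E).
 - rewrite Rmin_left, Rmax_right by lra. intros z Hz. apply H; lra.
 - rewrite Rmin_left, Rmax_right by lra. intros z Hz. apply continuity_pt_filterlim.
  apply (is_derive_continuous T z (D z)). apply H; lra.
 - rewrite Rmin_left, Rmax_right in Hc by lra. destruct (H c ok). nra.
Qed.

(** Continuity of the right inverse [g] is not assumed; it comes from the strict monotonicity of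
    [T]. *)
Lemma is_derive_inverse (T D g : R -> R) a b t : (forall x, a < x < b -> is_derive T x (D x) /\ 0 < D x) ->
 (forall t, a < g t < b /\ T (g t) = t) -> is_derive g t (/ D (g t)).
Proof.
 intros H Hg. assert (Hi := increasing_of_derive T D a b H).
 destruct (Hg t) as [Hgt HT]. set (q := g t) in *. destruct (H q Hgt) as [Hd HD]. set (l := D q) in *.
 assert (Hcont : forall e, 0 < e -> exists r, 0 < r /\ forall s, Rabs (s - t) < r -> Rabs (g s - q) < e).
 { intros e He. set (h := Rmin (e / 2) (Rmin ((q - a) / 2) ((b - q) / 2))).
  assert (Hh : 0 < h /\ h <= e / 2 /\ h <= (q - a) / 2 /\ h <= (b - q) / 2).
  { unfold h. split; [repeat apply Rmin_glb_lt; lra|]. repeat split.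
   - apply Rmin_l.
   - eapply Rle_trans; [apply Rmin_r|apply Rmin_l].
   - eapply Rle_trans; [apply Rmin_r|apply Rmin_r]. }
  assert (L1 := Hi (q - h) q ok ok ok).
  assert (L2 := Hi q (q + h) ok ok ok).
  exists (Rmin (t - T (q - h)) (T (q + h) - t)). split; [apply Rmin_glb_lt; lra|]. intros s Hs.
  assert (Hs1 := Rlt_le_trans _ _ _ Hs (Rmin_l _ _)). assert (Hs2 := Rlt_le_trans _ _ _ Hs (Rmin_r _ _)).
  apply Rabs_def2 in Hs1, Hs2. destruct (Hg s) as [Hgs HTs].
  assert (q - h < g s).
  { destruct (Rlt_le_dec (q - h) (g s)) as [|[Hc|Hc]]; trivial; exfalso.
   - generalize (Hi (g s) (q - h) ok Hc ok). lra.
   - rewrite Hc in HTs. lra. }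
  assert (g s < q + h).
  { destruct (Rlt_le_dec (g s) (q + h)) as [|[Hc|Hc]]; trivial; exfalso.
   - generalize (Hi (q + h) (g s) ok Hc ok). lra.
   - rewrite <- Hc in HTs. lra. }
  apply Rabs_def1; lra. }
 rewrite is_derive_eps in Hd. apply is_derive_eps. intros e He.
 set (e1 := Rmin (l / 2) (e * l * l / 2)).
 assert (He1 : 0 < e1 /\ e1 <= l / 2 /\ e1 <= e * l * l / 2).
 { unfold e1. split; [apply Rmin_glb_lt; [lra|]; assert (0 < e * l * l) by fin; lra|].
  split; [apply Rmin_l|apply Rmin_r]. }
 destruct (Hd e1 (proj1 He1)) as (r1 & Hr1 & H1). destruct (Hcont r1 Hr1) as (r & Hr & H2).
 exists r. split; trivial. intros s Hs. specialize (H1 (g s) (H2 s Hs)).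
 rewrite (proj2 (Hg s)), HT in H1. fold q. set (k := g s - q) in *.
 assert (Hk : Rabs k * l <= 2 * Rabs (s - t)).
 { assert (Rabs (k * l) <= Rabs (s - t) + e1 * Rabs k).
  { replace (k * l) with ((s - t) - (s - t - k * l)) by ring. triang. rewrite Rabs_Ropp. lra. }
  rewrite Rabs_mult, (Rabs_pos_eq l) in H0 by lra. generalize (Rabs_pos k). nra. }
 replace (k - (s - t) * / l) with (- (s - t - k * l) * / l) by fld.
 rewrite Rabs_mult, Rabs_Ropp, (Rabs_pos_eq (/ l)) by fin.
 apply Rmult_le_reg_r with l; trivial. inv_l; rewrite Rmult_1_r.
 le_by exact H1. generalize (Rabs_pos k) (Rabs_pos (s - t)). fin.
Qed.

Section glue.
Variable f : nat -> R -> R.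

Fixpoint gluek (m : nat) (Q : R) : R :=
 match m with O => f O Q | S k => if Rle_dec Q (INR (S k) * PI) then gluek k Q else f (S k) Q end.

Variable m : nat.
Hypothesis agree : forall k, k <' m -> f k (INR (S k) * PI) = f (S k) (INR (S k) * PI).

Lemma gluek_val m' k Q : m' <=' m -> k <=' m' -> INR k * PI <= Q -> (Q <= (INR k + 1) * PI \/ k = m') -> gluek m' Q = f k Q.
Proof.
 assert (HP := PI_range). revert k. induction m' as [|m' IH]; intros k Hm Hk HQ HQ'.
 - simpl. now replace k with O by lia.
 - cbn [gluek]. destruct (Rle_dec Q (INR (S m') * PI)) as [H|H].
  + destruct (Nat.eq_dec k (S m')) as [->|Hne].
   * assert (E : Q = INR (S m') * PI) by lra. rewrite (IH m') by (try lia; rewrite S_INR in *; try (left; nra); nra).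
    rewrite E. fin.
   * apply IH; [lia|lia|trivial|]. destruct HQ'; [now left|lia].
  + destruct HQ' as [HQ'|HQ']; [|now subst]. destruct (Nat.eq_dec k (S m')) as [->|Hne]; trivial.
   exfalso. apply H. le_by exact HQ'. mul_r. rewrite <- S_INR. apply le_INR. lia.
Qed.

Lemma gluek_derive k Q l : k <=' m -> INR k * PI <= Q < (INR k + 1) * PI -> 0 < Q -> is_derive (f k) Q l ->
 (forall k', k = S k' -> Q = INR k * PI -> is_derive (f k') Q l) -> is_derive (gluek m) Q l.
Proof.
 generalize PI_range. intros HP Hk HQ HQ0 Hd Hd'. destruct (Req_dec Q (INR k * PI)) as [E|E].
 - destruct k as [|k]; [simpl in E; lra|].
  apply (is_derive_glue _ (f k) (f (S k)) Q l PI); try lra.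
  + now apply (Hd' k).
  + trivial.
  + rewrite E. fin.
  + intros y Hy. rewrite S_INR in *. apply gluek_val; try lia; [nra|fin].
  + intros y Hy. rewrite S_INR in *. apply gluek_val; try lia; rewrite S_INR; [nra|fin].
 - apply (is_derive_ext_loc (f k)); trivial.
  apply (locally_interval _ Q (INR k * PI) ((INR k + 1) * PI)); simpl; try lra.
  intros y Hy1 Hy2. symmetry. apply gluek_val; (lia || lra || (left; lra)).
Qed.
End glue.

(** * The orbit assembled from a chain *)

Section orbit.
Variables (d : nat) (P : list trig_mode) (mu W : R).
Let F := Fbd d P.
Hypothesis mu_pos : 0 < mu.
Hypothesis W_ge : 2 <= W.
Hypothesis small : mu * F * (W + 2) <= / 10000000.
Let W_pos : 0 <= W. Proof. lra. Qed.
Let muF : mu * F <= 1 / 1000 := small2 d P mu W mu_pos W_pos small.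

(** The equations of motion with the lifted angle [Q] as independent variable; since [v Q O = 1],
    component 0 of [z] is the time. *)
Definition orbit_at (z v : R -> vec) (p : R -> R) (Q : R) : Prop :=
 0 < p Q /\ v Q O = 1 /\
 (forall j, j <=' d -> is_derive (fun Q => z Q j) Q (v Q j / p Q)) /\
 (forall j, (1 <= j <= d)%nat -> is_derive (fun Q => v Q j) Q (- mu * (1 - cos Q) * gz d P j (z Q) / p Q)) /\
 is_derive p Q (sin Q * (1 - mu * fz d P (z Q)) / p Q).

Lemma half_orbit s c x w pc z Q : s = 1 \/ s = -1 -> (forall y, cos (c + y) = cos y /\ sin (c + y) = sin y) ->
 w O = 1 -> 0 <= pc -> is_half d P mu s x w pc z -> 0 <= s * (Q - c) < 4 -> 0 < s * (Q - c) \/ 0 < pc ->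
 orbit_at (fun Q => z (s * (Q - c))) (fun Q j => w j + drift d P mu s pc j z (s * (Q - c)))
  (fun Q => pm d P mu pc z (s * (Q - c))) Q.
Proof.
 intros Hs Hc Hw Hpc [Cz Hz] Hy Hy'. set (y := s * (Q - c)) in *.
 assert (Hs2 : s * s = 1) by fin.
 assert (Hsa : Rabs s = 1) by (destruct Hs as [->| ->]; [apply Rabs_1|apply Rabs_m1]).
 assert (HQ : Q = c + s * y) by (unfold y; rewrite <- Rmult_assoc, Hs2; ring).
 assert (Hcos : cos Q = cos y) by (rewrite HQ; destruct (Hc (s * y)) as [-> _]; destruct Hs as [->| ->];
  [now rewrite Rmult_1_l|replace (-1 * y) with (- y) by ring; apply cos_neg]).
 assert (Hsin : sin Q = s * sin y) by (rewrite HQ; destruct (Hc (s * y)) as [_ ->]; destruct Hs as [->| ->];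
  [now rewrite !Rmult_1_l|replace (-1 * y) with (- y) by ring; rewrite sin_neg; ring]).
 assert (Hlin : is_derive (fun Q => s * (Q - c)) Q s) by (auto_derive; trivial; ring).
 assert (Hp : 0 < pm d P mu pc z y) by (apply (pm_pos d P mu mu_pos muF); trivial).
 assert (Hcl : clip y = y) by (apply clip_id; lra).
 assert (comp : forall (h : R -> R) l l', is_derive h y l -> l' = s * l -> is_derive (fun Q => h (s * (Q - c))) Q l').
 { intros h l l' Hh ->. exact (is_derive_comp h (fun Q => s * (Q - c)) Q l s Hh Hlin). }
 unfold orbit_at. fold y. split; [fin|split; [|split; [|split]]].
 - rewrite Hw, (drift_time d P mu s pc z y). ring.
 - intros j Hj. apply (comp (fun y => z y j) (s * hz d P mu s w pc j z y)).
  + apply (is_derive_ext_loc (fun y => Phi_half d P mu s x w pc z y j)).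
   * apply (locally_interval _ y m_infty 4); simpl; trivial; [lra|]. intros y' _ Hy1. symmetry. fin.
   * apply Phi_half_derive; trivial; lra.
  + rewrite <- Rmult_assoc, Hs2, Rmult_1_l. unfold hz. now rewrite Hcl.
 - intros j Hj. apply (comp (fun y => w j + drift d P mu s pc j z y) (- s * mu * hI d P mu pc j z y)).
  + replace (- s * mu * hI d P mu pc j z y) with (plus 0 (- s * mu * hI d P mu pc j z y)) by (unfold plus; simpl; ring).
   apply @is_derive_plus; [apply @is_derive_const|].
   apply (is_derive_scal (fun y => RInt (hI d P mu pc j z) 0 y)). apply RInt_hI_derive; trivial; [lia|lra].
  + unfold hI. rewrite Hcl, Hcos. fin.
 - apply (comp (pm d P mu pc z) (hA d P mu z y / pm d P mu pc z y)).
  + assert (HA : is_derive (fun y => pc ^ 2 + 2 * Aint d P mu z y) y (2 * hA d P mu z y)).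
   { replace (2 * hA d P mu z y) with (plus 0 (2 * hA d P mu z y)) by (unfold plus; simpl; ring).
    apply @is_derive_plus; [apply @is_derive_const|]. apply (is_derive_scal (Aint d P mu z)). apply Aint_derive; trivial; lra. }
   assert (Hpp : 0 < pc ^ 2 + 2 * Aint d P mu z y).
   { rewrite <- (pm_sq d P mu mu_pos muF) by trivial. fin. }
   assert (Hsq := is_derive_sqrt _ y _ HA Hpp). unfold pm at 1.
   replace (hA d P mu z y / pm d P mu pc z y) with (2 * hA d P mu z y / (2 * sqrt (pc ^ 2 + 2 * Aint d P mu z y))); [fin|].
   unfold pm in *. fin.
  + unfold hA. rewrite Hcl, Hsin. fin.
Qed.

(** On an extreme half [pc = 0] and the momentum lies between [q / 4] and [2 * q], so the time from
    [y] to the bump is logarithmic in [y]. This gives both the asymptotics and the transit time. *)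
Lemma end_time s x w z y : Rabs s = 1 -> w O = 1 -> is_half d P mu s x w 0 z -> 0 < y <= PI ->
 exists l, z y O = x O - s * l /\ (ln PI - ln y) / 2 <= l <= 4 * (ln PI - ln y).
Proof.
 intros Hs Hw [Cz Hz] Hy. assert (HP := PI_range).
 exists (RInt (hz d P mu s w 0 0 z) y PI).
 rewrite Hz by fin. unfold Phi_half. split.
 - rewrite <- (opp_RInt_swap (hz d P mu s w 0 0 z) y PI).
  + unfold opp; simpl. ring.
  + ex_rint. intros q Hq.
   apply (hz_cont d P mu mu_pos muF s); trivial; lia || lra.
 - assert (Hb : forall q, y <= q <= PI -> 1 / 2 / q <= hz d P mu s w 0 0 z q <= 4 / q).
  { intros q Hq. unfold hz. rewrite clip_id, Hw, (drift_time d P mu s) by lra. rewrite Rplus_0_r. replace (1 / pm d P mu 0 z q) with (/ pm d P mu 0 z q) by fin.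
   split; [|apply (pm_inv d P mu mu_pos muF); trivial; lra].
   assert (Hp : 0 < pm d P mu 0 z q) by (apply (pm_pos d P mu mu_pos muF); trivial; lra).
   replace (1 / 2 / q) with (/ (2 * q)) by fld. apply Rinv_le_contravar; trivial.
   apply Rsqr_incr_0_var; [|lra]. rewrite !Rsqr_pow2, (pm_sq d P mu mu_pos muF); trivial; [|lra].
   generalize (Aint_bounds d P mu mu_pos muF z q Cz ok). nra. }
  assert (Hex : ex_RInt (hz d P mu s w 0 0 z) y PI).
  { ex_rint. intros q Hq.
   apply (hz_cont d P mu mu_pos muF s); trivial; lia || lra. }
  replace ((ln PI - ln y) / 2) with (1 / 2 * (ln PI - ln y)) by field.
  note (is_RInt_inv (1 / 2) y PI ok ok) (is_RInt_inv 4 y PI ok ok) as I1 I2. split.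
  + rewrite <- (is_RInt_unique _ _ _ _ I1). apply RInt_le; [lra|eexists; exact I1|fin|].
   intros q Hq. apply Hb; lra.
  + rewrite <- (is_RInt_unique _ _ _ _ I2). apply RInt_le; [lra|fin|eexists; exact I2|].
   intros q Hq. apply Hb; lra.
Qed.

Lemma end_near s x w z y c k r : Rabs s = 1 -> is_half d P mu s x w 0 z -> 0 < y < 4 -> c = 2 * PI * IZR k ->
 y * (INR d + 6) <= r ->
 in_nbhd_torus d r (fun i => w (S i)) (fun i => w (S i) + drift d P mu s 0 (S i) z y) (c + s * y) (pm d P mu 0 z y).
Proof.
 intros Hs [Cz Hz] Hy Hc Hr. exists k. rewrite <- Hc.
 assert (Hs2 : s ^ 2 = 1) by (rewrite <- pow2_abs, Hs; ring).
 assert (Hd : 0 <= INR d) by apply pos_INR.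
 (* Actions contribute at most [d * y ^ 2], the momentum [2 * y ^ 2] and the angle [y ^ 2]; the
    slack between 5 and 6 makes the final inequality strict. *)
 apply Rle_lt_trans with (sqrt (((INR d + 5) * y) ^ 2)); [|rewrite sqrt_pow2; nra].
 apply sqrt_le_1_alt.
 assert (Hp : pm d P mu 0 z y ^ 2 <= 2 * y ^ 2).
 { rewrite (pm_sq d P mu mu_pos muF) by fin. generalize (Aint_bounds d P mu mu_pos muF z y Cz ok). lra. }
 assert (HI : vsum d (fun i => (w (S i) + drift d P mu s 0 (S i) z y - w (S i)) ^ 2) <= INR d * y ^ 2).
 { rewrite <- vsum_const. apply vsum_le. intros i Hi.
  replace (w (S i) + drift d P mu s 0 (S i) z y - w (S i)) with (drift d P mu s 0 (S i) z y) by ring.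
  rewrite <- pow2_abs. apply pow_incr. split; [fin|].
  eapply Rle_trans; [apply (drift_le d P mu mu_pos muF); trivial; lia || lra|].
  change (2 * (mu * F) * y ^ 2 <= y). fin. }
 fin.
Qed.

Section assembly.
Variables (n : nat) (x w : nat -> vec) (pc : nat -> R) (zi zo : nat -> R -> vec).
Hypothesis n_pos : 1 <=' n.
Hypothesis Hch : is_chain d P mu W n x w pc zi zo.

(* Piece k lives on k PI <= Q <= (k + 1) PI: even pieces are incoming halves, odd ones outgoing halves. *)
Definition sgn (k : nat) : R := if Nat.even k then 1 else -1.
Definition ctr (k : nat) : R := if Nat.even k then INR k * PI else (INR k + 1) * PI.
Definition zk (k : nat) : R -> vec := if Nat.even k then zi (Nat.div2 k) else zo (Nat.div2 k).
Definition arc (k : nat) : nat := Nat.div2 (S k).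
Definition loc (k : nat) (Q : R) : R := sgn k * (Q - ctr k).
Definition Vk (k : nat) (j : nat) (y : R) : R := w (arc k) j + drift d P mu (sgn k) (pc (arc k)) j (zk k) y.
Definition pk (k : nat) (y : R) : R := pm d P mu (pc (arc k)) (zk k) y.

Lemma even_piece i : sgn (2 * i) = 1 /\ ctr (2 * i) = 2 * INR i * PI /\ zk (2 * i) = zi i /\ arc (2 * i) = i.
Proof.
 unfold sgn, ctr, zk, arc. rewrite Nat.even_even, Nat.div2_double, Nat.div2_succ_double, mult_INR. repeat split.
Qed.

Lemma odd_piece i : sgn (S (2 * i)) = -1 /\ ctr (S (2 * i)) = 2 * INR (S i) * PI /\ zk (S (2 * i)) = zo i /\ arc (S (2 * i)) = S i.
Proof.
 unfold sgn, ctr, zk, arc. replace (S (S (2 * i))) with (2 * S i)%nat by lia.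
 rewrite Nat.even_succ, Nat.odd_even, Nat.div2_double, Nat.div2_succ_double, !S_INR, mult_INR. repeat split. simpl. ring.
Qed.

Lemma parity k : exists i, k = (2 * i)%nat \/ k = S (2 * i).
Proof. destruct (Nat.Even_or_Odd k) as [[i ->]|[i ->]]; exists i; lia. Qed.

Lemma pc_range i : i <=' n -> 0 <= pc i <= mu.
Proof. destruct Hch as (_ & _ & H & _). auto. Qed.

Lemma piece_half k : k <' 2 * n -> exists i, i <' n /\ (sgn k = 1 \/ sgn k = -1) /\ arc k <=' n /\
 is_half d P mu (sgn k) (x i) (w (arc k)) (pc (arc k)) (zk k).
Proof.
 intros Hk. destruct Hch as (_ & _ & _ & _ & Hh & _). destruct (parity k) as [i [->| ->]]; exists i.
 - destruct (even_piece i) as (-> & _ & -> & ->). repeat split; (lia || auto || now apply Hh; lia).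
 - destruct (odd_piece i) as (-> & _ & -> & ->). repeat split; (lia || auto || now apply Hh; lia).
Qed.

Lemma loc_range k Q : INR k * PI <= Q <= (INR k + 1) * PI -> 0 <= loc k Q <= PI.
Proof.
 intros HQ. unfold loc. destruct (parity k) as [i [->| ->]].
 - destruct (even_piece i) as (-> & -> & _). rewrite mult_INR in HQ. simpl INR in HQ. lra.
 - destruct (odd_piece i) as (-> & -> & _). rewrite S_INR, mult_INR in HQ. rewrite S_INR. simpl INR in HQ. lra.
Qed.

Lemma w_time i : i <=' n -> w i O = 1.
Proof. destruct Hch as (_ & _ & _ & H & _). intros Hi. now destruct (H i Hi). Qed.

Lemma ctr_period k y : cos (ctr k + y) = cos y /\ sin (ctr k + y) = sin y.
Proof.
 destruct (parity k) as [i [->| ->]].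
 - destruct (even_piece i) as (_ & -> & _). split; [rewrite <- (cos_period y i)|rewrite <- (sin_period y i)]; f_equal; ring.
 - destruct (odd_piece i) as (_ & -> & _). split; [rewrite <- (cos_period y (S i))|rewrite <- (sin_period y (S i))]; f_equal; ring.
Qed.

Lemma piece_orbit k Q : k <' 2 * n -> INR k * PI <= Q <= (INR k + 1) * PI -> 0 < Q < 2 * INR n * PI ->
 orbit_at (fun Q => zk k (loc k Q)) (fun Q j => Vk k j (loc k Q)) (fun Q => pk k (loc k Q)) Q.
Proof.
 intros Hk HQ HQ0. assert (HP := PI_range). assert (Hl := loc_range k Q HQ).
 destruct (piece_half k Hk) as (i & Hi & Hs & Ha & Hh).
 apply (half_orbit (sgn k) (ctr k) (x i) (w (arc k)) (pc (arc k)) (zk k) Q); trivial.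
 - intros y; apply ctr_period.
 - now apply w_time.
 - now apply pc_range.
 - unfold loc in Hl. lra.
 - unfold loc in Hl. destruct (Req_dec (sgn k * (Q - ctr k)) 0) as [E|E]; [right|left; lra].
  destruct Hch as (_ & _ & _ & _ & _ & _ & _ & Hc). clear Hh Hi Hs i. destruct (parity k) as [i [->| ->]].
  + destruct (even_piece i) as (E1 & E2 & _ & E3). rewrite E1, E2 in E. rewrite E3.
   destruct i as [|i]; [simpl in E; lra|]. apply Hc. lia.
  + destruct (odd_piece i) as (E1 & E2 & _ & E3). rewrite E1, E2 in E. rewrite E3. apply Hc.
   apply INR_lt. fin.
Qed.

(** At odd multiples of pi the agreement is the matching of action and energy at a bump; at even
    ones it is the common velocity and crossing momentum of the two halves of a gap. *)
Lemma piece_agree k : S k <' 2 * n -> let Q := INR (S k) * PI in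
 (forall j, j <=' d -> zk k (loc k Q) j = zk (S k) (loc (S k) Q) j) /\
 (forall j, j <=' d -> Vk k j (loc k Q) = Vk (S k) j (loc (S k) Q)) /\ pk k (loc k Q) = pk (S k) (loc (S k) Q).
Proof.
 intros Hk Q. assert (HP := PI_range). unfold loc, Vk, pk.
 destruct Hch as (_ & _ & _ & _ & Hh & HI & HE & Hc). destruct (parity k) as [i [->| ->]].
 - destruct (even_piece i) as (-> & -> & -> & ->). destruct (odd_piece i) as (-> & -> & -> & ->).
  assert (EQ : Q = 2 * INR i * PI + PI) by (unfold Q; rewrite S_INR, mult_INR; simpl INR; ring).
  replace (1 * (Q - 2 * INR i * PI)) with PI by (rewrite EQ; ring).
  replace (-1 * (Q - 2 * INR (S i) * PI)) with PI by (rewrite EQ, S_INR; ring).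
  destruct (Hh i ok) as [[_ Z1] [_ Z2]]. repeat split.
  + intros j Hj. rewrite Z1, Z2 by (trivial || lra). unfold Phi_half. rewrite !RInt_point. unfold zero; simpl. ring.
  + intros j Hj. destruct j as [|j]; [|apply HI; lia]. rewrite !drift_time, !w_time by lia. ring.
  + unfold pm. f_equal. generalize (HE i ok). lra.
 - destruct (odd_piece i) as (-> & -> & -> & ->). replace (S (S (2 * i))) with (2 * S i)%nat in * by lia.
  destruct (even_piece (S i)) as (-> & -> & -> & ->).
  assert (EQ : Q = 2 * INR (S i) * PI) by (unfold Q; rewrite !S_INR, mult_INR; simpl (INR 2); ring).
  rewrite EQ. rewrite !Rminus_diag, !Rmult_0_r.
  destruct (Hc i ok) as [_ Hc']. repeat split.
  + intros j Hj. symmetry. fin.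
  + intros j Hj. rewrite !drift_0. ring.
  + unfold pm. rewrite !Aint_0. ring.
Qed.

Let m := (2 * n - 1)%nat.
Definition zq (Q : R) : vec := fun j => gluek (fun k Q => zk k (loc k Q) j) m Q.
Definition vq (Q : R) : vec := fun j => gluek (fun k Q => Vk k j (loc k Q)) m Q.
Definition pq (Q : R) : R := gluek (fun k Q => pk k (loc k Q)) m Q.
Let Qmax := 2 * INR n * PI.

Lemma piece_index Q : 0 < Q < Qmax -> exists k, k <=' m /\ INR k * PI <= Q < (INR k + 1) * PI.
Proof.
 intros HQ. assert (HP := PI_range). destruct (nfloor_ex (Q / PI)) as [k Hk].
 - fin.
 - exists k. assert (E : Q = Q / PI * PI) by fld.
  assert (HkQ : INR k * PI <= Q < (INR k + 1) * PI) by (rewrite E; split; [apply Rmult_le_compat_r|apply Rmult_lt_compat_r]; lra).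
  split; trivial. unfold m. enough (k < 2 * n)%nat by lia.
  apply INR_lt. rewrite mult_INR. simpl (INR 2). apply Rmult_lt_reg_r with PI; [lra|]. unfold Qmax in HQ. lra.
Qed.

Lemma glued_value k Q : k <=' m -> INR k * PI <= Q <= (INR k + 1) * PI ->
 (forall j, j <=' d -> zq Q j = zk k (loc k Q) j /\ vq Q j = Vk k j (loc k Q)) /\ pq Q = pk k (loc k Q).
Proof.
 intros Hk HQ. assert (Ha : forall k, k <' m -> S k <' 2 * n) by (unfold m; lia). split; [intros j Hj; split|].
 - apply (gluek_val (fun k Q => zk k (loc k Q) j) m); (lia || lra || (left; lra) || idtac). intros k' Hk'. now apply (piece_agree k' (Ha k' Hk')).
 - apply (gluek_val (fun k Q => Vk k j (loc k Q)) m); (lia || lra || (left; lra) || idtac). intros k' Hk'. now apply (piece_agree k' (Ha k' Hk')).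
 - apply (gluek_val (fun k Q => pk k (loc k Q)) m); (lia || lra || (left; lra) || idtac). intros k' Hk'. now apply (piece_agree k' (Ha k' Hk')).
Qed.

Lemma gz_ext j z z' : (forall i, i <=' d -> z i = z' i) -> gz d P j z = gz d P j z'.
Proof. intros H. destruct j as [|j]; trivial. apply lsum_ext. intros a. now rewrite (phase_ext d a z z'). Qed.

Lemma glued_orbit Q : 0 < Q < Qmax -> orbit_at zq vq pq Q.
Proof.
 intros HQ. destruct (piece_index Q HQ) as (k & Hk & HkQ).
 assert (Ha : forall k, k <' m -> S k <' 2 * n) by (unfold m; lia).
 destruct (glued_value k Q Hk ok) as [Hv Hp].
 assert (Hz : forall j, j <=' d -> zq Q j = zk k (loc k Q) j) by (intros j Hj; now apply Hv).
 assert (HV : forall j, j <=' d -> vq Q j = Vk k j (loc k Q)) by (intros j Hj; now apply Hv).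
 assert (Hk' : k <' 2 * n) by (unfold m in Hk; lia).
 destruct (piece_orbit k Q Hk' ok HQ) as (O1 & O2 & O3 & O4 & O5).
 assert (Hprev : forall k', k = S k' -> Q = INR k * PI ->
  (forall j, j <=' d -> is_derive (fun Q => zk k' (loc k' Q) j) Q (vq Q j / pq Q)) /\
  (forall j, (1 <= j <= d)%nat -> is_derive (fun Q => Vk k' j (loc k' Q)) Q (- mu * (1 - cos Q) * gz d P j (zq Q) / pq Q)) /\
  is_derive (fun Q => pk k' (loc k' Q)) Q (sin Q * (1 - mu * fz d P (zq Q)) / pq Q)).
 { intros k' -> E. assert (Hr : INR k' * PI <= Q <= (INR k' + 1) * PI) by (rewrite S_INR in E; rewrite E; generalize PI_range; lra).
  destruct (glued_value k' Q ok Hr) as [Hv' Hp'].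
  destruct (piece_orbit k' Q ok Hr HQ) as (_ & _ & R3 & R4 & R5). split; [|split].
  - intros j Hj. rewrite Hp', (proj2 (Hv' j Hj)). fin.
  - intros j Hj. rewrite Hp', (gz_ext j _ (zk k' (loc k' Q))) by (intros; now apply Hv'). fin.
  - rewrite Hp', (fz_ext d P _ (zk k' (loc k' Q))) by (intros; now apply Hv'). exact R5. }
 split; [|split; [|split; [|split]]].
 - fin.
 - rewrite HV by lia. exact O2.
 - intros j Hj. apply (gluek_derive (fun k Q => zk k (loc k Q) j) m) with (k := k); trivial; try lra.
  + intros k' Hk1. now apply (piece_agree k' (Ha k' Hk1)).
  + rewrite Hp, HV by trivial. fin.
  + intros k' E1 E2. now apply (Hprev k').
 - intros j Hj. apply (gluek_derive (fun k Q => Vk k j (loc k Q)) m) with (k := k); trivial; try lra.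
  + intros k' Hk1. apply (piece_agree k' (Ha k' Hk1)). lia.
  + rewrite Hp, (gz_ext j _ (zk k (loc k Q))) by trivial. fin.
  + intros k' E1 E2. now apply (Hprev k').
 - apply (gluek_derive (fun k Q => pk k (loc k Q)) m) with (k := k); trivial; try lra.
  + intros k' Hk1. now apply (piece_agree k' (Ha k' Hk1)).
  + rewrite Hp, (fz_ext d P _ (zk k (loc k Q))) by trivial. exact O5.
  + intros k' E1 E2. now apply (Hprev k').
Qed.

Lemma time_derive Q : 0 < Q < Qmax -> is_derive (fun Q => zq Q O) Q (/ pq Q) /\ 0 < / pq Q.
Proof.
 intros HQ. destruct (glued_orbit Q HQ) as (O1 & O2 & O3 & _). split; [|now apply Rinv_0_lt_compat].
 specialize (O3 O ok). rewrite O2 in O3. unfold Rdiv in O3. now rewrite Rmult_1_l in O3.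
Qed.

Lemma Qmax_ge : 2 * PI <= Qmax.
Proof. unfold Qmax. generalize PI_range (le_INR _ _ n_pos). simpl INR. fin. Qed.

Lemma start_value y : 0 < y <= PI -> (forall j, j <=' d -> zq y j = zi O y j /\ vq y j = w O j + drift d P mu 1 0 j (zi O) y) /\
 pq y = pm d P mu 0 (zi O) y.
Proof.
 intros Hy. generalize (glued_value 0 y ok ltac:(simpl INR; lra)). unfold Vk, pk, loc.
 generalize (even_piece 0). change (2 * 0)%nat with O. intros (-> & -> & -> & ->). simpl (INR 0). destruct Hch as (-> & _).
 replace (1 * (y - 2 * 0 * PI)) with y by ring. trivial.
Qed.

Lemma stop_value y : 0 < y <= PI -> (forall j, j <=' d -> zq (Qmax - y) j = zo (n - 1)%nat y j /\
  vq (Qmax - y) j = w n j + drift d P mu (-1) 0 j (zo (n - 1)%nat) y) /\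
 pq (Qmax - y) = pm d P mu 0 (zo (n - 1)%nat) y.
Proof.
 intros Hy. assert (E : m = S (2 * (n - 1))) by (unfold m; lia).
 generalize (glued_value m (Qmax - y) ok). unfold Vk, pk, loc. rewrite E.
 destruct (odd_piece (n - 1)) as (-> & -> & -> & ->). replace (S (n - 1)) with n by lia.
 destruct Hch as (_ & -> & _). replace (-1 * (Qmax - y - 2 * INR n * PI)) with y by (unfold Qmax; ring).
 intros H. apply H. rewrite S_INR, mult_INR, minus_INR by lia. simpl (INR 2). simpl (INR 1). unfold Qmax. lra.
Qed.

Lemma start_time y : 0 < y <= PI -> x O O - 4 * (ln PI - ln y) <= zq y O <= x O O - (ln PI - ln y) / 2.
Proof.
 intros Hy. destruct (start_value y Hy) as [H _]. rewrite (proj1 (H O ok)).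
 destruct Hch as (E0 & _ & _ & _ & Hh & _). destruct (Hh O ok) as [H0 _]. rewrite E0 in H0.
 destruct (end_time 1 _ _ _ y Rabs_1 (w_time O ok) H0 Hy) as (l & -> & Hl). lra.
Qed.

Lemma stop_time y : 0 < y <= PI ->
 x (n - 1)%nat O + (ln PI - ln y) / 2 <= zq (Qmax - y) O <= x (n - 1)%nat O + 4 * (ln PI - ln y).
Proof.
 intros Hy. destruct (stop_value y Hy) as [H _]. rewrite (proj1 (H O ok)).
 destruct Hch as (_ & E0 & _ & _ & Hh & _). destruct (Hh (n - 1)%nat ok) as [_ H0].
 replace (S (n - 1)) with n in H0 by lia. rewrite E0 in H0.
 destruct (end_time (-1) _ _ _ y Rabs_m1 (w_time n ok) H0 Hy) as (l & -> & Hl). lra.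
Qed.

(** Time diverges to minus and plus infinity on the extreme halves; hence the assembled orbit is
    global. *)
Lemma time_onto t : exists Q, 0 < Q < Qmax /\ zq Q O = t.
Proof.
 note PI_range Qmax_ge as HP HQm.
 assert (Hsmall : forall a, exists y, 0 < y <= 1 /\ ln y <= a).
 { intros a. exists (exp (Rmin 0 a)). split; [split; [apply exp_pos|]|].
  - rewrite <- exp_0. destruct (Req_dec (Rmin 0 a) 0) as [->|E]; [lra|]. left. apply exp_increasing. generalize (Rmin_l 0 a). lra.
  - rewrite ln_exp. apply Rmin_r. }
 assert (HlP : 0 < ln PI) by (rewrite <- ln_1; apply ln_increasing; lra).
 destruct (Hsmall (2 * (t - x O O))) as (y1 & Hy1 & L1).
 destruct (Hsmall (- 2 * (t - x (n - 1)%nat O))) as (y2 & Hy2 & L2).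
 note (start_time y1 ok) (stop_time y2 ok) as T1 T2.
 destruct (f_interv_is_interv (fun Q => zq Q O) y1 (Qmax - y2) t) as [Q HQ].
 - lra.
 - lra.
 - intros Q HQ. apply continuity_pt_filterlim. apply (is_derive_continuous _ Q (/ pq Q)). apply time_derive. lra.
 - exists Q. fin.
Qed.

Definition qt (t : R) : R := epsilon (inhabits 0) (fun Q => 0 < Q < Qmax /\ zq Q O = t).

Lemma qt_spec t : 0 < qt t < Qmax /\ zq (qt t) O = t.
Proof. unfold qt. apply epsilon_spec. apply time_onto. Qed.

Lemma qt_derive t : is_derive qt t (pq (qt t)).
Proof.
 replace (pq (qt t)) with (/ / pq (qt t)) by apply Rinv_inv.
 apply (is_derive_inverse (fun Q => zq Q O) (fun Q => / pq Q) qt 0 Qmax t).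
 - apply time_derive.
 - apply qt_spec.
Qed.

Lemma time_mono Q Q' : 0 < Q < Qmax -> 0 < Q' < Qmax -> zq Q O <= zq Q' O -> Q <= Q'.
Proof.
 intros HQ HQ' H. destruct (Rle_lt_dec Q Q') as [|H1]; trivial. exfalso.
 generalize (increasing_of_derive (fun Q => zq Q O) (fun Q => / pq Q) 0 Qmax time_derive Q' Q ok H1 ok). lra.
Qed.

Lemma qt_time Q : 0 < Q < Qmax -> qt (zq Q O) = Q.
Proof.
 intros HQ. destruct (qt_spec (zq Q O)) as [H1 H2].
 apply Rle_antisym; apply time_mono; trivial; lra.
Qed.

Variable ft : vec -> R -> R.
Hypothesis Hft : forall phi t, ft phi t = trig_eval d P phi t.

Lemma fz_partial_derive t phi i y : i <' d -> is_derive (fun y => fz d P (stv t (vupd phi i y))) y (gz d P (S i) (stv t (vupd phi i y))).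
Proof.
 intros Hi. simpl gz. unfold fz.
 assert (Hph : forall a y', phase d a (stv t (vupd phi i y')) = phase d a (stv t (vupd phi i 0)) + freq a (S i) * y').
 { intros a y'. rewrite <- (phase_unit d a (S i)) by lia. unfold phase. rewrite Rmult_comm, <- vsum_scal, <- vsum_plus.
  apply vsum_ext. intros j Hj. unfold unit_vec, stv, vupd. destruct j as [|j]; simpl; [ring|]. destruct (Nat.eqb j i); ring. }
 generalize P; intros l0. induction l0 as [|a l IH].
 - unfold lsum; simpl. apply @is_derive_const.
 - apply (is_derive_ext (fun y => plus (mval a (phase d a (stv t (vupd phi i y)))) (lsum l (fun a => mval a (phase d a (stv t (vupd phi i y)))))));
   [intros; rewrite lsum_cons; reflexivity|]. rewrite lsum_cons. apply @is_derive_plus; [|exact IH].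
  apply (is_derive_ext (fun y => mval a (phase d a (stv t (vupd phi i 0)) + freq a (S i) * y))); [intros; now rewrite <- Hph|].
  rewrite (Hph a y). unfold mval, mder. auto_derive; trivial. ring.
Qed.

Lemma vupd_same phi i j : vupd phi i (phi i) j = phi j.
Proof. unfold vupd. destruct (Nat.eqb_spec j i) as [->|]; trivial. Qed.

Lemma dfphi_eq phi i q t : i <' d -> dfphi ft i phi q t = (1 - cos q) * gz d P (S i) (stv t phi).
Proof.
 intros Hi. unfold dfphi, fpert. rewrite (Derive_ext _ (fun y => (1 - cos q) * fz d P (stv t (vupd phi i y)))).
 - apply is_derive_unique. rewrite (gz_ext (S i) (stv t phi) (stv t (vupd phi i (phi i)))).
  + apply (is_derive_scal (fun y => fz d P (stv t (vupd phi i y)))). now apply fz_partial_derive.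
  + intros [|j] _; [reflexivity|]. simpl. now rewrite vupd_same.
 - intros y. now rewrite Hft, trig_eval_fz.
Qed.

Lemma dfq_eq phi q t : dfq ft phi q t = sin q * fz d P (stv t phi).
Proof.
 unfold dfq, fpert. apply is_derive_unique. rewrite Hft, trig_eval_fz. auto_derive; trivial. ring.
Qed.

Lemma stv_zq t i : stv t (fun i => zq (qt t) (S i)) i = zq (qt t) i.
Proof. destruct i; [symmetry; apply qt_spec|reflexivity]. Qed.

Lemma assembled_solution : is_solution d ft mu (fun t i => zq (qt t) (S i)) (fun t i => vq (qt t) (S i)) qt (fun t => pq (qt t)).
Proof.
 intros t. destruct (qt_spec t) as [Hq Ht]. destruct (glued_orbit (qt t) Hq) as (O1 & O2 & O3 & O4 & O5).
 assert (Hd := qt_derive t).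
 assert (comp : forall (h : R -> R) l l', is_derive h (qt t) l -> l' = pq (qt t) * l -> is_derive (fun t => h (qt t)) t l').
 { intros h l l' Hh ->. exact (is_derive_comp h qt t l (pq (qt t)) Hh Hd). }
 split; [|split; trivial].
 - intros i Hi. split.
  + apply (comp (fun Q => zq Q (S i)) _ _ (O3 (S i) ok)). fin.
  + apply (comp (fun Q => vq Q (S i)) _ _ (O4 (S i) ok)). rewrite dfphi_eq by trivial.
   rewrite (gz_ext (S i) (stv t _) (zq (qt t))) by (intros; apply stv_zq). fin.
 - apply (comp pq _ _ O5). rewrite dfq_eq, (fz_ext d P (stv t _) (zq (qt t))) by (intros; apply stv_zq). fin.
Qed.

Lemma start_near y r : 0 < y <= PI -> y * (INR d + 6) <= r ->
 in_nbhd_torus d r (fun i => w O (S i)) (fun i => vq y (S i)) y (pq y).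
Proof.
 intros Hy Hr. destruct (start_value y Hy) as [H1 ->].
 destruct Hch as (E0 & _ & _ & _ & Hh & _). destruct (Hh O ok) as [H0 _]. rewrite E0 in H0.
 assert (HP := PI_range).
 destruct (end_near 1 _ _ _ y 0 0%Z r Rabs_1 H0 ok ltac:(ring) Hr) as [k Hk]. exists k.
 replace (0 + 1 * y) with y in Hk by ring. erewrite vsum_ext; [exact Hk|].
 intros i Hi. cbv beta. now rewrite (proj2 (H1 (S i) ok)).
Qed.

Lemma stop_near y r : 0 < y <= PI -> y * (INR d + 6) <= r ->
 in_nbhd_torus d r (fun i => w n (S i)) (fun i => vq (Qmax - y) (S i)) (Qmax - y) (pq (Qmax - y)).
Proof.
 intros Hy Hr. destruct (stop_value y Hy) as [H1 ->].
 destruct Hch as (_ & E0 & _ & _ & Hh & _). destruct (Hh (n - 1)%nat ok) as [_ H0].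
 replace (S (n - 1)) with n in H0 by lia. rewrite E0 in H0.
 assert (HP := PI_range).
 destruct (end_near (-1) _ _ _ y Qmax (Z.of_nat n) r Rabs_m1 H0 ok ltac:(unfold Qmax; rewrite <- INR_IZR_INZ; ring) Hr) as [k Hk]. exists k.
 replace (Qmax + -1 * y) with (Qmax - y) in Hk by ring. erewrite vsum_ext; [exact Hk|].
 intros i Hi. cbv beta. now rewrite (proj2 (H1 (S i) ok)).
Qed.

Theorem chain_orbit : mu <= 1 -> exists (phi I : R -> vec) (q p : R -> R),
 is_solution d ft mu phi I q p /\ heteroclinic d (fun i => w O (S i)) (fun i => w n (S i)) I q p /\
 (forall t, exists k, k <=' n /\ forall i, i <' d -> Rabs (I t i - w k (S i)) <= 32 * (mu * F)) /\
 exists t1 t2, t1 <= t2 /\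
  in_nbhd_torus d mu (fun i => w O (S i)) (I t1) (q t1) (p t1) /\
  in_nbhd_torus d mu (fun i => w n (S i)) (I t2) (q t2) (p t2) /\
  t2 - t1 <= x (n - 1)%nat O - x O O + 8 * (ln 4 + ln (INR d + 6) - ln mu).
Proof.
 intros Hmu1. note PI_range Qmax_ge as HP HQm.
 assert (Hd : 0 <= INR d) by apply pos_INR.
 exists (fun t i => zq (qt t) (S i)), (fun t i => vq (qt t) (S i)), qt, (fun t => pq (qt t)).
 split; [apply assembled_solution|]. split; [split|split].
 - intros e He. set (y := Rmin 1 (e / (INR d + 6))).
  assert (Hy : 0 < y <= 1 /\ y <= e / (INR d + 6)).
  { unfold y. split; [split|apply Rmin_r]; [apply Rmin_glb_lt; [lra|apply Rdiv_lt_0_compat; lra]|apply Rmin_l]. }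
  exists (- zq y O). intros t Ht. destruct (qt_spec t) as [Hq Hqt].
  assert (Hle : qt t <= y) by (apply time_mono; lra).
  apply start_near; [lra|]. le_thru (e / (INR d + 6) * (INR d + 6)); [apply Rmult_le_compat_r; lra|].
  right; field; lra.
 - intros e He. set (y := Rmin 1 (e / (INR d + 6))).
  assert (Hy : 0 < y <= 1 /\ y <= e / (INR d + 6)).
  { unfold y. split; [split|apply Rmin_r]; [apply Rmin_glb_lt; [lra|apply Rdiv_lt_0_compat; lra]|apply Rmin_l]. }
  exists (zq (Qmax - y) O). intros t Ht. destruct (qt_spec t) as [Hq Hqt].
  assert (Hle : Qmax - y <= qt t) by (apply time_mono; lra).
  replace (qt t) with (Qmax - (Qmax - qt t)) by ring.
  apply stop_near; [lra|]. le_thru (e / (INR d + 6) * (INR d + 6)); [apply Rmult_le_compat_r; lra|].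
  right; field; lra.
 - intros t. destruct (qt_spec t) as [Hq _]. destruct (piece_index (qt t) Hq) as (k & Hk & HkQ).
  destruct (piece_half k ltac:(unfold m in Hk; lia)) as (i0 & _ & Hs & Ha & [Cz _]).
  exists (arc k). split; trivial. intros i Hi. destruct (glued_value k (qt t) Hk ok) as [Hv _].
  rewrite (proj2 (Hv (S i) ok)). unfold Vk.
  replace (_ + _ - _) with (drift d P mu (sgn k) (pc (arc k)) (S i) (zk k) (loc k (qt t))) by ring.
  assert (Hl := loc_range k (qt t) ok). assert (Hpc := pc_range (arc k) Ha).
  le_by (apply (drift_le d P mu mu_pos muF (sgn k)); trivial; try lia; try lra).
  + destruct Hs as [->| ->]; [apply Rabs_1|apply Rabs_m1].
  + change (2 * (mu * F) * loc k (qt t) ^ 2 <= 32 * (mu * F)).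
   assert (0 <= mu * F) by (apply Rmult_le_pos; [lra|generalize (Fbd_ge1 d P); unfold F; lra]).
   assert (loc k (qt t) ^ 2 <= 16) by nra. nra.
 (* At this distance from the ends [start_near] and [stop_near] give exactly [mu]-neighbourhoods,
    and the logarithm of [y] enters the time bound. *)
 - set (y := mu / (INR d + 6)).
  assert (Hy : 0 < y <= 1).
  { unfold y. split; [pos|]. reg_r (INR d + 6).
   unfold Rdiv. inv_l. lra. }
  assert (Hyr : y * (INR d + 6) <= mu) by (right; unfold y; field; lra).
  exists (zq y O), (zq (Qmax - y) O). rewrite !qt_time by lra. repeat split.
  + left. apply (increasing_of_derive (fun Q => zq Q O) (fun Q => / pq Q) 0 Qmax time_derive); lra.
  + apply start_near; lra.
  + apply stop_near; lra.
  + generalize (start_time y ok) (stop_time y ok).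
   assert (ln y = ln mu - ln (INR d + 6)) by (unfold y; apply ln_div; lra).
   assert (ln PI <= ln 4) by (apply ln_le; lra). lra.
Qed.
End assembly.
End orbit.

(** * Second derivatives of the Melnikov potential *)

Lemma is_derive_lsum {A} (l : list A) (h : A -> R -> R) (D : A -> R) t :
 (forall m, is_derive (h m) t (D m)) -> is_derive (fun t => lsum l (fun m => h m t)) t (lsum l D).
Proof.
 intros H. induction l as [|m l IH]; [unfold lsum; simpl; apply @is_derive_const|].
 apply (is_derive_ext (fun t => plus (h m t) (lsum l (fun m => h m t)))); [intros; reflexivity|].
 rewrite lsum_cons. apply @is_derive_plus; [fin|fin].
Qed.

Lemma comp_sq n v j : j <' n -> Rabs (v j) <= sqrt (sq n v).
Proof.
 intros Hj. rewrite <- sqrt_Rsqr_abs. apply sqrt_le_1_alt. rewrite Rsqr_pow2.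
 apply (vsum_term_le n (fun i => v i ^ 2)); trivial. fin.
Qed.

Lemma sq_nonneg n v : 0 <= sq n v.
Proof. apply vsum_nonneg. fin. Qed.

Lemma sq_le_comp n v M : (forall j, j <' n -> Rabs (v j) <= M) -> sq n v <= INR n * M ^ 2.
Proof.
 intros H. unfold sq. rewrite <- vsum_const. apply vsum_le. intros i Hi. rewrite <- pow2_abs.
 fin.
Qed.

Section hessian.
Variables (d : nat) (P : list trig_mode).
Let F := Fbd d P.

(** The second derivative of [Gpot om] at [x] as a bilinear form in [v] and [w]. *)
Definition Hb (om x v w : vec) : R :=
 lsum P (fun m => 2 * mval m (phase d m x) * phase d m v * phase d m w * Jm (phase d m om)).

Lemma Gder_line_derive om v x h t :
 is_derive (fun t => Gder d P om v (fun j => x j + t * h j)) t (Hb om (fun j => x j + t * h j) v h).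
Proof.
 unfold Gder, Hb. rewrite <- (Ropp_involutive (lsum _ _)). apply @is_derive_opp.
 replace (- lsum P (fun m => 2 * mval m (phase d m (fun j => x j + t * h j)) * phase d m v * phase d m h * Jm (phase d m om)))
  with (lsum P (fun m => - (2 * mval m (phase d m (fun j => x j + t * h j)) * phase d m v * phase d m h * Jm (phase d m om)))).
 2:{ rewrite (lsum_ext _ _ (fun m => -1 * (2 * mval m (phase d m (fun j => x j + t * h j)) * phase d m v * phase d m h * Jm (phase d m om))))
    by (intros; ring). rewrite lsum_scal. ring. }
 apply is_derive_lsum. intros m.
 apply (is_derive_ext (fun t => 2 * mder m (phase d m x + t * phase d m h) * phase d m v * Jm (phase d m om))).
 - intros s. now rewrite phase_plus, phase_scal.
 - rewrite phase_plus, phase_scal. unfold mder, mval. auto_derive; trivial. ring.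
Qed.

Lemma Gpot_line_derive om x h t :
 is_derive (fun t => Gpot d P om (fun j => x j + t * h j)) t (Gder d P om h (fun j => x j + t * h j)).
Proof.
 unfold Gpot, Gder. apply @is_derive_opp. apply is_derive_lsum. intros m.
 apply (is_derive_ext (fun t => 2 * mval m (phase d m x + t * phase d m h) * Jm (phase d m om))).
 - intros s. now rewrite phase_plus, phase_scal.
 - rewrite phase_plus, phase_scal. unfold mder, mval. auto_derive; trivial. ring.
Qed.

Lemma Hb_sym om x v w : Hb om x v w = Hb om x w v.
Proof. apply lsum_ext. fin. Qed.

Lemma Hb_ext om x x' v v' w w' : (forall j, j <=' d -> x j = x' j) -> (forall j, j <=' d -> v j = v' j) ->
 (forall j, j <=' d -> w j = w' j) -> Hb om x v w = Hb om x' v' w'.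
Proof. intros H1 H2 H3. apply lsum_ext. intros m. now rewrite (phase_ext d m x x'), (phase_ext d m v v'), (phase_ext d m w w'). Qed.

Lemma Hb_lin om x a v v' w : Hb om x (fun j => a * v j + v' j) w = a * Hb om x v w + Hb om x v' w.
Proof.
 unfold Hb. rewrite <- lsum_scal, <- lsum_plus. apply lsum_ext. intros m. rewrite phase_plus, phase_scal. ring.
Qed.

Lemma Hb_unit_sum om x v w : Hb om x v w = vsum (S d) (fun j => v j * Hb om x (unit_vec j) w).
Proof.
 unfold Hb. rewrite (vsum_ext _ _ (fun j => lsum P (fun m => v j * (2 * mval m (phase d m x) * phase d m (unit_vec j) * phase d m w * Jm (phase d m om)))))
  by (intros; now rewrite lsum_scal).
 rewrite <- lsum_vsum. apply lsum_ext. intros m.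
 rewrite (vsum_ext _ _ (fun j => (2 * mval m (phase d m x) * phase d m w * Jm (phase d m om)) * (freq m j * v j)))
  by (intros j Hj; rewrite phase_unit by lia; ring).
 rewrite vsum_scal. fold (phase d m v). ring.
Qed.

Lemma triple_bound m a b c k A V1 V2 K : 0 <= V1 -> 0 <= V2 -> 0 <= K -> Rabs a <= mamp m * A -> Rabs b <= mfreq d m * V1 ->
 Rabs c <= mfreq d m * V2 -> Rabs k <= K -> Rabs (2 * a * b * c * k) <= mamp m * A * mfreq d m ^ 2 * (2 * V1 * V2 * K).
Proof.
 intros H1 H2 H3 Ha Hb Hc Hk. rewrite !Rabs_mult, (Rabs_pos_eq 2) by lra. assert (Hf := mfreq_pos d m).
 assert (HA : 0 <= mamp m * A) by fin.
 le_thru (2 * (mamp m * A) * (mfreq d m * V1) * (mfreq d m * V2) * K); [|fin].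
 fin.
Qed.

Lemma cube_bound m a X : 0 <= X -> a <= mamp m * mfreq d m ^ 2 * X \/ a <= mamp m * mfreq d m ^ 3 * X -> a <= mamp m * (1 + mfreq d m) ^ 3 * X.
Proof.
 intros HX H. note (mamp_pos m) (mfreq_pos d m) as Ha Hf.
 assert (mfreq d m ^ 2 <= (1 + mfreq d m) ^ 3 /\ mfreq d m ^ 3 <= (1 + mfreq d m) ^ 3) as [E1 E2].
 { fin. }
 destruct H as [H|H]; (le_by exact H); apply Rmult_le_compat_r; trivial; now apply Rmult_le_compat_l.
Qed.

Section bounds.
Variables (V1 V2 : R) (v w : vec).
Hypothesis Hv : bnd d V1 v.
Hypothesis Hw : bnd d V2 w.

Let V1_pos : 0 <= V1. Proof. le_by apply Rabs_pos; apply (Hv O); lia. Qed.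
Let V2_pos : 0 <= V2. Proof. le_by apply Rabs_pos; apply (Hw O); lia. Qed.

Lemma Hb_le om x : Rabs (Hb om x v w) <= 64 * F * V1 * V2.
Proof.
 replace (64 * F * V1 * V2) with (F * (64 * V1 * V2)) by ring.
 apply lsum_Fbd; [fin|]. intros m.
 apply cube_bound; [fin|]. left.
 eapply Rle_trans; [apply (triple_bound m _ _ _ _ 1 V1 V2 32)|fin]; trivial; try lra.
 - rewrite Rmult_1_r. apply mval_le.
 - now apply phase_le.
 - now apply phase_le.
 - apply Jm_le.
Qed.

Lemma Hb_Lip om om' x x' D : bnd2 d D om om' -> bnd2 d D x x' ->
 Rabs (Hb om x v w - Hb om' x' v w) <= 1088 * F * V1 * V2 * D.
Proof.
 intros Hom Hx. assert (HD : 0 <= D) by (le_by apply Rabs_pos; apply (Hx O); lia).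
 assert (HV : 0 <= V1 * V2 * D) by fin.
 unfold Hb. rewrite <- lsum_minus. replace (1088 * F * V1 * V2 * D) with (F * (1088 * (V1 * V2 * D))) by ring.
 apply lsum_Fbd; [lra|]. intros m. apply cube_bound; [lra|]. right.
 replace (_ - _) with (2 * (mval m (phase d m x) - mval m (phase d m x')) * phase d m v * phase d m w * Jm (phase d m om)
  + 2 * mval m (phase d m x') * phase d m v * phase d m w * (Jm (phase d m om) - Jm (phase d m om'))) by ring.
 triang. assert (Hf := mfreq_pos d m).
 assert (HfD : 0 <= mfreq d m * D) by fin.
 assert (E1 := triple_bound m (mval m (phase d m x) - mval m (phase d m x')) (phase d m v) (phase d m w) (Jm (phase d m om))
  (mfreq d m * D) V1 V2 32 V1_pos V2_pos ok).
 assert (E2 := triple_bound m (mval m (phase d m x')) (phase d m v) (phase d m w) (Jm (phase d m om) - Jm (phase d m om'))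
  1 V1 V2 (512 * (mfreq d m * D)) V1_pos V2_pos ok).
 assert (HA : Rabs (mval m (phase d m x) - mval m (phase d m x')) <= mamp m * (mfreq d m * D)).
 { le_by apply mval_Lip. apply Rmult_le_compat_l; [apply mamp_pos|]. now apply phase_Lip. }
 assert (HB : Rabs (Jm (phase d m om) - Jm (phase d m om')) <= 512 * (mfreq d m * D)).
 { le_by apply Jm_Lip. mul_l. now apply phase_Lip. }
 specialize (E1 HA (phase_le d m v V1 Hv) (phase_le d m w V2 Hw) (Jm_le _)).
 specialize (E2 ltac:(rewrite Rmult_1_r; apply mval_le) (phase_le d m v V1 Hv) (phase_le d m w V2 Hw) HB).
 lra.
Qed.

Lemma Gder_Lip_om om om' x D : bnd2 d D om om' ->
 Rabs (Gder d P om v x - Gder d P om' v x) <= 1024 * F * V1 * D.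
Proof.
 intros Hom. assert (HD : 0 <= D) by (le_by apply Rabs_pos; apply (Hom O); lia).
 assert (HV : 0 <= V1 * D) by fin.
 unfold Gder. replace (_ - _) with (- (lsum P (fun m => 2 * mder m (phase d m x) * phase d m v * Jm (phase d m om)) -
  lsum P (fun m => 2 * mder m (phase d m x) * phase d m v * Jm (phase d m om')))) by ring.
 rewrite Rabs_Ropp, <- lsum_minus. replace (1024 * F * V1 * D) with (F * (1024 * (V1 * D))) by ring.
 apply lsum_Fbd; [lra|]. intros m. apply cube_bound; [lra|]. left.
 replace (_ - _) with (2 * mder m (phase d m x) * phase d m v * (Jm (phase d m om) - Jm (phase d m om'))) by ring.
 rewrite !Rabs_mult, (Rabs_pos_eq 2) by lra.
 le_thru (2 * mamp m * (mfreq d m * V1) * (512 * (mfreq d m * D))); [|fin].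
 note (mfreq_pos d m) (mamp_pos m) as Hf Ha.
 repeat (mul_abs; trivial); try lra;
  try (repeat apply Rmult_le_pos; try apply Rabs_pos; lra).
 - apply mder_le.
 - now apply phase_le.
 - le_by apply Jm_Lip. mul_l. now apply phase_Lip.
Qed.
End bounds.

Lemma Gder_mvt om v x h : exists t, 0 <= t <= 1 /\
 Gder d P om v (fun j => x j + h j) - Gder d P om v x = Hb om (fun j => x j + t * h j) v h.
Proof.
 destruct (MVT_gen (fun t => Gder d P om v (fun j => x j + t * h j)) 0 1 (fun t => Hb om (fun j => x j + t * h j) v h)) as (t & Ht & E).
 - intros t _. apply Gder_line_derive.
 - intros t _. apply continuity_pt_filterlim. eapply is_derive_continuous. apply Gder_line_derive.
 - rewrite Rmin_left, Rmax_right in Ht by lra. exists t. split; trivial. rewrite Rminus_0_r, Rmult_1_r in E. rewrite <- E.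
  f_equal; [|f_equal]; f_equal; apply functional_extensionality; intros j; ring.
Qed.

Lemma Gder_quad om v x h V M : bnd d V v -> bnd d M h ->
 Rabs (Gder d P om v (fun j => x j + h j) - Gder d P om v x - Hb om x v h) <= 1088 * F * V * M ^ 2.
Proof.
 intros Hv Hh. destruct (Gder_mvt om v x h) as (t & Ht & ->).
 replace (1088 * F * V * M ^ 2) with (1088 * F * V * M * M) by ring.
 apply (Hb_Lip V M v h Hv Hh).
 - intros j Hj. rewrite Rminus_diag, Rabs_R0. le_by apply Rabs_pos; now apply Hh.
 - intros j Hj. replace (x j + t * h j - x j) with (t * h j) by ring. rewrite Rabs_mult, (Rabs_pos_eq t) by lra.
  generalize (Hh j Hj) (Rabs_pos (h j)). nra.
Qed.
End hessian.

(** * Non-degenerate critical points are good sites *)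

Section site.
Variables (d : nat) (P : list trig_mode) (W0 k : R).
Let F := Fbd d P.
Let K := INR d.
Hypothesis W0_ge : 1 <= W0.
Hypothesis k_pos : 0 < k.
Definition site_Bb : R := 64 * F * W0 / k.
Let Bb := site_Bb.
Definition site_M : R := (1 + K * Bb) * (1 + W0).
Let M := site_M.
(** [k] is a convexity constant with respect to displacements; [M] bounds the site coordinates by
    the displacement, and half of [k] is reserved for the variation of the Hessian over the ball. *)
Definition site_kap : R := k / (2 * INR (S d) * M ^ 2).
Let kap := site_kap.
Let CL' := CL d W0 Bb.
(** The first quotient keeps the Hessian within [k / 2] of its value at the centre; the second makes
    the Taylor error on the sphere at most [kap * r ^ 2 / 2]. Another [kap * r ^ 2 / 2] is left for
    a gradient at the centre, which determines [site_rho]. *)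
Definition site_r : R := Rmin 1 (Rmin (k / (2176 * F * CL')) (kap / (2176 * F * CL' ^ 3))).
Let r := site_r.
Definition site_rho : R := kap * r / (2 * INR (S d) * CL').
Let rho := site_rho.

Let F_ge : 1 <= F. Proof. apply Fbd_ge1. Qed.
Let K_pos : 0 <= K. Proof. apply pos_INR. Qed.
Let Sd_ge : 1 <= INR (S d). Proof. rewrite S_INR. fold K. lra. Qed.

Lemma site_Bb_pos : 0 < Bb.
Proof. unfold Bb, site_Bb. fin. Qed.

Lemma site_M_ge : 2 <= M.
Proof. unfold M, site_M. generalize site_Bb_pos. fold Bb. intros. assert (0 <= K * Bb) by fin. nra. Qed.

Lemma site_kap_pos : 0 < kap.
Proof.
 unfold kap, site_kap. fold M. generalize site_M_ge. fin.
Qed.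

Lemma CL'_ge : 1 <= CL' /\ W0 <= CL' /\ 1 + K * Bb * W0 <= CL'.
Proof.
 generalize site_Bb_pos. intros. unfold CL', CL. fold K. assert (0 <= K * Bb) by fin. fin.
Qed.

Lemma site_r_spec : 0 < r <= 1 /\ 2176 * F * CL' * r <= k /\ 2176 * F * CL' ^ 3 * r <= kap.
Proof.
 destruct CL'_ge as (H1 & _). assert (Hk := site_kap_pos).
 assert (H3 : 0 < 2176 * F * CL') by fin.
 assert (H4 : 0 < 2176 * F * CL' ^ 3) by fin.
 assert (R1 : r <= 1) by apply Rmin_l.
 assert (R2 : r <= k / (2176 * F * CL')) by (eapply Rle_trans; [apply Rmin_r|apply Rmin_l]).
 assert (R3 : r <= kap / (2176 * F * CL' ^ 3)) by (eapply Rle_trans; [apply Rmin_r|apply Rmin_r]).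
 repeat split; trivial.
 - unfold r, site_r. repeat apply Rmin_glb_lt; [lra| |]; now apply Rdiv_lt_0_compat.
 - apply Rmult_le_compat_l with (r := 2176 * F * CL') in R2; [|lra].
  replace (2176 * F * CL' * (k / (2176 * F * CL'))) with k in R2; [fin|field; split; lra].
 - apply Rmult_le_compat_l with (r := 2176 * F * CL' ^ 3) in R3; [|lra].
  replace (2176 * F * CL' ^ 3 * (kap / (2176 * F * CL' ^ 3))) with kap in R3; [fin|field; split; lra].
Qed.

Lemma site_rho_pos : 0 < rho.
Proof.
 generalize site_kap_pos site_r_spec CL'_ge. intros H1 (H2 & _) (H3 & _). unfold rho, site_rho. fin.
Qed.

Lemma site_rho_le : INR (S d) * CL' * rho = kap * r / 2.
Proof. generalize CL'_ge. intros (H & _). unfold rho, site_rho. fin. Qed.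

Section at_site.
Variables (om c : vec).
Hypothesis om_0 : om O = 1.
Hypothesis om_le : bnd d W0 om.
Hypothesis H_pd : forall v, k * sq (S d) v <= Hb d P om c v v.
Hypothesis grad_le : forall j, j <=' d -> Rabs (Gder d P om (unit_vec j) c) <= rho.

Let A := Hb d P om c om om.
(** The coefficients that make [e_j - b j * om] conjugate to [om] for the Hessian at [c]. The
    quadratic part splits into the flow direction and the rest, so the gradient points outwards on
    each of the two balls separately. *)
Definition site_b : vec := fun j => match j with O => 0 | S _ => if Nat.leb j d then Hb d P om c om (unit_vec j) / A else 0 end.
Let b := site_b.

Lemma A_ge : k <= A.
Proof.
 le_thru (k * sq (S d) om); [|fin]. rewrite <- (Rmult_1_r k) at 1. mul_l.
 replace 1 with (om O ^ 2) by fin.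
 apply (vsum_term_le (S d) (fun i => om i ^ 2)); [intros; apply pow2_ge_0|lia].
Qed.

Lemma unit_le j i : Rabs (unit_vec j i) <= 1.
Proof. unfold unit_vec. destruct (Nat.eqb i j); rewrite ?Rabs_R1, ?Rabs_R0; lra. Qed.

Lemma site_b_le j : Rabs (b j) <= Bb.
Proof.
 note site_Bb_pos A_ge as HB HA. unfold b, site_b. destruct j as [|j]; [fin|].
 destruct (Nat.leb (S j) d); [|fin].
 unfold Rdiv. rewrite Rabs_mult, Rabs_inv, (Rabs_pos_eq A) by lra.
 unfold Bb, site_Bb, Rdiv. apply Rmult_le_compat; [fin|fin| |fin].
 eapply Rle_trans; [apply (Hb_le d P W0 1); trivial|fold F; lra]. intros; apply unit_le.
Qed.

Definition Lw (u : vec) : vec := fun j => site_sig d b u * om j + match j with O => 0 | S _ => u j end.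
(** The part of the displacement conjugate to the flow: [Lw u = u O * om + Gw u], and the Hessian
    pairs [Gw u] with [om] to 0. *)
Definition Gw (u : vec) : vec := fun j => - vsum d (fun j => b (S j) * u (S j)) * om j + match j with O => 0 | S _ => u j end.

Lemma site_pt_Lw u : site_pt d om b c u = fun j => c j + Lw u j.
Proof. reflexivity. Qed.

Lemma bsum_le u R0 : bnd d R0 u -> Rabs (vsum d (fun j => b (S j) * u (S j))) <= K * Bb * R0.
Proof.
 intros H. le_by apply vsum_abs. unfold K. rewrite Rmult_assoc, <- vsum_const. apply vsum_le. intros j Hj.
 rewrite Rabs_mult. mul_abs; [apply site_b_le|fin].
Qed.

Lemma Lw_le u R0 : bnd d R0 u -> bnd d (CL' * R0) (Lw u).
Proof.
 intros H j Hj. assert (HR : 0 <= R0) by (le_by apply Rabs_pos; now apply (H j)).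
 note (bsum_le u R0 H) (om_le j Hj) as H1 H2.
 assert (H3 : Rabs (site_sig d b u) <= (1 + K * Bb) * R0).
 { unfold site_sig. triang. rewrite Rabs_Ropp. generalize (H O ok). lra. }
 unfold Lw, CL', CL. fold K. triang. rewrite Rabs_mult.
 assert (Rabs match j with O => 0 | S _ => u j end <= R0) by (destruct j; [fin|fin]).
 assert (Rabs (site_sig d b u) * Rabs (om j) <= (1 + K * Bb) * R0 * W0) by fin. lra.
Qed.

Lemma Gw_le u R0 : bnd d R0 u -> bnd d (CL' * R0) (Gw u).
Proof.
 intros H j Hj. assert (HR : 0 <= R0) by (le_by apply Rabs_pos; now apply (H j)).
 note (bsum_le u R0 H) (om_le j Hj) as H1 H2.
 unfold Gw, CL', CL. fold K. triang. rewrite Rabs_mult, Rabs_Ropp.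
 assert (Rabs match j with O => 0 | S _ => u j end <= R0) by (destruct j; [fin|fin]).
 assert (Rabs (vsum d (fun j => b (S j) * u (S j))) * Rabs (om j) <= K * Bb * R0 * W0) by fin.
 fin.
Qed.

Lemma ball_comp u j : site_ball d r u -> j <=' d -> Rabs (u j) <= r.
Proof.
 intros [H1 H2] Hj. destruct site_r_spec as ((Hr & _) & _). apply Rabs_le.
 assert (H3 : u j ^ 2 <= r ^ 2).
 { destruct j as [|j]; trivial. eapply Rle_trans; [|exact H2]. apply (vsum_term_le d (fun i => vtail u i ^ 2)); [intros; apply pow2_ge_0|lia]. }
 fin.
Qed.

Lemma comp_from_L (w : vec) : sq (S d) w <= INR (S d) * M ^ 2 * sq (S d) (Lw w).
Proof.
 set (N := sqrt (sq (S d) (Lw w))). assert (HN : bnd d N (Lw w)) by (intros; apply comp_sq; lia).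
 assert (HN0 : 0 <= N) by apply sqrt_pos. generalize site_Bb_pos. fold Bb. intros HB.
 assert (H0 : Lw w O = site_sig d b w) by (unfold Lw; rewrite om_0; ring).
 assert (Hxi : forall j, (1 <= j <= d)%nat -> Rabs (w j) <= (1 + W0) * N).
 { intros j Hj. assert (E : w j = Lw w j - Lw w O * om j) by (rewrite H0; unfold Lw; destruct j; [lia|ring]).
  rewrite E. triang. rewrite Rabs_Ropp, Rabs_mult.
  generalize (HN j ok) (HN O ok) (om_le j ok). intros.
  assert (Rabs (Lw w O) * Rabs (om j) <= N * W0) by fin. lra. }
 rewrite <- (sqrt_sqrt (sq (S d) (Lw w))) by apply sq_nonneg. fold N.
 replace (INR (S d) * M ^ 2 * (N * N)) with (INR (S d) * (M * N) ^ 2) by ring.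
 apply sq_le_comp. intros j Hj. unfold M, site_M. destruct j as [|j].
 - assert (E : w O = Lw w O + vsum d (fun j => b (S j) * w (S j))) by (rewrite H0; unfold site_sig; ring).
  rewrite E. triang. generalize (HN O ok). intros.
  assert (Rabs (vsum d (fun j => b (S j) * w (S j))) <= K * Bb * ((1 + W0) * N)).
  { le_by apply vsum_abs. unfold K. rewrite (Rmult_assoc (INR d)), <- vsum_const. apply vsum_le. intros i Hi.
   rewrite Rabs_mult. mul_abs; [apply site_b_le|apply Hxi; lia]. }
  fin.
 - le_by (apply Hxi; lia). assert (0 <= K * Bb * ((1 + W0) * N)) by fin. lra.
Qed.

Lemma tail_from_G (u : vec) : sq d (vtail u) <= INR (S d) * M ^ 2 * sq (S d) (Gw u).
Proof.
 set (N := sqrt (sq (S d) (Gw u))). assert (HN : bnd d N (Gw u)) by (intros; apply comp_sq; lia).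
 assert (HN0 : 0 <= N) by apply sqrt_pos. generalize site_Bb_pos. fold Bb. intros HB.
 le_thru (INR d * ((1 + W0) * N) ^ 2).
 - apply sq_le_comp. intros j Hj. unfold vtail.
  assert (E : u (S j) = Gw u (S j) - Gw u O * om (S j)) by (unfold Gw; rewrite om_0; ring).
  rewrite E. triang. rewrite Rabs_Ropp, Rabs_mult.
  generalize (HN (S j) ok) (HN O ok) (om_le (S j) ok). intros.
  assert (Rabs (Gw u O) * Rabs (om (S j)) <= N * W0) by fin. lra.
 - rewrite <- (sqrt_sqrt (sq (S d) (Gw u))) by apply sq_nonneg. fold N.
  replace (INR (S d) * M ^ 2 * (N * N)) with (INR (S d) * (M * N) ^ 2) by ring.
  apply Rmult_le_compat; [fin|fin|rewrite S_INR; fold K; lra|]. apply pow_incr.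
  split; [fin|]. apply Rmult_le_compat_r; trivial. unfold M, site_M.
  assert (0 <= K * Bb * (1 + W0)) by fin. lra.
Qed.

Lemma b_dot u : A * vsum d (fun j => b (S j) * u (S j)) = vsum d (fun j => u (S j) * Hb d P om c om (unit_vec (S j))).
Proof.
 assert (HA := A_ge). rewrite <- vsum_scal. apply vsum_ext. intros j Hj. unfold b, site_b.
 destruct (Nat.leb_spec (S j) d); [field; lra|lia].
Qed.

Lemma Hb_om_Lw u : Hb d P om c om (Lw u) = A * u O.
Proof.
 rewrite Hb_sym. unfold Lw. rewrite Hb_lin. fold A. rewrite Hb_unit_sum, vsum_first, Rmult_0_l, Rplus_0_l.
 rewrite (vsum_ext d (fun i => u (S i) * Hb d P om c (unit_vec (S i)) om) (fun j => u (S j) * Hb d P om c om (unit_vec (S j))))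
  by (intros; now rewrite Hb_sym).
 rewrite <- b_dot. unfold site_sig. ring.
Qed.

Lemma Hb_Gw_Lw u : Hb d P om c (Gw u) (Lw u) = Hb d P om c (Gw u) (Gw u).
Proof.
 rewrite (Hb_ext d P om c c (Gw u) (Gw u) (Lw u) (fun j => u O * om j + Gw u j)) by
  (trivial; intros j Hj; unfold Lw, Gw, site_sig; ring).
 rewrite (Hb_sym d P om c (Gw u)), Hb_lin. rewrite (Hb_sym d P om c om (Gw u)). unfold Gw at 1. rewrite Hb_lin. fold A.
 rewrite (Hb_unit_sum d P om c _ om), vsum_first, Rmult_0_l, Rplus_0_l.
 rewrite (vsum_ext d (fun i => u (S i) * Hb d P om c (unit_vec (S i)) om) (fun j => u (S j) * Hb d P om c om (unit_vec (S j))))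
  by (intros; now rewrite Hb_sym).
 rewrite <- b_dot. ring.
Qed.

Lemma Gder_Lw (w : vec) y : Gder d P om (Lw w) y = site_sig d b w * Gder d P om om y + vsum d (fun j => w (S j) * Gder d P om (unit_vec (S j)) y).
Proof.
 rewrite (Gder_unit_sum d P om (Lw w)), (Gder_unit_sum d P om om y), <- vsum_scal, !(vsum_first d).
 rewrite Rplus_assoc, <- vsum_plus. unfold Lw. f_equal; [ring|]. apply vsum_ext. fin.
Qed.

Lemma Gder_Gw u y : Gder d P om (Gw u) y = vsum d (fun j => u (S j) * Gder d P om (unit_vec (S j)) y) - vsum d (fun j => b (S j) * u (S j)) * Gder d P om om y.
Proof.
 rewrite (Gder_unit_sum d P om (Gw u)), (Gder_unit_sum d P om om y), <- vsum_scal, !(vsum_first d).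
 unfold Gw. unfold Rminus. rewrite Ropp_plus_distr, (Rplus_comm (vsum d _)), Rplus_assoc. f_equal; [ring|].
 rewrite Rplus_comm. rewrite <- (Rmult_1_l (vsum d (fun i => vsum d _ * _))) .
 match goal with |- _ = ?a + - (1 * ?b) => replace (a + - (1 * b)) with (a - b) by ring end.
 rewrite <- vsum_minus. apply vsum_ext. fin.
Qed.

Lemma Gder_center v V : bnd d V v -> Rabs (Gder d P om v c) <= INR (S d) * V * rho.
Proof.
 intros Hv. rewrite Gder_unit_sum. le_by apply vsum_abs.
 rewrite Rmult_assoc, <- vsum_const. apply vsum_le. intros j Hj. rewrite Rabs_mult.
 mul_abs; [apply Hv|apply grad_le]; lia.
Qed.

Lemma two_kap : k = 2 * kap * (INR (S d) * M ^ 2).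
Proof. unfold kap, site_kap. fold M. generalize site_M_ge. fin. Qed.

Lemma kap_le_k : 2 * kap <= k.
Proof.
 rewrite two_kap. generalize site_M_ge site_kap_pos. intros.
 assert (1 <= INR (S d) * M ^ 2) by fin. nra.
Qed.

Lemma site_monotone u v : site_ball d r u -> site_ball d r v ->
 kap * vsum (S d) (fun j => (u j - v j) ^ 2) <=
 (site_sig d b u - site_sig d b v) *
  (Gder d P om om (site_pt d om b c u) - Gder d P om om (site_pt d om b c v)) +
 vsum d (fun j => (u (S j) - v (S j)) *
  (Gder d P om (unit_vec (S j)) (site_pt d om b c u) - Gder d P om (unit_vec (S j)) (site_pt d om b c v))).
Proof.
 intros Hu Hv. set (w := fun j => u j - v j). change (vsum (S d) (fun j => (u j - v j) ^ 2)) with (sq (S d) w).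
 set (Xu := site_pt d om b c u). set (Xv := site_pt d om b c v).
 assert (Hsig : site_sig d b w = site_sig d b u - site_sig d b v).
 { unfold site_sig, w. rewrite (vsum_ext _ (fun j => b (S j) * (u (S j) - v (S j))) (fun j => b (S j) * u (S j) - b (S j) * v (S j))) by (intros; ring).
  rewrite vsum_minus. ring. }
 assert (HX : Xu = fun j => Xv j + Lw w j).
 { apply functional_extensionality. intros j. unfold Xu, Xv, site_pt, Lw. rewrite Hsig. unfold w. destruct j; ring. }
 le_thru (Gder d P om (Lw w) Xu - Gder d P om (Lw w) Xv).
 - rewrite HX. destruct (Gder_mvt d P om (Lw w) Xv (Lw w)) as (t & Ht & ->).
  set (N := sqrt (sq (S d) (Lw w))). assert (HN : bnd d N (Lw w)) by (intros; apply comp_sq; lia).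
  destruct site_r_spec as (Hr & Hr2 & _).
  assert (HL := Hb_Lip d P N N (Lw w) (Lw w) HN HN om om (fun j => Xv j + t * Lw w j) c (CL' * r)).
  fold F in HL. rewrite (Rmult_assoc (1088 * F)) in HL.
  unfold N in HL. rewrite sqrt_sqrt in HL by apply sq_nonneg.
  assert (HL' : Rabs (Hb d P om (fun j => Xv j + t * Lw w j) (Lw w) (Lw w) - Hb d P om c (Lw w) (Lw w)) <= 1088 * F * sq (S d) (Lw w) * (CL' * r)).
  { apply HL.
   - intros j Hj. rewrite Rminus_diag, Rabs_R0. apply Rmult_le_pos; [generalize CL'_ge|]; lra.
   - intros j Hj. replace (Xv j + t * Lw w j - c j) with ((1 - t) * Lw v j + t * Lw u j).
    + note (Lw_le u r (fun i Hi => ball_comp u i Hu Hi) j Hj) (Lw_le v r (fun i Hi => ball_comp v i Hv Hi) j Hj) as A1 A2.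
     triang. rewrite !Rabs_mult, (Rabs_pos_eq t), (Rabs_pos_eq (1 - t)) by lra. nra.
    + unfold Xv, site_pt, Lw. rewrite Hsig. unfold w. destruct j; ring. }
  note (H_pd (Lw w)) (comp_from_L w) (sq_nonneg (S d) (Lw w)) site_kap_pos as B1 B2 B3 B4.
  assert (B5 : 1088 * F * sq (S d) (Lw w) * (CL' * r) <= k / 2 * sq (S d) (Lw w)).
  { fin. }
  assert (B6 : kap * sq (S d) w <= k / 2 * sq (S d) (Lw w)).
  { rewrite two_kap. fin. }
  fin.
 - rewrite !Gder_Lw, Hsig. right.
  rewrite (vsum_ext d (fun j => (u (S j) - v (S j)) * (Gder d P om (unit_vec (S j)) Xu - Gder d P om (unit_vec (S j)) Xv)) (fun j => w (S j) * Gder d P om (unit_vec (S j)) Xu - w (S j) * Gder d P om (unit_vec (S j)) Xv))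
   by (intros; unfold w; ring).
  rewrite vsum_minus. ring.
Qed.

Lemma r_pow : 1088 * F * CL' ^ 3 * r ^ 3 <= kap * r ^ 2 / 2.
Proof.
 destruct site_r_spec as (Hr & _ & H). fin.
Qed.

Lemma site_outward_tail u : site_ball d r u -> sq d (vtail u) = r ^ 2 ->
 kap * r ^ 2 <= vsum d (fun j => u (S j) * Gder d P om (unit_vec (S j)) (site_pt d om b c u)) -
   vsum d (fun j => b (S j) * u (S j)) * Gder d P om om (site_pt d om b c u).
Proof.
 intros Hu Hbd. rewrite <- Gder_Gw, site_pt_Lw. destruct site_r_spec as (Hr & _). destruct CL'_ge as (HC & _).
 assert (HG := Gw_le u r (fun i Hi => ball_comp u i Hu Hi)). assert (HL := Lw_le u r (fun i Hi => ball_comp u i Hu Hi)).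
 generalize (Gder_quad d P om (Gw u) c (Lw u) (CL' * r) (CL' * r) HG HL) (Gder_center (Gw u) (CL' * r) HG). fold F.
 rewrite Hb_Gw_Lw. intros E1 E2. generalize (H_pd (Gw u)) (tail_from_G u) r_pow site_kap_pos. rewrite Hbd. intros E3 E4 E5 E6.
 replace (INR (S d) * (CL' * r) * rho) with (kap * r / 2 * r) in E2 by (rewrite <- site_rho_le; ring).
 replace (1088 * F * (CL' * r) * (CL' * r) ^ 2) with (1088 * F * CL' ^ 3 * r ^ 3) in E1 by ring.
 assert (E7 : 2 * kap * r ^ 2 <= k * sq (S d) (Gw u)).
 { rewrite two_kap. fin. }
 fin.
Qed.

Lemma site_outward_time u : site_ball d r u -> u O ^ 2 = r ^ 2 ->
 kap * r ^ 2 <= u O * Gder d P om om (site_pt d om b c u).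
Proof.
 intros Hu Hbd. rewrite site_pt_Lw. destruct site_r_spec as (Hr & _). destruct CL'_ge as (HC & HW & _).
 assert (HL := Lw_le u r (fun i Hi => ball_comp u i Hu Hi)).
 assert (Hom : bnd d CL' om) by (intros; eapply Rle_trans; [fin|fin]).
 generalize (Gder_quad d P om om c (Lw u) CL' (CL' * r) Hom HL) (Gder_center om CL' Hom). fold F. fold A.
 rewrite Hb_om_Lw. intros E1 E2. note r_pow site_kap_pos A_ge kap_le_k as E5 E6 E7 E8.
 replace (INR (S d) * CL' * rho) with (kap * r / 2) in E2 by (now rewrite <- site_rho_le).
 set (Y := Gder d P om om (fun j => c j + Lw u j)) in *.
 assert (Hu0 : Rabs (u O) = r).
 { rewrite <- (Rabs_pos_eq r) by lra. rewrite <- !sqrt_Rsqr_abs, !Rsqr_pow2. now rewrite Hbd. }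
 assert (E9 : Rabs (Y - A * u O) <= kap * r / 2 + 1088 * F * CL' ^ 3 * r ^ 2).
 { fin. }
 assert (E10 : Rabs (u O * (Y - A * u O)) <= r * (kap * r / 2 + 1088 * F * CL' ^ 3 * r ^ 2)).
 { fin. }
 apply Rabs_le_between in E10. fin.
Qed.

Theorem nondegenerate_good_site : good_site d P W0 Bb r kap om b c.
Proof.
 split; [fin|split; [fin|split; [apply site_b_le|split; [|split]]]].
 - apply site_monotone.
 - apply site_outward_tail.
 - apply site_outward_time.
Qed.
End at_site.
End site.

(** * Non-degenerate minima *)

Definition qform (n : nat) (a : nat -> nat -> R) (v : vec) : R :=
 vsum n (fun i => v i * vsum n (fun j => a i j * v j)).

Lemma qform_first n a v : (forall i j, a i j = a j i) ->
 qform (S n) a v = a O O * v O ^ 2 + 2 * v O * vsum n (fun j => a O (S j) * v (S j)) +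
  qform n (fun i j => a (S i) (S j)) (vtail v).
Proof.
 intros Hs. unfold qform, vtail. rewrite vsum_first.
 rewrite (vsum_ext n (fun i => v (S i) * vsum (S n) (fun j => a (S i) j * v j))
  (fun i => v O * (a O (S i) * v (S i)) + v (S i) * vsum n (fun j => a (S i) (S j) * v (S j)))).
 - rewrite vsum_plus, vsum_scal, (vsum_first n (fun j => a O j * v j)). ring.
 - intros i Hi. rewrite vsum_first, (Hs (S i) O). ring.
Qed.

(* Completing the square in the first variable. *)
Lemma psd_dichotomy n : forall a, (forall i j, a i j = a j i) -> (forall v, 0 <= qform n a v) ->
 (exists k, 0 < k /\ forall v, k * sq n v <= qform n a v) \/
 (exists v, (exists j, j <' n /\ v j <> 0) /\ qform n a v = 0).
Proof.
 induction n as [|n IH]; intros a Hs Hp.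
 { left. exists 1. split; [lra|]. intros v. unfold sq, qform. rewrite !vsum_0. lra. }
 set (a0 := a O O). set (l := fun v : vec => vsum n (fun j => a O (S j) * v j)).
 set (cons := fun (x : R) (v : vec) j => match j with O => x | S i => v i end).
 assert (Hq : forall x v, qform (S n) a (cons x v) = a0 * x ^ 2 + 2 * x * l v + qform n (fun i j => a (S i) (S j)) v).
 { intros x v. rewrite (qform_first n a); trivial. }
 assert (Ha0 : 0 <= a0).
 { generalize (Hp (cons 1 (fun _ => 0))). rewrite Hq. unfold l, qform.
  rewrite (vsum_ext n (fun j => a O (S j) * 0) (fun _ => 0)) by (intros; ring).
  rewrite (vsum_ext n (fun i => 0 * _) (fun _ => 0)) by (intros; ring). rewrite !vsum_zero. lra. }
 destruct Ha0 as [Ha0|Ha0].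
 (* Schur complement of the entry [a0], nonnegative again by choosing the first coordinate
    optimally. *)
 - set (a' := fun i j => a (S i) (S j) + - / a0 * a O (S i) * a O (S j)).
  assert (Hq' : forall v, qform n a' v = qform n (fun i j => a (S i) (S j)) v - l v ^ 2 / a0).
  { intros v. unfold qform, a'.
   rewrite (vsum_ext n (fun i => v i * _) (fun i => v i * vsum n (fun j => a (S i) (S j) * v j) + (- / a0 * l v) * (a O (S i) * v i))).
   - rewrite vsum_plus, vsum_scal. fold (l v). fin.
   - intros i Hi. rewrite (vsum_ext n _ (fun j => a (S i) (S j) * v j + (- / a0 * a O (S i)) * (a O (S j) * v j))) by (intros; ring).
    rewrite vsum_plus, vsum_scal. fold (l v). ring. }
  assert (Hsq : forall x v, qform (S n) a (cons x v) = a0 * (x + l v / a0) ^ 2 + qform n a' v).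
  { intros x v. rewrite Hq, Hq'. fin. }
  destruct (IH a') as [(k & Hk & Hpd)|(v & Hv & Hn)].
  + intros i j. unfold a'. rewrite (Hs (S i) (S j)). ring.
  + intros v. generalize (Hp (cons (- l v / a0) v)). rewrite Hsq.
   fin.
  + left. set (B := vsum n (fun j => a O (S j) ^ 2) / a0 ^ 2).
   assert (HB : 0 <= B) by (apply Rdiv_le_0_compat; [apply vsum_nonneg; intros; apply pow2_ge_0|fin]).
   exists (Rmin (a0 / 2) (k / (1 + 2 * B))). split; [apply Rmin_glb_lt; [lra|fin]|].
   intros v. set (k' := Rmin (a0 / 2) (k / (1 + 2 * B))).
   assert (K1 : k' <= a0 / 2) by apply Rmin_l. assert (K2 : k' <= k / (1 + 2 * B)) by apply Rmin_r.
   assert (K0 : 0 < k') by (apply Rmin_glb_lt; [lra|fin]).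
   apply Rmult_le_compat_r with (r := 1 + 2 * B) in K2; [|lra]. unfold Rdiv in K2 at 1. rewrite Rmult_assoc, Rinv_l in K2 by lra.
   replace (qform (S n) a v) with (qform (S n) a (cons (v O) (vtail v))) by
    (f_equal; apply functional_extensionality; intros [|j]; reflexivity).
   rewrite Hsq. unfold sq. rewrite vsum_first. fold (sq n (vtail v)). change (vsum n (fun i => v (S i) ^ 2)) with (sq n (vtail v)).
   generalize (Hpd (vtail v)) (sq_nonneg n (vtail v)). set (w := vtail v). intros H1 H2.
   assert (HCS : (l w / a0) ^ 2 <= B * sq n w).
   { unfold B, Rdiv. rewrite Rpow_mult_distr.
    replace (vsum n (fun j => a O (S j) ^ 2) * / a0 ^ 2 * sq n w) with (vsum n (fun j => a O (S j) ^ 2) * sq n w * / a0 ^ 2) by ring.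
    rewrite pow_inv. apply Rmult_le_compat_r; [fin|].
    apply vsum_Cauchy_Schwarz. }
   set (y := l w / a0) in *. assert (v O ^ 2 <= 2 * (v O + y) ^ 2 + 2 * y ^ 2) by (assert (0 <= (v O + 2 * y) ^ 2) by apply pow2_ge_0; nra).
   assert (0 <= (v O + y) ^ 2) by apply pow2_ge_0.
   fin.
  + right. exists (cons (- l v / a0) v). split.
   * destruct Hv as (j & Hj & Hj0). exists (S j). fin.
   * rewrite Hsq, Hn. fin.
 - right. exists (cons 1 (fun _ => 0)). split; [exists O; split; [lia|simpl; lra]|].
  rewrite Hq, <- Ha0. unfold l, qform.
  rewrite (vsum_ext n (fun j => a O (S j) * 0) (fun _ => 0)) by (intros; ring).
  rewrite (vsum_ext n (fun i => 0 * _) (fun _ => 0)) by (intros; ring). rewrite !vsum_zero. ring.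
Qed.

Section minimum.
Variables (d : nat) (P : list trig_mode) (om x0 : vec).

Lemma vupd_line x j y : vupd x j y = fun i => vupd x j 0 i + y * unit_vec j i.
Proof. apply functional_extensionality. intros i. unfold vupd, unit_vec. destruct (Nat.eqb i j); ring. Qed.

Lemma vupd_id x j : vupd x j (x j) = x.
Proof. apply functional_extensionality. intros i. unfold vupd. destruct (Nat.eqb_spec i j) as [->|]; trivial. Qed.

Lemma partial_Gpot j x : partial (Gpot d P om) j x = Gder d P om (unit_vec j) x.
Proof.
 unfold partial. apply is_derive_unique. rewrite <- (vupd_id x j) at 2. rewrite vupd_line.
 apply (is_derive_ext (fun y => Gpot d P om (fun i => vupd x j 0 i + y * unit_vec j i))); [intros; now rewrite <- vupd_line|].
 apply Gpot_line_derive.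
Qed.

Lemma hessian_Gpot i j x : hessian (Gpot d P om) x i j = Hb d P om x (unit_vec i) (unit_vec j).
Proof.
 unfold hessian. apply is_derive_unique. rewrite <- (vupd_id x j) at 2. rewrite vupd_line.
 apply (is_derive_ext (fun y => Gder d P om (unit_vec i) (fun k => vupd x j 0 k + y * unit_vec j k))).
 - intros y. now rewrite partial_Gpot, <- vupd_line.
 - apply Gder_line_derive.
Qed.

Variable delta : R.
Hypothesis delta_pos : 0 < delta.
Hypothesis local_min : forall x, (forall i, i <' S d -> Rabs (x i - x0 i) < delta) -> Gpot d P om x0 <= Gpot d P om x.

Lemma line_min h : exists r, 0 < r /\ forall t, Rabs t < r -> Gpot d P om x0 <= Gpot d P om (fun j => x0 j + t * h j).
Proof.
 set (N := sqrt (sq (S d) h)). assert (HN : 0 <= N) by apply sqrt_pos.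
 exists (delta / (1 + N)). split; [fin|]. intros t Ht. apply local_min. intros i Hi.
 replace (x0 i + t * h i - x0 i) with (t * h i) by ring. rewrite Rabs_mult.
 generalize (comp_sq (S d) h i Hi). fold N. intros H1.
 apply Rle_lt_trans with (Rabs t * (1 + N)); [fin|].
 replace delta with (delta / (1 + N) * (1 + N)) by fld. fin.
Qed.

Lemma line_at0 h : (fun j => x0 j + 0 * h j) = x0.
Proof. apply functional_extensionality. fin. Qed.

Lemma min_gradient h : Gder d P om h x0 = 0.
Proof.
 destruct (line_min h) as (r & Hr & Hmin).
 assert (Hd := Gpot_line_derive d P om x0 h 0). rewrite line_at0 in Hd. set (l := Gder d P om h x0) in *.
 destruct (Req_dec l 0) as [|Hl]; trivial. exfalso.
 rewrite is_derive_eps in Hd. assert (Hla : 0 < Rabs l) by now apply Rabs_pos_lt.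
 destruct (Hd (Rabs l / 2) ok) as (r1 & Hr1 & H1).
 set (t0 := Rmin r r1 / 2). assert (Ht0 : 0 < t0 /\ t0 < r /\ t0 < r1).
 { unfold t0. generalize (Rmin_l r r1) (Rmin_r r r1) (Rmin_glb_lt _ _ _ Hr Hr1). lra. }
 assert (Hs : exists t, Rabs t = t0 /\ t * l = - (t0 * Rabs l)).
 { destruct (Rle_lt_dec 0 l).
  - exists (- t0). rewrite Rabs_Ropp, (Rabs_pos_eq t0), (Rabs_pos_eq l) by lra. fin.
  - exists t0. rewrite (Rabs_pos_eq t0), (Rabs_left l) by lra. fin. }
 destruct Hs as (t & Ht & Htl). generalize (H1 t ltac:(rewrite Rminus_0_r; lra)) (Hmin t ok).
 rewrite line_at0, Rminus_0_r, Htl, Ht. intros H2 H3. apply Rabs_le_between in H2. nra.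
Qed.

Lemma min_hessian h : 0 <= Hb d P om x0 h h.
Proof.
 destruct (line_min h) as (r & Hr & Hmin).
 assert (Hd := Gder_line_derive d P om h x0 h 0). rewrite line_at0 in Hd. set (l := Hb d P om x0 h h) in *.
 destruct (Rle_lt_dec 0 l) as [|Hl]; trivial. exfalso.
 rewrite is_derive_eps in Hd. destruct (Hd (- l / 2) ok) as (r1 & Hr1 & H1).
 set (t := Rmin r r1 / 2). assert (Ht0 : 0 < t /\ t < r /\ t < r1).
 { unfold t. generalize (Rmin_l r r1) (Rmin_r r r1) (Rmin_glb_lt _ _ _ Hr Hr1). lra. }
 assert (Hneg : forall s, 0 <= s <= t -> Gder d P om h (fun j => x0 j + s * h j) <= s * l / 2).
 { intros s Hs. generalize (H1 s ltac:(rewrite Rminus_0_r, Rabs_pos_eq; lra)).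
  rewrite line_at0, min_gradient, !Rminus_0_r, (Rabs_pos_eq s) by lra. fin. }
 assert (Hmvt : forall a b, 0 <= a <= b -> b <= t -> Gpot d P om (fun j => x0 j + b * h j) - Gpot d P om (fun j => x0 j + a * h j) <= (b - a) * (a * l / 2)).
 { intros a b Ha Hb0. destruct (MVT_gen (fun t => Gpot d P om (fun j => x0 j + t * h j)) a b (fun t => Gder d P om h (fun j => x0 j + t * h j))) as (s & Hs & ->).
  - intros s _. apply Gpot_line_derive.
  - intros s _. apply continuity_pt_filterlim. eapply is_derive_continuous. apply Gpot_line_derive.
  - rewrite Rmin_left, Rmax_right in Hs by lra. rewrite Rmult_comm. mul_l.
   le_by (apply Hneg; lra). nra. }
 (* On the first half the bound only says that the potential does not increase; on the second the
    slope is at most [t * l / 4 < 0], so the value at [t] falls strictly below the minimum. *)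
 generalize (Hmvt 0 (t / 2) ok ok) (Hmvt (t / 2) t ok ok) (Hmin t ltac:(rewrite Rabs_pos_eq; lra)).
 rewrite line_at0. intros. assert (0 < t * t) by fin. fin.
Qed.

Hypothesis kernel : forall v : vec,
 (forall i, i <' S d -> vsum (S d) (fun j => hessian (Gpot d P om) x0 i j * v j) = 0) ->
 forall j, j <' S d -> v j = 0.

Lemma Hb_qform v : Hb d P om x0 v v = qform (S d) (fun i j => Hb d P om x0 (unit_vec i) (unit_vec j)) v.
Proof.
 rewrite Hb_unit_sum. apply vsum_ext. intros i Hi. f_equal. rewrite Hb_sym, Hb_unit_sum.
 apply vsum_ext. intros j Hj. rewrite (Hb_sym d P om x0 (unit_vec j)). ring.
Qed.

(** An isotropic vector of a nonnegative form lies in its kernel, so non-degeneracy excludes the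
    second alternative of [psd_dichotomy]. *)
Lemma min_positive_definite : exists k, 0 < k /\ forall v, k * sq (S d) v <= Hb d P om x0 v v.
Proof.
 destruct (psd_dichotomy (S d) (fun i j => Hb d P om x0 (unit_vec i) (unit_vec j))) as [(k & Hk & H)|(v & (j & Hj & Hvj) & Hv)].
 - intros; apply Hb_sym.
 - intros v. rewrite <- Hb_qform. apply min_hessian.
 - exists k. split; trivial. intros v. rewrite Hb_qform. apply H.
 - exfalso. apply Hvj. apply kernel; trivial. intros i Hi. rewrite <- Hb_qform in Hv.
  rewrite (vsum_ext _ _ (fun j => v j * Hb d P om x0 (unit_vec j) (unit_vec i))) by (intros; rewrite hessian_Gpot, Hb_sym; ring).
  rewrite <- Hb_unit_sum. set (w := unit_vec i).
  assert (Ht : forall t, 0 <= 2 * t * Hb d P om x0 v w + t ^ 2 * Hb d P om x0 w w).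
  { intros t. generalize (min_hessian (fun j => t * w j + v j)).
   rewrite Hb_lin, (Hb_sym d P om x0 w), (Hb_sym d P om x0 v), !Hb_lin, Hv. rewrite (Hb_sym d P om x0 w v). fin. }
  set (p := Hb d P om x0 v w) in *. set (q := Hb d P om x0 w w) in *.
  assert (Hq : 0 <= q) by apply min_hessian.
  (* The minimiser would be [- p / q]; the shifted denominator is safe when [q = 0] and still gives
     a negative value unless [p = 0]. *)
  generalize (Ht (- p / (q + 1))). replace (2 * (- p / (q + 1)) * p + (- p / (q + 1)) ^ 2 * q) with (- (p / (q + 1)) ^ 2 * (q + 2)) by fld.
  intros H1. assert (H2 : (p / (q + 1)) ^ 2 <= 0) by nra.
  assert (H3 : p / (q + 1) = 0) by fin.
  replace p with (p / (q + 1) * (q + 1)) by fld. fin.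
Qed.
End minimum.

(** In place of the implicit function theorem: the variational inequality with a single site, whose
    multipliers vanish because the gradient points outwards. It continues minima to nearby
    frequencies. *)
Lemma critical_point d P W Bb r kap om b c : 0 < r <= 1 -> 0 < kap -> 0 <= Bb -> 1 <= W -> good_site d P W Bb r kap om b c ->
 exists x, (bnd2 d (CL d W Bb * r) x c) /\
  forall j, j <=' d -> Gder d P om (unit_vec j) x = 0.
Proof.
 intros Hr Hk HBb HW (Hom0 & Hom & Hb0 & S1 & S2 & S3).
 assert (HF := Fbd_ge1 d P). set (F := Fbd d P) in *.
 set (Ge := fun u : vec => Gder d P om om (site_pt d om b c u)).
 set (Gp := fun (u : vec) j => Gder d P om (unit_vec j) (site_pt d om b c u)).
 set (G := fun (u : nat -> vec) (i : nat) (j : nat) => match j with O => Ge (u i) | S _ => Gp (u i) j - b j * Ge (u i) end).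
 assert (HL : forall u v N, bnd2 d N u v -> bnd2 d (CL d W Bb * N) (site_pt d om b c u) (site_pt d om b c v)).
 { intros u v N H j Hj. assert (HN : 0 <= N) by (le_by apply Rabs_pos; now apply (H j)).
  unfold site_pt, site_sig, CL.
  assert (Hs : Rabs (vsum d (fun j => b (S j) * (u (S j) - v (S j)))) <= INR d * Bb * N).
  { le_by apply vsum_abs. rewrite Rmult_assoc, <- vsum_const. apply vsum_le. fin. }
  rewrite (vsum_ext d _ (fun j => b (S j) * u (S j) - b (S j) * v (S j))), vsum_minus in Hs by (intros; ring).
  set (su := vsum d (fun j => b (S j) * u (S j))) in *. set (sv := vsum d (fun j => b (S j) * v (S j))) in *.
  replace (_ - _) with ((u O - v O - (su - sv)) * om j + match j with O => 0 | S _ => u j - v j end) by (destruct j; ring).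
  triang. rewrite Rabs_mult.
  assert (Rabs (u O - v O - (su - sv)) <= (1 + INR d * Bb) * N).
  { triang. rewrite Rabs_Ropp. generalize (H O ok). lra. }
  assert (Rabs match j with O => 0 | S _ => u j - v j end <= N) by (destruct j; [fin|fin]).
  assert (Rabs (u O - v O - (su - sv)) * Rabs (om j) <= (1 + INR d * Bb) * N * W)
   by fin. lra. }
 set (Cl := CL d W Bb) in *. assert (HCl : 1 <= Cl) by apply (CL_ge d W Bb HW HBb).
 assert (HGe : forall u v N, bnd2 d N u v -> Rabs (Ge u - Ge v) <= 64 * F * W * (Cl * N)).
 { intros u v N H. apply Gder_Lip; [lra|fin|fin]. }
 assert (HGp : forall u v N j, bnd2 d N u v -> Rabs (Gp u j - Gp v j) <= 64 * F * 1 * (Cl * N)).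
 { intros u v N j H. apply Gder_Lip; [lra| |fin]. intros. apply unit_le. }
 set (LG := 64 * F * 1 * Cl + (1 + Bb) * (64 * F * W * Cl)).
 assert (V1 : forall g, vsum 1 g = g O) by (intros; rewrite vsum_S, vsum_0; ring).
 assert (H64 : 0 <= 64 * F * 1 * Cl /\ 0 <= 64 * F * W * Cl) by fin.
 destruct (variational_inequality 1 d r kap (INR (S d) * LG ^ 2) G ok Hk) as (u & Hu & H).
 - intros u v Hu Hv. unfold dist2, dot. rewrite !V1.
  le_by (apply (S1 (u O) (v O)); [apply (Hu O)|apply (Hv O)]; lia).
  right. rewrite (vsum_first d (fun j => (G u O j - G v O j) * (u O j - v O j))). unfold G. fold (Ge (u O)) (Ge (v O)).
  set (D := Ge (u O) - Ge (v O)).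
  rewrite (vsum_ext d (fun i => (Gp (u O) (S i) - b (S i) * Ge (u O) - (Gp (v O) (S i) - b (S i) * Ge (v O))) * (u O (S i) - v O (S i)))
   (fun i => (u O (S i) - v O (S i)) * (Gp (u O) (S i) - Gp (v O) (S i)) - D * (b (S i) * u O (S i) - b (S i) * v O (S i))))
   by (intros; unfold D; ring).
  rewrite vsum_minus, vsum_scal, vsum_minus. unfold site_sig. fold D. unfold Gp. ring.
 - intros u v Hu Hv. unfold dist2. rewrite !V1.
  set (N2 := vsum (S d) (fun j => (u O j - v O j) ^ 2)). set (N := sqrt N2).
  assert (HN2 : 0 <= N2) by (apply vsum_nonneg; intros; apply pow2_ge_0).
  assert (HN : bnd2 d N (u O) (v O)) by (intros; apply (comp_sq (S d) (fun j => u O j - v O j)); lia).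
  assert (HN0 : 0 <= N) by apply sqrt_pos.
  le_thru (INR (S d) * (LG * N) ^ 2); [|right; unfold N; rewrite Rpow_mult_distr, pow2_sqrt by trivial; ring].
  apply (sq_le_comp (S d) (fun j => G u O j - G v O j)). intros j Hj.
  note (HGe (u O) (v O) N HN) (HGp (u O) (v O) N j HN) as E1 E2.
  assert (0 <= Bb * (64 * F * W * Cl) * N) by fin.
  assert (0 <= 64 * F * 1 * Cl * N) by fin.
  assert (0 <= 64 * F * W * Cl * N) by fin.
  unfold G, LG. destruct j as [|j]; [lra|].
  replace (_ - _) with ((Gp (u O) (S j) - Gp (v O) (S j)) - b (S j) * (Ge (u O) - Ge (v O))) by ring.
  triang. rewrite Rabs_Ropp, Rabs_mult.
  assert (Rabs (b (S j)) * Rabs (Ge (u O) - Ge (v O)) <= Bb * (64 * F * W * (Cl * N))) by fin. lra.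
 - destruct (H O ok) as (l0 & l1 & Hl0 & Hl1 & E0 & E1 & C0 & C1).
  assert (Hub : site_ball d r (u O)) by (apply (Hu O); lia).
  assert (Z0 : l0 = 0).
  { destruct C0 as [|C0]; trivial. exfalso. generalize (S3 _ Hub C0). change (Gder d P om om (site_pt d om b c (u O))) with (G u O O).
   rewrite E0. replace (u O O * (- l0 * u O O)) with (- l0 * u O O ^ 2) by ring. rewrite C0.
   assert (0 < kap * r ^ 2) by fin. fin. }
  assert (Z1 : l1 = 0).
  { destruct C1 as [|C1]; trivial. exfalso. generalize (S2 _ Hub C1). fold (Ge (u O)).
   rewrite (Rmult_comm (vsum d _) (Ge (u O))), <- vsum_scal, <- vsum_minus.
   rewrite (vsum_ext d _ (fun j => - l1 * vtail (u O) j ^ 2)).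
   - rewrite vsum_scal. change (vsum d (fun j => vtail (u O) j ^ 2)) with (sq d (vtail (u O))). rewrite C1.
    assert (0 < kap * r ^ 2) by fin. fin.
   - intros j Hj. generalize (E1 (S j) ok). unfold G, Gp, vtail. fin. }
  assert (HGe0 : Ge (u O) = 0) by (change (G u O O = 0); rewrite E0, Z0; ring).
  assert (HGp0 : forall j, (1 <= j <= d)%nat -> Gp (u O) j = 0).
  { intros j Hj. generalize (E1 j Hj). unfold G. destruct j as [|j]; [lia|]. fin. }
  exists (site_pt d om b c (u O)). split.
  + intros j Hj. assert (E : site_pt d om b c (fun _ => 0) j = c j).
   { unfold site_pt, site_sig. rewrite (vsum_ext d _ (fun _ => 0)), vsum_zero by (intros; ring). destruct j; ring. }
   rewrite <- E. apply HL; trivial. intros i Hi. rewrite Rminus_0_r. destruct Hub as [B1 B2].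
   assert (B3 : u O i ^ 2 <= r ^ 2).
   { destruct i as [|i]; trivial. eapply Rle_trans; [|exact B2]. apply (vsum_term_le d (fun i => vtail (u O) i ^ 2)); [intros; apply pow2_ge_0|lia]. }
   apply Rabs_le. fin.
  + intros j Hj. destruct j as [|j]; [|apply HGp0; lia].
   generalize HGe0. unfold Ge. rewrite Gder_unit_sum, vsum_first, Hom0.
   rewrite (vsum_ext d _ (fun _ => 0)), vsum_zero; [lra|]. intros i Hi. fold (Gp (u O) (S i)). rewrite HGp0 by lia. ring.
Qed.

(** * Periodicity and compactness *)

Lemma trig_period_Z x (k : Z) : cos (x + 2 * PI * IZR k) = cos x /\ sin (x + 2 * PI * IZR k) = sin x.
Proof.
 destruct (Z_le_gt_dec 0 k) as [H|H].
 - rewrite <- (Z2Nat.id k H), <- INR_IZR_INZ. rewrite <- (cos_period x (Z.to_nat k)), <- (sin_period x (Z.to_nat k)).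
  fin.
 - rewrite <- (cos_period (x + 2 * PI * IZR k) (Z.to_nat (- k))), <- (sin_period (x + 2 * PI * IZR k) (Z.to_nat (- k))).
  rewrite INR_IZR_INZ, Z2Nat.id, opp_IZR by lia. fin.
Qed.

Lemma Gder_period d P om v x x' : (forall j, j <=' d -> exists k, x' j = x j + 2 * PI * IZR k) ->
 Gder d P om v x' = Gder d P om v x.
Proof.
 intros H. unfold Gder. f_equal. apply lsum_ext. intros m.
 assert (exists k, phase d m x' = phase d m x + 2 * PI * IZR k) as [k Hk].
 { unfold phase. assert (forall n, n <=' S d -> exists k,
   vsum n (fun j => freq m j * x' j) = vsum n (fun j => freq m j * x j) + 2 * PI * IZR k) as E; [|apply E; lia].
  induction n as [|n IH]; intros Hn; [exists 0%Z; rewrite !vsum_0; ring|].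
  destruct IH as [k Hk]; [lia|]. destruct (H n ok) as [k1 Hk1]. rewrite !vsum_S, Hk, Hk1.
  assert (exists f, freq m n = IZR f) as [f Hf] by (destruct n; eexists; reflexivity).
  exists (k + f * k1)%Z. rewrite plus_IZR, mult_IZR, Hf. ring. }
 rewrite Hk. unfold mder. destruct (trig_period_Z (phase d m x) k) as [-> ->]. ring.
Qed.

Lemma good_site_period d P W Bb r kap om b c c' : (forall j, j <=' d -> exists k, c' j = c j + 2 * PI * IZR k) ->
 good_site d P W Bb r kap om b c -> good_site d P W Bb r kap om b c'.
Proof.
 intros H (H1 & H2 & H3 & S1 & S2 & S3).
 assert (E : forall v u, Gder d P om v (site_pt d om b c' u) = Gder d P om v (site_pt d om b c u)).
 { intros v u. apply Gder_period. intros j Hj. destruct (H j Hj) as [k Hk]. exists k. unfold site_pt. fin. }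
 split; [fin|split; [fin|split; [fin|split; [|split]]]].
 - intros u v Hu Hv. rewrite !E. le_by fin. right. f_equal. apply vsum_ext. intros. now rewrite !E.
 - intros u Hu Hb. rewrite E. le_by exact (S2 u Hu Hb). right. f_equal. apply vsum_ext. intros. now rewrite !E.
 - intros u Hu Hb. rewrite E. fin.
Qed.

Section near.
Variables (d : nat) (P : list trig_mode) (W0 k D : R) (om0 m : vec).
Let F := Fbd d P.
Hypothesis W0_ge : 1 <= W0.
Hypothesis k_pos : 0 < k.
Hypothesis om0_le : forall j, j <=' d -> Rabs (om0 j) + 1 <= W0.
Hypothesis crit : forall j, j <=' d -> Gder d P om0 (unit_vec j) m = 0.
Hypothesis pd : forall v, k * sq (S d) v <= Hb d P om0 m v v.
Hypothesis D_range : 0 < D <= 1.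
Hypothesis D_k : 1088 * F * D <= k / 2.
Hypothesis D_rho : 1088 * F * D <= site_rho d P W0 (k / 2).

Lemma Hb_near om x om' x' k' D' : 0 <= D' -> (forall v, k' * sq (S d) v <= Hb d P om' x' v v) ->
 bnd2 d D' om om' -> bnd2 d D' x x' ->
 forall v, (k' - 1088 * F * D') * sq (S d) v <= Hb d P om x v v.
Proof.
 intros HD' H H1 H2 v. set (N := sqrt (sq (S d) v)).
 assert (HN : bnd d N v) by (intros; apply comp_sq; lia).
 generalize (Hb_Lip d P N N v v HN HN om om' x x' D' H1 H2) (H v). rewrite (Rmult_assoc (1088 * Fbd d P)).
 unfold N. rewrite sqrt_sqrt by apply sq_nonneg. fold F. fin.
Qed.

Lemma near_good om c : om O = 1 -> bnd2 d D om om0 ->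
 bnd2 d D c m ->
 (forall v, k / 2 * sq (S d) v <= Hb d P om c v v) /\
 (forall j, Rabs (site_b d P om c j) <= site_Bb d P W0 (k / 2)) /\
 good_site d P W0 (site_Bb d P W0 (k / 2)) (site_r d P W0 (k / 2)) (site_kap d P W0 (k / 2)) om (site_b d P om c) c.
Proof.
 intros Hom0 Hom Hc.
 assert (Hpd : forall v, k / 2 * sq (S d) v <= Hb d P om c v v).
 { intros v. eapply Rle_trans; [|apply (Hb_near om c om0 m k D ok pd Hom Hc v)].
  apply Rmult_le_compat_r; [apply sq_nonneg|lra]. }
 assert (HomW : bnd d W0 om).
 { intros j Hj. replace (om j) with (om j - om0 j + om0 j) by ring. triang.
  generalize (Hom j Hj) (om0_le j Hj). lra. }
 assert (Hk2 : 0 < k / 2) by lra.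
 split; [fin|split; [now apply site_b_le|]]. apply nondegenerate_good_site; trivial.
 intros j Hj. eapply Rle_trans; [|exact D_rho].
 replace (Gder d P om (unit_vec j) c) with
  ((Gder d P om (unit_vec j) c - Gder d P om0 (unit_vec j) c) + (Gder d P om0 (unit_vec j) c - Gder d P om0 (unit_vec j) m))
  by (rewrite (crit j Hj); ring).
 triang.
 generalize (Gder_Lip_om d P 1 (unit_vec j) (fun i _ => unit_le j i) om om0 c D Hom)
  (Gder_Lip d P om0 (unit_vec j) c m 1 D ok (fun i _ => unit_le j i) Hc). fold F. lra.
Qed.

(** The old minimum [m] is still the centre of a good site for [om], so [critical_point] applies.
    Convexity drops to [k / 2] by changing the frequency and to [k / 4] by moving to the new
    point. *)
Lemma near_critical om : om O = 1 -> bnd2 d D om om0 ->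
 exists m', (forall j, j <=' d -> Gder d P om (unit_vec j) m' = 0) /\ forall v, k / 4 * sq (S d) v <= Hb d P om m' v v.
Proof.
 intros Hom0 Hom. destruct (near_good om m Hom0 Hom) as (H1 & H2 & H3).
 { fin. }
 assert (Hk2 : 0 < k / 2) by lra.
 destruct (site_r_spec d P W0 (k / 2) W0_ge Hk2) as (Hr & Hr2 & _).
 destruct (CL'_ge d P W0 (k / 2) W0_ge Hk2) as (HC & _).
 note (site_Bb_pos d P W0 (k / 2) W0_ge Hk2) (site_kap_pos d P W0 (k / 2) W0_ge Hk2) as HB Hkap.
 destruct (critical_point _ _ _ _ _ _ _ _ _ Hr Hkap (Rlt_le _ _ HB) W0_ge H3) as (x & Hx & Hcr).
 exists x. split; trivial. intros v. set (Q := CL d W0 (site_Bb d P W0 (k / 2)) * site_r d P W0 (k / 2)) in *.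
 assert (HQ : 0 <= Q) by (apply Rmult_le_pos; lra).
 eapply Rle_trans; [|apply (Hb_near om x om m (k / 2) Q HQ H1)]; trivial.
 - apply Rmult_le_compat_r; [apply sq_nonneg|]. fold F in Hr2. unfold Q in *. lra.
 - fin.
Qed.
End near.

Lemma near_radius d P W0 k : 1 <= W0 -> 0 < k -> exists D, 0 < D <= 1 /\ 1088 * Fbd d P * D <= k / 2 /\ 1088 * Fbd d P * D <= site_rho d P W0 (k / 2).
Proof.
 intros HW Hk. assert (Hrho := site_rho_pos d P W0 (k / 2) HW ok). assert (HF := Fbd_ge1 d P).
 set (B := Rmin 1 (Rmin (k / 2) (site_rho d P W0 (k / 2)))).
 assert (HB : 0 < B <= 1 /\ B <= k / 2 /\ B <= site_rho d P W0 (k / 2)).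
 { unfold B. split; [split; [repeat apply Rmin_glb_lt; lra|apply Rmin_l]|].
  split; (le_by apply Rmin_r); [apply Rmin_l|apply Rmin_r]. }
 exists (B / (1088 * Fbd d P)).
 assert (E : 1088 * Fbd d P * (B / (1088 * Fbd d P)) = B) by fld. fin.
Qed.

(** * Uniform constants along the curve *)

Section curve.
Variables (d : nat) (P : list trig_mode) (ft : vec -> R -> R) (L : R) (gam : R -> vec).
Hypothesis Hft : forall phi t, ft phi t = trig_eval d P phi t.
Hypothesis hgam : smooth_embedding d L gam.
Hypothesis hmin : forall s, 0 <= s <= L -> exists x0 : vec, nondeg_local_min (S d) (Gfun ft (gam s)) x0.

Lemma curve_Lip : exists Lg, 0 < Lg /\ forall s s' i, 0 <= s <= L -> 0 <= s' <= L -> i <' d ->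
 Rabs (gam s i - gam s' i) <= Lg * Rabs (s - s').
Proof.
 destruct hgam as (HL & (e & He & Hsm) & _ & _).
 assert (H1 : forall i, i <' d -> exists B, 0 <= B /\ forall s s', 0 <= s <= L -> 0 <= s' <= L -> Rabs (gam s i - gam s' i) <= B * Rabs (s - s')).
 { intros i Hi.
  assert (Hd1 : forall s, - e < s < L + e -> is_derive (fun x => gam x i) s (Derive (fun x => gam x i) s)).
  { intros s Hs. apply Derive_correct. exact (Hsm i 1%nat s Hi Hs). }
  assert (Hd2 : forall s, 0 <= s <= L -> continuity_pt (fun s => Rabs (Derive (fun x => gam x i) s)) s).
  { intros s Hs. apply continuity_pt_filterlim. apply (continuous_comp (Derive (fun x => gam x i)) Rabs).
   - apply @ex_derive_continuous. apply (ex_derive_ext (Derive_n (fun x => gam x i) 1)); [reflexivity|].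
    exact (Hsm i 2%nat s Hi ok).
   - apply continuous_Rabs. }
  destruct (continuity_ab_maj _ 0 L (Rlt_le _ _ HL) Hd2) as (M & HM & _).
  exists (Rabs (Derive (fun x => gam x i) M)). split; [fin|]. intros s s' Hs Hs'.
  destruct (MVT_gen (fun x => gam x i) s' s (Derive (fun x => gam x i))) as (c & Hc & ->).
  - intros x Hx. apply Hd1. split.
   + eapply Rlt_trans; [|apply Hx]. apply Rmin_glb_lt; lra.
   + eapply Rlt_trans; [apply Hx|]. apply Rmax_lub_lt; lra.
  - intros x Hx. apply continuity_pt_filterlim. eapply is_derive_continuous. apply Hd1. split.
   + eapply Rlt_le_trans; [|apply Hx]. apply Rmin_glb_lt; lra.
   + eapply Rle_lt_trans; [apply Hx|]. apply Rmax_lub_lt; lra.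
  - rewrite Rabs_mult. apply Rmult_le_compat_r; [fin|]. apply HM. split.
   + eapply Rle_trans; [|apply Hc]. apply Rmin_glb; lra.
   + le_by apply Hc. apply Rmax_lub; lra. }
 assert (forall n, n <=' d -> exists B, 0 < B /\ forall s s' i, 0 <= s <= L -> 0 <= s' <= L -> i <' n ->
  Rabs (gam s i - gam s' i) <= B * Rabs (s - s')) as H2; [|exact (H2 d (le_n d))].
 induction n as [|n IH]; intros Hn; [exists 1; split; [lra|fin]|].
 destruct IH as (B & HB & H); [lia|]. destruct (H1 n ok) as (B' & HB' & H').
 exists (B + B'). split; [lra|]. intros s s' i Hs Hs' Hi. rewrite Rmult_plus_distr_r.
 assert (0 <= B * Rabs (s - s') /\ 0 <= B' * Rabs (s - s')) by fin.
 destruct (Nat.eq_dec i n) as [->|]; [specialize (H' s s' Hs Hs'); lra|specialize (H s s' i Hs Hs' ok); lra].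
Qed.

Lemma curve_bound : exists W0, 1 <= W0 /\ forall s j, 0 <= s <= L -> j <=' d -> Rabs (stv 1 (gam s) j) + 1 <= W0.
Proof.
 destruct curve_Lip as (Lg & HLg & H). destruct hgam as (HL & _).
 set (S0 := vsum d (fun i => Rabs (gam 0 i))). assert (HS : 0 <= S0) by (apply vsum_nonneg; intros; apply Rabs_pos).
 assert (HLL : 0 <= Lg * L) by fin.
 exists (2 + S0 + Lg * L). split; [lra|].
 intros s j Hs Hj. destruct j as [|j]; simpl; [rewrite Rabs_R1; lra|].
 generalize (H s 0 j Hs ok ok) (vsum_term_le d (fun i => Rabs (gam 0 i)) j (fun i _ => Rabs_pos _) ok).
 fold S0. rewrite Rminus_0_r, (Rabs_pos_eq s) by lra. intros H1 H2.
 replace (gam s j) with ((gam s j - gam 0 j) + gam 0 j) by ring.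
 generalize (Rabs_triang (gam s j - gam 0 j) (gam 0 j)). fin.
Qed.

Lemma curve_minimum s : 0 <= s <= L -> exists m k, 0 < k /\
 (forall j, j <=' d -> Gder d P (stv 1 (gam s)) (unit_vec j) m = 0) /\
 forall v, k * sq (S d) v <= Hb d P (stv 1 (gam s)) m v v.
Proof.
 intros Hs. destruct (hmin s Hs) as (x0 & (delta & Hdel & Hm) & _ & Hker).
 assert (E : Gfun ft (gam s) = Gpot d P (stv 1 (gam s))) by (apply functional_extensionality; intros x; now apply Gfun_eq).
 rewrite E in *. destruct (min_positive_definite d P (stv 1 (gam s)) x0 delta Hdel Hm Hker) as (k & Hk & H).
 exists x0, k. split; [fin|split; [|fin]]. intros j Hj. now apply (min_gradient d P _ x0 delta).
Qed.

(** The minima [m] are chosen separately for each [s], with no continuity in [s]; only the constants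
    are uniform. Phases count modulo [2 * PI], which periodicity of the potential permits. *)
Theorem uniform_sites : exists W0 Bb r kap D, 1 <= W0 /\ 0 <= Bb /\ 0 < r <= 1 /\ 0 < kap /\ 0 < D <= 1 /\
 (forall s j, 0 <= s <= L -> j <=' d -> Rabs (stv 1 (gam s) j) + 1 <= W0) /\
 forall s, 0 <= s <= L -> exists m : vec, forall om c, om O = 1 ->
  bnd2 d D om (stv 1 (gam s)) ->
  (forall j, j <=' d -> exists k, Rabs (c j - m j - 2 * PI * IZR k) <= D) ->
  exists b, (forall j, Rabs (b j) <= Bb) /\ good_site d P W0 Bb r kap om b c.
Proof.
 destruct curve_bound as (W0 & HW0 & HW). destruct curve_Lip as (Lg & HLg & HLip).
 assert (HLips : forall s s' j, 0 <= s <= L -> 0 <= s' <= L -> j <=' d -> Rabs (stv 1 (gam s) j - stv 1 (gam s') j) <= Lg * Rabs (s - s')).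
 { intros s s' j Hs Hs' Hj. destruct j as [|j]; simpl; [|fin].
  fin. }
 (* local radius of continuation, capped by the local convexity constant *)
 assert (Hloc : forall s, exists del : posreal, 0 <= s <= L -> forall s', 0 <= s' <= L -> Rabs (s' - s) < del ->
  exists m, (forall j, j <=' d -> Gder d P (stv 1 (gam s')) (unit_vec j) m = 0) /\
   forall v, del * sq (S d) v <= Hb d P (stv 1 (gam s')) m v v).
 { intros s. destruct (excluded_middle_informative (0 <= s <= L)) as [Hs|Hs]; [|exists (mkposreal 1 Rlt_0_1); tauto].
  destruct (curve_minimum s Hs) as (m & k & Hk & Hcr & Hpd).
  destruct (near_radius d P W0 k HW0 Hk) as (D & HD & HD1 & HD2).
  assert (Hpos : 0 < Rmin (D / Lg) (k / 4)) by (apply Rmin_glb_lt; [fin|lra]).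
  exists (mkposreal _ Hpos). simpl. intros _ s' Hs' Hss.
  destruct (near_critical d P W0 k D (stv 1 (gam s)) m HW0 Hk (fun j Hj => HW s j Hs Hj) Hcr Hpd HD HD1 HD2 (stv 1 (gam s'))) as (m' & Hm' & Hpd').
  - reflexivity.
  - intros j Hj. le_by fin.
   assert (Rabs (s' - s) < D / Lg) by (eapply Rlt_le_trans; [exact Hss|apply Rmin_l]).
   replace D with (Lg * (D / Lg)) by fld. fin.
  - exists m'. split; trivial. intros v. eapply Rle_trans; [|fin].
   apply Rmult_le_compat_r; [apply sq_nonneg|apply Rmin_r]. }
 set (delta := fun s => proj1_sig (constructive_indefinite_description _ (Hloc s))).
 (* A single number serves as radius and as convexity constant, so its lower bound over a cover is a
    common convexity constant. *)
 destruct (compactness_value_1d 0 L delta) as [k0 Hk0].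
 set (k := pos k0). assert (Hk : 0 < k) by apply cond_pos.
 destruct (near_radius d P W0 k HW0 Hk) as (D & HD & HD1 & HD2).
 assert (Hk2 : 0 < k / 2) by lra.
 exists W0, (site_Bb d P W0 (k / 2)), (site_r d P W0 (k / 2)), (site_kap d P W0 (k / 2)), D.
 split; [fin|split; [now left; apply site_Bb_pos|split; [now apply site_r_spec|split; [now apply site_kap_pos|split; [fin|split; [fin|]]]]]].
 intros s Hs.
 assert (exists t, (0 <= t <= L) /\ Rabs (s - t) < delta t /\ k0 <= delta t) as (t & Ht & Hst & Hkt) by (apply NNPP; now apply Hk0).
 destruct (proj2_sig (constructive_indefinite_description _ (Hloc t)) Ht s Hs Hst) as (m & Hcr & Hpd).
 assert (Hpd' : forall v, k * sq (S d) v <= Hb d P (stv 1 (gam s)) m v v).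
 { intros v. eapply Rle_trans; [|fin]. apply Rmult_le_compat_r; [apply sq_nonneg|fin]. }
 exists m. intros om c Hom0 Hom Hc.
 assert (Hsel : forall j, exists k1, j <=' d -> Rabs (c j - m j - 2 * PI * IZR k1) <= D).
 { intros j. destruct (le_lt_dec j d) as [Hj|Hj]; [destruct (Hc j Hj) as [k1 H1]; now exists k1|exists 0%Z; lia]. }
 set (kk := fun j => proj1_sig (constructive_indefinite_description _ (Hsel j))).
 set (c0 := fun j => c j - 2 * PI * IZR (kk j)).
 destruct (near_good d P W0 k D (stv 1 (gam s)) m HW0 Hk (fun j Hj => HW s j Hs Hj) Hcr Hpd' HD HD1 HD2 om c0 Hom0 Hom) as (_ & Hb & Hg).
 { intros j Hj. unfold c0. replace (c j - 2 * PI * IZR (kk j) - m j) with (c j - m j - 2 * PI * IZR (kk j)) by ring.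
  exact (proj2_sig (constructive_indefinite_description _ (Hsel j)) Hj). }
 exists (site_b d P om c0). split; trivial. apply (good_site_period d P _ _ _ _ om _ c0 c); trivial.
 intros j Hj. exists (kk j). unfold c0. ring.
Qed.
End curve.

(** * Return times of torus translations *)

Lemma choice_fun {A B : Type} (R0 : A -> B -> Prop) : (forall x, exists y, R0 x y) -> exists f, forall x, R0 x (f x).
Proof.
 intros H. exists (fun x => proj1_sig (constructive_indefinite_description _ (H x))).
 intros x. exact (proj2_sig (constructive_indefinite_description _ (H x))).
Qed.

Lemma pigeonhole (K : nat) : forall (f : nat -> nat) l, (forall v, In v l -> f v <' K) -> 1 <=' K ->
 exists c, (length l <= K * length (filter (fun v => Nat.eqb (f v) c) l))%nat.
Proof.
 induction K as [|K IH]; intros f l Hl HK; [lia|]. destruct (Nat.eq_dec K 0) as [->|HK0].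
 - exists O. rewrite (forallb_filter_id _ l); [lia|].
  apply forallb_forall. intros v Hv. apply Nat.eqb_eq. generalize (Hl v Hv). lia.
 - destruct (IH f (filter (fun v => negb (Nat.eqb (f v) K)) l)) as [c Hc]; [|lia|].
  + intros v Hv. apply filter_In in Hv. destruct Hv as [H1 H2]. generalize (Hl v H1).
   destruct (Nat.eqb_spec (f v) K); simpl in H2; [fin|lia].
  + assert (Hlen := filter_length (fun v => Nat.eqb (f v) K) l).
   assert (Hsub : forall k, (length (filter (fun v => Nat.eqb (f v) c) (filter k l)) <= length (filter (fun v => Nat.eqb (f v) c) l))%nat).
   { intros k. clear. induction l as [|a l IHl]; simpl; [lia|]. destruct (k a); simpl; destruct (Nat.eqb (f a) c); simpl; lia. }
   specialize (Hsub (fun v => negb (Nat.eqb (f v) K))).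
   destruct (le_lt_dec (length (filter (fun v => Nat.eqb (f v) K) l)) (length (filter (fun v => Nat.eqb (f v) c) l))); [exists c|exists K]; nia.
Qed.

Definition near_Z (r x : R) : Prop := exists k : Z, Rabs (x - IZR k) <= r.

(** One coordinate at a time: the circle is cut into [K] arcs and the most populated one is kept, at
    the cost of a factor [K]. *)
Lemma pigeonhole_torus (K : nat) (al : nat -> R) n l : 1 <=' K -> exists f, length l <=' K ^ n * length (filter f l) /\
 forall u v j, In u (filter f l) -> In v (filter f l) -> j <' n -> near_Z (/ INR K) ((INR u - INR v) * al j).
Proof.
 intros HK. assert (HKR : 1 <= INR K) by (apply (le_INR 1); trivial). induction n as [|n (f & Hf & Hn)].
 - exists (fun _ => true). rewrite (forallb_filter_id _ l) by (now apply forallb_forall). simpl. fin.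
 - set (col := fun v => Z.to_nat (Int_part (INR K * frac_part (INR v * al n)))).
  assert (Hcol : forall v, 0 <= INR K * frac_part (INR v * al n) - INR (col v) < 1 /\ col v <' K).
  { intros v. destruct (base_fp (INR v * al n)) as [F0 F1]. set (x := frac_part (INR v * al n)) in *.
   destruct (base_Int_part (INR K * x)) as [I1 I2].
   assert (Hx : 0 <= INR K * x < INR K) by fin.
   assert (Hz : (0 <= Int_part (INR K * x))%Z) by (apply Z.lt_succ_r, lt_IZR; rewrite succ_IZR; lra).
   assert (E : INR (col v) = IZR (Int_part (INR K * x))) by (unfold col; fold x; rewrite INR_IZR_INZ, Z2Nat.id; trivial).
   rewrite E. split; [lra|]. apply INR_lt. fin. }
  destruct (pigeonhole K col (filter f l)) as [c Hc]; [intros; apply Hcol|fin|].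
  exists (fun v => andb (f v) (Nat.eqb (col v) c)).
  assert (E : filter (fun v => andb (f v) (Nat.eqb (col v) c)) l = filter (fun v => Nat.eqb (col v) c) (filter f l)).
  { clear. induction l as [|a l IHl]; simpl; trivial. destruct (f a); simpl; [destruct (Nat.eqb (col a) c)|]; now rewrite IHl. }
  rewrite E. split.
  + simpl. eapply Nat.le_trans; [exact Hf|]. nia.
  + intros u v j Hu Hv Hj. apply filter_In in Hu, Hv. destruct Hu as [Hu Hcu], Hv as [Hv Hcv].
   destruct (Nat.eq_dec j n) as [->|Hjn]; [|apply Hn; trivial; lia].
   apply Nat.eqb_eq in Hcu, Hcv. destruct (Hcol u) as [U _], (Hcol v) as [V _]. rewrite Hcu in U. rewrite Hcv in V.
   exists (Int_part (INR u * al n) - Int_part (INR v * al n))%Z. rewrite minus_IZR.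
   replace ((INR u - INR v) * al n - _) with (frac_part (INR u * al n) - frac_part (INR v * al n)) by (unfold frac_part; ring).
   set (x := frac_part (INR u * al n)) in *. set (y := frac_part (INR v * al n)) in *.
   apply Rmult_le_reg_l with (INR K); [lra|]. rewrite Rinv_r by lra.
   rewrite <- (Rabs_pos_eq (INR K)) at 1 by lra. rewrite <- Rabs_mult. fin.
Qed.

Lemma dirichlet (K : nat) (al : nat -> R) n : 1 <=' K ->
 exists j, (1 <= j <= K ^ n)%nat /\ forall i, i <' n -> near_Z (/ INR K) (INR j * al i).
Proof.
 intros HK. destruct (pigeonhole_torus K al n (seq 0 (K ^ n + 1)) HK) as (f & Hf & H).
 rewrite length_seq in Hf. assert (Hnd : NoDup (filter f (seq 0 (K ^ n + 1)))) by apply NoDup_filter, seq_NoDup.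
 assert (Hr : forall u, In u (filter f (seq 0 (K ^ n + 1))) -> u <=' K ^ n).
 { intros u Hu. apply filter_In in Hu. destruct Hu as [Hu _]. apply in_seq in Hu. lia. }
 destruct (filter f (seq 0 (K ^ n + 1))) as [|a [|b l]]; simpl length in Hf; try nia.
 inversion Hnd as [|? ? Hni _]; subst. assert (Hab : a <> b) by (intros ->; apply Hni; now left).
 note (Hr a (or_introl eq_refl)) (Hr b (or_intror (or_introl eq_refl))) as Ha Hb.
 destruct (lt_dec a b).
 - exists (b - a)%nat. split; [lia|]. intros i Hi. rewrite minus_INR by lia. apply H; trivial; [right; now left|now left].
 - exists (a - b)%nat. split; [lia|]. intros i Hi. rewrite minus_INR by lia. apply H; trivial; [now left|right; now left].
Qed.

Lemma StronglySorted_filter (f : nat -> bool) l : StronglySorted lt l -> StronglySorted lt (filter f l).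
Proof.
 induction 1 as [|a l Hl IH Ha]; simpl; [constructor|]. destruct (f a); trivial. constructor; trivial.
 apply Forall_forall. intros x Hx. apply filter_In in Hx. now apply (proj1 (Forall_forall _ _) Ha).
Qed.

Lemma StronglySorted_seq a n : StronglySorted lt (seq a n).
Proof.
 revert a. induction n as [|n IH]; intros a; simpl; constructor; trivial.
 apply Forall_forall. intros x Hx. apply in_seq in Hx. lia.
Qed.

Lemma StronglySorted_nth l i : StronglySorted lt l -> S i <' length l -> nth i l 0 <' nth (S i) l 0.
Proof.
 revert i. induction l as [|a l IH]; intros i Hs Hi; simpl in *; [lia|]. inversion Hs as [|? ? Hl Ha]; subst.
 destruct i as [|i].
 - apply (proj1 (Forall_forall _ _) Ha). apply nth_In. lia.
 - apply IH; trivial. lia.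
Qed.

Lemma nth_mono l i j : StronglySorted lt l -> (i <= j < length l)%nat -> nth i l 0 <=' nth j l 0.
Proof.
 intros Hs Hij. assert (forall k, i + k <' length l -> nth i l 0 <=' nth (i + k) l 0) as H.
 { induction k as [|k IH]; intros Hk; [rewrite Nat.add_0_r; lia|]. rewrite Nat.add_succ_r in *.
  generalize (StronglySorted_nth l (i + k) Hs Hk) (IH ok). lia. }
 replace j with (i + (j - i))%nat by lia. apply H. lia.
Qed.

(** Differences of members of one pigeonhole class return close to 0 in all coordinates; the times
    are counted from its first member. [Y] is appended as the last time without any closeness, which
    [dirichlet] provides where it is needed. *)
Lemma visits (K Y : nat) (al : nat -> R) n : 1 <=' K -> K ^ n <' Y ->
 exists m (v : nat -> nat), 2 <=' m /\ Y <=' K ^ n * m /\ v O = O /\ v m = Y /\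
 (forall i, i <' m -> v i <' v (S i)) /\
 forall i j, i <' m -> j <' n -> near_Z (/ INR K) (INR (v i) * al j).
Proof.
 intros HK HY. destruct (pigeonhole_torus K al n (seq 0 Y) HK) as (f & Hf & H).
 rewrite length_seq in Hf. set (l := filter f (seq 0 Y)) in *. set (m := length l) in *.
 assert (Hss : StronglySorted lt l) by apply StronglySorted_filter, StronglySorted_seq.
 assert (Hm : 2 <=' m) by nia.
 assert (Hin : forall i, i <' m -> In (nth i l O) l /\ nth i l 0 <' Y).
 { intros i Hi. assert (Hi' : In (nth i l O) l) by (apply nth_In; exact Hi). split; trivial.
  apply filter_In in Hi'. destruct Hi' as [Hi' _]. apply in_seq in Hi'. lia. }
 assert (H0 : forall i, i <' m -> nth 0 l 0 <=' nth i l 0) by (intros i Hi; apply nth_mono; trivial; fold m; lia).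
 exists m, (fun i => if Nat.ltb i m then (nth i l 0 - nth 0 l 0)%nat else Y). repeat split; trivial.
 - destruct (Nat.ltb_spec 0 m); lia.
 - destruct (Nat.ltb_spec m m); lia.
 - intros i Hi. destruct (Nat.ltb_spec i m); [|lia]. destruct (Nat.ltb_spec (S i) m).
  + generalize (StronglySorted_nth l i Hss ltac:(fold m; lia)) (H0 i Hi). lia.
  + destruct (Hin i Hi). lia.
 - intros i j Hi Hj. destruct (Nat.ltb_spec i m); [|lia]. rewrite minus_INR by fin.
  apply H; trivial; apply Hin; lia.
Qed.

(** * Reachability by slowly varying frequencies *)

Section reach.
Variables (d : nat) (T0 st : R) (adm : vec -> vec -> Prop).

(* The state is a phase c together with the frequency o of the last arc. *)
Inductive reach (c o : vec) : vec -> vec -> R -> Prop :=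
| reach_refl : adm c o -> reach c o c o 0
| reach_step c' o' T c'' o'' t : reach c o c' o' T -> T0 <= t -> o'' O = 1 ->
  bnd2 d st o'' o' ->
  (forall j, j <=' d -> c'' j = c' j + t * o'' j) -> adm c'' o'' -> reach c o c'' o'' (T + t).

Lemma reach_trans c o c' o' T c'' o'' T' : reach c o c' o' T -> reach c' o' c'' o'' T' -> reach c o c'' o'' (T + T').
Proof.
 intros H1 H2. induction H2 as [|c1 o1 T1 c2 o2 t H IH Ht H0 Hs Hc Hok]; [now rewrite Rplus_0_r|].
 rewrite <- Rplus_assoc. now apply (reach_step _ _ c1 o1 (T + T1) c2 o2 t).
Qed.

Lemma reach_sequence c o c' o' T : reach c o c' o' T -> exists (N : nat) (Om cs : nat -> vec),
 cs O = c /\ Om O = o /\ cs N = c' /\ Om N = o' /\ c' O - c O = T /\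
 (forall i, i <=' N -> adm (cs i) (Om i)) /\
 forall i, i <' N -> T0 <= cs (S i) O - cs i O /\ Om (S i) O = 1 /\
  forall j, j <=' d -> Rabs (Om (S i) j - Om i j) <= st /\ cs (S i) j - cs i j = (cs (S i) O - cs i O) * Om (S i) j.
Proof.
 induction 1 as [Hok|c1 o1 T1 c2 o2 t H (N & Om & cs & E1 & E2 & E3 & E4 & E5 & Ho & Hst) Ht H0 Hs Hc Hok].
 - exists O, (fun _ => o), (fun _ => c). repeat split; trivial; try ring; intros; lia || trivial.
 - exists (S N), (fun i => if Nat.leb i N then Om i else o2), (fun i => if Nat.leb i N then cs i else c2).
  assert (Hc0 : c2 O = c1 O + t) by (rewrite Hc, H0 by lia; ring).
  rewrite (proj2 (Nat.leb_gt (S N) N)) by lia. change (Nat.leb 0 N) with true. cbv iota. repeat split; trivial.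
  + fin.
  + intros i Hi. destruct (Nat.leb_spec i N); [fin|fin].
  + destruct (Nat.leb_spec i N); [|lia]. destruct (Nat.leb_spec (S i) N); [apply Hst; (lia || trivial)|].
   assert (i = N) as -> by lia. rewrite E3, Hc0. lra.
  + destruct (Nat.leb_spec (S i) N); [apply Hst; (lia || trivial)|fin].
  + destruct (Nat.leb_spec i N); [|lia]. destruct (Nat.leb_spec (S i) N); [apply Hst; (lia || trivial)|].
   assert (i = N) as -> by lia. rewrite E4. fin.
  + destruct (Nat.leb_spec i N); [|lia]. destruct (Nat.leb_spec (S i) N); [apply Hst; (lia || trivial)|].
   assert (i = N) as -> by lia. rewrite E3, Hc0, Hc by trivial. ring.
Qed.

Definition near_torus (r : R) (c c' : vec) : Prop := forall j, j <=' d -> exists k, Rabs (c j - c' j - 2 * PI * IZR k) <= r.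

Lemma near_torus_trans r r' c c' c'' : near_torus r c c' -> near_torus r' c' c'' -> near_torus (r + r') c c''.
Proof.
 intros H H' j Hj. destruct (H j Hj) as [k Hk], (H' j Hj) as [k' Hk']. exists (k + k')%Z. rewrite plus_IZR.
 fin.
Qed.

Lemma near_torus_refl c : near_torus 0 c c.
Proof. intros j Hj. exists 0%Z. fin. Qed.

Section window.
Variables (n0 X m : nat) (v : nat -> nat) (rho e V sg : R) (c o Delta : vec).
Hypothesis n0_pos : 1 <=' n0.
Hypothesis T0_le : T0 <= 2 * PI * INR n0.
Hypothesis m_ge : 2 <=' m.
Hypothesis v_0 : v O = O.
Hypothesis v_m : v m = X.
Hypothesis v_incr : forall i, i <' m -> v i <' v (S i).
Hypothesis V_ge : INR X <= V * INR m.
Hypothesis e_pos : 0 < e.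
Hypothesis rho_pos : e <= rho.
Hypothesis v_near : forall i j, i <' m -> (1 <= j <= d)%nat -> near_Z rho (INR n0 * INR (v i) * o j).
Hypothesis end_near : forall j, (1 <= j <= d)%nat -> near_Z e (INR n0 * INR X * o j).
Hypothesis o_0 : o O = 1.
Hypothesis Delta_0 : Delta O = 0.
Hypothesis Delta_le : forall j, j <=' d -> Rabs (Delta j) * (INR n0 * INR X) <= e.
Hypothesis st_ge : 17 * e * V ^ 2 <= st * INR n0 * INR X ^ 2.
Hypothesis sg_ge : 5 * e / INR n0 <= sg.
Hypothesis adm_near : forall c1 o1, o1 O = 1 -> bnd2 d sg o1 o ->
 near_torus (2 * PI * (rho + 5 * e * V)) c1 c -> adm c1 o1.

Let M := INR m.
Let n0R := INR n0.
Let M_ge : 2 <= M. Proof. apply (le_INR 2). trivial. Qed.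
Let n0R_ge : 1 <= n0R. Proof. apply (le_INR 1). trivial. Qed.

(** A parabola vanishing at both ends of the window: a multiple of it added to the linear
    interpolation of the frequency keeps the end frequencies and changes the total phase. *)
Definition wt (l : nat) : R := INR l * (M - INR l) / M ^ 2.
Definition gp (l : nat) : R := INR (v (S l)) - INR (v l).
Definition Sum1 : R := vsum m (fun l => gp l * (INR (S l) / M)).
Definition Sum2 : R := vsum m (fun l => gp l * wt (S l)).

Lemma gp_ge l : l <' m -> 1 <= gp l.
Proof. intros Hl. unfold gp. generalize (le_INR _ _ (v_incr l Hl)). rewrite S_INR. lra. Qed.

Lemma gp_sum i : i <=' m -> vsum i gp = INR (v i).
Proof.
 induction i as [|i IH]; intros Hi; [rewrite vsum_0, v_0; reflexivity|]. rewrite vsum_S, IH by lia. unfold gp. ring.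
Qed.

Lemma v_ge i : i <=' m -> i <=' v i.
Proof. induction i as [|i IH]; intros Hi; [lia|]. generalize (v_incr i ok) (IH ok). lia. Qed.

Lemma v_le i : i <=' m -> v i <=' X.
Proof.
 intros Hi. rewrite <- v_m. assert (forall k, i + k <=' m -> v i <=' v (i + k)) as H.
 { induction k as [|k IH]; intros Hk; [rewrite Nat.add_0_r; lia|]. rewrite Nat.add_succ_r in *.
  generalize (v_incr (i + k) ok) (IH ok). lia. }
 replace m with (i + (m - i))%nat by lia. apply H. lia.
Qed.

Lemma X_ge : M <= INR X.
Proof. rewrite <- v_m. apply le_INR, v_ge. lia. Qed.

Lemma wt_range l : l <=' m -> 0 <= wt l <= / 4.
Proof.
 intros Hl. unfold wt. assert (HM2 : 0 < M ^ 2) by fin. generalize (le_INR _ _ Hl) (pos_INR l). fold M. intros H1 H2.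
 split; [fin|].
 apply Rmult_le_reg_r with (M ^ 2); trivial. unfold Rdiv. inv_l.
 assert (0 <= (M - 2 * INR l) ^ 2) by apply pow2_ge_0. lra.
Qed.

Lemma wt_sum n : vsum n (fun l => INR (S l) * (M - INR (S l))) = M * INR n * (INR n + 1) / 2 - INR n * (INR n + 1) * (2 * INR n + 1) / 6.
Proof. induction n as [|n IH]; [rewrite vsum_0; simpl; field|]. rewrite vsum_S, IH, !S_INR. field. Qed.

(** The return times are irregular, but their gaps are at least 1 and the weights nonnegative, so
    the exact sum of the parabola bounds the leverage of the correction from below. *)
Lemma Sum2_ge : M / 8 <= Sum2.
Proof.
 le_thru (vsum m (fun l => wt (S l))).
 - unfold wt. rewrite (vsum_ext _ _ (fun l => / M ^ 2 * (INR (S l) * (M - INR (S l))))) by (intros; unfold Rdiv; ring).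
  rewrite vsum_scal, wt_sum. fold M.
  replace (/ M ^ 2 * (M * M * (M + 1) / 2 - M * (M + 1) * (2 * M + 1) / 6)) with ((M ^ 2 - 1) / (6 * M)) by fld.
  reg_r (6 * M). unfold Rdiv. rewrite (Rmult_assoc (M ^ 2 - 1)), Rinv_l by lra. nra.
 - apply vsum_le. intros l Hl. generalize (gp_ge l Hl) (wt_range (S l) ok). nra.
Qed.

Lemma Sum1_range : 0 <= Sum1 <= INR X.
Proof.
 assert (Hr : forall l, l <' m -> 0 <= INR (S l) / M <= 1).
 { intros l Hl. generalize (le_INR _ _ Hl) (pos_INR (S l)). fold M. intros. split; [fin|].
  reg_r M. unfold Rdiv. rewrite Rmult_assoc, Rinv_l; lra. }
 split.
 - apply vsum_nonneg. intros l Hl. generalize (gp_ge l Hl) (Hr l Hl). nra.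
 - rewrite <- v_m, <- (gp_sum m) by lia. apply vsum_le. intros l Hl. generalize (gp_ge l Hl) (Hr l Hl). nra.
Qed.

Lemma end_integer j : exists k : Z, j <=' d -> Rabs (n0R * INR X * o j - IZR k) <= e.
Proof.
 destruct (le_lt_dec j d) as [Hj|Hj]; [|exists 0%Z; lia]. destruct j as [|j].
 - exists (Z.of_nat (n0 * X)). intros _. rewrite o_0, <- INR_IZR_INZ, mult_INR. unfold n0R.
  fin.
 - destruct (end_near (S j) ok) as [k Hk]. exists k. fin.
Qed.

Section coordinates.
Variable kz : nat -> Z.
Hypothesis kz_0 : IZR (kz O) = n0R * INR X.
Hypothesis kz_near : forall j, j <=' d -> Rabs (n0R * INR X * o j - IZR (kz j)) <= e.

(** Solution of the linear equation that makes the total phase of the window, in units of [2 * PI],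
    exactly the integer [kz j]. *)
Definition kpa (j : nat) : R := - ((n0R * INR X * o j - IZR (kz j)) / n0R + Delta j * Sum1) / Sum2.
Definition dl (l j : nat) : R := Delta j * (INR l / M) + kpa j * wt l.
Definition ofr (l : nat) : vec := fun j => o j + dl l j.
Definition cph (i : nat) : vec := fun j => c j + 2 * PI * n0R * (INR (v i) * o j + vsum i (fun l => gp l * dl (S l) j)).

Lemma kpa_le j : j <=' d -> Rabs (kpa j) <= 16 * e / (n0R * M).
Proof.
 intros Hj. generalize Sum2_ge Sum1_range X_ge (kz_near j Hj) (Delta_le j Hj). fold n0R. intros H2 H1 HX Hk HD.
 unfold kpa. unfold Rdiv at 1. rewrite Rabs_mult, Rabs_Ropp, Rabs_inv, (Rabs_pos_eq Sum2) by lra.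
 replace (16 * e / (n0R * M)) with (2 * e / n0R * / (M / 8)) by (field; split; lra).
 apply Rmult_le_compat; [fin|fin| |fin].
 triang. unfold Rdiv. rewrite !Rabs_mult, Rabs_inv, (Rabs_pos_eq n0R), (Rabs_pos_eq Sum1) by lra.
 assert (Hi : 0 < / n0R) by fin.
 assert (Rabs (n0R * INR X * o j - IZR (kz j)) * / n0R <= e * / n0R) by fin.
 assert (Rabs (Delta j) * Sum1 <= e * / n0R); [|lra].
 le_thru (Rabs (Delta j) * INR X); [fin|].
 reg_r n0R. rewrite (Rmult_assoc e), Rinv_l by lra. lra.
Qed.

Lemma Delta_small j : j <=' d -> Rabs (Delta j) <= e / (n0R * M).
Proof.
 intros Hj. generalize X_ge (Delta_le j Hj). fold n0R. intros HX HD.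
 apply Rmult_le_reg_r with (n0R * M); [fin|].
 replace (e / (n0R * M) * (n0R * M)) with e by (field; split; lra).
 eapply Rle_trans; [|exact HD]. apply Rmult_le_compat_l; [fin|]. apply Rmult_le_compat_l; lra.
Qed.

Lemma dl_le l j : l <=' m -> j <=' d -> Rabs (dl l j) <= 5 * e / (n0R * M).
Proof.
 intros Hl Hj. note (kpa_le j Hj) (Delta_small j Hj) (wt_range l Hl) as Hk HD Hw.
 assert (Hr : 0 <= INR l / M <= 1).
 { generalize (le_INR _ _ Hl) (pos_INR l). fold M. intros. split; [fin|].
  reg_r M. unfold Rdiv. rewrite Rmult_assoc, Rinv_l; lra. }
 unfold dl. triang. rewrite !Rabs_mult, (Rabs_pos_eq (INR l / M)), (Rabs_pos_eq (wt l)) by lra.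
 assert (Rabs (Delta j) * (INR l / M) <= e / (n0R * M) * 1) by fin.
 assert (Rabs (kpa j) * wt l <= 16 * e / (n0R * M) * / 4) by fin.
 replace (5 * e / (n0R * M)) with (e / (n0R * M) * 1 + 16 * e / (n0R * M) * / 4) by fin. lra.
Qed.

Lemma dl_step l j : l <' m -> j <=' d -> Rabs (dl (S l) j - dl l j) <= st.
Proof.
 intros Hl Hj. note (kpa_le j Hj) (Delta_small j Hj) X_ge as Hk HD HX.
 le_thru (17 * e / (n0R * M ^ 2)).
 - replace (dl (S l) j - dl l j) with (Delta j * / M + kpa j * ((M - 2 * INR l - 1) / M * / M)) by (unfold dl, wt; rewrite S_INR; field; lra).
  assert (HiM : 0 < / M) by fin.
  assert (Hw : Rabs ((M - 2 * INR l - 1) / M) <= 1).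
  { unfold Rdiv. rewrite Rabs_mult, (Rabs_pos_eq (/ M)) by lra. reg_r M. inv_l.
   generalize (pos_INR l) (le_INR _ _ Hl). rewrite S_INR. fold M. intros. rewrite Rmult_1_r, Rmult_1_l. fin. }
  triang. rewrite !Rabs_mult, (Rabs_pos_eq (/ M)) by lra.
  assert (Rabs (Delta j) * / M <= e / (n0R * M) * / M) by fin.
  assert (Rabs (kpa j) * (Rabs ((M - 2 * INR l - 1) / M) * / M) <= 16 * e / (n0R * M) * (1 * / M)).
  { fin. }
  replace (17 * e / (n0R * M ^ 2)) with (e / (n0R * M) * / M + 16 * e / (n0R * M) * (1 * / M)) by (field; split; lra). lra.
 - assert (HX2 : INR X ^ 2 <= V ^ 2 * M ^ 2) by (rewrite <- Rpow_mult_distr; apply pow_incr; fold M in V_ge; lra).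
  assert (HX0 : 0 < INR X ^ 2) by fin.
  assert (HM2 : 0 < M ^ 2) by fin.
  assert (Hst : 0 <= st).
  { apply Rmult_le_reg_r with (n0R * INR X ^ 2); [fin|]. rewrite Rmult_0_l, <- Rmult_assoc.
   eapply Rle_trans; [|exact st_ge]. fin. }
  assert (HV2 : 0 < V ^ 2) by nra.
  apply Rmult_le_reg_r with (n0R * M ^ 2 * V ^ 2); [fin|].
  replace (17 * e / (n0R * M ^ 2) * (n0R * M ^ 2 * V ^ 2)) with (17 * e * V ^ 2) by (field; split; lra).
  le_by exact st_ge. fold n0R.
  replace (st * (n0R * M ^ 2 * V ^ 2)) with (st * n0R * (V ^ 2 * M ^ 2)) by ring. fin.
Qed.

Lemma dl_0 l : dl l 0 = 0.
Proof.
 unfold dl, kpa. fin.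
Qed.

Lemma drift_sum_le i j : i <=' m -> j <=' d -> n0R * Rabs (vsum i (fun l => gp l * dl (S l) j)) <= 5 * e * V.
Proof.
 intros Hi Hj. assert (Hn : 0 < n0R * M) by fin.
 assert (H5 : 0 <= 5 * e / (n0R * M)) by fin.
 le_thru (n0R * (5 * e / (n0R * M) * INR X)).
 - mul_l. le_by apply vsum_abs.
  le_thru (5 * e / (n0R * M) * INR (v i)); [|apply Rmult_le_compat_l; [fin|apply le_INR, v_le; lia]].
  rewrite <- (gp_sum i Hi), <- vsum_scal. apply vsum_le. intros l Hl. rewrite Rabs_mult, Rmult_comm.
  assert (Hg := gp_ge l ok). rewrite (Rabs_pos_eq (gp l)) by lra. mul_r. apply dl_le; lia.
 - replace (n0R * (5 * e / (n0R * M) * INR X)) with (5 * e / M * INR X) by (field; split; lra).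
  replace (5 * e * V) with (5 * e / M * (V * M)) by fld. fin.
Qed.

Lemma cph_near i : i <=' m -> near_torus (2 * PI * (rho + 5 * e * V)) (cph i) c.
Proof.
 intros Hi j Hj. assert (HP := PI_RGT_0). assert (HD := drift_sum_le i j Hi Hj).
 assert (Hz : near_Z rho (n0R * INR (v i) * o j)).
 { destruct (Nat.eq_dec i m) as [->|Hne].
  - rewrite v_m. exists (kz j). eapply Rle_trans; [fin|lra].
  - destruct j as [|j]; [|apply v_near; lia]. exists (Z.of_nat (n0 * v i)). rewrite o_0, <- INR_IZR_INZ, mult_INR. fold n0R.
   fin. }
 destruct Hz as [k Hk]. exists k. unfold cph. set (D := vsum i (fun l => gp l * dl (S l) j)) in *.
 replace (c j + 2 * PI * n0R * (INR (v i) * o j + D) - c j - 2 * PI * IZR k) with (2 * PI * ((n0R * INR (v i) * o j - IZR k) + n0R * D)) by ring.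
 rewrite Rabs_mult, (Rabs_pos_eq (2 * PI)) by lra. mul_l.
 triang. rewrite (Rabs_mult n0R), (Rabs_pos_eq n0R) by lra. lra.
Qed.

Lemma ofr_near i : i <=' m -> bnd2 d sg (ofr i) o.
Proof.
 intros Hi j Hj. unfold ofr. replace (o j + dl i j - o j) with (dl i j) by ring. le_by now apply dl_le.
 eapply Rle_trans; [|exact sg_ge]. fold n0R. unfold Rdiv. mul_l. apply Rinv_le_contravar; [lra|]. nra.
Qed.

Lemma ofr_time i : ofr i O = 1.
Proof. unfold ofr. rewrite dl_0, o_0. ring. Qed.

Lemma window_reach i : i <=' m -> reach c o (cph i) (ofr i) (2 * PI * n0R * INR (v i)).
Proof.
 assert (HP := PI_RGT_0). induction i as [|i IH]; intros Hi.
 - assert (E1 : cph 0 = c).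
  { apply functional_extensionality. intros j. unfold cph. rewrite v_0, vsum_0. simpl. ring. }
  assert (E2 : ofr 0 = o).
  { apply functional_extensionality. intros j. unfold ofr, dl, wt. simpl. fin. }
  rewrite E1, E2, v_0. simpl. rewrite Rmult_0_r. apply reach_refl. rewrite <- E1 at 1. rewrite <- E2.
  apply adm_near; [apply ofr_time|now apply ofr_near|now apply cph_near].
 - replace (2 * PI * n0R * INR (v (S i))) with (2 * PI * n0R * INR (v i) + 2 * PI * n0R * gp i) by (unfold gp; ring).
  apply (reach_step c o (cph i) (ofr i)); [apply IH; lia| |apply ofr_time| | |].
  + le_by exact T0_le. fold n0R. assert (Hg := gp_ge i ok).
   assert (0 < 2 * PI * n0R) by fin. nra.
  + intros j Hj. unfold ofr. replace (o j + dl (S i) j - (o j + dl i j)) with (dl (S i) j - dl i j) by ring. apply dl_step; lia.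
  + intros j Hj. unfold cph, ofr. rewrite vsum_S. unfold gp at 2 3. unfold gp. ring.
  + apply adm_near; [apply ofr_time|now apply ofr_near|now apply cph_near].
Qed.

Lemma window_closes : near_torus 0 (cph m) c /\ ofr m = fun j => o j + Delta j.
Proof.
 assert (HS := Sum2_ge). split.
 - intros j Hj. exists (kz j). unfold cph. rewrite v_m.
  assert (E : vsum m (fun l => gp l * dl (S l) j) = Delta j * Sum1 + kpa j * Sum2).
  { unfold Sum1, Sum2, dl. rewrite <- !vsum_scal, <- vsum_plus. apply vsum_ext. fin. }
  rewrite E. unfold kpa.
  match goal with |- Rabs ?a <= _ => replace a with 0 by (field; split; lra) end. fin.
 - apply functional_extensionality. intros j. unfold ofr, dl, wt. fold M. fin.
Qed.
End coordinates.

Lemma window : exists c', reach c o c' (fun j => o j + Delta j) (2 * PI * INR n0 * INR X) /\ near_torus 0 c' c.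
Proof.
 destruct (choice_fun (fun j k => (j <= d)%nat -> Rabs (n0R * INR X * o j - IZR k) <= e) end_integer) as [kz0 Hkz0].
 set (kz := fun j => match j with O => Z.of_nat (n0 * X) | S _ => kz0 j end).
 assert (H0 : IZR (kz O) = n0R * INR X) by (unfold kz; rewrite <- INR_IZR_INZ, mult_INR; reflexivity).
 assert (Hk : forall j, j <=' d -> Rabs (n0R * INR X * o j - IZR (kz j)) <= e).
 { intros [|j] Hj; [|fin]. rewrite H0, o_0. fin. }
 destruct (window_closes kz) as [H1 H2]. exists (cph kz m). split; trivial. rewrite <- H2, <- v_m.
 now apply window_reach.
Qed.
End window.
End reach.

Lemma near_torus_mono d r r' c c' : r <= r' -> near_torus d r c c' -> near_torus d r' c c'.
Proof. intros Hr H j Hj. destruct (H j Hj) as [k Hk]. exists k. lra. Qed.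

Section chord.
Variables (d : nat) (T0 st : R) (adm : vec -> vec -> Prop) (n0 X Kr Ke : nat).
Hypothesis n0_pos : 1 <=' n0.
Hypothesis T0_le : T0 <= 2 * PI * INR n0.
Hypothesis Kr_pos : 1 <=' Kr.
Hypothesis Ke_pos : 5 * Kr ^ d * Kr <=' Ke.
Hypothesis X_ge : Kr ^ d <' X.
Hypothesis st_ge : 17 * INR (Kr ^ d) ^ 2 * / INR Ke <= st * INR n0 * INR X ^ 2.
Let Qm := (Ke ^ d * X)%nat.
Let rho := / INR Kr.
Let e := / INR Ke.
Let V := INR (Kr ^ d).

Let KrR : 1 <= INR Kr. Proof. apply (le_INR 1); trivial. Qed.
Let Kp : 1 <=' Kr ^ d. Proof. apply Nat.neq_0_lt_0, Nat.pow_nonzero. lia. Qed.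
Let V_ge1 : 1 <= V. Proof. apply (le_INR 1); trivial. Qed.
Let Ke_ge : Kr <=' Ke. Proof. nia. Qed.
Let KeR : 1 <= INR Ke. Proof. apply (le_INR 1); lia. Qed.
Let e_pos : 0 < e. Proof. apply Rinv_0_lt_compat; lra. Qed.
Let e_rho : 5 * e * V <= rho.
Proof.
 unfold e, rho, V. apply Rmult_le_reg_r with (INR Ke * INR Kr); [fin|].
 replace (5 * / INR Ke * INR (Kr ^ d) * (INR Ke * INR Kr)) with (5 * INR (Kr ^ d) * INR Kr) by fld.
 replace (/ INR Kr * (INR Ke * INR Kr)) with (INR Ke) by fld.
 replace 5 with (INR 5) by (simpl; ring). rewrite <- !mult_INR. now apply le_INR.
Qed.

(** Dirichlet finds a multiple of [X], by a factor at most [Ke ^ d], at which the phase returns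
    within the fine tolerance [e]; [visits] fills the time up to it with returns within the coarse
    [rho]. The relation between [Ke] and [Kr] makes the phase deviation caused by the correction
    smaller than [rho]. *)
Lemma one_window c o Delta sg : o O = 1 -> Delta O = 0 ->
 (forall j, j <=' d -> Rabs (Delta j) * (INR n0 * INR Qm) <= e) -> 5 * e / INR n0 <= sg ->
 (forall c1 o1, o1 O = 1 -> bnd2 d sg o1 o ->
  near_torus d (4 * PI * rho) c1 c -> adm c1 o1) ->
 exists Y c', Y <=' Qm /\ reach d T0 st adm c o c' (fun j => o j + Delta j) (2 * PI * INR n0 * INR Y) /\ near_torus d 0 c' c.
Proof.
 intros Ho HD0 HD Hsg Hok.
 assert (HKe : 1 <=' Ke) by lia.
 destruct (dirichlet Ke (fun i => INR n0 * INR X * o (S i)) d HKe) as (a & Ha & Hdir).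
 set (Y := (a * X)%nat).
 assert (HY : Kr ^ d <' Y) by (unfold Y; nia).
 assert (HYQ : Y <=' Qm) by (unfold Y, Qm; nia).
 destruct (visits Kr Y (fun i => INR n0 * o (S i)) d Kr_pos HY) as (m & v & Hm & HmY & Hv0 & Hvm & Hinc & Hnear).
 destruct (window d T0 st adm n0 Y m v rho e V sg c o Delta) as (c' & H1 & H2); trivial.
 - unfold V. rewrite <- mult_INR. now apply le_INR.
 - fin.
 - intros i j Hi Hj. destruct (Hnear i (j - 1)%nat Hi ok) as [k Hk]. exists k.
  replace (S (j - 1)) with j in Hk by lia. replace (INR n0 * INR (v i) * o j) with (INR (v i) * (INR n0 * o j)) by ring. exact Hk.
 - intros j Hj. destruct (Hdir (j - 1)%nat ok) as [k Hk]. exists k.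
  replace (S (j - 1)) with j in Hk by lia. unfold Y. rewrite mult_INR.
  replace (INR n0 * (INR a * INR X) * o j) with (INR a * (INR n0 * INR X * o j)) by ring. exact Hk.
 - intros j Hj. eapply Rle_trans; [|now apply (HD j)]. apply Rmult_le_compat_l; [fin|].
  apply Rmult_le_compat_l; [fin|now apply le_INR].
 - unfold V. replace (17 * e * INR (Kr ^ d) ^ 2) with (17 * INR (Kr ^ d) ^ 2 * / INR Ke) by (unfold e; ring).
  le_by exact st_ge.
  assert (HX : 0 < INR X) by (apply lt_0_INR; lia). assert (Hn0 : 1 <= INR n0) by (apply (le_INR 1); trivial).
  assert (Hst : 0 <= st).
  { apply Rmult_le_reg_r with (INR n0 * INR X ^ 2); [fin|]. rewrite Rmult_0_l, <- Rmult_assoc.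
   eapply Rle_trans; [|exact st_ge]. fin. }
  apply Rmult_le_compat_l; [fin|]. apply pow_incr. split; [lra|]. apply le_INR. unfold Y. nia.
 - intros c1 o1 H0 H1 H2. apply Hok; trivial. apply (near_torus_mono d (2 * PI * (rho + 5 * e * V))); trivial.
  generalize PI_RGT_0. fin.
 - exists Y, c'. auto.
Qed.

(** A straight frequency segment cut into [N] windows. Each closes its phase exactly, so errors do
    not accumulate. *)
Lemma chord c o Dt len sg N : 1 <=' N -> o O = 1 -> Dt O = 0 ->
 bnd d len Dt -> len * (INR n0 * INR Qm) <= e * INR N -> 5 * e / INR n0 <= sg ->
 (forall c1 o1, o1 O = 1 -> bnd2 d (len + sg) o1 o ->
  near_torus d (4 * PI * rho) c1 c -> adm c1 o1) ->
 exists c' T, reach d T0 st adm c o c' (fun j => o j + Dt j) T /\ near_torus d 0 c' c /\ T <= INR N * (2 * PI * INR n0 * INR Qm).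
Proof.
 intros HN Ho HD0 HD Hlen Hsg Hok. assert (HP := PI_RGT_0).
 assert (HNR : 1 <= INR N) by (apply (le_INR 1); trivial).
 assert (Hlen0 : 0 <= len) by (le_by apply Rabs_pos; apply (HD O); lia).
 assert (Hn0 : 1 <= INR n0) by (apply (le_INR 1); trivial).
 assert (Hsg0 : 0 <= sg) by (eapply Rle_trans; [|exact Hsg]; apply Rdiv_le_0_compat; lra).
 assert (Hrho : 0 < rho) by fin.
 assert (Hpr : 0 <= 4 * PI * rho) by fin.
 assert (HW : 0 <= 2 * PI * INR n0 * INR Qm) by fin.
 assert (Hi : forall i, i <=' N -> exists c' T, reach d T0 st adm c o c' (fun j => o j + INR i / INR N * Dt j) T /\
   near_torus d 0 c' c /\ T <= INR i * (2 * PI * INR n0 * INR Qm)).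
 { induction i as [|i IH]; intros Hi.
  - exists c, 0. split; [|split; [apply near_torus_refl|fin]].
   replace (fun j => o j + INR 0 / INR N * Dt j) with o by (apply functional_extensionality; intros j; simpl; field; lra).
   apply reach_refl. apply Hok; trivial.
   + fin.
   + apply (near_torus_mono d 0); [fin|apply near_torus_refl].
  - destruct IH as (c1 & T1 & R1 & N1 & L1); [lia|].
   destruct (one_window c1 (fun j => o j + INR i / INR N * Dt j) (fun j => / INR N * Dt j) sg) as (Y & c2 & HY & R2 & N2); trivial.
   + fin.
   + fin.
   + intros j Hj. rewrite Rabs_mult, (Rabs_pos_eq (/ INR N)) by fin.
    le_thru (/ INR N * (len * (INR n0 * INR Qm))).
    * rewrite Rmult_assoc. fin.
    * apply Rmult_le_reg_l with (INR N); [lra|]. rewrite <- Rmult_assoc, Rinv_r by lra. lra.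
   + intros c3 o3 H0 H1 H2. apply Hok; trivial.
    * intros j Hj. replace (o3 j - o j) with ((o3 j - (o j + INR i / INR N * Dt j)) + INR i / INR N * Dt j) by ring.
     triang. rewrite Rabs_mult.
     assert (Hr : 0 <= INR i / INR N <= 1).
     { split; [fin|]. reg_r (INR N).
      unfold Rdiv. rewrite Rmult_assoc, Rinv_l, Rmult_1_r, Rmult_1_l by lra. apply le_INR. lia. }
     rewrite (Rabs_pos_eq (INR i / INR N)) by lra.
     assert (INR i / INR N * Rabs (Dt j) <= 1 * len) by fin.
     generalize (H1 j Hj). lra.
    * rewrite <- (Rplus_0_r (4 * PI * rho)). now apply (near_torus_trans d _ _ c3 c1 c).
   + exists c2, (T1 + 2 * PI * INR n0 * INR Y). split; [|split].
    * replace (fun j => o j + INR (S i) / INR N * Dt j) with (fun j => (o j + INR i / INR N * Dt j) + / INR N * Dt j).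
     -- now apply (reach_trans d T0 st adm c o c1 (fun j => o j + INR i / INR N * Dt j)).
     -- apply functional_extensionality. intros j. rewrite S_INR. fin.
    * rewrite <- (Rplus_0_r 0). now apply (near_torus_trans d _ _ c2 c1 c).
    * rewrite S_INR. assert (2 * PI * INR n0 * INR Y <= 2 * PI * INR n0 * INR Qm); [|lra].
     apply Rmult_le_compat_l; [fin|now apply le_INR]. }
 destruct (Hi N (le_n N)) as (c' & T & R1 & N1 & L1). exists c', T. split; [|fin].
 replace (fun j => o j + Dt j) with (fun j => o j + INR N / INR N * Dt j); trivial.
 apply functional_extensionality. fin.
Qed.
End chord.

(** * Rational frequencies with prescribed returns *)

Lemma digits (B : nat) (x : nat -> nat) : 1 <=' B -> (forall j, x j <' B) -> forall n,
 exists v, v <' B ^ n /\ forall j, (1 <= j <= n)%nat -> exists k : Z,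
  0 <= INR v / INR B ^ j - IZR k - INR (x j) / INR B < / INR B.
Proof.
 intros HB Hx. assert (HBR : 1 <= INR B) by (apply (le_INR 1); trivial). induction n as [|n (v & Hv & H)].
 - exists O. split; [simpl; lia|fin].
 - assert (Hp : forall i, 0 < INR B ^ i) by (intros; apply pow_lt; lra).
  exists (v + x (S n) * B ^ n)%nat. split.
  + simpl. generalize (Hx (S n)). intros. nia.
  + intros j Hj. rewrite plus_INR, mult_INR, pow_INR. destruct (Nat.eq_dec j (S n)) as [->|Hne].
   * exists 0%Z. assert (Hpn := Hp n). simpl (INR B ^ S n). replace ((INR v + INR (x (S n)) * INR B ^ n) / (INR B * INR B ^ n) - 0 - INR (x (S n)) / INR B)
     with (INR v / (INR B ^ n) / INR B) by (field; split; lra).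
    apply lt_INR in Hv. rewrite pow_INR in Hv. split.
    -- fin.
    -- apply Rmult_lt_reg_r with (INR B); [lra|]. rewrite Rinv_l by lra.
      replace (INR v / INR B ^ n / INR B * INR B) with (INR v / INR B ^ n) by (field; split; lra).
      apply Rmult_lt_reg_r with (INR B ^ n); [fin|]. unfold Rdiv. inv_l. lra.
   * destruct (H j ok) as [k Hk]. exists (k + Z.of_nat (x (S n) * B ^ (n - j)))%Z.
    rewrite plus_IZR, <- INR_IZR_INZ, mult_INR, pow_INR.
    assert (E : INR B ^ n = INR B ^ j * INR B ^ (n - j)) by (rewrite <- pow_add; f_equal; lia).
    replace ((INR v + INR (x (S n)) * INR B ^ n) / INR B ^ j) with (INR v / INR B ^ j + INR (x (S n)) * INR B ^ (n - j))
     by (rewrite E; field; generalize (Hp j); lra). lra.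
Qed.

(* In time 2 pi A v, the frequency a / A + 1 / (A B^j) advances the phase j by 2 pi v / B^j mod 2 pi. *)
Lemma jump_time d (A B : nat) (a : nat -> Z) (o c be : vec) T0 : 1 <=' A -> 1 <=' B -> 0 <= T0 -> o O = 1 ->
 (forall j, (1 <= j <= d)%nat -> o j = IZR (a j) / INR A + / (INR A * INR B ^ j)) ->
 exists t, T0 <= t <= T0 + 2 * PI * (1 + 2 * (INR A * INR B ^ d)) /\
  near_torus d (2 * PI / INR B) (fun j => c j + t * o j) be.
Proof.
 intros HA HB HT0 Ho0 Ho. assert (HP := PI_RGT_0). set (p2 := 2 * PI). assert (Hp2 : 0 < p2) by (unfold p2; lra).
 assert (HAR : 1 <= INR A) by (apply (le_INR 1); trivial). assert (HBR : 1 <= INR B) by (apply (le_INR 1); trivial).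
 assert (Hp : forall i, 1 <= INR B ^ i) by (intros; now apply pow_R1_Rle).
 (* [t0] settles the time component; everything added later is a multiple of [2 * PI] and leaves it
    alone. *)
 set (y := (be O - c O) / p2). destruct (base_fp y) as [F0 F1]. set (t0 := p2 * frac_part y).
 assert (Ht0 : 0 <= t0 <= p2) by (unfold t0; split; [fin|fin]).
 set (th := fun j => (be j - c j - t0 * o j) / p2).
 set (x := fun j => Z.to_nat (Int_part (INR B * frac_part (th j)))).
 assert (Hx : forall j, 0 <= frac_part (th j) - INR (x j) / INR B < / INR B /\ x j <' B).
 { intros j. destruct (base_fp (th j)) as [G0 G1]. set (z := frac_part (th j)) in *.
  destruct (base_Int_part (INR B * z)) as [I1 I2].
  assert (Hz : 0 <= INR B * z < INR B) by fin.
  assert (Hz0 : (0 <= Int_part (INR B * z))%Z) by (apply Z.lt_succ_r, lt_IZR; rewrite succ_IZR; lra).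
  assert (E : INR (x j) = IZR (Int_part (INR B * z))) by (unfold x; fold z; rewrite INR_IZR_INZ, Z2Nat.id; trivial).
  rewrite E. split; [|apply INR_lt; rewrite E; lra].
  assert (E2 : z - IZR (Int_part (INR B * z)) / INR B = (INR B * z - IZR (Int_part (INR B * z))) / INR B) by fld.
  rewrite E2. split; [fin|]. unfold Rdiv. rewrite <- (Rmult_1_l (/ INR B)) at 2.
  apply Rmult_lt_compat_r; [fin|]; lra. }
 destruct (digits B x HB (fun j => proj2 (Hx j)) d) as (v & Hv & Hdig).
 set (per := p2 * (INR A * INR B ^ d)). assert (HAB : 1 <= INR A * INR B ^ d) by (generalize (Hp d); nra).
 assert (Hper : 0 < per) by (unfold per; apply Rmult_lt_0_compat; lra).
 destruct (nfloor_ex (T0 / per)) as [q Hq]; [fin|].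
 assert (Hq' : INR q * per <= T0 < (INR q + 1) * per).
 { assert (E : T0 = T0 / per * per) by fld. fin. }
 (* [per] is a period of all components at this frequency, so adding [q + 1] of them reaches [T0]
    without changing any phase. *)
 set (t := t0 + p2 * INR A * INR v + (INR q + 1) * per).
 assert (HvR : 0 <= INR v <= INR B ^ d) by (split; [fin|rewrite <- pow_INR; apply le_INR; lia]).
 assert (Hv2 : 0 <= p2 * INR A * INR v <= per).
 { unfold per. split; [fin|]. rewrite Rmult_assoc. fin. }
 exists t. split.
 - unfold t. replace (p2 * (1 + 2 * (INR A * INR B ^ d))) with (p2 + 2 * per) by (unfold per; ring). lra.
 - intros j Hj. destruct j as [|j].
  + exists (Z.of_nat (A * v) + Z.of_nat ((q + 1) * (A * B ^ d)) - Int_part y)%Z.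
   rewrite minus_IZR, plus_IZR, <- !INR_IZR_INZ, !mult_INR, plus_INR, pow_INR. simpl (INR 1).
   match goal with |- Rabs ?a <= _ => replace a with 0 end.
   * fin.
   * fold p2. rewrite Ho0. unfold t, t0, per. unfold frac_part.
    replace (be O) with (c O + p2 * y) by (unfold y; field; lra). ring.
  + destruct (Hdig (S j) ok) as [k Hk]. destruct (Hx (S j)) as [Hxj _].
   exists (Z.of_nat v * a (S j) + k + (Z.of_nat (q + 1)) * (a (S j) * Z.of_nat (B ^ d) + Z.of_nat (B ^ (d - S j))) - Int_part (th (S j)))%Z.
   rewrite minus_IZR, !plus_IZR, !mult_IZR, plus_IZR, mult_IZR, <- !INR_IZR_INZ, plus_INR, !pow_INR. simpl (INR 1). fold p2.
   assert (E : INR B ^ d = INR B ^ S j * INR B ^ (d - S j)) by (rewrite <- pow_add; f_equal; lia).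
   assert (Eo : o (S j) = IZR (a (S j)) / INR A + / (INR A * INR B ^ S j)) by (apply Ho; lia).
   assert (Hpj := Hp (S j)).
   assert (E2 : be (S j) = c (S j) + t0 * o (S j) + p2 * th (S j)) by (unfold th; field; lra).
   match goal with |- Rabs ?a <= _ => replace a with (p2 * (INR v / INR B ^ S j - IZR k - frac_part (th (S j)))) end.
   * rewrite Rabs_mult, (Rabs_pos_eq p2) by lra. unfold Rdiv at 2. mul_l. fin.
   * rewrite E2. unfold frac_part, t, per. rewrite Eo, E. fin.
Qed.

(** * The diffusion path *)

Lemma nat_above x : 0 <= x -> exists n, x < INR n <= x + 1.
Proof. intros Hx. destruct (nfloor_ex x Hx) as [n Hn]. exists (S n). rewrite S_INR. lra. Qed.

Section path.
Variables (d : nat) (L : R) (gam : R -> vec) (Lg D D' : R) (m : R -> vec).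
Hypothesis L_pos : 0 < L.
Hypothesis Lg_pos : 0 < Lg.
Hypothesis gam_Lip : forall s s' i, 0 <= s <= L -> 0 <= s' <= L -> i <' d ->
 Rabs (gam s i - gam s' i) <= Lg * Rabs (s - s').

Definition near_curve (c o : vec) : Prop := exists s, 0 <= s <= L /\
 (bnd2 d D' o (stv 1 (gam s))) /\ near_torus d D c (m s).

Variables (n0 X Kr Ke B N Nw A : nat) (T0 st : R).
Hypothesis D_pos : 0 < D.
Hypothesis n0_pos : 1 <=' n0.
Hypothesis T0_pos : 0 <= T0.
Hypothesis T0_le : T0 <= 2 * PI * INR n0.
Hypothesis Kr_pos : 1 <=' Kr.
Hypothesis Ke_pos : 5 * Kr ^ d * Kr <=' Ke.
Hypothesis X_ge : Kr ^ d <' X.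
Hypothesis st_ge : 17 * INR (Kr ^ d) ^ 2 * / INR Ke <= st * INR n0 * INR X ^ 2.
Hypothesis st_pos : 0 <= st.
Hypothesis B_pos : 1 <=' B.
Hypothesis A_pos : 1 <=' A.
Hypothesis N_pos : 1 <=' N.
Hypothesis Nw_pos : 1 <=' Nw.
Let Lam := Lg * L.
Let tol := Lam / INR N.
Let Qm := (Ke ^ d * X)%nat.
Hypothesis Kr_D : 4 * PI * / INR Kr <= D / 2.
Hypothesis B_D : 2 * PI / INR B <= D / 2.
Hypothesis A_tol : 2 / INR A <= tol.
Hypothesis N_D' : 4 * tol + 5 * / INR Ke / INR n0 <= D'.
Hypothesis Nw_ge : 3 * tol * (INR n0 * INR Qm) <= / INR Ke * INR Nw.

Let NR : 1 <= INR N. Proof. apply (le_INR 1); trivial. Qed.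
Let AR : 1 <= INR A. Proof. apply (le_INR 1); trivial. Qed.
Let BR : 1 <= INR B. Proof. apply (le_INR 1); trivial. Qed.
Let Lam_pos : 0 < Lam. Proof. apply Rmult_lt_0_compat; trivial. Qed.
Let tol_pos : 0 < tol. Proof. apply Rdiv_lt_0_compat; lra. Qed.

Definition knot (i : nat) : R := L * (INR i / INR N).
Definition wnum (i j : nat) : Z := Int_part (INR A * gam (knot i) (j - 1)%nat).
(** Interior knots are rounded to the rational frequencies of [jump_time]; the two ends stay exact,
    because the orbit must connect the given tori. *)
Definition waypoint (i : nat) : vec :=
 if Nat.eqb i 0 then stv 1 (gam 0) else if Nat.eqb i N then stv 1 (gam L)
 else fun j => match j with O => 1 | S _ => IZR (wnum i j) / INR A + / (INR A * INR B ^ j) end.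

Lemma knot_range i : i <=' N -> 0 <= knot i <= L.
Proof.
 intros Hi. unfold knot. assert (0 <= INR i / INR N <= 1).
 { split; [fin|]. reg_r (INR N).
  unfold Rdiv. rewrite Rmult_assoc, Rinv_l, Rmult_1_r, Rmult_1_l by lra. now apply le_INR. }
 nra.
Qed.

Lemma knot_0 : knot 0 = 0.
Proof. unfold knot. simpl. field. lra. Qed.

Lemma knot_N : knot N = L.
Proof. unfold knot. fin. Qed.

Lemma waypoint_time i : waypoint i O = 1.
Proof. unfold waypoint. destruct (Nat.eqb i 0); [reflexivity|]. destruct (Nat.eqb i N); reflexivity. Qed.

Lemma waypoint_near i j : i <=' N -> j <=' d -> Rabs (waypoint i j - stv 1 (gam (knot i)) j) <= tol.
Proof.
 intros Hi Hj. unfold waypoint. destruct (Nat.eqb_spec i 0) as [->|Hi0].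
 { rewrite knot_0, Rminus_diag, Rabs_R0. lra. }
 destruct (Nat.eqb_spec i N) as [->|HiN].
 { rewrite knot_N, Rminus_diag, Rabs_R0. lra. }
 destruct j as [|j]; [simpl; rewrite Rminus_diag, Rabs_R0; lra|]. cbv [stv]. eapply Rle_trans; [|exact A_tol].
 unfold wnum. replace (S j - 1)%nat with j by lia. set (g := gam (knot i) j).
 destruct (base_Int_part (INR A * g)) as [I1 I2].
 assert (HB : 1 <= INR B ^ S j) by now apply pow_R1_Rle.
 assert (HiA : 0 < / INR A) by fin.
 assert (H1 : 0 < / (INR A * INR B ^ S j) <= / INR A) by (split; [fin|apply Rinv_le_contravar; nra]).
 assert (H2 : - / INR A <= IZR (Int_part (INR A * g)) / INR A - g <= 0).
 { replace (IZR (Int_part (INR A * g)) / INR A - g) with ((IZR (Int_part (INR A * g)) - INR A * g) * / INR A) by fld. nra. }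
 fin.
Qed.

Lemma knot_step i : S i <=' N -> bnd2 d tol (stv 1 (gam (knot (S i)))) (stv 1 (gam (knot i))).
Proof.
 intros Hi j Hj. destruct j as [|j]; cbv [stv]; [fin|].
 le_by (apply gam_Lip; [now apply knot_range|apply knot_range; lia|lia]).
 unfold knot. rewrite S_INR. replace (L * ((INR i + 1) / INR N) - L * (INR i / INR N)) with (L / INR N) by fin.
 rewrite Rabs_pos_eq by fin. right. unfold tol, Lam. fin.
Qed.

Let Tc := INR Nw * (2 * PI * INR n0 * INR Qm).
Let Tj := T0 + 2 * PI * (1 + 2 * (INR A * INR B ^ d)).

Lemma chord_step i c : S i <=' N -> near_torus d (D / 2) c (m (knot i)) ->
 exists c' T, reach d T0 st near_curve c (waypoint i) c' (waypoint (S i)) T /\ T <= Tc.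
Proof.
 intros Hi Hc. set (Dt := fun j => waypoint (S i) j - waypoint i j).
 destruct (chord d T0 st near_curve n0 X Kr Ke n0_pos T0_le Kr_pos Ke_pos X_ge st_ge c (waypoint i) Dt (3 * tol)
  (5 * / INR Ke / INR n0) Nw Nw_pos) as (c' & T & H1 & H2 & H3).
 - apply waypoint_time.
 - unfold Dt. rewrite !waypoint_time. ring.
 - intros j Hj. generalize (waypoint_near (S i) j Hi Hj) (waypoint_near i j ok Hj) (knot_step i Hi j Hj). unfold Dt.
  fin.
 - fin.
 - lra.
 - intros c1 o1 H0 Ho Hn. exists (knot i). split; [apply knot_range; lia|split].
  + intros j Hj. generalize (Ho j Hj) (waypoint_near i j ok Hj). fin.
  + apply (near_torus_mono d (4 * PI * / INR Kr + D / 2)); [lra|]. now apply (near_torus_trans d _ _ c1 c).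
 - exists c', T. split; trivial. replace (waypoint (S i)) with (fun j => waypoint i j + Dt j); trivial.
  apply functional_extensionality. intros j. unfold Dt. ring.
Qed.

(** A chord returns the phase to the minimum of the old knot; a jump at the new rational frequency
    then carries it to the minimum of the new knot. No jump follows the last chord, which is
    admissible with respect to the knot before it. *)
Lemma path_prefix i : i <' N -> exists c T, reach d T0 st near_curve (m 0) (stv 1 (gam 0)) c (waypoint i) T /\
 near_torus d (D / 2) c (m (knot i)) /\ T <= INR i * (Tc + Tj).
Proof.
 induction i as [|i IH]; intros Hi.
 - exists (m 0), 0. change (waypoint 0) with (stv 1 (gam 0)). rewrite knot_0.
  assert (Hn : forall r, 0 <= r -> near_torus d r (m 0) (m 0)) by (intros r Hr; apply (near_torus_mono d 0); trivial; apply near_torus_refl).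
  split; [|split; [apply Hn; lra|simpl; lra]].
  apply reach_refl. exists 0. split; [lra|split; [|apply Hn; lra]].
  intros j Hj. rewrite Rminus_diag, Rabs_R0.
  assert (0 <= 5 * / INR Ke / INR n0); [|lra].
  assert (0 < INR n0) by (apply lt_0_INR; lia).
  assert (0 < INR Ke) by (apply lt_0_INR; assert (Kr ^ d <> 0)%nat by (apply Nat.pow_nonzero; lia); nia).
  fin.
 - destruct IH as (c & T & H1 & H2 & H3); [lia|].
  destruct (chord_step i c ok H2) as (c1 & T1 & H4 & H5).
  destruct (jump_time d A B (wnum (S i)) (waypoint (S i)) c1 (m (knot (S i))) T0 A_pos B_pos T0_pos (waypoint_time _)) as (t & Ht & Hn).
  { intros j Hj. unfold waypoint. destruct (Nat.eqb_spec (S i) 0); [lia|]. destruct (Nat.eqb_spec (S i) N); [lia|]. destruct j; [lia|fin]. }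
  assert (HnD : near_torus d (D / 2) (fun j => c1 j + t * waypoint (S i) j) (m (knot (S i)))) by now apply (near_torus_mono d (2 * PI / INR B)).
  exists (fun j => c1 j + t * waypoint (S i) j), (T + T1 + t). split; [|split; trivial].
  + apply (reach_step d T0 st near_curve _ _ c1 (waypoint (S i))); trivial; try lra.
   * now apply (reach_trans d T0 st near_curve _ _ c (waypoint i)).
   * apply waypoint_time.
   * fin.
   * exists (knot (S i)). split; [apply knot_range; lia|split].
    -- intros j Hj. generalize (waypoint_near (S i) j ok Hj).
      assert (0 <= 5 * / INR Ke / INR n0); [|lra].
      assert (0 < INR n0) by (apply lt_0_INR; lia).
      assert (0 < INR Ke) by (apply lt_0_INR; assert (Kr ^ d <> 0)%nat by (apply Nat.pow_nonzero; lia); nia).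
      fin.
    -- apply (near_torus_mono d (D / 2)); trivial. lra.
  + rewrite S_INR. unfold Tj in *. lra.
Qed.

Lemma path : exists c T, reach d T0 st near_curve (m 0) (stv 1 (gam 0)) c (stv 1 (gam L)) T /\ T <= INR N * (Tc + Tj).
Proof.
 destruct (path_prefix (N - 1) ok) as (c & T & H1 & H2 & H3).
 destruct (chord_step (N - 1) c ok H2) as (c1 & T1 & H4 & H5). replace (S (N - 1)) with N in H4 by lia.
 exists c1, (T + T1). split.
 - replace (stv 1 (gam L)) with (waypoint N).
  + now apply (reach_trans d T0 st near_curve _ _ c (waypoint (N - 1))).
  + unfold waypoint. destruct (Nat.eqb_spec N 0); [lia|]. now rewrite Nat.eqb_refl.
 - rewrite minus_INR in H3 by lia. simpl (INR 1) in H3. assert (HP := PI_RGT_0).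
  assert (0 <= Tj).
  { unfold Tj. assert (0 <= INR A * INR B ^ d) by fin.
   fin. }
  lra.
Qed.
End path.

Lemma ln_le_sqrt mu : 0 < mu -> - ln mu <= 2 / sqrt mu.
Proof.
 intros Hmu. set (q := sqrt mu). assert (Hq : 0 < q) by now apply sqrt_lt_R0.
 assert (E : mu = q * q) by (symmetry; apply sqrt_sqrt; lra).
 rewrite E, ln_mult by trivial. assert (- ln q <= / q); [|fin].
 rewrite <- ln_Rinv by trivial. assert (Hi : 0 < / q) by fin.
 generalize (exp_ineq1_le (ln (/ q))). rewrite exp_ln by trivial. lra.
Qed.

(** [Cp] is fixed before [D']. A smaller [D'] needs more knots, but the chords shorten in
    proportion, so the leading part of the time does not depend on their number; the part that does
    is absorbed by taking [mu] small. *)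
Lemma path_exists d L gam Lg D eps : 0 < L -> 0 < Lg ->
 (forall s s' i, 0 <= s <= L -> 0 <= s' <= L -> i <' d -> Rabs (gam s i - gam s' i) <= Lg * Rabs (s - s')) ->
 0 < D <= 1 -> 0 < eps <= 1 -> exists Cp, 0 < Cp /\ forall D', 0 < D' <= 1 -> exists mu1, 0 < mu1 <= / 10 /\
 forall mu m, 0 < mu <= mu1 -> exists c T,
  reach d (60 * - ln mu) (eps * mu) (near_curve d L gam D D' m) (m 0) (stv 1 (gam 0)) c (stv 1 (gam L)) T /\
  T <= Cp * (- ln mu) / mu.
Proof.
 intros HL HLg HLip HD Heps. assert (HP := PI_range).
 set (Lam := Lg * L). assert (HLam : 0 < Lam) by (apply Rmult_lt_0_compat; trivial).
 destruct (nat_above (32 / D)) as (Kr & HKr1 & _); [fin|].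
 destruct (nat_above (16 / D)) as (B & HB1 & _); [fin|].
 assert (HKr : 1 <= INR Kr).
 { assert (1 <= 32 / D) by (reg_r D; unfold Rdiv; rewrite Rmult_assoc, Rinv_l; lra). lra. }
 assert (HB : 1 <= INR B).
 { assert (1 <= 16 / D) by (reg_r D; unfold Rdiv; rewrite Rmult_assoc, Rinv_l; lra). lra. }
 assert (HKrn : 1 <=' Kr) by (apply INR_le; exact HKr). assert (HBn : 1 <=' B) by (apply INR_le; exact HB).
 assert (HKrD : 4 * PI * / INR Kr <= D / 2).
 { reg_r (INR Kr). inv_l; rewrite Rmult_1_r.
  assert (32 <= D * INR Kr); [|nra]. replace 32 with (D * (32 / D)) by fld. fin. }
 assert (HBD : 2 * PI / INR B <= D / 2).
 { reg_r (INR B). unfold Rdiv at 1. inv_l; rewrite Rmult_1_r.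
  assert (16 <= D * INR B); [|nra]. replace 16 with (D * (16 / D)) by fld. fin. }
 set (Ke := (5 * Kr ^ d * Kr)%nat).
 assert (Hpw : 1 <=' Kr ^ d) by (apply Nat.neq_0_lt_0, Nat.pow_nonzero; lia).
 assert (HKen : 5 <=' Ke) by fin.
 assert (HKe : 5 <= INR Ke) by (apply le_INR in HKen; simpl in HKen; lra).
 set (e := / INR Ke). assert (He : 0 < e <= / 5) by (split; [apply Rinv_0_lt_compat; lra|apply Rinv_le_contravar; lra]).
 set (V := INR (Kr ^ d)). assert (HV : 1 <= V) by (apply (le_INR 1); trivial).
 set (Q := INR (Ke ^ d)). assert (HQ : 1 <= Q) by (apply (le_INR 1), Nat.neq_0_lt_0, Nat.pow_nonzero; lia).
 (* With the step [eps * mu] the condition [st_ge] reads [a ^ 2 <= n0 * mu * X ^ 2]; hence [X] is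
    taken slightly above [a / sqrt (n0 * mu)]. *)
 set (a := sqrt (17 * V ^ 2 * e / eps)).
 assert (Ha2 : a ^ 2 = 17 * V ^ 2 * e / eps).
 { unfold a. rewrite pow2_sqrt; trivial. fin. }
 assert (Ha : 0 <= a) by apply sqrt_pos.
 set (A1 := a + 1 + V).
 set (C0 := 6 * PI * Lam * Q ^ 2 / e * 11 * A1 ^ 2).
 assert (HC0 : 0 <= C0).
 { unfold C0. fin. }
 exists (C0 + 1). split; [lra|]. intros D' HD'.
 destruct (nat_above (8 * Lam / D')) as (N & HN1 & _); [fin|].
 assert (HN0 : 0 < 8 * Lam / D') by fin.
 assert (HNn : 1 <=' N) by (apply INR_lt; simpl; lra).
 assert (HN : 1 <= INR N) by (apply (le_INR 1); trivial).
 set (tol := Lam / INR N). assert (Htol : 0 < tol) by (apply Rdiv_lt_0_compat; lra).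
 assert (Htol4 : 4 * tol <= D' / 2).
 { unfold tol. reg_r (INR N). replace (4 * (Lam / INR N) * INR N) with (4 * Lam) by fld.
  assert (8 * Lam <= D' * INR N); [|lra]. replace (8 * Lam) with (D' * (8 * Lam / D')) by fld. fin. }
 destruct (nat_above (2 / tol)) as (A & HA1 & _); [fin|].
 assert (HA0 : 0 < 2 / tol) by fin.
 assert (HAn : 1 <=' A) by (apply INR_lt; simpl; lra).
 assert (HA : 1 <= INR A) by (apply (le_INR 1); trivial).
 assert (HAtol : 2 / INR A <= tol).
 { reg_r (INR A). replace (2 / INR A * INR A) with (tol * (2 / tol)) by (field; split; lra). fin. }
 set (J := 2 * PI * (1 + 2 * (INR A * INR B ^ d))).
 assert (HJ : 0 <= J).
 { unfold J. assert (0 <= INR A * INR B ^ d) by fin. fin. }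
 set (Z := 22 + INR N * (44 * PI * Q * A1 + 60 + J)).
 assert (HA1' : 1 <= A1) by (unfold A1; lra).
 assert (HZ : 22 <= Z).
 { unfold Z. assert (0 <= 44 * PI * Q * A1) by fin. fin. }
 (* After multiplication by [mu] the terms that depend on the number of knots are at most
    [sqrt mu * Z * |log mu|], and [sqrt mu * Z <= 1]. The exponential gives
    [|log mu| >= 1 + 1 / D']. *)
 set (mu1 := Rmin ((/ Z) ^ 2) (exp (- (1 + 1 / D')))).
 assert (HiZ : 0 < / Z <= / 22) by (split; [fin|fin]).
 exists mu1. split.
 { split; [apply Rmin_glb_lt; [fin|apply exp_pos]|]. le_by apply Rmin_l. nra. }
 intros mu m Hmu.
 assert (Hmu2 : mu <= (/ Z) ^ 2) by (eapply Rle_trans; [apply Hmu|apply Rmin_l]).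
 assert (Hmu3 : mu <= exp (- (1 + 1 / D'))) by (eapply Rle_trans; [apply Hmu|apply Rmin_r]).
 set (Lm := - ln mu).
 assert (HLm : 1 + 1 / D' <= Lm).
 { unfold Lm. apply ln_le in Hmu3; [|lra]. rewrite ln_exp in Hmu3. lra. }
 assert (HiD' : 0 < 1 / D') by fin.
 set (y := sqrt mu). assert (Hy : 0 < y) by (apply sqrt_lt_R0; lra). assert (Hyy : y * y = mu) by (apply sqrt_sqrt; lra).
 assert (HyZ : y * Z <= 1).
 { assert (y <= / Z) by (unfold y; rewrite <- (sqrt_pow2 (/ Z)) by lra; now apply sqrt_le_1_alt).
  le_thru (/ Z * Z); [fin|rewrite Rinv_l; lra]. }
 assert (HLmy : Lm * y <= 2).
 { generalize (ln_le_sqrt mu ok). fold Lm y. intros H. apply Rmult_le_compat_r with (r := y) in H; [|lra].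
  replace (2 / y * y) with 2 in H by fld. lra. }
 (* Every gap of a window lasts at least [2 * PI * n0], and [2 * PI * 10] exceeds the required
    60. *)
 destruct (nat_above (10 * Lm)) as (n0 & Hn0); [lra|].
 assert (Hn0n : 1 <=' n0) by (apply INR_lt; simpl; lra).
 assert (Hn0mu : INR n0 * mu <= 1).
 { assert (INR n0 <= 11 * Lm) by lra. le_thru (11 * Lm * mu); [fin|]. rewrite <- Hyy. nra. }
 set (w := sqrt (INR n0 * mu)). assert (Hw : 0 < w <= 1).
 { split; [apply sqrt_lt_R0, Rmult_lt_0_compat; lra|]. rewrite <- sqrt_1. now apply sqrt_le_1_alt. }
 assert (Hw2 : w ^ 2 = INR n0 * mu) by (apply pow2_sqrt, Rmult_le_pos; lra).
 assert (Hyw : y <= w). { unfold y, w. apply sqrt_le_1_alt. rewrite <- (Rmult_1_l mu) at 1. fin. }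
 destruct (nat_above (a / w)) as (X0 & HX0); [fin|].
 set (X := (X0 + Kr ^ d)%nat).
 assert (HXn : Kr ^ d <' X) by (unfold X; assert (0 < X0)%nat by (apply INR_lt; simpl; assert (0 <= a / w) by fin; lra); lia).
 assert (HXR : a / w <= INR X <= A1 / w).
 { unfold X. rewrite plus_INR. fold V. assert (1 <= / w) by (rewrite <- Rinv_1; apply Rinv_le_contravar; lra).
  unfold A1, Rdiv in *. split; [lra|]. assert (V <= V * / w) by nra. lra. }
 assert (HX2 : a ^ 2 <= INR n0 * mu * INR X ^ 2 <= A1 ^ 2).
 { rewrite <- Hw2, <- Rpow_mult_distr. split; apply pow_incr.
  - split; trivial. replace a with (w * (a / w)) at 1 by fld. fin.
  - split; [fin|]. replace A1 with (w * (A1 / w)) by fld. fin. }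
 set (Qm := (Ke ^ d * X)%nat). assert (HQm : INR Qm = Q * INR X) by (unfold Qm; now rewrite mult_INR).
 set (x := INR n0 * INR Qm). assert (Hx : 0 <= x) by (apply Rmult_le_pos; apply pos_INR).
 (* Windows per chord: a chord is at most [3 * tol] long, and a window moves the frequency by at
    most [e / x]. *)
 destruct (nat_above (3 * tol * x / e)) as (Nw & HNw); [fin|].
 assert (HNw0 : 0 <= 3 * tol * x / e) by fin.
 assert (HNwn : 1 <=' Nw) by (apply INR_lt; simpl; lra).
 destruct (path d L gam Lg D D' m HL HLg HLip n0 X Kr Ke B N Nw A (60 * Lm) (eps * mu)) as (c & T & H1 & H2); trivial; try lra.
 - le_thru (6 * (10 * Lm)); [lra|]. fin.
 - fold V e. replace (17 * V ^ 2 * e) with (eps * a ^ 2) by (rewrite Ha2; field; lra).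
  replace (eps * mu * INR n0 * INR X ^ 2) with (eps * (INR n0 * mu * INR X ^ 2)) by ring. fin.
 - fin.
 - fold Lam tol e. le_thru (D' / 2 + D' / 2); [apply Rplus_le_compat; trivial|lra].
  assert (1 <= D' * INR n0).
  { replace 1 with (D' * (1 / D')) by fld. fin. }
  reg_r (INR n0). unfold Rdiv. inv_l.
  assert (10 <= D' * INR n0); [|lra]. replace 10 with (D' * (10 * (1 / D'))) by fld. fin.
 - fold Lam tol Qm x e. replace (3 * tol * x) with (e * (3 * tol * x / e)) by fld. fin.
 - exists c, T. split; trivial. le_by exact H2. fold Qm. fold J. rewrite (Rmult_assoc (2 * PI)). fold x.
  assert (HT : INR N * (INR Nw * (2 * PI * x) + (60 * Lm + J)) <= 6 * PI * Lam / e * x ^ 2 + INR N * (2 * PI * x + (60 * Lm + J))).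
  { assert (INR Nw * (2 * PI * x) <= (3 * tol * x / e + 1) * (2 * PI * x)) by fin.
   le_thru (INR N * ((3 * tol * x / e + 1) * (2 * PI * x) + (60 * Lm + J))); [fin|].
   right. unfold tol. field. fin. }
  le_by exact HT.
  assert (HX1 : INR X * y <= A1).
  { le_thru (A1 / w * w); [fin|]. right; field; lra. }
  reg_r mu. replace ((C0 + 1) * Lm / mu * mu) with (C0 * Lm + Lm) by fld.
  rewrite Rmult_plus_distr_r. apply Rplus_le_compat.
  + replace (6 * PI * Lam / e * x ^ 2 * mu) with (6 * PI * Lam * Q ^ 2 / e * (INR n0 * (INR n0 * mu * INR X ^ 2))) by (unfold x; rewrite HQm; field; lra).
   replace (C0 * Lm) with (6 * PI * Lam * Q ^ 2 / e * (11 * Lm * A1 ^ 2)) by (unfold C0; field; lra).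
   fin.
  + assert (Hx1 : x * mu <= 11 * Lm * Q * A1 * y).
   { unfold x. rewrite HQm, <- Hyy. replace (INR n0 * (Q * INR X) * (y * y)) with (INR n0 * (Q * (INR X * y)) * y) by ring.
    replace (11 * Lm * Q * A1 * y) with (11 * Lm * (Q * A1) * y) by ring. fin. }
   assert (Hmy : mu <= y) by (rewrite <- Hyy; nra).
   le_thru (Lm * (y * Z)); [|rewrite <- (Rmult_1_r Lm) at 2; apply Rmult_le_compat_l; lra].
   le_thru (Lm * (y * (INR N * (44 * PI * Q * A1 + 60 + J)))).
   * replace (INR N * (2 * PI * x + (60 * Lm + J)) * mu) with (INR N * (2 * PI * (x * mu) + 60 * Lm * mu + J * mu)) by ring.
    replace (Lm * (y * (INR N * (44 * PI * Q * A1 + 60 + J)))) with (INR N * (4 * PI * (11 * Lm * Q * A1 * y) + 60 * Lm * y + J * (Lm * y))) by ring.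
    mul_l.
    assert (0 <= 11 * Lm * Q * A1 * y) by fin.
    assert (2 * PI * (x * mu) <= 4 * PI * (11 * Lm * Q * A1 * y)).
    { fin. }
    assert (60 * Lm * mu <= 60 * Lm * y) by fin.
    assert (J * mu <= J * (Lm * y)) by (apply Rmult_le_compat_l; [lra|nra]). lra.
   * mul_l. mul_l. unfold Z; lra.
Qed.

Lemma vnorm_le n v M : 0 <= M -> (forall i, i <' n -> Rabs (v i) <= M) -> vnorm n v <= INR n * M.
Proof.
 intros HM H. unfold vnorm. destruct n as [|n]; [rewrite vsum_0, sqrt_0; simpl; lra|].
 assert (Hn : 1 <= INR (S n)) by (apply (le_INR 1); lia).
 rewrite <- (sqrt_pow2 (INR (S n) * M)) by fin. apply sqrt_le_1_alt.
 le_by exact (sq_le_comp (S n) v M H). fin.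
Qed.

Lemma in_nbhd_ext d r om om' I q p : (forall i, i <' d -> om i = om' i) -> in_nbhd_torus d r om I q p -> in_nbhd_torus d r om' I q p.
Proof.
 intros H [k Hk]. exists k. erewrite vsum_ext; [exact Hk|]. intros i Hi. cbv beta. now rewrite (H i Hi).
Qed.

Theorem theorem1p3 (d N : nat) (hd : (1 <= d)%nat)
  (ft : vec -> R -> R) (hft : is_trig_poly d N ft)
  (L : R) (gam : R -> vec) (omegaI omegaF : vec)
  (hgam : smooth_embedding d L gam)
  (hI : forall i, (i < d)%nat -> gam 0 i = omegaI i)
  (hF : forall i, (i < d)%nat -> gam L i = omegaF i)
  (hmin : forall s, 0 <= s <= L ->
     exists x0 : vec, nondeg_local_min (S d) (Gfun ft (gam s)) x0) :
  exists C, 0 < C /\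
  forall eta, 0 < eta ->
  exists mu0, 0 < mu0 /\
  forall mu, 0 < mu <= mu0 ->
  exists (phi I : R -> vec) (q p : R -> R),
    is_solution d ft mu phi I q p /\
    heteroclinic d omegaI omegaF I q p /\
    (forall t, exists s, 0 <= s <= L /\ vnorm d (fun i => I t i - gam s i) <= eta) /\
    (exists t1 t2, t1 <= t2 /\
       in_nbhd_torus d mu omegaI (I t1) (q t1) (p t1) /\
       in_nbhd_torus d mu omegaF (I t2) (q t2) (p t2) /\
       t2 - t1 <= C / mu * Rabs (ln mu)).
Proof.
 destruct hft as (P & _ & Hft). assert (HL : 0 < L) by apply hgam.
 destruct (uniform_sites d P ft L gam Hft hgam hmin) as (W0 & Bb & r & kap & D & HW0 & HBb & Hr & Hkap & HD & HgamW & Hsite).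
 destruct (curve_Lip d L gam hgam) as (Lg & HLg & HLip).
 assert (Hm : forall s, exists m : vec, 0 <= s <= L -> forall om c, om O = 1 ->
  bnd2 d D om (stv 1 (gam s)) ->
  (forall j, j <=' d -> exists k, Rabs (c j - m j - 2 * PI * IZR k) <= D) ->
  exists b, (forall j, Rabs (b j) <= Bb) /\ good_site d P W0 Bb r kap om b c).
 { intros s. destruct (excluded_middle_informative (0 <= s <= L)) as [Hs|Hs]; [|exists (fun _ => 0); tauto].
  destruct (Hsite s Hs) as [m H]. exists m. fin. }
 apply choice_fun in Hm. destruct Hm as [m Hm].
 destruct (chain_exists d P W0 Bb r kap HW0 HBb Hr Hkap) as (eps & Heps & Hchain).
 destruct (path_exists d L gam Lg D eps HL HLg HLip HD Heps) as (Cp & HCp & Hpath).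
 destruct (Hchain eps ok) as (muc & Hmuc & Hch).
 exists (Cp + 1). split; [lra|]. intros eta Heta.
 assert (HdR : 1 <= INR d) by (apply (le_INR 1); trivial).
 (* Four errors of at most [h] separate a component of the action from the curve: the drift within
    an arc, the spacing term [2 * theta], the term [CR * mu], and the distance [D'] of the path from
    the curve. *)
 set (h := eta / (4 * INR d)). assert (Hh : 0 < h) by (apply Rdiv_lt_0_compat; lra).
 set (D' := Rmin (D / 2) h).
 assert (HD' : 0 < D' /\ D' <= D / 2 /\ D' <= h).
 { unfold D'. split; [apply Rmin_glb_lt; lra|]. split; [apply Rmin_l|apply Rmin_r]. }
 destruct (Hpath D' ok) as (mu1 & Hmu1 & Hp).
 set (theta := Rmin eps (h / 2)).
 assert (Hth : 0 < theta /\ theta <= eps /\ 2 * theta <= h).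
 { unfold theta. generalize (Rmin_r eps (h / 2)). intros. split; [apply Rmin_glb_lt; lra|]. split; [apply Rmin_l|lra]. }
 assert (HF := Fbd_ge1 d P). set (F := Fbd d P) in *.
 set (CR := 1 + CRem d P (W0 + 4)).
 assert (HCR : 1 <= CR).
 { unfold CR, CRem. fold F. fin. }
 set (dB := 1 + INR d * Bb). assert (HdB : 1 <= dB) by (unfold dB; assert (0 <= INR d * Bb) by pos; lra).
 set (CLc := CL d W0 Bb). assert (HCL : 1 <= CLc) by (apply CL_ge; lra).
 assert (Hl4 : 0 < ln 4) by (rewrite <- ln_1; apply ln_increasing; lra).
 assert (Hl6 : 0 < ln (INR d + 6)) by (rewrite <- ln_1; apply ln_increasing; lra).
 set (Kt := 2 * CLc + 8 * (ln 4 + ln (INR d + 6)) + 8). assert (HKt : 10 <= Kt) by (unfold Kt; lra).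
 (* For [|log mu| >= Lm0] the spacing [60 * |log mu|] of the path exceeds both lower bounds that
    [chain_exists] puts on the gaps. *)
 set (Lm0 := 1 + 1 / theta + 2 * dB + 8 * ln 4).
 assert (Hith : 0 < 1 / theta) by pos.
 set (Z := 10000000 * F * (W0 + 6) + 32 * F / h + CR / h + 2 / D + Kt).
 assert (HFh : 0 < 32 * F / h) by pos. assert (HCh : 0 < CR / h) by pos.
 assert (HiD : 0 < 2 / D) by pos.
 assert (HFW : 10000000 <= 10000000 * F * (W0 + 6)) by nra.
 assert (HZ : 10000000 <= Z) by (unfold Z; lra).
 set (mu0 := Rmin (Rmin muc mu1) (Rmin (/ Z) (exp (- Lm0)))).
 exists mu0. split.
 { unfold mu0. repeat apply Rmin_glb_lt; try lra; [apply Rinv_0_lt_compat; lra|apply exp_pos]. }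
 intros mu Hmu.
 assert (Hm1 : mu <= muc /\ mu <= mu1 /\ mu <= / Z /\ mu <= exp (- Lm0)).
 { unfold mu0 in Hmu. generalize (Rmin_l (Rmin muc mu1) (Rmin (/ Z) (exp (- Lm0)))) (Rmin_r (Rmin muc mu1) (Rmin (/ Z) (exp (- Lm0))))
   (Rmin_l muc mu1) (Rmin_r muc mu1) (Rmin_l (/ Z) (exp (- Lm0))) (Rmin_r (/ Z) (exp (- Lm0))). lra. }
 destruct Hm1 as (Hm1 & Hm2 & Hm3 & Hm4).
 assert (HmuZ : mu * Z <= 1) by (le_thru (/ Z * Z); [apply Rmult_le_compat_r; lra|rewrite Rinv_l; lra]).
 assert (Hpart : forall a, 0 <= a <= Z -> mu * a <= 1) by (intros a Ha; le_thru (mu * Z); [apply Rmult_le_compat_l; lra|trivial]).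
 assert (Hs1 : mu * (10000000 * F * (W0 + 6)) <= 1) by (apply Hpart; unfold Z; lra).
 assert (Hs2 : 32 * (mu * F) <= h).
 { assert (mu * (32 * F / h) <= 1) by (apply Hpart; unfold Z; lra). apply Rmult_le_compat_r with (r := h) in H; [|lra].
  replace (mu * (32 * F / h) * h) with (32 * (mu * F)) in H by fld. lra. }
 assert (Hs3 : CR * mu <= h).
 { assert (mu * (CR / h) <= 1) by (apply Hpart; unfold Z; lra). apply Rmult_le_compat_r with (r := h) in H; [|lra].
  replace (mu * (CR / h) * h) with (CR * mu) in H by fld. lra. }
 assert (Hs4 : mu <= D / 2).
 { assert (mu * (2 / D) <= 1) by (apply Hpart; unfold Z; lra). apply Rmult_le_compat_r with (r := D) in H; [|lra].
  replace (mu * (2 / D) * D) with (2 * mu) in H by fld. lra. }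
 assert (Hs5 : mu * Kt <= 1) by (apply Hpart; unfold Z; lra).
 assert (Hmu01 : 0 < mu <= 1) by nra.
 set (Lm := - ln mu).
 assert (HLm : Lm0 <= Lm) by (unfold Lm; apply ln_le in Hm4; [rewrite ln_exp in Hm4; lra|lra]).
 assert (HLm1 : 1 <= Lm) by (unfold Lm0 in HLm; lra).
 destruct (Hp mu m ok) as (c' & T & Hreach & HT). fold Lm in Hreach, HT.
 destruct (reach_sequence _ _ _ _ _ _ _ _ _ Hreach) as (n & Om & cs & E1 & E2 & E3 & E4 & E5 & Hok & Hst).
 (* The sites [0] to [n] need the arcs [0] to [n + 1], one more frequency than the path provides;
    repeating the last one keeps the final arc exactly on the target torus. *)
 set (Om' := fun i => if Nat.leb i n then Om i else Om n).
 assert (HOm' : forall i, i <=' n -> Om' i = Om i) by (intros i Hi; unfold Om'; destruct (Nat.leb_spec i n); trivial; lia).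
 assert (HOm'' : forall i, n <=' i -> Om' i = Om n).
 { intros i Hi. unfold Om'. destruct (Nat.leb_spec i n); trivial. now replace i with n by lia. }
 assert (Htime : forall i, i <=' n -> Om i O = 1).
 { intros [|i] Hi; [now rewrite E2|]. now apply Hst. }
 assert (Hnear : forall i, exists s, i <=' n -> 0 <= s <= L /\ (bnd2 d D' (Om i) (stv 1 (gam s))) /\ near_torus d D (cs i) (m s)).
 { intros i. destruct (le_lt_dec i n) as [Hi|Hi]; [|exists 0; lia]. destruct (Hok i Hi) as (s & Hs). exists s. auto. }
 apply choice_fun in Hnear. destruct Hnear as [sf Hsf].
 assert (Hstep : forall i j, j <=' d -> Rabs (Om' (S i) j - Om' i j) <= eps * mu).
 { intros i j Hj. destruct (lt_dec i n) as [Hi|Hi].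
  - rewrite !HOm' by lia. destruct (Hst i Hi) as (_ & _ & H). now apply H.
  - rewrite !HOm'' by lia. rewrite Rminus_diag, Rabs_R0. fin. }
 assert (Hb : forall i, exists b : vec, (forall j, Rabs (b j) <= Bb) /\ (i <' S n -> good_site d P W0 Bb r kap (Om' (S i)) b (cs i))).
 { intros i. destruct (lt_dec i (S n)) as [Hi|Hi]; [|exists (fun _ => 0); split; [intros; rewrite Rabs_R0; lra|lia]].
  destruct (Hsf i ok) as (Hs & Ho & Hn).
  destruct (Hm (sf i) Hs (Om' (S i)) (cs i)) as (b & Hb1 & Hb2).
  - destruct (le_lt_dec (S i) n); [rewrite HOm' by lia; now apply Htime|rewrite HOm'' by lia; now apply Htime].
  - intros j Hj. generalize (Hstep i j Hj) (Ho j Hj). rewrite (HOm' i) by lia. intros H1 H2.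
   assert (eps * mu <= D / 2) by nra. fin.
  - exact Hn.
  - exists b. fin. }
 apply choice_fun in Hb. destruct Hb as [b Hb].
 destruct (Hch mu theta (S n) Om' cs b) as (x & w & pc & zi & zo & Hc & Hw0 & Hwn & Hclose & Hx); try lia; try lra.
 - intros i. destruct (le_lt_dec i n); [rewrite HOm' by lia; now apply Htime|rewrite HOm'' by lia; now apply Htime].
 - intros i j Hj. assert (Hi : exists k, k <=' n /\ Om' i = Om k).
  { destruct (le_lt_dec i n); [exists i; split; trivial; now apply HOm'|exists n; split; [lia|apply HOm''; lia]]. }
  destruct Hi as (k & Hk & ->). destruct (Hsf k Hk) as (Hs & Ho & _).
  note (Ho j Hj) (HgamW (sf k) j Hs Hj) as H1 H2. replace (Om k j) with (Om k j - stv 1 (gam (sf k)) j + stv 1 (gam (sf k)) j) by ring.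
  triang. lra.
 - fin.
 - intros i j. exact (proj1 (Hb i) j).
 - intros i Hi. exact (proj2 (Hb i) Hi).
 - intros i j Hi Hj. rewrite HOm' by lia. destruct (Hst i ok) as (_ & _ & H). now apply H.
 - intros i Hi. destruct (Hst i ok) as (H & _). fold dB. eapply Rle_trans; [|exact H]. unfold Lm0 in HLm. lra.
 - intros i Hi. destruct (Hst i ok) as (H & _). fold dB. eapply Rlt_le_trans; [|exact H]. fold Lm. unfold Rminus. fold Lm. unfold Lm0 in HLm. lra.
 - assert (Hsm : mu * F * (W0 + 4 + 2) <= / 10000000) by lra.
  destruct (chain_orbit d P mu (W0 + 4) ok ok Hsm (S n) x w pc zi zo ok Hc ft Hft ok)
   as (phi & I & q & p & Hsol & (Het1 & Het2) & Hact & t1 & t2 & Ht12 & Hn1 & Hn2 & Htt).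
  assert (HwI : forall i, i <' d -> w O (S i) = omegaI i).
  { intros i Hi. rewrite Hw0, HOm', E2 by lia. simpl. fin. }
  assert (HwF : forall i, i <' d -> w (S n) (S i) = omegaF i).
  { intros i Hi. rewrite Hwn, HOm'', E4 by lia. simpl. fin. }
  exists phi, I, q, p. split; [exact Hsol|split; [split|split]].
  + intros e He. destruct (Het1 e He) as [T1 H1]. exists T1. intros t Ht. eapply in_nbhd_ext; [exact HwI|]. fin.
  + intros e He. destruct (Het2 e He) as [T1 H1]. exists T1. intros t Ht. eapply in_nbhd_ext; [exact HwF|]. fin.
  + intros t. destruct (Hact t) as (k & Hk & HI). set (k' := Nat.min k n).
   assert (Hk' : Om' k = Om k') by (unfold k'; destruct (le_lt_dec k n); [rewrite HOm', Nat.min_l by lia|rewrite HOm'', Nat.min_r by lia]; trivial).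
   destruct (Hsf k' ltac:(unfold k'; lia)) as (Hs & Ho & _). exists (sf k'). split; trivial.
   le_thru (INR d * (eta / INR d)); [|right; field; lra]. apply vnorm_le; [pos|].
   intros i Hi. generalize (HI i Hi) (Hclose k (S i) Hk ok) (Ho (S i) ok). rewrite Hk'. fold F CR. simpl (stv 1 _ (S i)).
   intros A1 A2 A3. replace (eta / INR d) with (4 * h) by (unfold h; field; lra).
   fin.
  + exists t1, t2. split; [trivial|split; [now apply (in_nbhd_ext d mu (fun i => w O (S i)))|split; [now apply (in_nbhd_ext d mu (fun i => w (S n) (S i)))|]]].
   replace (Rabs (ln mu)) with Lm by (unfold Lm; rewrite <- Rabs_Ropp; symmetry; apply Rabs_pos_eq; fold Lm; lra).
   generalize (Hx O O ok ok) (Hx n O ok ok). fold CLc. rewrite E1, E3. intros B1 B2.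
   replace (S n - 1)%nat with n in Htt by lia. apply Rabs_le_between in B1, B2.
   assert (Hb1 : Kt * Lm <= Lm / mu).
   { reg_r mu. unfold Rdiv. rewrite (Rmult_assoc Lm), Rinv_l by lra. nra. }
   assert (Hb2 : 2 * CLc + 8 * (ln 4 + ln (INR d + 6) - ln mu) <= Kt * Lm).
   { replace (ln mu) with (- Lm) by (unfold Lm; ring). unfold Kt.
    assert (0 <= 2 * CLc + 8 * (ln 4 + ln (INR d + 6))) by lra. nra. }
   fin.
Qed.
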